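(* Let $\mathcal{G}$ be the set of pairs $(f_1,f_2)\in C^\infty(\mathbb{T})\times C^\infty(\mathbb{T})$ with $1+f_1(x_1)+f_2(x_2)>0$ on $\mathbb{T}^2$ such that the Liouville metric $g_0=(1+f_1(x_1)+f_2(x_2))(\mathrm{d}x_1^2+\mathrm{d}x_2^2)$ satisfies the noncoincidence condition on some compact interval $I\subset\mathbb{R}_{\ge 0}$ containing the common length of the closed geodesics of some graph rational torus of $g_0$. Then $\mathcal{G}$ is open and dense (in the $C^\infty$ topology, among the pairs with $1+f_1+f_2>0$), and the following holds. Let $(f_1,f_2)\in\mathcal{G}$, let $U\in C^\infty(\mathbb{T}^2)$ be arbitrary, and for small $|\epsilon|$ let $g_\epsilon$ be the Riemannian metric on $\mathbb{T}^2$ with line element $$\mathrm{d}s_\epsilon^2=\bigl(1+f_1(x_1)+f_2(x_2)+\epsilon\,U(x_1,x_2)\bigr)(\mathrm{d}x_1^2+\mathrm{d}x_2^2),$$ where $|\epsilon|$ is small enough that the conformal factor is positive. If the family $(g_\epsilon)$ is isospectral for small $|\epsilon|$, i.e. there is $\epsilon_0>0$ with $\mathrm{Spec}(-\Delta_{g_\epsilon})=\mathrm{Spec}(-\Delta_{g_0})$ for all $|\epsilon|<\epsilon_0$, then $U\equiv 0$.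
   Context: $\mathbb{T}=\mathbb{R}/\mathbb{Z}$ and $\mathbb{T}^2=\mathbb{T}\times\mathbb{T}$. $\Delta_g$ is the Laplace–Beltrami operator of $g$ and $\mathrm{Spec}(-\Delta_g)$ is the multiset of eigenvalues of $-\Delta_g$, repeated according to multiplicity. Length spectra: for a Riemannian metric $g$ on $\mathbb{T}^2$ and $(m,n)\in\mathbb{Z}^2\cong H_1(\mathbb{T}^2,\mathbb{Z})$, $\mathcal{L}^{m,n}(\mathbb{T}^2,g)\subset\mathbb{R}_{\ge0}$ is the set of lengths of all closed geodesics (iterates included) in the homology class $(m,n)$. Put $\mathcal{L}^{\mathrm{rot}}(\mathbb{T}^2,g)=\bigcup_{mn\ne0}\mathcal{L}^{m,n}(\mathbb{T}^2,g)$ and $\mathcal{L}^{\mathrm{osc}}(\mathbb{T}^2,g)=\bigcup_{mn=0}\mathcal{L}^{m,n}(\mathbb{T}^2,g)$. Noncoincidence condition: $g$ satisfies the noncoincidence condition on a nonempty closed interval $I\subset\mathbb{R}_{\ge0}$ if $I\cap\mathcal{L}^{\mathrm{rot}}(\mathbb{T}^2,g)\cap\mathcal{L}^{\mathrm{osc}}(\mathbb{T}^2,g)=\varnothing$. Rational torus: let $s:\mathbb{T}^2\to S\mathbb{T}^2$ be a continuous section of the unit tangent bundle of $(\mathbb{T}^2,g)$. Its image $\mathcal{T}$ is a rational torus if it is invariant under the geodesic flow and there is $T>0$ such that every point of $\mathcal{T}$ is periodic with period $T$; the minimal such $T$ is the length of $\mathcal{T}$, and the homology class of $\mathcal{T}$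 is the class of any closed geodesic $\gamma:[0,T]\to\mathbb{T}^2$ corresponding to a length-$T$ orbit in $\mathcal{T}$. A graph rational torus is a rational torus whose homology class $(m,n)$ satisfies $mn\neq0$. *)

(* Defs.v *)
From HB Require Import structures.
From mathcomp Require Import all_boot all_order all_algebra.
From mathcomp Require Import all_classical all_reals all_analysis.

Set Implicit Arguments.
Unset Strict Implicit.
Unset Printing Implicit Defensive.

Import Order.TTheory GRing.Theory Num.Theory.
Import numFieldNormedType.Exports.

Local Open Scope classical_set_scope.
Local Open Scope ring_scope.

(* The tori T = R/Z and T^2 = R^2/Z^2 are handled through their universal
   covers: functions, vector fields and metrics on them are Z-periodic
   (resp. Z^2-periodic) objects on R (resp. on 'rV[R]_2), and curves on T^2 are
   represented by their lifts to 'rV[R]_2. *)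

Section CircleFunctions.
Context {R : realType}.

Definition circle_smooth (f : R -> R) : Prop :=
  (forall (k : nat) (t : R), derivable (derive1n k f) t 1) /\ periodic f 1.

Record circle_cinfty : Type := CircleCinfty {
  circle_fun :> R -> R ;
  circle_funP : circle_smooth circle_fun }.

HB.instance Definition _ := gen_eqMixin circle_cinfty.
HB.instance Definition _ := gen_choiceMixin circle_cinfty.

(* The C^oo topology: uniform convergence of every derivative, i.e. the
   initial topology for f |-> (f, f', f'', ...). *)
Definition jets (f : circle_cinfty) :
    prod_topology (fun _ : nat => {uniform R -> R}) :=
  fun k => derive1n k f.

HB.instance Definition _ :=
  Topological.copy circle_cinfty (initial_topology jets).

Record liouville_pair : Type := LiouvillePair {
  liouville1 : circle_cinfty ;
  liouville2 : circle_cinfty ;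
  liouville_gt0 : forall s t : R, 0 < 1 + liouville1 s + liouville2 t }.

HB.instance Definition _ := gen_eqMixin liouville_pair.
HB.instance Definition _ := gen_choiceMixin liouville_pair.

Definition liouville_val (f : liouville_pair) : circle_cinfty * circle_cinfty :=
  (liouville1 f, liouville2 f).

(* Subspace topology from C^oo(T) x C^oo(T). *)
HB.instance Definition _ :=
  Topological.copy liouville_pair (initial_topology liouville_val).

End CircleFunctions.

Arguments circle_cinfty : clear implicits.
Arguments liouville_pair : clear implicits.

Section TorusGeometry.
Context {R : realType}.
Local Notation plane := 'rV[R]_2.

Definition lattice (z : 'rV[int]_2) : plane := map_mx intr z.

Definition biperiodic (V : Type) (f : plane -> V) : Prop :=
  forall (x : plane) (z : 'rV[int]_2), f (x + lattice z) = f x.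

Definition partial (i : 'I_2) (f : plane -> R) : plane -> R :=
  fun x => 'D_(delta_mx ord0 i) f x.

Definition torus_smooth (f : plane -> R) : Prop :=
  (forall (s : seq 'I_2) (x : plane), differentiable (foldr partial f s) x)
  /\ biperiodic f.

Definition metric_dot (g : plane -> 'M[R]_2) (x u v : plane) : R :=
  (u *m g x *m v^T) ord0 ord0.

Definition riemannian_metric (g : plane -> 'M[R]_2) : Prop :=
  [/\ forall i j : 'I_2, torus_smooth (fun x => g x i j),
      forall x : plane, (g x)^T = g x
    & forall x v : plane, v != 0 -> 0 < metric_dot g x v v].

Definition laplace_beltrami (g : plane -> 'M[R]_2) (u : plane -> R)
    (x : plane) : R :=
  (Num.sqrt (\det (g x)))^-1 *
  \sum_i partial i (fun y =>
    \sum_j Num.sqrt (\det (g y)) * invmx (g y) i j * partial j u y) x.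

Definition eigenfunction (g : plane -> 'M[R]_2) (lam : R) (u : plane -> R) :=
  torus_smooth u /\ forall x, - laplace_beltrami g u x = lam * u x.

Definition lin_indep (k : nat) (u : 'I_k -> plane -> R) : Prop :=
  forall c : 'I_k -> R,
    (forall x, \sum_i c i * u i x = 0) -> forall i, c i = 0.

(* Spec(-Delta_g), as a multiset of reals, is given by its multiplicity
   function: lam is sent to the dimension of its eigenspace (0 when lam is not
   an eigenvalue).  By elliptic regularity and self-adjointness, real smooth
   eigenfunctions suffice. *)
Definition Spec (g : plane -> 'M[R]_2) : R -> \bar R := fun lam =>
  ereal_sup [set k%:R%:E | k in [set k : nat |
    exists u : 'I_k -> plane -> R,
      (forall i, eigenfunction g lam (u i)) /\ lin_indep u]].

Definition christoffel (g : plane -> 'M[R]_2) (k i j : 'I_2) (x : plane) : R :=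
  2^-1 * \sum_l invmx (g x) k l *
    (partial i (fun y => g y j l) x + partial j (fun y => g y i l) x
     - partial l (fun y => g y i j) x).

Definition geodesic (g : plane -> 'M[R]_2) (c : R -> plane) : Prop :=
  forall t : R, [/\ derivable c t 1, derivable (derive1 c) t 1
    & forall k : 'I_2, derive1 (derive1 c) t ord0 k =
        - \sum_i \sum_j christoffel g k i j (c t)
                        * derive1 c t ord0 i * derive1 c t ord0 j].

Definition curve_length (g : plane -> 'M[R]_2) (c : R -> plane) (T : R) : R :=
  \int[lebesgue_measure]_(t in `[0, T])
     Num.sqrt (metric_dot g (c t) (derive1 c t) (derive1 c t)).

(* A closed curve on T^2 has homology class z in Z^2 = H_1(T^2, Z) when its
   lift c is translated by z over one period. *)
Definition closed_geodesic (g : plane -> 'M[R]_2) (z : 'rV[int]_2)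
    (T : R) (c : R -> plane) : Prop :=
  [/\ 0 < T, geodesic g c, derive1 c 0 != 0
    & forall t, c (t + T) = c t + lattice z].

Definition length_spectrum (g : plane -> 'M[R]_2) (z : 'rV[int]_2) : set R :=
  [set l | exists T c, closed_geodesic g z T c /\ l = curve_length g c T].

Definition graph_class (z : 'rV[int]_2) : Prop := z ord0 0 * z ord0 1 != 0.

Definition rot_spectrum (g : plane -> 'M[R]_2) : set R :=
  \bigcup_(z in [set z | graph_class z]) length_spectrum g z.

Definition osc_spectrum (g : plane -> 'M[R]_2) : set R :=
  \bigcup_(z in [set z | ~ graph_class z]) length_spectrum g z.

Definition noncoincidence (g : plane -> 'M[R]_2) (I : set R) : Prop :=
  I `&` rot_spectrum g `&` osc_spectrum g = set0.

(* The geodesic flow on (the lift to R^2 of) the tangent bundle, as a relation: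
   the point p = (x, v) is sent to q at time t. *)
Definition geodesic_flow (g : plane -> 'M[R]_2) (t : R) (p q : plane * plane) :=
  exists c, [/\ geodesic g c, (c 0, derive1 c 0) = p & (c t, derive1 c t) = q].

(* A section of the unit tangent bundle is x |-> (x, v x). *)
Definition unit_section (g : plane -> 'M[R]_2) (v : plane -> plane) : Prop :=
  [/\ continuous v, biperiodic v & forall x, metric_dot g x (v x) (v x) = 1].

Definition flow_invariant (g : plane -> 'M[R]_2) (v : plane -> plane) : Prop :=
  forall (t : R) (x : plane) (q : plane * plane),
    geodesic_flow g t (x, v x) q -> q.2 = v q.1.

Definition common_period (g : plane -> 'M[R]_2) (v : plane -> plane) (T : R) :=
  0 < T /\ forall x, exists z : 'rV[int]_2,
    geodesic_flow g T (x, v x) (x + lattice z, v x).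

Definition rational_torus (g : plane -> 'M[R]_2) (v : plane -> plane) : Prop :=
  [/\ unit_section g v, flow_invariant g v & exists T, common_period g v T].

Definition torus_length (g : plane -> 'M[R]_2) (v : plane -> plane) (T : R) :=
  common_period g v T /\ forall T', common_period g v T' -> T <= T'.

Definition torus_class (g : plane -> 'M[R]_2) (v : plane -> plane)
    (z : 'rV[int]_2) : Prop :=
  exists T, torus_length g v T /\
    forall x, geodesic_flow g T (x, v x) (x + lattice z, v x).

Definition graph_rational_torus (g : plane -> 'M[R]_2) (v : plane -> plane) :=
  rational_torus g v /\ exists z, torus_class g v z /\ graph_class z.

Definition conformal_metric (rho : plane -> R) : plane -> 'M[R]_2 :=
  fun x => (rho x)%:M.

Definition liouville_factor (f : liouville_pair R) (x : plane) : R :=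
  1 + liouville1 f (x ord0 0) + liouville2 f (x ord0 1).

Definition liouville_metric (f : liouville_pair R) : plane -> 'M[R]_2 :=
  conformal_metric (liouville_factor f).

Definition deformed_metric (f : liouville_pair R) (U : plane -> R) (e : R) :
    plane -> 'M[R]_2 :=
  conformal_metric (fun x => liouville_factor f x + e * U x).

Definition noncoincident_pairs : set (liouville_pair R) :=
  [set f | exists a b : R,
    [/\ 0 <= a, a <= b, noncoincidence (liouville_metric f) `[a, b]
      & exists v T, [/\ graph_rational_torus (liouville_metric f) v,
          torus_length (liouville_metric f) v T & T \in `[a, b]]]].

End TorusGeometry.

Arguments noncoincident_pairs : clear implicits.

(* Main.v *)
From HB Require Import structures.
From mathcomp Require Import all_boot all_order all_algebra.
From mathcomp Require Import all_classical all_reals all_analysis.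
From mathcomp Require Import ring lra zify.
Require Import Defs.

(** The three assertions rest on two independent arguments.

Geometry. In the time [s] with [ds = dt / rho] a geodesic of the Liouville metric
[rho = 1 + f1(x1) + f2(x2)] splits into two Newton equations [x_i'' = f_i'(x_i) / 2]
whose energies [a] and [b] add up to 1, and its length is the increment of the time
with derivative [rho] ([length_spectrumE]). A closed geodesic winding in both
variables rotates in both, and its length is the stationary value of
[m * act f1 a + n * act f2 b] over [a + b = 1]. This function is concave, so every
class of this kind has exactly one length, which depends continuously and strictly
monotonically on the potentials ([rot_exists], [rot_unique], [rot_length_lt]).
Hence a pair belongs to the set in question if and only if one of these lengths
avoids the oscillating spectrum ([noncoincidentP]). Limits of closed orbits are
closed orbits ([closed_orbit_compact]), so avoidance persists under perturbation and
the set is open. For density, the lengths of orbits oscillating in one given variable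
are critical values of the length, as in Sard's theorem, and therefore leave gaps
([osc_gap]). A bump placed next to a nondegenerate minimum of a potential is never
seen by orbits oscillating in it, of bounded period ([step_bump]), whereas it
strictly increases the rotating length; this moves the rotating length into a gap of
one direction and then of the other.

Spectral rigidity. The rigidity statement holds for every deformation of a conformal
metric on the torus. In an orthonormal basis of trigonometric functions the equation
[- lap u = lam rho u] becomes [w = lam K w], where [K] is a symmetric Hilbert-Schmidt
matrix obtained from multiplication by [rho] after projecting out the constants and
multiplying by the inverse square roots of the eigenvalues of the flat Laplacian. Its
eigenvectors are smooth eigenfunctions ([eig_to_l2], [l2_to_eig]), and the sum of
the squares of its eigenvalues is its Hilbert-Schmidt norm ([trace_le], [trace_ge]),
so this norm is a spectral invariant ([hsn_transfer]). For [rho + e U], of mass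
[V + e v], the matrix [(V + e v) K_e] is quadratic in [e]: its leading coefficient is
[v M - U^ U^^T] with the same multipliers, where [M] is multiplication by [U]. Its
squared norm is a polynomial of degree 4 in [e], equal to a constant times
[(V + e v)^2] for small [e]. So the coefficient of [e^4] vanishes, and with it the
squared norm of the leading matrix ([quartic_rigid]): [v M (k, l) = U^(k) U^(l)] for
all nonzero frequencies. On the diagonal, far out, [M (k, k)] tends to [v] and
[U^(k)] to 0, so [v = 0]; then every [U^(k)] vanishes and [U = 0]
([rank_one_trivial]). Regularity and completeness are proved through decay of
coefficients, and means over the torus are ultralimits of averages over finer and
finer grids. *)

Set Implicit Arguments.
Unset Strict Implicit.
Unset Printing Implicit Defensive.

Import Order.TTheory GRing.Theory Num.Theory.
Import numFieldNormedType.Exports.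

Local Open Scope classical_set_scope.
Local Open Scope ring_scope.

(** * Ultralimits and one-variable calculus *)

Section Ultralimit.
Context {R : realType}.

(** A fixed nonprincipal ultrafilter: every bounded sequence then has a limit
that respects sums and products, which replaces extraction of subsequences. *)
Definition ufil : set_system nat := sval (cid (@ultraFilterLemma nat \oo _)).

#[global] Instance ufil_ultra : UltraFilter ufil.
Proof. by rewrite /ufil; case: cid => /= U []. Qed.

#[global] Instance ufil_proper : ProperFilter ufil.
Proof. exact: (@ultra_proper _ _ ufil_ultra). Qed.

Lemma oo_ufil : \oo `<=` ufil.
Proof. by rewrite /ufil; case: cid => /= U []. Qed.

Definition ulim (u : nat -> R) : R := lim (u @ ufil).

Lemma ulim_cvg (u : nat -> R) (C : R) :
  (forall n, `|u n| <= C) -> u @ ufil --> ulim u.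
Proof.
move=> uC; apply/cvg_ex.
have cpt := @segment_compact R (- C) C.
have uI : ufil (u @^-1` `[- C, C]).
  by apply: (@filterS _ ufil _ setT) => [n _|]; rewrite /= ?in_itv /= -?ler_norml//; exact: filterT.
have [l [_ cl]] := cpt (u @ ufil) _ uI.
exists l => A nA.
have [//|nUA] := in_ultra_setVsetC (u @^-1` A) ufil_ultra.
by have [y [+ +]] := cl (~` A) A nUA nA.
Qed.

Lemma ulim_unique (u : nat -> R) (l : R) : u @ ufil --> l -> ulim u = l.
Proof. exact: cvg_lim. Qed.

End Ultralimit.

Section Calculus.
Context {R : realType}.
Implicit Types f g F : R -> R.

(** Global derivatives on the line, as a relation so that derivatives of
composite expressions are found by proof rather than by rewriting. *)
Definition deriv f g := forall x : R, is_derive x (1 : R) f (g x).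

Lemma deriv_cont f g : deriv f g -> continuous f.
Proof.
move=> fg x; apply: differentiable_continuous; apply/derivable1_diffP.
by have [] := fg x.
Qed.

Lemma deriv_incr f g (a b : R) : a <= b ->
  deriv f g -> (forall x, a <= x <= b -> 0 <= g x) -> f a <= f b.
Proof.
rewrite le_eqVlt => /predU1P[->//|ab] fg g0.
have [|c cab E] := @MVT R f g a b ab (fun x _ => fg x).
  by apply: continuous_subspaceT; exact: deriv_cont fg.
have /andP[ac cb] : a < c < b by move: cab; rewrite in_itv.
by rewrite -subr_ge0 E mulr_ge0 ?subr_ge0 ?(ltW ab)// g0// (ltW ac) (ltW cb).
Qed.

Lemma deriv_sincr f g (a b : R) : a < b ->
  deriv f g -> (forall x, a <= x <= b -> 0 < g x) -> f a < f b.
Proof.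
move=> ab fg g0.
have [|c cab E] := @MVT R f g a b ab (fun x _ => fg x).
  by apply: continuous_subspaceT; exact: deriv_cont fg.
have /andP[ac cb] : a < c < b by move: cab; rewrite in_itv.
by rewrite -subr_gt0 E mulr_gt0 ?subr_gt0// g0// (ltW ac) (ltW cb).
Qed.

Lemma derivD f f' g g' : deriv f f' -> deriv g g' ->
  deriv (fun x => f x + g x) (fun x => f' x + g' x).
Proof. by move=> h1 h2 x; have h3 := h1 x; have h4 := h2 x; exact: is_deriveD. Qed.

Lemma derivB f f' g g' : deriv f f' -> deriv g g' ->
  deriv (fun x => f x - g x) (fun x => f' x - g' x).
Proof. by move=> h1 h2 x; have h3 := h1 x; have h4 := h2 x; exact: is_deriveB. Qed.

Lemma derivM f f' g g' : deriv f f' -> deriv g g' ->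
  deriv (fun x => f x * g x) (fun x => f' x * g x + f x * g' x).
Proof.
move=> h1 h2 x; have h3 := h1 x; have h4 := h2 x.
by apply: is_derive_eq; rewrite addrC /GRing.scale /= (mulrC (g x)).
Qed.

Lemma derivC (k : R) : deriv (fun=> k) (fun=> 0).
Proof. move=> x; exact: is_derive_cst. Qed.

Lemma derivX : deriv id (fun=> 1).
Proof. move=> x; exact: is_derive_id. Qed.

Lemma derivZ (k : R) f f' : deriv f f' ->
  deriv (fun x => k * f x) (fun x => k * f' x).
Proof. by move=> h1 x; have h3 := h1 x; exact: is_deriveZ. Qed.

Lemma derivN f f' : deriv f f' -> deriv (fun x => - f x) (fun x => - f' x).
Proof. by move=> h1 x; have h3 := h1 x; exact: is_deriveN. Qed.

Lemma is_derive_compR f g (x df dg : R) : is_derive (g x) (1:R) f df ->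
  is_derive x (1:R) g dg -> is_derive x (1:R) (fun x => f (g x)) (df * dg).
Proof.
move=> h1 h2; have [d1 e1] := h1; have [d2 e2] := h2.
have D := @is_derive1_comp R f g x df dg h1 h2.
exact: D.
Qed.

Lemma deriv_comp f f' g g' : deriv f f' -> deriv g g' ->
  deriv (fun x => f (g x)) (fun x => f' (g x) * g' x).
Proof. by move=> h1 h2 x; exact: is_derive_compR. Qed.

Lemma deriv_ext f g f' g' : deriv f g -> f =1 f' -> g =1 g' -> deriv f' g'.
Proof. by move=> h /funext <- /funext <-. Qed.

Lemma deriv_le f f' g g' (a b : R) : a <= b -> deriv f f' -> deriv g g' ->
  (forall x, a <= x <= b -> f' x <= g' x) -> f b - f a <= g b - g a.
Proof.
move=> ab df dg le; suff: g a - f a <= g b - f b by lra.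
apply: (deriv_incr ab (derivB dg df)) => x /le; lra.
Qed.

Lemma deriv_const f : deriv f (fun=> 0) -> forall a b, f a = f b.
Proof.
move=> df a b; wlog ab : a b / a <= b.
  by move=> H; have [/H//|/ltW/H->] := leP a b.
apply/eqP; rewrite eq_le; apply/andP; split.
  by apply: (deriv_incr ab df).
suff: - f a <= - f b by lra.
apply: (deriv_incr ab (derivN df)) => x _; lra.
Qed.

Lemma deriv_lip f f' (C a b : R) : deriv f f' ->
  (forall x, Num.min a b <= x <= Num.max a b -> `|f' x| <= C) ->
  `|f b - f a| <= C * `|b - a|.
Proof.
move=> df; wlog ab : a b / a <= b.
  move=> H; have [ab|ba] := orP (le_total a b); first exact: (H _ _ ab).
  by rewrite minC maxC => /(H _ _ ba); rewrite distrC (distrC a b).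
rewrite (min_idPl ab) (max_idPr ab) => le.
rewrite (ger0_norm (_ : 0 <= b - a)) ?subr_ge0//.
have dC : deriv (fun x => C * x) (fun=> C).
  by apply: (deriv_ext (derivZ C derivX)) => // x; rewrite mulr1.
rewrite ler_norml; apply/andP; split.
  have := deriv_le ab (derivN dC) df _; rewrite mulrBr => H.
  suff: - (C * b) - - (C * a) <= f b - f a by lra.
  by apply: H => x /le; rewrite ler_norml => /andP[].
rewrite mulrBr; apply: (deriv_le ab df dC) => x /le.
by rewrite ler_norml => /andP[].
Qed.

Lemma deriv_lipT f f' (C a b : R) : deriv f f' -> (forall x, `|f' x| <= C) ->
  `|f b - f a| <= C * `|b - a|.
Proof. by move=> df le; apply: (deriv_lip df). Qed.

(** The quadratic remainder only uses a Lipschitz derivative, so no second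
derivative of the function is asked for. *)
Lemma deriv_taylor f f' (C x h : R) : 0 <= C -> deriv f f' ->
  (forall y, `|y - x| <= `|h| -> `|f' y - f' x| <= C * `|y - x|) ->
  `|f (x + h) - f x - h * f' x| <= C * h ^+ 2.
Proof.
move=> C0 df lip.
have dg : deriv (fun y => f y - y * f' x) (fun y => f' y - f' x).
  apply: (deriv_ext (derivB df (derivM derivX (derivC (f' x))))) => // y.
  by rewrite mul1r mulr0 addr0.
have /(_ (C * `|h|) x (x + h)) := deriv_lip dg.
rewrite (_ : f (x + h) - (x + h) * f' x - (f x - x * f' x) =
  f (x + h) - f x - h * f' x); last by ring.
rewrite (_ : x + h - x = h); last by ring.
rewrite -mulrA -expr2 real_normK ?num_real// => H; apply: H => y Hy.
have yx : `|y - x| <= `|h|.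
  move: Hy; case: (leP x (x+h)) => [h0|h0] /andP[y1 y2].
    by rewrite !ger0_norm; lra.
  by rewrite !ler0_norm; lra.
by apply: (le_trans (lip _ yx)); rewrite ler_wpM2l.
Qed.

(** A quadratic remainder identifies the derivative; this is how series and flat
functions are differentiated below. *)
Lemma is_derive_quad f (x l C : R) :
  (forall h, `|f (x + h) - f x - h * l| <= C * h ^+ 2) ->
  is_derive x (1:R) f l.
Proof.
move=> le.
have C0 : 0 <= C.
  by have := le 1; rewrite expr1n mulr1; apply: le_trans.
have c : (fun h : R => h^-1 *: ((f \o shift x) (h *: (1:R)) - f x)) @ 0^' --> l.
  apply/cvgrPdist_lt => e e0; near=> h.
  have h0 : h != 0 by near: h; exact: nbhs_dnbhs_neq.
  rewrite /= [h *: _]mulr1 /GRing.scale /= (addrC h).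
  have -> : l - h^-1 * (f (x + h) - f x) = - (h^-1 * (f (x + h) - f x - h * l)).
    by field.
  rewrite normrN normrM normfV.
  have hp : 0 < `|h| by rewrite normr_gt0.
  apply: (@le_lt_trans _ _ (C * `|h|)).
    rewrite ler_pdivrMl// (le_trans (le h))// -(real_normK (num_real h)) expr2.
    by rewrite mulrA (mulrC `|h|) .
  have : `|h| < e / (C + 1).
    near: h; apply: dnbhs0_lt; rewrite divr_gt0//; lra.
  rewrite ltr_pdivlMr; last by lra.
  by apply: le_lt_trans; nra.
split; first by apply/cvg_ex; exists l; exact: c.
exact: (cvg_lim _ c).
Unshelve. all: by end_near. Qed.

Lemma deriv_locconst f (a b : R) :
  (forall x, a < x < b -> is_derive x (1:R) f 0) ->
  forall x y, a < x < b -> a < y < b -> f x = f y.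
Proof.
move=> df x y; wlog xy : x y / x <= y.
  move=> H xb yb; have [xy|yx] := orP (le_total x y); first exact: H.
  by apply/esym/H.
move=> /andP[ax _] /andP[_ yb].
have ab t : x <= t <= y -> a < t < b.
  by move=> /andP[t1 t2]; rewrite (lt_le_trans ax t1) (le_lt_trans t2 yb).
have dc z : z \in `]x, y[ -> is_derive z (1:R) f ((fun=> 0) z).
  by rewrite in_itv /= => /andP[/ltW z1 /ltW z2]; apply/df/ab; rewrite z1.
have [|c _] := MVT_segment xy dc.
  apply/continuous_in_subspaceT => t; rewrite inE /= in_itv /= => /ab tb.
  by apply/differentiable_continuous/derivable1_diffP; case: (df t tb).
by rewrite mul0r => /eqP; rewrite subr_eq0 => /eqP.
Qed.

Lemma right_primitive f : continuous f ->
  exists P : R -> R, forall x : R, -1 < x -> is_derive x (1:R) P (f x).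
Proof.
move=> cf.
exists (fun x => (\int[lebesgue_measure]_(t in [set` `[-1, x]]) (f t))%R) => x x1.
have xx : x < x + 1 by rewrite ltrDl.
have [||dF E] := @continuous_FTC1_closed R f (-1) x (x + 1) xx _ x1.
- apply: continuous_compact_integrable; first exact: segment_compact.
  exact: continuous_subspaceT.
- exact: cf.
by split => //; rewrite -derive1E.
Qed.

(** Glue the primitives on half-lines given by the fundamental theorem of calculus. *)
Lemma primitive f : continuous f -> exists F, deriv F f.
Proof.
move=> cf.
have [P dP] := right_primitive cf.
have [Q dQ] : exists Q : R -> R, forall x : R, -1 < x -> is_derive x (1:R) Q (f (- x)).
  by apply: right_primitive => x; apply: continuous_comp; [exact: opp_continuous|exact: cf].
pose Q' x := Q 0 - Q (- x).
have dQ' (x : R) : x < 1 -> is_derive x (1:R) Q' (f x).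
  move=> x1.
  have h1 : is_derive (- x) (1:R) Q (f x).
    by rewrite -{2}(opprK x); apply: dQ; rewrite ltrN2.
  have h2 := is_derive_compR h1 (derivN derivX x).
  have h3 := is_deriveB (derivC (Q 0) x) h2.
  by apply: is_derive_eq h3 _; rewrite mulrN1 sub0r opprK.
pose F x := if x < 0 then Q' x else P x - P 0.
have dPP (x : R) : -1 < x -> is_derive x (1:R) (fun x => P x - P 0) (f x).
  move=> /dP h; have h3 := is_deriveB h (derivC (P 0) x).
  by apply: is_derive_eq h3 _; rewrite subr0.
have PQ (x : R) : -1 < x -> x < 1 -> P x - P 0 = Q' x.
  move=> x1 x2.
  have dD (z : R) : -1 < z < 1 -> is_derive z (1:R) (fun x => P x - P 0 - Q' x) 0.
    move=> /andP[z1 z2]; have h1 := dPP z z1; have h2 := dQ' z z2.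
    by have h3 := is_deriveB h1 h2; apply: is_derive_eq h3 _; rewrite subrr.
  have /(_ x 0) := deriv_locconst dD.
  rewrite x1 x2 !ltrN10 ltr01 => /(_ isT isT).
  rewrite /Q' oppr0; lra.
exists F => x.
have [x0|x0] := ltP x 0.
  apply: near_eq_is_derive (dQ' x _); last by lra.
  near=> y; rewrite /F ifT//; near: y; exact: lt_nbhsl.
apply: near_eq_is_derive (dPP x _); last by lra.
near=> y; rewrite /F; case: ltP => // y0; apply: PQ; last lra.
near: y; apply: lt_nbhsr; lra.
Unshelve. all: by end_near. Qed.

(** A speed bounded below makes the clock a bijection of the line, so it has an
inverse whose derivative is the reciprocal speed. *)
Lemma reparam f g (a : R) : deriv f g -> continuous g -> 0 < a -> (forall x, a <= g x) ->
  exists h, [/\ cancel f h, cancel h f & deriv h (fun s => (g (h s))^-1)].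
Proof.
move=> df cg a0 ag.
have daff : deriv (fun x : R => a * x) (fun=> a).
  by apply: (deriv_ext (derivZ a derivX)) => // x; rewrite mulr1.
have flt x y : x < y -> f x < f y.
  by move=> xy; apply: (deriv_sincr xy df) => z _; apply: lt_le_trans (ag z).
have finj : injective f.
  move=> x y E; have [xy|yx|//] := ltgtP x y.
    by have := flt _ _ xy; rewrite E ltxx.
  by have := flt _ _ yx; rewrite E ltxx.
have fgrow x y : x <= y -> a * (y - x) <= f y - f x.
  by move=> xy; rewrite mulrBr; apply: (deriv_le xy daff df) => z _; exact: ag.
have fsurj s : exists x, f x = s.
  pose D := `|s - f 0| / a.
  have D0 : 0 <= D by rewrite divr_ge0// ltW.
  have aD : a * D = `|s - f 0| by rewrite /D mulrC divfK// gt_eqF.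
  have h1 := fgrow 0 D D0; have h2 := fgrow (- D) 0; rewrite oppr_le0 in h2.
  have {}h2 := h2 D0; rewrite subr0 aD in h1; rewrite sub0r opprK aD in h2.
  have n0 := normr_ge0 (s - f 0).
  have [|||x _ fx] := @IVT R f (- D) D s; first lra.
  - exact: continuous_subspaceT (deriv_cont df).
  - have ff : f (- D) <= f D by lra.
    rewrite (min_idPl ff) (max_idPr ff).
    have := ler_norm (s - f 0); have := ler_norm (- (s - f 0)); rewrite normrN; lra.
  by exists x.
pose h s := xget 0 [set x | f x = s].
have hK : cancel h f.
  move=> s; rewrite /h; case: xgetP => [x _ //|/= no].
  by have [x fx] := fsurj s; have := no x.
have fK : cancel f h by move=> x; apply: finj; rewrite hK.
exists h; split => // s.
rewrite -{1}(hK s); apply: is_derive_inverse.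
- by near=> x; exact: fK.
- by near=> x; exact: deriv_cont df x.
- exact: df.
- by rewrite gt_eqF// (lt_le_trans a0).
Unshelve. all: by end_near. Qed.

Lemma periodicz f (z : int) (x : R) : periodic f 1 -> f (x + z%:~R) = f x.
Proof.
move=> pf; case: z => n; first exact: (periodicn pf n).
by rewrite NegzE mulrNz -[LHS](periodicn pf n.+1) subrK.
Qed.

Lemma periodic_max f : continuous f -> periodic f 1 ->
  exists y, forall x, f x <= f y.
Proof.
move=> cf pf.
have [y _ ym] := @EVT_max R f 0 1 ler01 (continuous_subspaceT cf).
exists y => x; rewrite -(subrK (Num.floor x)%:~R x) (periodicz _ _ pf); apply: ym.
rewrite in_itv /=; have := floor_itv x; rewrite intrD => /andP[]; lra.
Qed.

Lemma periodic_min f : continuous f -> periodic f 1 ->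
  exists y, forall x, f y <= f x.
Proof.
move=> cf pf; have [||y ym] := @periodic_max (fun x => - f x).
- by move=> x; apply: continuousN; exact: cf.
- by move=> x; rewrite pf.
by exists y => x; have := ym x; rewrite lerN2.
Qed.

Lemma periodic_bounded f : continuous f -> periodic f 1 ->
  exists2 C, 0 <= C & forall x, `|f x| <= C.
Proof.
move=> cf pf; have [||y ym] := @periodic_max (fun x => `|f x|).
- by move=> x; apply: continuous_comp (cf x) _; exact: norm_continuous.
- by move=> x; rewrite pf.
by exists `|f y|.
Qed.

End Calculus.

(** * Newton equations on the circle *)

Section Newton.
Context {R : realType}.
Implicit Types f x p w v r : R -> R.

(** Quantitative class of the potentials: one constant bounds the function and its
first two derivatives, which is what compactness arguments keep fixed. *)
Record C2per f (K : R) : Prop := {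
  C2d1 : deriv f (derive1 f) ;
  C2d2 : deriv (derive1 f) (derive1 (derive1 f)) ;
  C2per0 : periodic f 1 ;
  C2K : 0 <= K ;
  C2b0 : forall y : R, `|f y| <= K ;
  C2b1 : forall y : R, `|derive1 f y| <= K ;
  C2b2 : forall y : R, `|derive1 (derive1 f) y| <= K }.

(** Motion in the potential [- f / 2]: the factor makes the energy relation read
[p ^ 2 - f (x) = constant]. *)
Definition newton f x p := deriv x p /\ deriv p (fun s => (derive1 f) (x s) / 2).

(** The quantity [w^2 + v^2 + e^2] grows at most exponentially, since its derivative
is controlled by itself; the term [e ^ 2] absorbs the forcing. *)
Lemma gronwall w v r (K e S : R) : 0 <= K -> 0 <= S -> deriv w v -> deriv v r ->
  (forall s, 0 <= s <= S -> `|r s| <= K * `|w s| + e) ->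
  w S ^+ 2 + v S ^+ 2 + e ^+ 2 <=
  (w 0 ^+ 2 + v 0 ^+ 2 + e ^+ 2) * expR ((K + 2) * S).
Proof.
move=> K0 S0 dw dv rle.
pose D s := w s * w s + v s * v s + e ^+ 2.
pose E s := expR (- ((K + 2) * s)).
have dD := derivD (derivD (derivM dw dw) (derivM dv dv)) (derivC (e ^+ 2)).
have dE : deriv E (fun s => E s * - ((K + 2) * 1)).
  have dexp : deriv (@expR R) expR by move=> y; exact: is_derive_expR.
  exact: (deriv_comp dexp (derivN (derivZ (K + 2) derivX))).
have dDE := derivM dD dE.
have H : - (D 0 * E 0) <= - (D S * E S).
  apply: (deriv_incr S0 (derivN dDE)) => s /rle le.
  have E0 : 0 < E s by exact: expR_gt0.
  rewrite -/(D s).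
  set X := (X in 0 <= - (X * _ + _)).
  suff XD : X <= D s * (K + 2) by nra.
  rewrite /X /D /=.
  have n1 := ler_norm (w s); have n2 := ler_norm (- w s); rewrite normrN in n2.
  have rr : r s * v s <= (K * `|w s| + e) * `|v s|.
    by rewrite (le_trans (ler_norm _))// normrM ler_wpM2r.
  have := normr_ge0 (v s); have := normr_ge0 (w s).
  rewrite -!expr2 -(real_normK (num_real (w s))) -(real_normK (num_real (v s))).
  have wv : w s * v s <= `|w s| * `|v s| by rewrite -normrM ler_norm.
  have : 0 <= K * (`|w s| - `|v s|) ^+ 2 by rewrite mulr_ge0 ?sqr_ge0.
  have := sqr_ge0 (`|w s| - `|v s|).
  have := sqr_ge0 (e - `|v s|).
  have : 0 <= K * e ^+ 2 by rewrite mulr_ge0 ?sqr_ge0.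
  have := sqr_ge0 (`|w s|); have := sqr_ge0 (`|v s|); have := sqr_ge0 e.
  move: (`|w s|) (`|v s|) rr wv => W V; nra.
move: H; rewrite /D /E mulr0 oppr0 expR0 mulr1 lerN2 -!expr2.
by rewrite expRN ler_pdivrMr ?expR_gt0.
Qed.

Lemma newton_shift f x p (a : R) : newton f x p ->
  newton f (fun s => x (s + a)) (fun s => p (s + a)).
Proof.
move=> [dx dp]; have da : deriv (fun s : R => s + a) (fun=> 1).
  by apply: (deriv_ext (derivD derivX (derivC a))) => // s; rewrite addr0.
by split; [apply: (deriv_ext (deriv_comp dx da))|
  apply: (deriv_ext (deriv_comp dp da))] => // s; rewrite mulr1.
Qed.

Lemma newton_rev f x p : newton f x p ->
  newton f (fun s => x (- s)) (fun s => - p (- s)).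
Proof.
move=> [dx dp]; have da := derivN (@derivX R).
split; [apply: (deriv_ext (deriv_comp dx da))|
  apply: (deriv_ext (derivN (deriv_comp dp da)))] => // s; rewrite mulrN1 ?opprK//.
Qed.

Lemma derive1_periodic f : periodic f 1 -> periodic (derive1 f) 1.
Proof.
move=> pf x; rewrite /derive1.
suff -> : (fun h : R => h^-1 *: (f (h + (x + 1)) - f (x + 1))) =
          (fun h : R => h^-1 *: (f (h + x) - f x)) by [].
by apply/funext => h; rewrite pf addrA pf.
Qed.

Lemma newton_translate f x p (z : int) : periodic f 1 -> newton f x p ->
  newton f (fun s => x s + z%:~R) p.
Proof.
move=> pf [dx dp]; split.
  by apply: (deriv_ext (derivD dx (derivC z%:~R))) => // s; rewrite addr0.
by apply: (deriv_ext dp) => // s; rewrite periodicz//; exact: derive1_periodic.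
Qed.

Lemma newton_energy f x p : deriv f (derive1 f) -> newton f x p ->
  forall s, p s ^+ 2 - f (x s) = p 0 ^+ 2 - f (x 0).
Proof.
move=> df [dx dp] s.
have d := derivB (derivM dp dp) (deriv_comp df dx).
have d0 : deriv (fun s => p s * p s - f (x s)) (fun=> 0).
  by apply: (deriv_ext d) => // t; field.
by have := deriv_const d0 s 0; rewrite !expr2.
Qed.

Lemma lip_derive1 f (K a b : R) : C2per f K -> `|(derive1 f) a - (derive1 f) b| <= K * `|a - b|.
Proof. by case=> ? d2 ? ? ? ? b2; exact: (deriv_lipT _ _ d2). Qed.

Lemma lip_C2 f (K a b : R) : C2per f K -> `|f a - f b| <= K * `|a - b|.
Proof. by case=> d1 ? ? ? ? b1 ?; exact: (deriv_lipT _ _ d1). Qed.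

(** Two motions in nearby potentials stay close: apply the Gronwall bound to their
difference. *)
Lemma newton_close f K x p y q (S : R) : C2per f K -> 0 <= S ->
  newton f x p -> newton f y q ->
  (x S - y S) ^+ 2 + (p S - q S) ^+ 2 <=
  ((x 0 - y 0) ^+ 2 + (p 0 - q 0) ^+ 2) * expR ((K + 2) * S).
Proof.
move=> cf S0 [dx dp] [dy dq].
have := @gronwall _ _ _ K 0 S (C2K cf) S0 (derivB dx dy) (derivB dp dq).
rewrite expr0n /= !addr0; apply => s _.
rewrite addr0 -mulrBl normrM (ger0_norm (_ : 0 <= 2^-1))//.
have := lip_derive1 (x s) (y s) cf; have := normr_ge0 ((derive1 f) (x s) - (derive1 f) (y s)); lra.
Qed.

Lemma newton_uniq f K x p y q : C2per f K -> newton f x p -> newton f y q ->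
  x 0 = y 0 -> p 0 = q 0 -> forall s, x s = y s /\ p s = q s.
Proof.
move=> cf.
have pos x' p' y' q' (s : R) : 0 <= s -> newton f x' p' -> newton f y' q' ->
    x' 0 = y' 0 -> p' 0 = q' 0 -> x' s = y' s /\ p' s = q' s.
  move=> s0 n1 n2 E1 E2; have := newton_close cf s0 n1 n2.
  rewrite E1 E2 !subrr expr0n /= addr0 mul0r => le.
  have a0 := sqr_ge0 (x' s - y' s); have b0 := sqr_ge0 (p' s - q' s).
  have /eqP : (x' s - y' s) ^+ 2 = 0 by lra.
  have /eqP : (p' s - q' s) ^+ 2 = 0 by lra.
  by rewrite !sqrf_eq0 !subr_eq0 => /eqP -> /eqP ->.
move=> n1 n2 E1 E2 s; have [s0|/ltW s0] := leP 0 s; first exact: pos.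
have := pos _ _ _ _ (- s) _ (newton_rev n1) (newton_rev n2).
by rewrite oppr_ge0 oppr0 opprK E1 E2 => /(_ s0 erefl erefl)[-> /oppr_inj].
Qed.

Lemma newton_const f (y : R) : (derive1 f) y = 0 -> newton f (fun=> y) (fun=> 0).
Proof.
move=> y0; split; first exact: derivC.
by apply: (deriv_ext (derivC 0)) => // s; rewrite y0 mul0r.
Qed.

(** Returning to the initial position modulo 1 with the initial velocity forces
periodicity, by uniqueness. *)
Lemma newton_periodic f K x p (S : R) (z : int) : C2per f K -> newton f x p ->
  x S = x 0 + z%:~R -> p S = p 0 ->
  forall s, x (s + S) = x s + z%:~R /\ p (s + S) = p s.
Proof.
move=> cf n xS pS; apply: (newton_uniq cf).
- exact: newton_shift.
- exact: newton_translate (C2per0 cf) n.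
- by rewrite add0r.
- by rewrite add0r.
Qed.

Lemma circle_C2per (f : circle_cinfty R) : exists K, C2per f K.
Proof.
case: f => f [/= df pf].
have d k : deriv (derive1n k f) (derive1n k.+1 f).
  by move=> x; split; [exact: df|rewrite derive1nS derive1E].
have c k : continuous (derive1n k f) by exact: deriv_cont (d k).
have pr k : periodic (derive1n k f) 1.
  by elim: k => // k IH; rewrite derive1nS; exact: derive1_periodic.
have [K0 K00 b0] := periodic_bounded (c 0%N) (pr 0%N).
have [K1 K10 b1] := periodic_bounded (c 1%N) (pr 1%N).
have [K2 K20 b2] := periodic_bounded (c 2%N) (pr 2%N).
exists (K0 + K1 + K2); split => //.
- exact: (d 0%N).
- exact: (d 1%N).
- by rewrite !addr_ge0.
- by move=> x; apply: (le_trans (b0 x)); lra.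
- by move=> x; apply: (le_trans (b1 x)); lra.
- by move=> x; apply: (le_trans (b2 x)); lra.
Qed.

End Newton.

(** * Liouville metrics in coordinates *)

Section Plane.
Context {R : realType}.
Local Notation plane := 'rV[R]_2.

Lemma ord2P (k : 'I_2) : k = 0 \/ k = 1.
Proof. by case: k => -[|[|//]] H; [left|right]; apply: val_inj. Qed.

Lemma sum2 (V : nmodType) (F : 'I_2 -> V) : \sum_i F i = F 0 + F 1.
Proof.
by rewrite !big_ord_recl big_ord0 addr0; congr (_ + F _); apply: val_inj.
Qed.

(** Points of the plane given by their two coordinates. *)
Definition row2 (V : Type) (a b : V) : 'rV[V]_2 := \row_k (if k == 0 then a else b).

Lemma row2_0 (V : Type) (a b : V) : row2 a b ord0 0 = a.
Proof. by rewrite mxE. Qed.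

Lemma row2_1 (V : Type) (a b : V) : row2 a b ord0 1 = b.
Proof. by rewrite mxE. Qed.

Lemma row2P (V : Type) (u : 'rV[V]_2) : u = row2 (u ord0 0) (u ord0 1).
Proof.
by apply/rowP => k; rewrite mxE; case: (ord2P k) => ->.
Qed.

Lemma derivable_row (c : R -> plane) (c' : 'I_2 -> R -> R) :
  (forall k, deriv (fun t => c t ord0 k) (c' k)) ->
  (forall t, derivable c t 1) /\ (forall t, derive1 c t = \row_k c' k t).
Proof.
move=> dc; have D t : derivable c t 1.
  apply/derivable_mxP => i j; rewrite (ord1 i); by have [] := dc j t.
split=> // t; rewrite derive1E derive_mx//; apply/rowP => k; rewrite !mxE.
by have [_] := dc k t.
Qed.

Lemma deriv_coord (c : R -> plane) (k : 'I_2) : (forall t, derivable c t 1) ->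
  deriv (fun t => c t ord0 k) (fun t => derive1 c t ord0 k).
Proof.
move=> D t; rewrite derive1E derive_mx// mxE.
by apply: DeriveDef => //; exact: ((derivable_mxP c t 1).1 (D t) ord0 k).
Qed.

(** A directional derivative is a derivative along a line. *)
Lemma is_derive_line (F : plane -> R) (x v : plane) (d : R) :
  is_derive (0:R) (1:R) (fun h : R => F (x + h *: v)) d -> is_derive x v F d.
Proof.
move=> [D E].
have H : (fun h : R => h^-1 *: (((fun h : R => F (x + h *: v)) \o shift 0) (h *: (1:R)) -
    F (x + 0 *: v))) = (fun h => h^-1 *: ((F \o shift x) (h *: v) - F x)).
  apply/funext => h /=.
  by rewrite scale0r !addr0 [X in F (_ + X *: _)]mulr1 [x + _]addrC.
by split; [rewrite /derivable -H; exact: D | rewrite /derive -H; exact: E].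
Qed.

Definition potential (f : liouville_pair R) (i : 'I_2) : R -> R :=
  if i == 0 then liouville1 f else liouville2 f.

Lemma liouville_factorE (f : liouville_pair R) x :
  liouville_factor f x = 1 + \sum_i potential f i (x ord0 i).
Proof. by rewrite sum2 /liouville_factor addrA. Qed.

Lemma potential_deriv (f : liouville_pair R) i :
  deriv (potential f i) (derive1 (potential f i)).
Proof.
rewrite /potential; case: ifP => _.
  by have [K []] := circle_C2per (liouville1 f).
by have [K []] := circle_C2per (liouville2 f).
Qed.

Lemma partial_liouville (f : liouville_pair R) (b : bool) i x :
  partial i (fun y => liouville_factor f y *+ b) x =
  derive1 (potential f i) (x ord0 i) *+ b.
Proof.
rewrite /partial; apply: derive_val; apply: is_derive_line.
have dl (h : R) k : (x + h *: delta_mx ord0 i : plane) ord0 k = x ord0 k + h * (k == i)%:R.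
  by rewrite !mxE eqxx.
have dk (k : 'I_2) : deriv (fun h : R => x ord0 k + h * (k == i)%:R) (fun=> (k == i)%:R).
  apply: (deriv_ext (derivD (derivC _) (derivM derivX (derivC _)))) => // h.
  by rewrite mulr0 mul1r add0r addr0.
have d0 := deriv_comp (potential_deriv f 0) (dk 0).
have d1 := deriv_comp (potential_deriv f 1) (dk 1).
have d2 := derivZ b%:R (derivD (derivC 1) (derivD d0 d1)).
rewrite [X in is_derive _ _ X _](_ : _ = fun h => b%:R *
    (1 + (potential f 0 (x ord0 0 + h * (0 == i)%:R) +
          potential f 1 (x ord0 1 + h * (1 == i)%:R)))); last first.
  by apply/funext => h; rewrite liouville_factorE sum2 !dl mulr_natl.
apply: is_derive_eq (d2 0) _; rewrite !mul0r !addr0.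
by case: (ord2P i) => ->; rewrite /= ?mulr1 ?mulr0 ?addr0 ?add0r mulr_natl.
Qed.

Lemma liouville_factor_gt0 (f : liouville_pair R) x : 0 < liouville_factor f x.
Proof. exact: liouville_gt0. Qed.

Lemma invmx_scalar2 (a : R) : a != 0 -> invmx (a%:M : 'M[R]_2) = a^-1%:M.
Proof. by move=> a0; rewrite invmx_scalar. Qed.

(** For a conformal factor the Christoffel symbols only involve its logarithmic
derivatives. *)
Lemma christoffel_liouville (f : liouville_pair R) (k i j : 'I_2) x :
  christoffel (liouville_metric f) k i j x = (2 * liouville_factor f x)^-1 *
  (derive1 (potential f i) (x ord0 i) *+ (j == k) +
   derive1 (potential f j) (x ord0 j) *+ (i == k) -
   derive1 (potential f k) (x ord0 k) *+ (i == j)).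
Proof.
have r0 := liouville_factor_gt0 f x.
rewrite /christoffel invfM -mulrA; congr (_ * _).
rewrite (bigD1 k) //= big1 ?addr0; last first.
  move=> l lk; rewrite /liouville_metric /conformal_metric invmx_scalar2 ?(gt_eqF r0)//.
  by rewrite mxE eq_sym (negbTE lk) mulr0n mul0r.
rewrite /liouville_metric /conformal_metric invmx_scalar2 ?(gt_eqF r0)//.
rewrite mxE eqxx mulr1n; congr (_ * _).
have E a b : (fun y => (liouville_factor f y)%:M a b) =
    (fun y : plane => liouville_factor f y *+ (a == b)).
  by apply/funext => y; rewrite mxE.
by rewrite !E !partial_liouville.
Qed.

Definition liouville_acc (f : liouville_pair R) (x v : plane) (k : 'I_2) : R :=
  - (2 * liouville_factor f x)^-1 *
  (2 * v ord0 k * (\sum_i derive1 (potential f i) (x ord0 i) * v ord0 i)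
   - derive1 (potential f k) (x ord0 k) * (v ord0 0 ^+ 2 + v ord0 1 ^+ 2)).

Lemma geodesic_acc (f : liouville_pair R) (x v : plane) (k : 'I_2) :
  - \sum_i \sum_j christoffel (liouville_metric f) k i j x * v ord0 i * v ord0 j =
  liouville_acc f x v k.
Proof.
rewrite /liouville_acc !sum2 !christoffel_liouville.
by case: (ord2P k) => -> /=; rewrite ?mulr1n ?mulr0n; ring.
Qed.

Lemma geodesicP (f : liouville_pair R) (c : R -> plane) :
  geodesic (liouville_metric f) c ->
  forall k, deriv (fun t => c t ord0 k) (fun t => derive1 c t ord0 k) /\
            deriv (fun t => derive1 c t ord0 k)
                  (fun t => liouville_acc f (c t) (derive1 c t) k).
Proof.
move=> g k; have dc t : derivable c t 1 by have [] := g t.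
have dd t : derivable (derive1 c) t 1 by have [] := g t.
split; first exact: deriv_coord.
apply: (deriv_ext (deriv_coord k dd)) => // t.
by have [_ _ ->] := g t; rewrite geodesic_acc.
Qed.

Lemma geodesicI (f : liouville_pair R) (c : R -> plane) (v : 'I_2 -> R -> R) :
  (forall k, deriv (fun t => c t ord0 k) (v k)) ->
  (forall k, deriv (v k) (fun t => liouville_acc f (c t) (\row_j v j t) k)) ->
  geodesic (liouville_metric f) c.
Proof.
move=> dc dv; have [D E] := derivable_row dc.
have E' : derive1 c = fun t => \row_k v k t by apply/funext.
have dr k : deriv (fun t => (\row_k v k t) ord0 k) (fun t => liouville_acc f (c t) (\row_j v j t) k).
  by apply: (deriv_ext (dv k)) => // t; rewrite mxE.
have [D' E''] := derivable_row dr.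
move=> t; rewrite E'; split => // k.
by rewrite E'' mxE geodesic_acc.
Qed.

(** Unit speed in the metric becomes the condition that the two energies add up to
zero once the constant 1 is split between the variables. *)
Definition newton_orbit (f1 f2 x1 p1 x2 p2 t : R -> R) : Prop :=
  [/\ newton f1 x1 p1, newton f2 x2 p2,
      forall s, p1 s ^+ 2 + p2 s ^+ 2 = 1 + f1 (x1 s) + f2 (x2 s)
    & deriv t (fun s => 1 + f1 (x1 s) + f2 (x2 s))].

(** A closed geodesic of homology class [(z1, z2)], written in separated variables:
in the time [s] with [dt = rho ds] each coordinate obeys its own Newton equation,
and the length is the physical time [t S - t 0]. *)
Definition closed_orbit (f1 f2 : R -> R) (z1 z2 : int) (l : R) : Prop :=
  exists S x1 p1 x2 p2 t, [/\ 0 < S, newton_orbit f1 f2 x1 p1 x2 p2 t,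
    x1 S = x1 0 + z1%:~R /\ p1 S = p1 0,
    x2 S = x2 0 + z2%:~R /\ p2 S = p2 0 & l = t S - t 0].

Lemma liouville_lower (f : liouville_pair R) :
  exists2 a, 0 < a & forall s t, a <= 1 + liouville1 f s + liouville2 f t.
Proof.
have [K [d1 _ per1 _ _ _ _]] := circle_C2per (liouville1 f).
have [K' [d2 _ per2 _ _ _ _]] := circle_C2per (liouville2 f).
have [y1 m1] := periodic_min (deriv_cont d1) per1.
have [y2 m2] := periodic_min (deriv_cont d2) per2.
exists (1 + liouville1 f y1 + liouville2 f y2); first exact: liouville_gt0.
by move=> s t; have := m1 s; have := m2 t; lra.
Qed.

Lemma metric_dotE (rho : plane -> R) x v :
  metric_dot (conformal_metric rho) x v v = rho x * (v ord0 0 ^+ 2 + v ord0 1 ^+ 2).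
Proof.
rewrite /metric_dot /conformal_metric mul_mx_scalar -scalemxAl mxE mxE sum2 !mxE.
by rewrite !expr2.
Qed.
End Plane.

(** * Geodesics of Liouville metrics as Newton orbits *)

Section Reparametrization.
Context {R : realType}.
Local Notation plane := 'rV[R]_2.
Implicit Types (f : liouville_pair R).

Lemma deriv_continuous_liouville f (x1 p1 x2 p2 : R -> R) :
  deriv x1 p1 -> deriv x2 p2 ->
  deriv (fun s => 1 + liouville1 f (x1 s) + liouville2 f (x2 s))
    (fun s => derive1 (liouville1 f) (x1 s) * p1 s + derive1 (liouville2 f) (x2 s) * p2 s).
Proof.
move=> d1 d2.
have := derivD (derivD (derivC 1) (deriv_comp (potential_deriv f 0) d1))
  (deriv_comp (potential_deriv f 1) d2).
by move=> h; apply: (deriv_ext h) => // s; rewrite add0r.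
Qed.

Lemma deriv_inv (g g' : R -> R) : (forall s, g s != 0) -> deriv g g' ->
  deriv (fun s => (g s)^-1) (fun s => - (g s) ^- 2 * g' s).
Proof.
by move=> g0 dg s; have h := dg s; have := @is_deriveV R g s (g' s) 1 (g0 s) h.
Qed.

(** Changing time by [ds = dt / rho] removes the velocity-dependent part of the
geodesic equation and leaves two decoupled Newton equations. *)
Lemma geodesic_newton f c :
  geodesic (liouville_metric f) c -> derive1 c 0 != 0 ->
  exists E th h x1 p1 x2 p2,
  [/\ 0 < E,
      newton_orbit (liouville1 f) (liouville2 f) x1 p1 x2 p2 (fun s => E * h s),
      [/\ cancel th h, cancel h th, th 0 = 0 & {homo th : a b / a < b}],
      (forall s, c (h s) = row2 (x1 s) (x2 s) /\
                 (1 + liouville1 f (x1 s) + liouville2 f (x2 s)) *: derive1 c (h s) =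
                 E *: row2 (p1 s) (p2 s))
    & forall t, metric_dot (liouville_metric f) (c t) (derive1 c t) (derive1 c t) = E ^+ 2].
Proof.
move=> /geodesicP g c0.
have [d1 a1] := g 0; have [d2 a2] := g 1.
set y1 := (fun t => c t ord0 0) in d1; set y2 := (fun t => c t ord0 1) in d2.
set v1 := (fun t => derive1 c t ord0 0) in d1 a1.
set v2 := (fun t => derive1 c t ord0 1) in d2 a2.
pose r t := 1 + liouville1 f (y1 t) + liouville2 f (y2 t).
have rE t : liouville_factor f (c t) = r t by [].
have r0 t : 0 < r t by exact: liouville_gt0.
have rn t : r t != 0 by rewrite gt_eqF.
have dr := deriv_continuous_liouville f d1 d2; rewrite -/r in dr.
have [a a_gt0 ale] := liouville_lower f.
pose F1 t := derive1 (liouville1 f) (y1 t); pose F2 t := derive1 (liouville2 f) (y2 t).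
have acc1 t : liouville_acc f (c t) (derive1 c t) 0 =
   - (2 * r t)^-1 * (2 * v1 t * (F1 t * v1 t + F2 t * v2 t) - F1 t * (v1 t ^+ 2 + v2 t ^+ 2)).
  by rewrite /liouville_acc sum2.
have acc2 t : liouville_acc f (c t) (derive1 c t) 1 =
   - (2 * r t)^-1 * (2 * v2 t * (F1 t * v1 t + F2 t * v2 t) - F2 t * (v1 t ^+ 2 + v2 t ^+ 2)).
  by rewrite /liouville_acc sum2.
pose en t := r t * (v1 t * v1 t + v2 t * v2 t).
have den : deriv en (fun=> 0).
  apply: (deriv_ext (derivM dr (derivD (derivM a1 a1) (derivM a2 a2)))) => // t.
  by rewrite acc1 acc2 -/(F1 t) -/(F2 t); field.
have enE t : en t = en 0 by exact: deriv_const.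
have en0 : 0 < en 0.
  rewrite /en mulr_gt0// -!expr2 lt0r addr_ge0 ?sqr_ge0// andbT.
  rewrite paddr_eq0 ?sqr_ge0// !sqrf_eq0; apply: contra_neqN c0 => /andP[/eqP e1 /eqP e2].
  apply/rowP => k; rewrite mxE; case: (ord2P k) => ->; [exact: e1|exact: e2].
pose E := Num.sqrt (en 0).
have E0 : 0 < E by rewrite sqrtr_gt0.
have EE : E ^+ 2 = en 0 by rewrite sqr_sqrtr// ltW.
have [K1 cK1] := circle_C2per (liouville1 f).
have [K2 cK2] := circle_C2per (liouville2 f).
have dth0 : continuous (fun t => E * (r t)^-1).
  by apply: deriv_cont; exact: (derivZ E (deriv_inv rn dr)).
have [th0 dth] := primitive dth0.
pose th t := th0 t - th0 0.
have {}dth : deriv th (fun t => E * (r t)^-1).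
  by apply: (deriv_ext (derivB dth (derivC (th0 0)))) => // t; rewrite subr0.
have rle t : r t <= 1 + K1 + K2.
  have := C2b0 cK1 (y1 t); have := C2b0 cK2 (y2 t).
  have := ler_norm (liouville1 f (y1 t)); have := ler_norm (liouville2 f (y2 t)).
  rewrite /r; lra.
have K0 : 0 < 1 + K1 + K2 by have := C2K cK1; have := C2K cK2; lra.
have lo t : E * (1 + K1 + K2)^-1 <= E * (r t)^-1.
  by rewrite ler_pM2l// lef_pV2// posrE.
have lo0 : 0 < E * (1 + K1 + K2)^-1 by rewrite mulr_gt0// invr_gt0.
have [h [thK hK dh]] := reparam dth dth0 lo0 lo.
have {}dh : deriv h (fun s => r (h s) / E).
  by apply: (deriv_ext dh) => // s; rewrite invfM invrK mulrC.
exists E, th, h, (fun s => y1 (h s)), (fun s => r (h s) * v1 (h s) / E),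
  (fun s => y2 (h s)), (fun s => r (h s) * v2 (h s) / E).
split=> //.
- split.
  + split; first by apply: (deriv_ext (deriv_comp d1 dh)) => // s; ring.
    have D := derivM (deriv_comp (derivM dr a1) dh) (derivC E^-1).
    apply: (deriv_ext D) => // s.
    rewrite acc1 -/(F1 (h s)) -/(F2 (h s)) mulr0 addr0.
    have H := enE (h s); rewrite -EE /en in H.
    transitivity (F1 (h s) / 2 * (r (h s) * (v1 (h s) * v1 (h s) + v2 (h s) * v2 (h s))) / E ^+ 2).
      by field; rewrite rn gt_eqF.
    by rewrite H mulfK// expf_neq0// gt_eqF.
  + split; first by apply: (deriv_ext (deriv_comp d2 dh)) => // s; ring.
    have D := derivM (deriv_comp (derivM dr a2) dh) (derivC E^-1).
    apply: (deriv_ext D) => // s.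
    rewrite acc2 -/(F1 (h s)) -/(F2 (h s)) mulr0 addr0.
    have H := enE (h s); rewrite -EE /en in H.
    transitivity (F2 (h s) / 2 * (r (h s) * (v1 (h s) * v1 (h s) + v2 (h s) * v2 (h s))) / E ^+ 2).
      by field; rewrite rn gt_eqF.
    by rewrite H mulfK// expf_neq0// gt_eqF.
  + move=> s; have H := enE (h s); rewrite -EE /en in H.
    transitivity (r (h s) * (r (h s) * (v1 (h s) * v1 (h s) + v2 (h s) * v2 (h s))) / E ^+ 2).
      by field; rewrite gt_eqF.
    by rewrite H mulfK// expf_neq0// gt_eqF.
  + by apply: (deriv_ext (derivZ E dh)) => // s; rewrite mulrC divfK// gt_eqF.
- split => //; first by rewrite /th subrr.
  move=> s t st; apply: (deriv_sincr st dth) => u _; exact: lt_le_trans (lo u).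
- move=> s; split; first by rewrite [LHS]row2P.
  apply/rowP => k; rewrite !mxE -/(r (h s)).
  by case: (ord2P k) => -> /=; rewrite [RHS]mulrC divfK ?gt_eqF.
- by move=> t; rewrite metric_dotE rE !expr2 -/(en t) enE -expr2 EE.
Qed.

(** The converse change of time; the clock is invertible because [rho] is bounded
below. *)
Lemma newton_geodesic f (x1 p1 x2 p2 t : R -> R) :
  newton_orbit (liouville1 f) (liouville2 f) x1 p1 x2 p2 t ->
  exists h c,
  [/\ geodesic (liouville_metric f) c,
      cancel t h, cancel h t,
      (forall s, c (t s) = row2 (x1 s) (x2 s) /\
                 derive1 c (t s) =
                 (1 + liouville1 f (x1 s) + liouville2 f (x2 s))^-1 *: row2 (p1 s) (p2 s))
    & forall t, metric_dot (liouville_metric f) (c t) (derive1 c t) (derive1 c t) = 1].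
Proof.
move=> [[dx1 dp1] [dx2 dp2] en dt].
have [a a_gt0 ale] := liouville_lower f.
pose r s := 1 + liouville1 f (x1 s) + liouville2 f (x2 s).
have r0 s : 0 < r s by exact: liouville_gt0.
have rn s : r s != 0 by rewrite gt_eqF.
have dr := deriv_continuous_liouville f dx1 dx2; rewrite -/r in dr.
have [h [tK hK dh]] := reparam dt (deriv_cont dr) a_gt0 (fun s => ale _ _).
rewrite -/r in dh.
pose c u : plane := row2 (x1 (h u)) (x2 (h u)).
pose v (k : 'I_2) u := (if k == 0 then p1 (h u) else p2 (h u)) / r (h u).
have dc k : deriv (fun u => c u ord0 k) (v k).
  case: (ord2P k) => ->.
    by apply: (deriv_ext (deriv_comp dx1 dh)) => // u; rewrite row2_0.
  by apply: (deriv_ext (deriv_comp dx2 dh)) => // u; rewrite row2_1.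
have dv k : deriv (v k) (fun u => liouville_acc f (c u) (\row_j v j u) k).
  case: (ord2P k) => ->.
    apply: (deriv_ext (deriv_comp (derivM dp1 (deriv_inv rn dr)) dh)) => // u.
    rewrite /liouville_acc sum2 !mxE /v /=.
    have -> : liouville_factor f (c u) = r (h u) by rewrite /liouville_factor row2_0 row2_1.
    rewrite /potential /=; have := en (h u); rewrite -/(r _) => H.
    rewrite !expr_div_n -mulrDl H.
    by field; exact: rn.
  apply: (deriv_ext (deriv_comp (derivM dp2 (deriv_inv rn dr)) dh)) => // u.
  rewrite /liouville_acc sum2 !mxE /v /=.
  have -> : liouville_factor f (c u) = r (h u) by rewrite /liouville_factor row2_0 row2_1.
  rewrite /potential /=; have := en (h u); rewrite -/(r _) => H.
  rewrite !expr_div_n -mulrDl H.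
  by field; exact: rn.
have [_ E] := derivable_row dc.
have E' u : derive1 c u = (r (h u))^-1 *: row2 (p1 (h u)) (p2 (h u)).
  by rewrite E; apply/rowP => k; rewrite !mxE /v mulrC.
exists h, c; split => //.
- exact: geodesicI dc dv.
- by move=> s; rewrite E' /c tK.
- move=> u; rewrite metric_dotE E' !mxE /=.
  have -> : liouville_factor f (c u) = r (h u) by rewrite /liouville_factor row2_0 row2_1.
  by rewrite !exprMn -mulrDr en -/(r _); field; exact: rn.
Qed.

Lemma curve_length_const (g : plane -> 'M[R]_2) (c : R -> plane) (E T : R) :
  0 <= E -> 0 <= T ->
  (forall t, metric_dot g (c t) (derive1 c t) (derive1 c t) = E ^+ 2) ->
  curve_length g c T = E * T.
Proof.
move=> E0 T0 mE; rewrite /curve_length.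
under eq_Rintegral do rewrite mE sqrtr_sqr ger0_norm//.
rewrite Rintegral_cst//; congr (_ * _).
have := @lebesgue_measure_itv R `[0, T]; rewrite /= lte_fin => ->.
by move: T0; rewrite le_eqVlt => /predU1P[<-|->]; rewrite ?ltxx //= oppr0 addr0.
Qed.

(** The length spectrum is thereby described by two one-dimensional systems. *)
Lemma length_spectrumE f (z : 'rV[int]_2) l :
  length_spectrum (liouville_metric f) z l <->
  closed_orbit (liouville1 f) (liouville2 f) (z ord0 0) (z ord0 1) l.
Proof.
have [K1 cK1] := circle_C2per (liouville1 f).
have [K2 cK2] := circle_C2per (liouville2 f).
split.
  move=> [T [c [[T0 geo c0 cT] ->]]].
  have [E [th [h [x1 [p1 [x2 [p2 [E0 orb [thK hK th0 thi] xc mE]]]]]]]] := geodesic_newton geo c0.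
  have h0 : h 0 = 0 by rewrite -th0 thK.
  have cP : forall t, derive1 c (t + T) = derive1 c t.
    move=> t; rewrite /derive1.
    suff -> : (fun h : R => h^-1 *: (c (h + (t + T)) - c (t + T))) =
          (fun h : R => h^-1 *: (c (h + t) - c t)) by [].
    by apply/funext => u; rewrite cT addrA cT opprD addrACA subrr addr0.
  have [c00 v00] := xc 0; have [cTT vTT] := xc (th T).
  rewrite h0 in c00 v00; rewrite thK -[T]add0r in cTT vTT.
  rewrite cT c00 in cTT; rewrite cP in vTT.
  have X1 : x1 (th (0 + T)) = x1 0 + (z ord0 0)%:~R.
    by have := congr1 (fun u : plane => u ord0 0) cTT; rewrite !mxE /=.
  have X2 : x2 (th (0 + T)) = x2 0 + (z ord0 1)%:~R.
    by have := congr1 (fun u : plane => u ord0 1) cTT; rewrite !mxE /=.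
  rewrite X1 X2 !periodicz in vTT; try exact: C2per0 cK1; try exact: C2per0 cK2.
  rewrite v00 add0r in vTT; rewrite !add0r in X1 X2.
  have En : E != 0 by rewrite gt_eqF.
  have vv := scalerI En vTT.
  have P1 : p1 (th T) = p1 0 by have := congr1 (fun u : plane => u ord0 0) vv; rewrite !mxE.
  have P2 : p2 (th T) = p2 0 by have := congr1 (fun u : plane => u ord0 1) vv; rewrite !mxE.
  exists (th T), x1, p1, x2, p2, (fun s => E * h s).
  split=> //; first by rewrite -th0 thi.
  by rewrite (curve_length_const (ltW E0) (ltW T0) mE) thK h0 mulr0 subr0.
move=> [S [x1 [p1 [x2 [p2 [t0 [S0 [n1 n2 en dt0] [X1 P1] [X2 P2] ->]]]]]]].
pose t s := t0 s - t0 0.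
have dt : deriv t (fun s => 1 + liouville1 f (x1 s) + liouville2 f (x2 s)).
  by apply: (deriv_ext (derivB dt0 (derivC (t0 0)))) => // s; rewrite subr0.
have orb : newton_orbit (liouville1 f) (liouville2 f) x1 p1 x2 p2 t by [].
have [h [c [geo tK hK xc mE]]] := newton_geodesic orb.
have x1P := newton_periodic cK1 n1 X1 P1.
have x2P := newton_periodic cK2 n2 X2 P2.
have tS : 0 < t S.
  have -> : 0 = t 0 by rewrite /t subrr.
  apply: (deriv_sincr S0 dt) => u _; exact: liouville_gt0.
have tP s : t (s + S) = t s + t S.
  have da : deriv (fun s : R => s + S) (fun=> 1).
    by apply: (deriv_ext (derivD derivX (derivC S))) => // u; rewrite addr0.
  have dd : deriv (fun s => t (s + S) - t s) (fun=> 0).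
    apply: (deriv_ext (derivB (deriv_comp dt da) dt)) => // u.
    have [-> _] := x1P u; have [-> _] := x2P u.
    by rewrite (periodicz _ _ (C2per0 cK1)) (periodicz _ _ (C2per0 cK2)) mulr1 subrr.
  have := deriv_const dd s 0; rewrite add0r {4}/t subrr subr0; lra.
exists (t S), c; split.
  split=> //.
    have [_ v0] := xc 0; rewrite {1}/t subrr in v0; rewrite v0.
    have r0 := liouville_gt0 f (x1 0) (x2 0).
    rewrite scaler_eq0 invr_eq0 gt_eqF//=; apply/eqP => /rowP H.
    have /(_ 0) := en; have := H 0; have := H 1; rewrite !mxE /= => -> ->.
    by rewrite expr0n /= addr0 => E; rewrite -E ltxx in r0.
  move=> u; rewrite -(hK u) -tP.
  have [-> _] := xc (h u + S); have [-> _] := xc (h u).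
  have [-> _] := x1P (h u); have [-> _] := x2P (h u).
  by apply/rowP => k; rewrite !mxE; case: (ord2P k) => ->.
rewrite (@curve_length_const _ _ 1 (t S)) ?mul1r ?ler01 ?(ltW tS)//.
by move=> u; rewrite mE expr1n.
Qed.
End Reparametrization.

(** * First-order flows and their periods *)

Section Circle.
Context {R : realType}.
Implicit Types f g u w F : R -> R.

(** The integral over one period, through any primitive of the integrand. *)
Definition intg w : R := let F := xget (fun=> 0) [set F | deriv F w] in F 1 - F 0.

Lemma intgE F w : deriv F w -> intg w = F 1 - F 0.
Proof.
move=> dF; rewrite /intg; case: xgetP => [G _ dG|/(_ F)//].
have d : deriv (fun x => F x - G x) (fun=> 0).
  by apply: (deriv_ext (derivB dF dG)) => // x; rewrite subrr.
have := deriv_const d 0 1; lra.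
Qed.

Lemma intg_le w w' : continuous w -> continuous w' -> (forall x, w x <= w' x) ->
  intg w <= intg w'.
Proof.
move=> /primitive[F dF] /primitive[F' dF'] le.
by rewrite (intgE dF) (intgE dF'); apply: (deriv_le ler01 dF dF') => x _.
Qed.

Lemma intgD w w' : continuous w -> continuous w' ->
  intg (fun x => w x + w' x) = intg w + intg w'.
Proof.
move=> /primitive[F dF] /primitive[F' dF'].
rewrite (intgE dF) (intgE dF') (intgE (derivD dF dF')); lra.
Qed.

Lemma intgZ k w : continuous w -> intg (fun x => k * w x) = k * intg w.
Proof.
by move=> /primitive[F dF]; rewrite (intgE dF) (intgE (derivZ k dF)) mulrBr.
Qed.

Lemma intgC k : intg (fun=> k) = k.
Proof.
have d : deriv (fun x : R => k * x) (fun=> k).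
  by apply: (deriv_ext (derivZ k derivX)) => // x; rewrite mulr1.
by rewrite (intgE d) mulr1 mulr0 subr0.
Qed.

Lemma intg_gt0 w x0 : continuous w -> (forall x, 0 <= w x) -> 0 <= x0 < 1 -> 0 < w x0 ->
  0 < intg w.
Proof.
move=> cw w0 /andP[x00 x01] wx0; have [F dF] := primitive cw.
have incr x y : x <= y -> F x <= F y by move=> xy; apply: (deriv_incr xy dF).
have [e e0 He] : exists2 e : R, 0 < e & forall x, x0 <= x <= x0 + e -> 0 < w x.
  have /cvgrPdist_lt /(_ _ wx0) := cw x0.
  rewrite -filter_from_ballE /= => -[e /= e0 He].
  exists (e / 2); first by rewrite divr_gt0.
  move=> x xe; have /He : ball x0 e x.
    by rewrite /ball /= distrC ger0_norm; lra.
  by move=> /=; have := ler_norm (w x0 - w x); lra.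
pose d := Num.min e (1 - x0).
have d0 : 0 < d by rewrite lt_min e0 subr_gt0.
have de : d <= e /\ d <= 1 - x0 by rewrite /d !ge_min !lexx orbT.
rewrite (intgE dF) subr_gt0; apply: (@le_lt_trans _ _ (F x0)); first exact: incr.
apply: (@lt_le_trans _ _ (F (x0 + d))); last by apply: incr; lra.
apply: (deriv_sincr _ dF) => [|x xd]; first lra.
by apply: He; lra.
Qed.

Lemma intg_dist w w' C : continuous w -> continuous w' ->
  (forall x, `|w x - w' x| <= C) -> `|intg w - intg w'| <= C.
Proof.
have half v v' : continuous v -> continuous v' -> (forall x, v x <= v' x + C) ->
    intg v <= intg v' + C.
  move=> cv cv' le; have cC : continuous (fun _ : R => C) by move=> ?; exact: cvg_cst.
  rewrite -[X in _ <= _ + X]intgC -intgD//.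
  by apply: intg_le => // x; apply: cvgD; [exact: cv'|exact: cC].
move=> cw cw' le; rewrite ler_norml.
have h1 : intg w <= intg w' + C.
  by apply: half => // x; have := le x; rewrite ler_norml; lra.
have h2 : intg w' <= intg w + C.
  by apply: half => // x; have := le x; rewrite ler_norml; lra.
lra.
Qed.

(** Speed at [x] of the rotating motion of energy [a]. *)
Definition spd f (a : R) (x : R) : R := Num.sqrt (f x + a).
(** Time needed by the rotating motion of energy [a] to go once around the circle. *)
Definition tau f a : R := intg (fun x => (spd f a x)^-1).
(** The action variable of the rotating motion; its derivative in [a] is half the
period [tau]. *)
Definition act f a : R := intg (spd f a).

Lemma spd_gt0 f a x : 0 < f x + a -> 0 < spd f a x.
Proof. by rewrite sqrtr_gt0. Qed.

Lemma spd_sqr f a x : 0 < f x + a -> spd f a x ^+ 2 = f x + a.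
Proof. by move=> h; rewrite sqr_sqrtr// ltW. Qed.

Lemma spd_cont f a : continuous f -> continuous (spd f a).
Proof.
move=> cf x; apply: continuous_comp; last exact: sqrt_continuous.
by apply: continuousD; [exact: cf|exact: cst_continuous].
Qed.

Lemma spdV_cont f a : continuous f -> (forall x, 0 < f x + a) ->
  continuous (fun x => (spd f a x)^-1).
Proof.
move=> cf f0 x; apply: continuousV; last exact: spd_cont.
by rewrite gt_eqF// spd_gt0.
Qed.

Lemma spd_deriv f a : deriv f (derive1 f) -> (forall x, 0 < f x + a) ->
  deriv (spd f a) (fun x => derive1 f x / (2 * spd f a x)).
Proof.
move=> df f0 x.
have h1 := derivD df (derivC a) x.
have h := @is_derive_compR R Num.sqrt (fun x => f x + a) x _ _ (is_derive1_sqrt (f0 x)) h1.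
by apply: is_derive_eq h _; rewrite addr0 mulrC.
Qed.

(** Separation of variables: invert the primitive of the reciprocal speed. *)
Lemma flow_exists f K a : C2per f K -> (forall x, 0 < f x + a) ->
  exists P X, [/\ deriv P (fun x => (spd f a x)^-1), cancel P X, cancel X P,
    deriv X (fun s => spd f a (X s)) & forall x, P (x + 1) = P x + tau f a].
Proof.
move=> cf f0.
have cs := spdV_cont (deriv_cont (C2d1 cf)) f0.
have [P dP] := primitive cs.
have [y ym] := periodic_max (deriv_cont (C2d1 cf)) (C2per0 cf).
have lo x : (spd f a y)^-1 <= (spd f a x)^-1.
  rewrite lef_pV2 ?posrE ?spd_gt0//; apply: ler_wsqrtr; have := ym x; lra.
have lo0 : 0 < (spd f a y)^-1 by rewrite invr_gt0 spd_gt0.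
have [X [PK XK dX]] := reparam dP cs lo0 lo.
exists P, X; split=> //.
  by apply: (deriv_ext dX) => // s; rewrite invrK.
move=> x; have da : deriv (fun x : R => x + 1) (fun=> 1).
  by apply: (deriv_ext (derivD derivX (derivC 1))) => // z; rewrite addr0.
have d : deriv (fun x => P (x + 1) - P x) (fun=> 0).
  apply: (deriv_ext (derivB (deriv_comp dP da) dP)) => // z.
  by rewrite /spd (C2per0 cf) mulr1 subrr.
by have := deriv_const d x 0; rewrite /tau (intgE dP) add0r; lra.
Qed.

Lemma addz_shift (P : R -> R) (T : R) : (forall x, P (x + 1) = P x + T) ->
  forall (z : int) x, P (x + z%:~R) = P x + z%:~R * T.
Proof.
move=> PT; have N n x : P (x + n%:R) = P x + n%:R * T.
  elim: n x => [|n IH] x; first by rewrite mul0r !addr0.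
  by rewrite -addn1 natrD addrA PT IH; ring.
case=> n x; first exact: N.
have := N n.+1 (x + (Negz n)%:~R); rewrite NegzE mulrNz subrK => ->; ring.
Qed.

Lemma newton_spd f K a X : C2per f K -> (forall x, 0 < f x + a) ->
  deriv X (fun s => spd f a (X s)) -> newton f X (fun s => spd f a (X s)).
Proof.
move=> cf f0 dX; split=> //.
apply: (deriv_ext (deriv_comp (spd_deriv (C2d1 cf) f0) dX)) => // s.
by field; rewrite gt_eqF// spd_gt0.
Qed.

Lemma newton_pos f K a x p : C2per f K -> (forall y, 0 < f y + a) ->
  newton f x p -> 0 < p 0 -> p 0 ^+ 2 = f (x 0) + a ->
  forall s, p s = spd f a (x s).
Proof.
move=> cf f0 n p0 E s.
have [P [X [dP PK XK dX _]]] := flow_exists cf f0.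
have n' := newton_shift (P (x 0)) (newton_spd cf f0 dX).
have := newton_uniq cf n n'; rewrite /= add0r PK.
have E0 : p 0 = spd f a (x 0) by rewrite /spd -E sqrtr_sqr ger0_norm// ltW.
by move=> /(_ erefl E0 s)[-> ->].
Qed.

Lemma flow_time f a P x p : deriv P (fun y => (spd f a y)^-1) ->
  (forall y, 0 < f y + a) -> deriv x p -> (forall s, p s = spd f a (x s)) ->
  forall s, P (x s) = P (x 0) + s.
Proof.
move=> dP f0 dx E s.
have d : deriv (fun s => P (x s) - s) (fun=> 0).
  apply: (deriv_ext (derivB (deriv_comp dP dx) derivX)) => // u.
  by rewrite E mulVf ?subrr// gt_eqF// spd_gt0.
by have := deriv_const d s 0; lra.
Qed.

Lemma act_shift f K a Q : C2per f K -> deriv Q (spd f a) ->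
  forall x, Q (x + 1) = Q x + act f a.
Proof.
move=> cf dQ x.
have da : deriv (fun x : R => x + 1) (fun=> 1).
  by apply: (deriv_ext (derivD derivX (derivC 1))) => // z; rewrite addr0.
have d : deriv (fun x => Q (x + 1) - Q x) (fun=> 0).
  apply: (deriv_ext (derivB (deriv_comp dQ da) dQ)) => // z.
  by rewrite /spd (C2per0 cf) mulr1 subrr.
by have := deriv_const d x 0; rewrite /act (intgE dQ) add0r; lra.
Qed.

Lemma tau_gt0 f K a : C2per f K -> (forall x, 0 < f x + a) -> 0 < tau f a.
Proof.
move=> cf f0; apply: (@intg_gt0 _ 0) => [||//|].
- exact: spdV_cont (deriv_cont (C2d1 cf)) f0.
- by move=> x; rewrite invr_ge0 sqrtr_ge0.
- by rewrite lexx ltr01.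
- by rewrite invr_gt0 spd_gt0.
Qed.

Lemma act_gt0 f K a : C2per f K -> (forall x, 0 < f x + a) -> 0 < act f a.
Proof.
move=> cf f0; apply: (@intg_gt0 _ 0) => [||//|].
- exact: spd_cont (deriv_cont (C2d1 cf)).
- by move=> x; rewrite sqrtr_ge0.
- by rewrite lexx ltr01.
- by rewrite spd_gt0.
Qed.

(** A winding path takes the value [y] modulo 1, by the intermediate value theorem. *)
Lemma cross_point (x : R -> R) (y : R) (S : R) (z : int) : continuous x -> z != 0 ->
  x S = x 0 + z%:~R -> exists s k, x s = y + k%:~R.
Proof.
move=> cx z0 xS.
have [k kP] : exists k : int, Num.min (x 0) (x S) <= y + k%:~R <= Num.max (x 0) (x S).
  set m := Num.min (x 0) (x S).
  have Mm : m + 1 <= Num.max (x 0) (x S).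
    rewrite /m xS; have [z1|z1] : (1 <= z) \/ (z <= -1) by lia.
      have : (1:R) <= z%:~R by rewrite ler1z.
      by move=> H; rewrite (min_idPl _) ?(max_idPr _); lra.
    have : z%:~R <= (-1:R) by rewrite -[X in _ <= X](intrN _ 1) ler_int.
    by move=> H; rewrite (min_idPr _) ?(max_idPl _); lra.
  exists (- Num.floor (y - m)); rewrite intrN.
  have := floor_itv (y - m); rewrite intrD => /andP[]; lra.
have [S0|/ltW S0] := leP 0 S.
  have [s _ xs] := @IVT R x 0 S (y + k%:~R) S0 (continuous_subspaceT cx) kP.
  by exists s, k.
rewrite minC maxC in kP.
have [s _ xs] := @IVT R x S 0 (y + k%:~R) S0 (continuous_subspaceT cx) kP.
by exists s, k.
Qed.

Lemma derive1_min0 f y : deriv f (derive1 f) -> (forall x, f y <= f x) -> derive1 f y = 0.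
Proof.
move=> df ym.
have yI : y \in `](y - 1), (y + 1)[ by rewrite in_itv /=; lra.
have h := @derive1_at_min R f (y - 1) (y + 1) y _ _ yI _.
rewrite derive1E; apply: derive_val; apply: h => //; first lra.
by move=> t _; have [] := df t.
Qed.

(** A motion that winds around the circle passes over the maximum of the potential
with nonzero velocity, so its energy exceeds that maximum and its velocity never
vanishes: it solves a first-order equation. *)
Lemma winding_orbit f K x p (S : R) (z : int) : C2per f K -> newton f x p ->
  0 < S -> z != 0 -> x S = x 0 + z%:~R -> p S = p 0 ->
  exists a, [/\ forall y, 0 < f y + a, forall s, p s ^+ 2 = f (x s) + a,
    S = `|z|%N%:R * tau f a
    & forall Q, deriv Q (fun s => p s ^+ 2) -> Q S - Q 0 = `|z|%N%:R * act f a].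
Proof.
move=> cf n S0 z0 xS pS.
pose a := p 0 ^+ 2 - f (x 0).
have pE s : p s ^+ 2 = f (x s) + a by have := newton_energy (C2d1 cf) n s; rewrite /a; lra.
have cx := deriv_cont n.1.
have f_ge0 y : 0 <= f y + a.
  have [s [k xs]] := cross_point y cx z0 xS.
  by rewrite -(periodicz k y (C2per0 cf)) -xs -pE sqr_ge0.
have f0 y : 0 < f y + a.
  rewrite lt_neqAle f_ge0 andbT; apply/negP => /eqP E.
  have ym t : f y <= f t by have := f_ge0 t; lra.
  have [s [k xs]] := cross_point y cx z0 xS.
  have ps : p s = 0.
    by apply/eqP; rewrite -sqrf_eq0 pE xs (periodicz _ _ (C2per0 cf)) -E.
  have dy : derive1 f (x s) = 0.
    rewrite xs (periodicz _ _ (derive1_periodic (C2per0 cf))).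
    exact: derive1_min0 (C2d1 cf) ym.
  have := newton_uniq cf (newton_shift s n) (newton_const dy).
  rewrite /= add0r ps => /(_ erefl erefl) H.
  have [H0 _] := H (0 - s); have [HS _] := H (S - s).
  rewrite subrK in H0; rewrite subrK in HS.
  move: xS; rewrite H0 HS => /eqP; rewrite -subr_eq0 opprD addrA subrr add0r oppr_eq0.
  by rewrite intr_eq0 (negbTE z0).
have [P [X [dP _ _ _ Psh]]] := flow_exists cf f0.
have [Q0 dQ0] := primitive (@spd_cont f a (deriv_cont (C2d1 cf))).
have Qsh := addz_shift (act_shift cf dQ0).
have {}Psh := addz_shift Psh.
have t0 := tau_gt0 cf f0.
have key x' p' (z' : int) : newton f x' p' -> x' S = x' 0 + z'%:~R -> 0 < p' 0 ->
    p' 0 ^+ 2 = f (x' 0) + a ->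
    [/\ (0 <= z')%R, S = `|z'|%N%:R * tau f a
      & forall Q, deriv Q (fun s => p' s ^+ 2) -> Q S - Q 0 = `|z'|%N%:R * act f a].
  move=> n' xS' p0' E'.
  have pq := newton_pos cf f0 n' p0' E'.
  have := flow_time dP f0 n'.1 pq S; rewrite xS' Psh => H.
  have SE : S = z'%:~R * tau f a by lra.
  have z'0 : (0 <= z')%R.
    by rewrite -(ler0z R); rewrite SE pmulr_lgt0// in S0; exact: ltW.
  have zE : z'%:~R = `|z'|%N%:R :> R by rewrite natr_absz ger0_norm.
  split=> //; first by rewrite -zE.
  move=> Q dQ.
  have d : deriv (fun s => Q s - Q0 (x' s)) (fun=> 0).
    apply: (deriv_ext (derivB dQ (deriv_comp dQ0 n'.1))) => // s.
    by rewrite -pq expr2 subrr.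
  have := deriv_const d S 0; rewrite xS' Qsh -zE; lra.
exists a; split=> //.
  have [p0|p0|p0] := ltgtP (p 0) 0; last by have := f0 (x 0); rewrite -pE p0 expr0n /= ltxx.
    have nr := newton_rev (newton_shift S n).
    have h1 : x (- S + S) = x (- 0 + S) + (- z)%:~R.
      by rewrite oppr0 add0r addNr xS intrN addrK.
    have h2 : 0 < - p (- 0 + S) by rewrite oppr0 add0r pS oppr_gt0.
    have h3 : (- p (- 0 + S)) ^+ 2 = f (x (- 0 + S)) + a by rewrite sqrrN pE.
    by have [_ + _] := key _ _ (- z) nr h1 h2 h3; rewrite abszN.
  by have [_ + _] := key _ _ z n xS p0 (pE 0).
have [p0|p0|p0] := ltgtP (p 0) 0; last by have := f0 (x 0); rewrite -pE p0 expr0n /= ltxx.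
  have nr := newton_rev (newton_shift S n).
  have h1 : x (- S + S) = x (- 0 + S) + (- z)%:~R.
    by rewrite oppr0 add0r addNr xS intrN addrK.
  have h2 : 0 < - p (- 0 + S) by rewrite oppr0 add0r pS oppr_gt0.
  have h3 : (- p (- 0 + S)) ^+ 2 = f (x (- 0 + S)) + a by rewrite sqrrN pE.
  have [_ _ H] := key _ _ (- z) nr h1 h2 h3; rewrite abszN in H.
  move=> Q dQ; have da : deriv (fun s : R => - s + S) (fun=> -1).
    by apply: (deriv_ext (derivD (derivN derivX) (derivC S))) => // s; rewrite addr0.
  rewrite -(H (fun s => - Q (- s + S))); first by rewrite oppr0 add0r addNr; lra.
  apply: (deriv_ext (derivN (deriv_comp dQ da))) => // s; by rewrite mulrN1 opprK sqrrN.
by have [_ _ H] := key _ _ z n xS p0 (pE 0).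
Qed.
End Circle.

(** * Lengths of rotating geodesics *)

Section RotationLength.
Context {R : realType}.
Implicit Types f g u w F : R -> R.

(** The energies [a] and [b] of a resonant torus winding [m] and [n] times. The
equality of times is the stationarity of the length in [a]. *)
Definition rot_data (m n : nat) f g (a b l : R) : Prop :=
  [/\ a + b = 1, forall x, 0 < f x + a, forall x, 0 < g x + b,
      m%:R * tau f a = n%:R * tau g b & l = m%:R * act f a + n%:R * act g b].

Definition rot_length m n f g l := exists a b, rot_data m n f g a b l.

Lemma rot_length_swap m n f g l : rot_length m n f g l -> rot_length n m g f l.
Proof.
by move=> [a [b [ab f0 g0 E ->]]]; exists b, a; split; rewrite // addrC.
Qed.

(** Iterating a torus [d] times multiplies all data by [d], so the homology class may
be taken primitive. *)
Lemma rot_length_primitive d m n f g l : (0 < d)%N ->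
  rot_length (d * m) (d * n) f g l -> rot_length m n f g (l / d%:R).
Proof.
move=> d0 [a [b [ab f0 g0 E ->]]]; exists a, b; split => //.
  have dR : d%:R != 0 :> R by rewrite pnatr_eq0 -lt0n.
  by apply: (mulfI dR); rewrite !mulrA -!natrM.
by rewrite !natrM; field; rewrite pnatr_eq0 -lt0n.
Qed.

(** Tangent line inequality for the concave function [Num.sqrt]. *)
Lemma sqrt_tangent (s t : R) : 0 < s -> 0 < t ->
  Num.sqrt t <= Num.sqrt s + (t - s) * (2 * Num.sqrt s)^-1.
Proof.
move=> s0 t0; have h1 : 0 < Num.sqrt s by rewrite sqrtr_gt0.
have E1 := sqr_sqrtr (ltW s0); have E2 := sqr_sqrtr (ltW t0).
rewrite -{2}E1 -{2}E2 -subr_ge0.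
set S := Num.sqrt s in h1 *; set T := Num.sqrt t.
have -> : S + (T ^+ 2 - S ^+ 2) / (2 * S) - T = (S - T) ^+ 2 / (2 * S).
  by field; rewrite gt_eqF.
by rewrite divr_ge0 ?sqr_ge0// mulr_ge0// ltW.
Qed.

(** Concavity of the square root, integrated over one period. *)
Lemma act_tangent f f' K K' a a' w : C2per f K -> C2per f' K' ->
  (forall x, 0 < f x + a) -> (forall x, 0 < f' x + a') -> continuous w ->
  (forall x, (f' x - f x) * (2 * spd f a x)^-1 <= w x) ->
  act f' a' <= act f a + (a' - a) / 2 * tau f a + intg w.
Proof.
move=> cf cf' f0 f0' cw le.
have c1 := @spd_cont R f a (deriv_cont (C2d1 cf)).
have c2 := spdV_cont (deriv_cont (C2d1 cf)) f0.
have c3 : continuous (fun x => (a' - a) / 2 * (spd f a x)^-1).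
  by move=> x; apply: cvgM; [exact: cvg_cst|exact: c2].
have c4 : continuous (fun x => spd f a x + (a' - a) / 2 * (spd f a x)^-1).
  by move=> x; apply: cvgD; [exact: c1|exact: c3].
rewrite /act /tau -intgZ// -intgD// -intgD//.
apply: intg_le.
- exact: spd_cont (deriv_cont (C2d1 cf')).
- by move=> x; apply: cvgD; [exact: c4|exact: cw].
- move=> x; apply: (le_trans (sqrt_tangent (f0 x) (f0' x))).
  have := le x; rewrite -/(spd f a x).
  have s0 : spd f a x != 0 by rewrite gt_eqF// spd_gt0.
  have -> : (f' x + a' - (f x + a)) / (2 * spd f a x) =
     (f' x - f x) / (2 * spd f a x) + (a' - a) / 2 * (spd f a x)^-1.
    by field.
  lra.
Qed.

(** The rotation length is a maximum over the energy split of a concave function, so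
the data of one potential give an upper bound for the length of another. *)
Lemma rot_compare m n f g f' g' K1 K2 K1' K2' a b a' b' l l' w1 w2 :
  C2per f K1 -> C2per g K2 -> C2per f' K1' -> C2per g' K2' ->
  rot_data m n f g a b l -> rot_data m n f' g' a' b' l' ->
  continuous w1 -> continuous w2 ->
  (forall x, (f' x - f x) * (2 * spd f a x)^-1 <= w1 x) ->
  (forall x, (g' x - g x) * (2 * spd g b x)^-1 <= w2 x) ->
  l' <= l + m%:R * intg w1 + n%:R * intg w2.
Proof.
move=> cf cg cf' cg' [ab f0 g0 E ->] [ab' f0' g0' _ ->] cw1 cw2 le1 le2.
have h1 := act_tangent cf cf' f0 f0' cw1 le1.
have h2 := act_tangent cg cg' g0 g0' cw2 le2.
have m0 : 0 <= m%:R :> R by [].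
have n0 : 0 <= n%:R :> R by [].
have k1 := ler_wpM2l m0 h1; have k2 := ler_wpM2l n0 h2.
have bb : b' - b = - (a' - a) by lra.
rewrite bb in k2; apply: (le_trans (lerD k1 k2)).
have -> : m%:R * (act f a + (a' - a) / 2 * tau f a + intg w1) +
   n%:R * (act g b + - (a' - a) / 2 * tau g b + intg w2) =
   m%:R * act f a + n%:R * act g b + m%:R * intg w1 + n%:R * intg w2 +
   (a' - a) / 2 * (m%:R * tau f a - n%:R * tau g b) by ring.
by rewrite E subrr mulr0 addr0.
Qed.

(** First-order comparison: a perturbation of size [d] changes the length by at most
[d] times the travel time. *)
Lemma rot_le m n f g f' g' K1 K2 K1' K2' a b a' b' l l' d :
  C2per f K1 -> C2per g K2 -> C2per f' K1' -> C2per g' K2' ->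
  rot_data m n f g a b l -> rot_data m n f' g' a' b' l' ->
  (forall x, f' x - f x <= d) -> (forall x, g' x - g x <= d) ->
  l' <= l + m%:R * tau f a * d.
Proof.
move=> cf cg cf' cg' D D' le1 le2; have [ab f0 g0 E _] := D.
have c1 := spdV_cont (deriv_cont (C2d1 cf)) f0.
have c2 := spdV_cont (deriv_cont (C2d1 cg)) g0.
have := @rot_compare m n f g f' g' _ _ _ _ a b a' b' l l' (fun x => d / 2 * (spd f a x)^-1)
  (fun x => d / 2 * (spd g b x)^-1) cf cg cf' cg' D D'.
rewrite !intgZ// -/(tau f a) -/(tau g b).
have -> : l + m%:R * (d / 2 * tau f a) + n%:R * (d / 2 * tau g b) = l + m%:R * tau f a * d.
  rewrite [n%:R * _]mulrCA [m%:R * _]mulrCA -E; lra.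
apply.
- by move=> x; apply: cvgM; [exact: cvg_cst|exact: c1].
- by move=> x; apply: cvgM; [exact: cvg_cst|exact: c2].
- move=> x; rewrite invfM mulrA ler_wpM2r ?invr_ge0 ?sqrtr_ge0//.
  have := le1 x; lra.
- move=> x; rewrite invfM mulrA ler_wpM2r ?invr_ge0 ?sqrtr_ge0//.
  have := le2 x; lra.
Qed.

(** A concave function has only one stationary value. *)
Lemma rot_unique m n f g K1 K2 l l' : C2per f K1 -> C2per g K2 ->
  rot_length m n f g l -> rot_length m n f g l' -> l = l'.
Proof.
move=> cf cg [a [b D]] [a' [b' D']].
apply/eqP; rewrite eq_le; apply/andP; split.
  have := rot_le cf cg cf cg D' D (d := 0); rewrite mulr0 addr0; apply => x; lra.
have := rot_le cf cg cf cg D D' (d := 0); rewrite mulr0 addr0; apply => x; lra.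
Qed.

(** Strictness comes from a point where the perturbation is positive, since a rotating
orbit visits every point of the circle. *)
Lemma rot_length_lt m n f g g' K1 K2 K2' l l' x0 : (0 < n)%N ->
  C2per f K1 -> C2per g K2 -> C2per g' K2' ->
  rot_length m n f g l -> rot_length m n f g' l' ->
  (forall x, g x <= g' x) -> g x0 < g' x0 -> l < l'.
Proof.
move=> n0 cf cg cg' [a [b D]] [a' [b' D']] le lt0.
have [ab f0 g0 E _] := D'.
have c2 := spdV_cont (deriv_cont (C2d1 cg')) g0.
pose w x := (g' x - g x) * (2^-1 * (spd g' b' x)^-1).
have cw : continuous w.
  move=> x; apply: cvgM.
    by apply: cvgB; [exact: deriv_cont (C2d1 cg') x|exact: deriv_cont (C2d1 cg) x].
  by apply: cvgM; [exact: cvg_cst|exact: c2].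
have w0 x : 0 <= w x.
  by rewrite mulr_ge0 ?subr_ge0// mulr_ge0// invr_ge0 sqrtr_ge0.
have wp : 0 < intg w.
  apply: (@intg_gt0 _ w (x0 - (Num.floor x0)%:~R)) => //.
    by have := floor_itv x0; rewrite intrD => /andP[]; lra.
  rewrite /w /spd -intrN !(periodicz _ _ (C2per0 cg)) !(periodicz _ _ (C2per0 cg')).
  by rewrite mulr_gt0 ?subr_gt0// mulr_gt0// invr_gt0 sqrtr_gt0.
have := @rot_compare m n f g' f g _ _ _ _ a' b' a b l' l (fun=> 0) (fun x => -1 * w x)
   cf cg' cf cg D' D.
rewrite intgC intgZ// mulr0 addr0 => H.
have {}H : l <= l' + n%:R * (-1 * intg w).
  apply: H.
  - by move=> ?; exact: cvg_cst.
  - by move=> x; apply: cvgM; [exact: cvg_cst|exact: cw].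
  - by move=> x; rewrite subrr mul0r.
  - by move=> x; rewrite /w invfM; lra.
apply: (le_lt_trans H); rewrite mulN1r mulrN ltrBlDr ltrDl mulr_gt0// ltr0n//.
Qed.

(** The time [m * tau f a] is controlled by the length. *)
Lemma rot_time m n f g K1 K2 a b l lo : C2per f K1 -> C2per g K2 ->
  rot_data m n f g a b l -> (forall x y, lo <= 1 + f x + g y) ->
  lo * (m%:R * tau f a) <= l.
Proof.
move=> cf cg [ab f0 g0 E ->] lole.
have [y1 ym1] := periodic_min (deriv_cont (C2d1 cf)) (C2per0 cf).
have [y2 ym2] := periodic_min (deriv_cont (C2d1 cg)) (C2per0 cg).
have key (h : R -> R) (K c y : R) : C2per h K -> (forall x, 0 < h x + c) -> (forall x, h y <= h x) ->
    (h y + c) * tau h c <= act h c.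
  move=> ch h0 ym; rewrite /tau -intgZ; last exact: spdV_cont (deriv_cont (C2d1 ch)) h0.
  apply: intg_le.
  - move=> x; apply: cvgM; first exact: cvg_cst.
    exact: spdV_cont (deriv_cont (C2d1 ch)) h0 x.
  - exact: spd_cont (deriv_cont (C2d1 ch)).
  - move=> x; rewrite ler_pdivrMr ?spd_gt0// -expr2 spd_sqr//; have := ym x; lra.
have m0 : 0 <= m%:R :> R by [].
have n0 : 0 <= n%:R :> R by [].
have k1 := ler_wpM2l m0 (key _ _ _ _ cf f0 ym1).
have k2 := ler_wpM2l n0 (key _ _ _ _ cg g0 ym2).
apply: le_trans (lerD k1 k2).
rewrite [n%:R * _]mulrCA [m%:R * (_ * _)]mulrCA -E -mulrDl ler_wpM2r//.
  by rewrite mulr_ge0// ltW// (tau_gt0 cf f0).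
by have := lole y1 y2; lra.
Qed.

(** A closed orbit with both winding numbers nonzero rotates in both variables; its
energies are then resonant and its length is the rotation length. *)
Lemma winding_rot f g K1 K2 (z1 z2 : int) l : C2per f K1 -> C2per g K2 ->
  closed_orbit f g z1 z2 l -> z1 != 0 -> z2 != 0 ->
  rot_length `|z1|%N `|z2|%N f g l.
Proof.
move=> cf cg [S [x1 [p1 [x2 [p2 [t [S0 [n1 n2 en dt] [X1 P1] [X2 P2] ->]]]]]]] z1n z2n.
have [a [f0 e1 T1 Q1]] := winding_orbit cf n1 S0 z1n X1 P1.
have [b [g0 e2 T2 Q2]] := winding_orbit cg n2 S0 z2n X2 P2.
exists a, b; split=> //.
- by have := en 0; rewrite e1 e2; lra.
- by rewrite -T1 -T2.
have csq (p : R -> R) : continuous p -> continuous (fun s => p s ^+ 2).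
  by move=> cp s; exact: (@continuous_comp _ _ _ p (@GRing.exp R ^~ 2%N) s (cp s) (@exprn_continuous R 2 (p s))).
have cp1 := csq _ (deriv_cont n1.2); have cp2 := csq _ (deriv_cont n2.2).
have [q1 d1] := primitive cp1; have [q2 d2] := primitive cp2.
rewrite -(Q1 _ d1) -(Q2 _ d2).
have d : deriv (fun s => t s - (q1 s + q2 s)) (fun=> 0).
  by apply: (deriv_ext (derivB dt (derivD d1 d2))) => // s; rewrite en subrr.
have := deriv_const d S 0; lra.
Qed.

(** Near the bottom of the allowed energies the motion passes close to an equilibrium,
where by uniqueness it takes arbitrarily long. *)
Lemma tau_blowup f K a y : C2per f K -> (forall x, 0 < f x + a) ->
  (forall x, f y <= f x) -> 1 <= (f y + a) * expR ((K + 2) * tau f a).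
Proof.
move=> cf f0 ym.
have [P [X [dP PK XK dX Psh]]] := flow_exists cf f0.
have n := newton_shift (P y) (newton_spd cf f0 dX).
have dy := derive1_min0 (C2d1 cf) ym.
have d1 := derivB n.1 (derivC y).
have := @gronwall R _ _ _ K 0 (tau f a) (C2K cf) (ltW (tau_gt0 cf f0)) d1
   (derivB n.2 (derivC 0)) _.
rewrite add0r PK subrr expr0n /= add0r addr0 addr0 subr0 spd_sqr//.
have -> : X (tau f a + P y) = y + 1 by rewrite addrC -Psh PK.
have -> : y + 1 - y = 1 by ring.
rewrite expr1n subr0 spd_sqr// => H; apply: (le_trans _ (H _)).
  by rewrite lerDl ltW.
move=> s _; rewrite subr0 addr0 normrM (ger0_norm (_ : 0 <= 2^-1))//.
have := lip_derive1 (X (s + P y)) y cf; rewrite dy subr0.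
by have := normr_ge0 (derive1 f (X (s + P y))); lra.
Qed.

Lemma tau_bound f K a c : C2per f K -> 0 < c -> (forall x, c <= f x + a) ->
  tau f a <= (Num.sqrt c)^-1.
Proof.
move=> cf c0 le; have f0 x : 0 < f x + a by exact: lt_le_trans (le x).
rewrite -[leRHS]intgC; apply: intg_le.
- exact: spdV_cont (deriv_cont (C2d1 cf)) f0.
- by move=> ?; exact: cvg_cst.
- by move=> x; rewrite lef_pV2 ?posrE ?sqrtr_gt0// ler_wsqrtr.
Qed.

Lemma tau_lip f K a a' c : C2per f K -> 0 < c -> (forall x, c <= f x + a) ->
  (forall x, c <= f x + a') ->
  `|tau f a - tau f a'| <= (c * Num.sqrt c)^-1 * `|a - a'|.
Proof.
move=> cf c0 le le'.
have f0 x : 0 < f x + a by exact: lt_le_trans (le x).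
have f0' x : 0 < f x + a' by exact: lt_le_trans (le' x).
apply: intg_dist.
- exact: spdV_cont (deriv_cont (C2d1 cf)) f0.
- exact: spdV_cont (deriv_cont (C2d1 cf)) f0'.
move=> x; have s0 := spd_gt0 (f0 x); have s0' := spd_gt0 (f0' x).
have E : (spd f a x)^-1 - (spd f a' x)^-1 =
    (a' - a) * (spd f a x * spd f a' x * (spd f a x + spd f a' x))^-1.
  have : a' - a = spd f a' x ^+ 2 - spd f a x ^+ 2 by rewrite !spd_sqr//; ring.
  move=> ->; field; rewrite !gt_eqF// addr_gt0//.
have sc : 0 < Num.sqrt c by rewrite sqrtr_gt0.
have cs : Num.sqrt c <= spd f a x by exact: ler_wsqrtr.
have cs' : Num.sqrt c <= spd f a' x by exact: ler_wsqrtr.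
rewrite E normrM mulrC distrC ler_wpM2r// ger0_norm; last first.
  by rewrite invr_ge0 ltW// !mulr_gt0// addr_gt0.
rewrite lef_pV2 ?posrE ?mulr_gt0 ?addr_gt0//.
rewrite -{1}(sqr_sqrtr (ltW c0)) expr2.
have sc' := ltW sc; apply: ler_pM; [exact: mulr_ge0 | exact: sc' | exact: ler_pM |].
by rewrite (le_trans cs)// lerDl ltW.
Qed.

Lemma lip_ivt (h : R -> R) (a b C : R) : a <= b ->
  (forall x y, a <= x <= b -> a <= y <= b -> `|h x - h y| <= C * `|x - y|) ->
  h b <= 0 <= h a -> exists2 c, a <= c <= b & h c = 0.
Proof.
move=> ab lip /andP[hb ha].
pose cl x : R := Num.max a (Num.min b x).
have clI x : a <= cl x <= b.
  by rewrite /cl le_max lexx /= ge_max ab ge_min lexx.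
have clE x : a <= x <= b -> cl x = x.
  by move=> /andP[ax xb]; rewrite /cl (min_idPr xb) (max_idPr ax).
have cll x y : `|cl x - cl y| <= `|x - y|.
  have n1 := ler_norm (x - y); have n2 := ler_norm (y - x); rewrite distrC in n2.
  rewrite ler_norml /cl; case: (leP b x) => h1; case: (leP b y) => h2;
    case: (leP a b) => h3; case: (leP a x) => h4; case: (leP a y) => h5;
    apply/andP; split; lra.
have cH : continuous (h \o cl).
  move=> x; apply/cvgrPdist_lt => e e0; near=> y.
  have C0 : 0 < `|C| + 1 by rewrite ltr_wpDl.
  apply: (@le_lt_trans _ _ (`|C| * `|x - y|)).
    apply: (le_trans (lip _ _ (clI x) (clI y))).
    apply: (@le_trans _ _ (`|C| * `|cl x - cl y|)); first by rewrite ler_wpM2r// ler_norm.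
    by rewrite ler_wpM2l.
  have : `|x - y| < e / (`|C| + 1).
    by near: y; apply: cvgr_dist_lt; rewrite ?divr_gt0//; exact: cvg_id.
  rewrite ltr_pdivlMr// => H; apply: le_lt_trans H.
  by rewrite mulrC ler_wpM2l// lerDl.
have [|c cab hc] := @IVT R (h \o cl) a b 0 ab (continuous_subspaceT cH).
  rewrite /= !clE ?lexx ?ab//.
  by rewrite (min_idPr (le_trans hb ha)) (max_idPl (le_trans hb ha)) hb ha.
move: cab; rewrite in_itv /= => cab; exists c => //.
by move: hc; rewrite /= clE.
Unshelve. all: by end_near. Qed.

(** The difference of the two travel times changes sign: each of them tends to
infinity at one end of the energy interval. *)
Lemma rot_exists m n f g K1 K2 : (0 < m)%N -> (0 < n)%N ->
  C2per f K1 -> C2per g K2 -> (forall x y, 0 < 1 + f x + g y) ->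
  exists l, rot_length m n f g l.
Proof.
move=> m0 n0 cf cg pos.
have [y1 ym1] := periodic_min (deriv_cont (C2d1 cf)) (C2per0 cf).
have [y2 ym2] := periodic_min (deriv_cont (C2d1 cg)) (C2per0 cg).
pose d := (1 + f y1 + g y2) / 2.
have d0 : 0 < d by rewrite divr_gt0.
have dE : d * 2 = 1 + f y1 + g y2 by rewrite /d; field.
pose B := (Num.sqrt d)^-1.
have B0 : 0 < B by rewrite invr_gt0 sqrtr_gt0.
have mR : 1 <= m%:R :> R by rewrite ler1n.
have nR : 1 <= n%:R :> R by rewrite ler1n.
pose e1 := Num.min d (expR (- ((K1 + 2) * (n%:R * B + 1)))).
pose e2 := Num.min d (expR (- ((K2 + 2) * (m%:R * B + 1)))).
have e10 : 0 < e1 by rewrite lt_min d0 expR_gt0.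
have e20 : 0 < e2 by rewrite lt_min d0 expR_gt0.
have e1d : e1 <= d by rewrite ge_min lexx.
have e2d : e2 <= d by rewrite ge_min lexx.
pose aL := e1 - f y1; pose aR := 1 + g y2 - e2.
have blow h K y c k e B' : C2per h K -> (forall x, h y <= h x) -> (k%:R >= 1 :> R) ->
    0 < e -> c = e - h y -> e <= expR (- ((K + 2) * (B' + 1))) ->
    B' <= (k%:R : R) * tau h c.
  move=> ch ym k1 e0 -> ele.
  have h0 x : 0 < h x + (e - h y) by have := ym x; lra.
  have t0 := tau_gt0 ch h0.
  have := tau_blowup ch h0 ym; rewrite addrC subrK => H.
  have K20 : 0 < K + 2 by have := C2K ch; lra.
  have : 1 <= expR (- ((K + 2) * (B' + 1))) * expR ((K + 2) * tau h (e - h y)).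
    by apply: (le_trans H); rewrite ler_wpM2r// ltW// expR_gt0.
  rewrite -expRD -[X in X <= _]expR0 ler_expR => H'.
  have : 0 <= (K + 2) * (tau h (e - h y) - (B' + 1)) by lra.
  rewrite pmulr_rge0// => H''.
  have : 1 * tau h (e - h y) <= k%:R * tau h (e - h y) by rewrite ler_wpM2r// ltW.
  lra.
have [c c0 lec] : exists2 c, 0 < c & forall a, aL <= a <= aR ->
   (forall x, c <= f x + a) /\ (forall x, c <= g x + (1 - a)).
  exists (Num.min e1 e2); first by rewrite lt_min e10.
  move=> a /andP[a1 a2]; split=> x.
    by rewrite ge_min; apply/orP; left; have := ym1 x; rewrite /aL in a1; lra.
  by rewrite ge_min; apply/orP; right; have := ym2 x; rewrite /aR in a2; lra.
have aLR : aL <= aR by rewrite /aL /aR; lra.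
have [||a aab E] := @lip_ivt (fun a => m%:R * tau f a - n%:R * tau g (1 - a)) aL aR
   ((m%:R + n%:R) * (c * Num.sqrt c)^-1) aLR.
- move=> a a' /lec[l1 l2] /lec[l1' l2'].
  have h1 := tau_lip cf c0 l1 l1'; have h2 := tau_lip cg c0 l2' l2.
  rewrite (_ : 1 - a' - (1 - a) = a - a') in h2; last by ring.
  rewrite (_ : _ - _ - _ = m%:R * (tau f a - tau f a') + n%:R * (tau g (1 - a') - tau g (1 - a))); last by ring.
  apply: (le_trans (ler_normD _ _)); rewrite !normrM !normr_nat -mulrA mulrDl.
  by apply: lerD; rewrite ler_wpM2l.
- apply/andP; split.
    rewrite subr_le0.
    have h1 : tau f aR <= B.
      by apply: (tau_bound cf d0) => x; have := ym1 x; rewrite /aR; lra.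
    have h2 : m%:R * B <= n%:R * tau g (1 - aR).
      apply: (blow _ _ _ _ _ e2 _ cg ym2 nR e20); first by rewrite /aR; ring.
      by rewrite ge_min lexx orbT.
    by apply: le_trans h2; rewrite ler_wpM2l.
  rewrite subr_ge0.
  have h1 : tau g (1 - aL) <= B.
    by apply: (tau_bound cg d0) => x; have := ym2 x; rewrite /aL; lra.
  have h2 : n%:R * B <= m%:R * tau f aL.
    apply: (blow _ _ _ _ _ e1 _ cf ym1 mR e10) => //.
    by rewrite ge_min lexx orbT.
  by apply: le_trans h2; rewrite ler_wpM2l.
have [l1 l2] := lec a aab.
exists (m%:R * act f a + n%:R * act g (1 - a)), a, (1 - a); split=> //; try lra.
- by move=> x; exact: lt_le_trans (l1 x).
- by move=> x; exact: lt_le_trans (l2 x).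
Qed.
End RotationLength.

(** * Rational tori and the noncoincidence condition *)

Section Tori.
Context {R : realType}.
Local Notation plane := 'rV[R]_2.
Implicit Types (f : liouville_pair R).

(** Lengths of closed geodesics in the classes with a vanishing component. *)
Definition osc_length (f g : R -> R) (l : R) :=
  exists z1 z2 : int, z1 * z2 = 0 /\ closed_orbit f g z1 z2 l.

Lemma osc_spectrumE f l :
  osc_spectrum (liouville_metric f) l <-> osc_length (liouville1 f) (liouville2 f) l.
Proof.
split.
  move=> [z /= zosc /length_spectrumE H]; exists (z ord0 0), (z ord0 1); split=> //.
  by apply/eqP; apply: contrapT => /negP H'; apply: zosc; rewrite /graph_class.
move=> [z1 [z2 [z0 H]]]; exists (row2 z1 z2) => /=.
  by rewrite /graph_class row2_0 row2_1 z0 eqxx.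
by apply/length_spectrumE; rewrite row2_0 row2_1.
Qed.

(** Following the orbit [d] times; periodicity of the velocities makes this an orbit
of the [d]-fold class. *)
Lemma closed_orbit_iter (F G : R -> R) K1 K2 z1 z2 l d : C2per F K1 -> C2per G K2 ->
  (0 < d)%N -> closed_orbit F G z1 z2 l ->
  closed_orbit F G (z1 *+ d) (z2 *+ d) (d%:R * l).
Proof.
move=> cF cG d0 [S [x1 [p1 [x2 [p2 [t [S0 [n1 n2 en dt] [X1 P1] [X2 P2] ->]]]]]]].
have x1P := newton_periodic cF n1 X1 P1.
have x2P := newton_periodic cG n2 X2 P2.
have it (x p : R -> R) (z : int) : (forall s, x (s + S) = x s + z%:~R /\ p (s + S) = p s) ->
    forall k, x (k%:R * S) = x 0 + (z *+ k)%:~R /\ p (k%:R * S) = p 0.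
  move=> H; elim=> [|k [IH1 IH2]]; first by rewrite mul0r mulr0n addr0.
  have -> : k.+1%:R * S = k%:R * S + S by rewrite -natr1; ring.
  have [-> ->] := H (k%:R * S); rewrite IH1 IH2; split=> //.
  by rewrite mulrS [in RHS]intrD; ring.
have tP s : t (s + S) = t s + (t S - t 0).
  have da : deriv (fun s : R => s + S) (fun=> 1).
    by apply: (deriv_ext (derivD derivX (derivC S))) => // u; rewrite addr0.
  have dd : deriv (fun s => t (s + S) - t s) (fun=> 0).
    apply: (deriv_ext (derivB (deriv_comp dt da) dt)) => // u.
    have [-> _] := x1P u; have [-> _] := x2P u.
    by rewrite (periodicz _ _ (C2per0 cF)) (periodicz _ _ (C2per0 cG)) mulr1 subrr.
  have := deriv_const dd s 0; rewrite add0r; lra.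
have tk k : t (k%:R * S) = t 0 + k%:R * (t S - t 0).
  elim: k => [|k IH]; first by rewrite !mul0r addr0.
  have -> : k.+1%:R * S = k%:R * S + S by rewrite -natr1; ring.
  by rewrite tP IH -natr1; ring.
exists (d%:R * S), x1, p1, x2, p2, t; split=> //.
- by rewrite mulr_gt0// ltr0n.
- exact: it.
- exact: it.
- by rewrite tk; ring.
Qed.

Lemma osc_length_iter (F G : R -> R) K1 K2 l d : C2per F K1 -> C2per G K2 ->
  (0 < d)%N -> osc_length F G l -> osc_length F G (d%:R * l).
Proof.
move=> cF cG d0 [z1 [z2 [z0 H]]]; exists (z1 *+ d), (z2 *+ d); split.
  by rewrite mulrnAr mulrnAl z0 !mul0rn.
exact: closed_orbit_iter cF cG d0 H.
Qed.

Lemma unit_geodesic f c : geodesic (liouville_metric f) c ->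
  metric_dot (liouville_metric f) (c 0) (derive1 c 0) (derive1 c 0) = 1 ->
  exists th h x1 p1 x2 p2,
  [/\ newton_orbit (liouville1 f) (liouville2 f) x1 p1 x2 p2 h,
      [/\ cancel th h, cancel h th, th 0 = 0 & {homo th : a b / a < b}]
    & forall s, c (h s) = row2 (x1 s) (x2 s) /\
      derive1 c (h s) = (1 + liouville1 f (x1 s) + liouville2 f (x2 s))^-1 *: row2 (p1 s) (p2 s)].
Proof.
move=> g m1.
have c0 : derive1 c 0 != 0.
  apply/eqP => c0; move: m1; rewrite c0 metric_dotE !mxE expr0n /= addr0 mulr0.
  by move/eqP; rewrite eq_sym oner_eq0.
have [E [th [h [x1 [p1 [x2 [p2 [E0 orb th4 xc mE]]]]]]]] := geodesic_newton g c0.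
have E1 : E = 1.
  have := mE 0; rewrite m1 => /esym/eqP; rewrite sqrf_eq1 => /orP[/eqP//|/eqP].
  lra.
rewrite E1 in orb xc; exists th, h, x1, p1, x2, p2; split=> //.
  by move: orb; rewrite [fun s => _](_ : _ = h)//; apply/funext => s; rewrite mul1r.
move=> s; have [-> vs] := xc s; split=> //; rewrite scale1r in vs.
have r0 := liouville_gt0 f (x1 s) (x2 s).
by rewrite -vs scalerA mulVf ?scale1r// gt_eqF.
Qed.

Lemma flow_closed_orbit f (z : 'rV[int]_2) (T : R) (x u : plane) : 0 < T ->
  metric_dot (liouville_metric f) x u u = 1 ->
  geodesic_flow (liouville_metric f) T (x, u) (x + lattice z, u) ->
  closed_orbit (liouville1 f) (liouville2 f) (z ord0 0) (z ord0 1) T.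
Proof.
have [K1 cK1] := circle_C2per (liouville1 f).
have [K2 cK2] := circle_C2per (liouville2 f).
move=> T0 m1 [c [g [c0 c0'] [cT cT']]].
have [|th [h [x1 [p1 [x2 [p2 [orb [thK hK th0 thi] xc]]]]]]] := unit_geodesic g.
  by rewrite c0 c0'.
have h0 : h 0 = 0 by rewrite -th0 thK.
have [xT vT] := xc (th T); rewrite thK cT cT' in xT vT.
have [x0 v0] := xc 0; rewrite h0 c0 c0' in x0 v0.
have X1 : x1 (th T) = x1 0 + (z ord0 0)%:~R.
  by have := congr1 (fun u : plane => u ord0 0) xT; rewrite x0 !mxE /=.
have X2 : x2 (th T) = x2 0 + (z ord0 1)%:~R.
  by have := congr1 (fun u : plane => u ord0 1) xT; rewrite x0 !mxE /=.
rewrite X1 X2 (periodicz _ _ (C2per0 cK1)) (periodicz _ _ (C2per0 cK2)) in vT.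
have r0 : (1 + liouville1 f (x1 0) + liouville2 f (x2 0))^-1 != 0.
  by rewrite invr_eq0 gt_eqF// liouville_gt0.
rewrite v0 in vT; have vv := scalerI r0 vT.
have P1 : p1 (th T) = p1 0 by have := congr1 (fun u : plane => u ord0 0) vv; rewrite !mxE.
have P2 : p2 (th T) = p2 0 by have := congr1 (fun u : plane => u ord0 1) vv; rewrite !mxE.
exists (th T), x1, p1, x2, p2, h; split=> //; first by rewrite -th0 thi.
by rewrite thK h0 subr0.
Qed.

(** The closed orbits of a graph torus wind in both variables, so their common length
is a rotation length. *)
Lemma torus_rot f v T : graph_rational_torus (liouville_metric f) v ->
  torus_length (liouville_metric f) v T ->
  exists z : 'rV[int]_2, [/\ graph_class z,
    length_spectrum (liouville_metric f) z T
    & rot_length (absz (z ord0 0)) (absz (z ord0 1)) (liouville1 f) (liouville2 f) T].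
Proof.
have [K1 cK1] := circle_C2per (liouville1 f).
have [K2 cK2] := circle_C2per (liouville2 f).
move=> [[[cv _ uv] _ _] [z [[T' [[pT' minT'] flow]] gz]]] [pT minT].
have TT' : T' = T by apply/eqP; rewrite eq_le minT'// minT.
rewrite TT' in flow; exists z; have T0 := pT.1.
have co := flow_closed_orbit T0 (uv 0) (flow 0).
have /andP[z1 z2] : (z ord0 0 != 0) && (z ord0 1 != 0).
  by move: gz; rewrite /graph_class mulf_eq0 negb_or.
split; [exact: gz | | exact: (winding_rot cK1 cK2 co z1 z2)].
exact: (length_spectrumE f z T).2 co.
Qed.

Lemma contD (X : topologicalType) (a b : X -> R) : continuous a -> continuous b ->
  continuous (fun x => a x + b x).
Proof. by move=> ca cb x; apply: cvgD; [exact: ca|exact: cb]. Qed.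

Lemma contM (X : topologicalType) (a b : X -> R) : continuous a -> continuous b ->
  continuous (fun x => a x * b x).
Proof. by move=> ca cb x; apply: cvgM; [exact: ca|exact: cb]. Qed.

Lemma contV (X : topologicalType) (a : X -> R) : continuous a -> (forall x, a x != 0) ->
  continuous (fun x => (a x)^-1).
Proof. by move=> ca a0 x; apply: cvgV; [exact: a0|exact: ca]. Qed.

Lemma continuous_row2 (X : topologicalType) (a b : X -> R) :
  continuous a -> continuous b -> continuous (fun x => row2 (a x) (b x)).
Proof.
move=> ca cb.
have -> : (fun x => row2 (a x) (b x)) =
    (fun x => a x *: (delta_mx ord0 0 : plane) + b x *: (delta_mx ord0 1 : plane)).
  apply/funext => x; apply/rowP => k; rewrite !mxE eqxx.
  by case: (ord2P k) => -> /=; rewrite ?mulr1 ?mulr0 ?addr0 ?add0r.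
by move=> x; apply: cvgD; apply: cvgZr_tmp; [exact: ca|exact: cb].
Qed.

(** The rotating motions of two fixed resonant energies foliate the torus; they define
the section [x |-> (q1 (x1), q2 (x2)) / rho]. Coprimality makes the period minimal. *)
Lemma rot_torus f m n l : (0 < m)%N -> (0 < n)%N -> coprime m n ->
  rot_length m n (liouville1 f) (liouville2 f) l ->
  exists v, graph_rational_torus (liouville_metric f) v /\
            torus_length (liouville_metric f) v l.
Proof.
have [K1 cK1] := circle_C2per (liouville1 f).
have [K2 cK2] := circle_C2per (liouville2 f).
move=> m0 n0 mn [a [b [ab f0 g0 E lE]]].
have [P1 [X1 [dP1 PK1 XK1 dX1 Psh1]]] := flow_exists cK1 f0.
have [P2 [X2 [dP2 PK2 XK2 dX2 Psh2]]] := flow_exists cK2 g0.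
have {}Psh1 := addz_shift Psh1; have {}Psh2 := addz_shift Psh2.
have sc1 := @spd_cont R _ a (deriv_cont (C2d1 cK1)).
have sc2 := @spd_cont R _ b (deriv_cont (C2d1 cK2)).
have [Q1 dQ1] := primitive sc1.
have [Q2 dQ2] := primitive sc2.
have Qsh1 := addz_shift (act_shift cK1 dQ1).
have Qsh2 := addz_shift (act_shift cK2 dQ2).
have t1 := tau_gt0 cK1 f0; have t2 := tau_gt0 cK2 g0.
have a1 := act_gt0 cK1 f0; have a2 := act_gt0 cK2 g0.
set q1 := spd (liouville1 f) a in sc1 dQ1 dX1 dP1.
set q2 := spd (liouville2 f) b in sc2 dQ2 dX2 dP2.
have q10 x : 0 < q1 x by exact: spd_gt0.
have q20 x : 0 < q2 x by exact: spd_gt0.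
have q1E x : q1 x ^+ 2 = liouville1 f x + a by exact: spd_sqr.
have q2E x : q2 x ^+ 2 = liouville2 f x + b by exact: spd_sqr.
have q1p (z : int) x : q1 (x + z%:~R) = q1 x by rewrite /q1 /spd (periodicz _ _ (C2per0 cK1)).
have q2p (z : int) x : q2 (x + z%:~R) = q2 x by rewrite /q2 /spd (periodicz _ _ (C2per0 cK2)).
pose rho (x : plane) := liouville_factor f x.
have rho0 x : 0 < rho x by exact: liouville_gt0.
have rhoE x : rho x = q1 (x ord0 0) ^+ 2 + q2 (x ord0 1) ^+ 2.
  by rewrite q1E q2E /rho /liouville_factor; lra.
pose v (x : plane) : plane := row2 ((rho x)^-1 * q1 (x ord0 0)) ((rho x)^-1 * q2 (x ord0 1)).
have vE x : v x = (rho x)^-1 *: row2 (q1 (x ord0 0)) (q2 (x ord0 1)).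
  by apply/rowP => k; rewrite !mxE; case: ifP.
have crd (k : 'I_2) : continuous (fun x : plane => x ord0 k).
  by move=> x; exact: coord_continuous.
have cq1 : continuous (fun x : plane => q1 (x ord0 0)).
  by move=> x; apply: (@continuous_comp _ _ _ (fun x : plane => x ord0 0) q1); [exact: crd|exact: sc1].
have cq2 : continuous (fun x : plane => q2 (x ord0 1)).
  by move=> x; apply: (@continuous_comp _ _ _ (fun x : plane => x ord0 1) q2); [exact: crd|exact: sc2].
have crho : continuous rho.
  have -> : rho = fun x : plane => q1 (x ord0 0) * q1 (x ord0 0) + q2 (x ord0 1) * q2 (x ord0 1).
    by apply/funext => x; rewrite rhoE !expr2.
  by apply: contD; apply: contM.
have crV : continuous (fun x => (rho x)^-1).
  by apply: contV => // x; rewrite gt_eqF.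
have lat (x : plane) (z : 'rV[int]_2) (k : 'I_2) : (x + lattice z) ord0 k = x ord0 k + (z ord0 k)%:~R.
  by rewrite !mxE.
have rhop x z : rho (x + lattice z) = rho x by rewrite !rhoE !lat q1p q2p.
have vper : biperiodic v.
  by move=> x z; rewrite !vE rhop !lat q1p q2p.
have unit : unit_section (liouville_metric f) v.
  split=> //.
    by apply: continuous_row2; apply: contM.
  move=> x; rewrite metric_dotE -/(rho x) row2_0 row2_1 !exprMn -mulrDr -rhoE.
  by field; rewrite gt_eqF.
have follow c x : geodesic (liouville_metric f) c -> c 0 = x -> derive1 c 0 = v x ->
    exists th h x1 p1 x2 p2,
    [/\ newton_orbit (liouville1 f) (liouville2 f) x1 p1 x2 p2 h,
      [/\ cancel th h, cancel h th, th 0 = 0 & {homo th : a b / a < b}],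
      (forall s, p1 s = q1 (x1 s)) /\ (forall s, p2 s = q2 (x2 s))
    & forall s, c (h s) = row2 (x1 s) (x2 s) /\ derive1 c (h s) = v (c (h s))].
  move=> g cx cv'; have [_ _ mv] := unit.
  have [|th [h [x1 [p1 [x2 [p2 [orb th4 xc]]]]]]] := unit_geodesic g.
    by rewrite cx cv'.
  have [thK hK th0 thi] := th4.
  have h0 : h 0 = 0 by rewrite -th0 thK.
  have rx s : 1 + liouville1 f (x1 s) + liouville2 f (x2 s) = rho (row2 (x1 s) (x2 s)).
    by rewrite /rho /liouville_factor row2_0 row2_1.
  have [c0 v0] := xc 0; rewrite h0 cx cv' in c0 v0.
  have r0 : (rho (row2 (x1 0) (x2 0)))^-1 != 0 by rewrite invr_eq0 gt_eqF.
  rewrite vE c0 rx row2_0 row2_1 in v0; have vv := scalerI r0 v0.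
  have e1 : p1 0 = q1 (x1 0) by have := congr1 (fun u : plane => u ord0 0) vv; rewrite !mxE.
  have e2 : p2 0 = q2 (x2 0) by have := congr1 (fun u : plane => u ord0 1) vv; rewrite !mxE.
  have [nn1 nn2 _ _] := orb.
  have pp1 : forall s, p1 s = q1 (x1 s).
    by apply: (newton_pos cK1 f0 nn1); rewrite e1.
  have pp2 : forall s, p2 s = q2 (x2 s).
    by apply: (newton_pos cK2 g0 nn2); rewrite e2.
  exists th, h, x1, p1, x2, p2; split=> //.
  move=> s; have [-> ->] := xc s; split=> //.
  by rewrite vE rx row2_0 row2_1 pp1 pp2.
have inv : flow_invariant (liouville_metric f) v.
  move=> t x q [c [g [cx cv'] <-]] /=.
  have [th [h [x1 [p1 [x2 [p2 [_ [thK _ _ _] _ xc]]]]]]] := follow c x g cx cv'.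
  by have [_] := xc (th t); rewrite thK.
pose z : 'rV[int]_2 := row2 m%:Z n%:Z.
have flow x : geodesic_flow (liouville_metric f) l (x, v x) (x + lattice z, v x).
  pose y1 s := X1 (s + P1 (x ord0 0)); pose y2 s := X2 (s + P2 (x ord0 1)).
  have ny1 := newton_shift (P1 (x ord0 0)) (newton_spd cK1 f0 dX1).
  have ny2 := newton_shift (P2 (x ord0 1)) (newton_spd cK2 g0 dX2).
  rewrite -/(y1 _) in ny1; rewrite -/(y2 _) in ny2.
  pose t s := Q1 (y1 s) - Q1 (y1 0) + (Q2 (y2 s) - Q2 (y2 0)).
  have dt : deriv t (fun s => 1 + liouville1 f (y1 s) + liouville2 f (y2 s)).
    apply: (deriv_ext (derivD (derivB (deriv_comp dQ1 ny1.1) (derivC (Q1 (y1 0))))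
      (derivB (deriv_comp dQ2 ny2.1) (derivC (Q2 (y2 0)))))) => // s.
    by rewrite !subr0 -!expr2 q1E q2E -/(y1 s) -/(y2 s); lra.
  have orb : newton_orbit (liouville1 f) (liouville2 f) y1 (fun s => q1 (y1 s)) y2 (fun s => q2 (y2 s)) t.
    by split=> // s; rewrite q1E q2E; lra.
  have [h [c [g tK hK xc _]]] := newton_geodesic orb.
  have t0 : t 0 = 0 by rewrite /t !subrr addr0.
  have y10 : y1 0 = x ord0 0 by rewrite /y1 add0r PK1.
  have y20 : y2 0 = x ord0 1 by rewrite /y2 add0r PK2.
  pose S := m%:R * tau (liouville1 f) a.
  have y1S : y1 S = x ord0 0 + m%:Z%:~R.
    by rewrite /y1 /S addrC -(Psh1 m) PK1.
  have y2S : y2 S = x ord0 1 + n%:Z%:~R.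
    by rewrite /y2 /S E addrC -(Psh2 n) PK2.
  have tS : t S = l.
    by rewrite /t y1S y2S y10 y20 Qsh1 Qsh2 lE -!pmulrn; ring.
  have [c0 v0] := xc 0; have [cS vS] := xc S; rewrite t0 in c0 v0; rewrite tS in cS vS.
  exists c; split=> //.
    congr (_, _); first by rewrite c0 y10 y20 -row2P.
    by rewrite v0 y10 y20 vE /rho.
  congr (_, _).
    by rewrite cS y1S y2S; apply/rowP => k; rewrite !mxE; case: (ord2P k) => ->.
  rewrite vS y1S y2S q1p q2p (periodicz _ _ (C2per0 cK1)) (periodicz _ _ (C2per0 cK2)).
  by rewrite vE /rho.
have l0 : 0 < l by rewrite lE addr_gt0// mulr_gt0// ltr0n.
have per : common_period (liouville_metric f) v l.
  by split=> // x; exists z.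
have tlen : torus_length (liouville_metric f) v l.
  split=> // T' [T'0 /(_ 0) [z' [c [g [c0 v0] [cT vT]]]]].
  have [th [h [x1 [p1 [x2 [p2 [[nn1 nn2 en dh] [thK hK th0 thi] [pp1 pp2] xc]]]]]]] :=
    follow c 0 g c0 v0.
  have s0 : 0 < th T' by rewrite -th0 thi.
  have h0 : h 0 = 0 by rewrite -th0 thK.
  have [xT _] := xc (th T'); rewrite thK cT in xT.
  have [x0 _] := xc 0; rewrite h0 c0 in x0; rewrite x0 in xT.
  have e1 : x1 (th T') = x1 0 + (z' ord0 0)%:~R.
    by have := congr1 (fun u : plane => u ord0 0) xT; rewrite !mxE /=.
  have e2 : x2 (th T') = x2 0 + (z' ord0 1)%:~R.
    by have := congr1 (fun u : plane => u ord0 1) xT; rewrite !mxE /=.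
  have T1 := flow_time dP1 f0 nn1.1 pp1 (th T'); rewrite e1 Psh1 in T1.
  have T2 := flow_time dP2 g0 nn2.1 pp2 (th T'); rewrite e2 Psh2 in T2.
  have dd : deriv (fun s => h s - (Q1 (x1 s) + Q2 (x2 s))) (fun=> 0).
    apply: (deriv_ext (derivB dh (derivD (deriv_comp dQ1 nn1.1) (deriv_comp dQ2 nn2.1)))) => // s.
    by rewrite pp1 pp2 -!expr2 q1E q2E; lra.
  have := deriv_const dd (th T') 0; rewrite thK h0 e1 e2 Qsh1 Qsh2 => TE.
  have T1' : (z' ord0 0)%:~R * tau (liouville1 f) a = th T' by lra.
  have T2' : (z' ord0 1)%:~R * tau (liouville2 f) b = th T' by lra.
  have z10 : 0 < z' ord0 0.
    by rewrite -(ltr0z R) -(pmulr_lgt0 _ t1) T1'.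
  have z20 : 0 < z' ord0 1.
    by rewrite -(ltr0z R) -(pmulr_lgt0 _ t2) T2'.
  move: z10 z20 T1' T2' TE.
  case: (z' ord0 0) => // k1; case: (z' ord0 1) => // k2 _ _ T1' T2' TE.
  rewrite -!pmulrn in T1' T2' TE.
  have : (k1 * n)%N%:R = (k2 * m)%N%:R :> R.
    apply: (mulIf (lt0r_neq0 t1)).
    rewrite !natrM mulrAC T1' -mulrA E mulrCA T2'; ring.
  move/eqP; rewrite eqr_nat => /eqP kE.
  have mk : (m %| k1)%N by rewrite -(Gauss_dvdl _ mn) kE dvdn_mull.
  have k10 : (0 < k1)%N by rewrite lt0n; apply/eqP => k0; rewrite k0 mul0r in T1'; lra.
  have mk1 : (m <= k1)%N by exact: dvdn_leq.
  have nk2 : (n <= k2)%N.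
    by rewrite -(leq_pmul2r m0) -kE mulnC leq_mul2r mk1 orbT.
  have : m%:R * act (liouville1 f) a <= k1%:R * act (liouville1 f) a.
    by rewrite ler_wpM2r ?ler_nat// ltW.
  have : n%:R * act (liouville2 f) b <= k2%:R * act (liouville2 f) b.
    by rewrite ler_wpM2r ?ler_nat// ltW.
  rewrite lE; lra.
exists v; split=> //; split; first by split=> //; exists l.
exists z; split; first by exists l; split.
by rewrite /graph_class row2_0 row2_1 mulf_eq0 negb_or !eqz_nat -!lt0n m0 n0.
Qed.

(** Since every geodesic in a graph class has the rotation length of its class, an
interval may be shrunk to the single length of the torus; only its avoidance by
the oscillating spectrum remains. *)
Lemma noncoincidentP f : noncoincident_pairs R f <->
  exists m n l, [/\ (0 < m)%N, (0 < n)%N,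
    rot_length m n (liouville1 f) (liouville2 f) l
    & ~ osc_length (liouville1 f) (liouville2 f) l].
Proof.
have [K1 cK1] := circle_C2per (liouville1 f).
have [K2 cK2] := circle_C2per (liouville2 f).
split.
  move=> [a [b [a0 ab nc [v [T [gt tl Tab]]]]]].
  have [z [gz zT rl]] := torus_rot gt tl.
  exists (absz (z ord0 0)), (absz (z ord0 1)), T.
  have /andP[z1 z2] : (z ord0 0 != 0) && (z ord0 1 != 0).
  by move: gz; rewrite /graph_class mulf_eq0 negb_or.
  split=> //; rewrite ?absz_gt0// => /osc_spectrumE os.
  have : (`[a, b] `&` rot_spectrum (liouville_metric f) `&` osc_spectrum (liouville_metric f)) T.
    by split=> //; split => //; exists z.
  by rewrite nc.
move=> [m [n [l [m0 n0 rl nos]]]].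
pose d := gcdn m n.
have d0 : (0 < d)%N by rewrite gcdn_gt0 m0.
have [m' mE] : exists m', m = (d * m')%N by exists (m %/ d)%N; rewrite mulnC divnK// dvdn_gcdl.
have [n' nE] : exists n', n = (d * n')%N by exists (n %/ d)%N; rewrite mulnC divnK// dvdn_gcdr.
have m'0 : (0 < m')%N by move: m0; rewrite mE muln_gt0 => /andP[].
have n'0 : (0 < n')%N by move: n0; rewrite nE muln_gt0 => /andP[].
have cop : coprime m' n'.
  rewrite /coprime -(eqn_pmul2l d0) muln_gcdr -mE -nE muln1 //.
rewrite mE nE in rl; have rl' := rot_length_primitive d0 rl.
have [v [gt tl]] := rot_torus m'0 n'0 cop rl'.
have l0 := tl.1.1.
exists (l / d%:R), (l / d%:R); split; [exact: ltW | exact: lexx | |].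
  rewrite /noncoincidence; apply/seteqP; split=> // x [[/= + _] /osc_spectrumE].
  rewrite in_itv /= -eq_le => /eqP <- os; apply: nos.
  have := osc_length_iter cK1 cK2 d0 os.
  by rewrite mulrC divfK// pnatr_eq0 -lt0n.
by exists v, (l / d%:R); split=> //; rewrite in_itv /= lexx.
Qed.

End Tori.

(** * Compactness of closed orbits *)

Section Compactness.
Context {R : realType}.
Implicit Types (u w e : nat -> R).

Lemma ucvg_oo u (a : R) : u @ \oo --> a -> u @ ufil --> a.
Proof. by move=> ua A /ua; exact: oo_ufil. Qed.

Lemma ucvg_harmonic : (fun n => (n.+1%:R : R)^-1) @ ufil --> (0 : R).
Proof. exact: ucvg_oo cvg_harmonic. Qed.

Lemma ucvg_near u w e (a : R) : w @ ufil --> a -> e @ ufil --> (0:R) ->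
  (forall n, `|u n - w n| <= e n) -> u @ ufil --> a.
Proof.
move=> wa e0 le; have en : (fun n => - e n) @ ufil --> (0:R).
  by rewrite -[X in _ --> X]oppr0; exact: cvgN.
have h : (fun n => u n - w n) @ ufil --> (0:R).
  apply: (squeeze_cvgr _ en e0); apply: filterE => n; rewrite -ler_norml; exact: le.
have E : (fun n => u n - w n + w n) = u by apply/funext => n; rewrite subrK.
by rewrite -E -[a]add0r; exact: cvgD h wa.
Qed.

Lemma ucvg_eq u w (a b : R) : u @ ufil --> a -> w @ ufil --> b -> u =1 w -> a = b.
Proof. by move=> ua wb /funext E; rewrite E in ua; exact: cvg_unique ua wb. Qed.

(** Equi-Lipschitz functions: the ultralimit may be taken along moving points. *)
Lemma ulim_lip (F : nat -> R -> R) (S : nat -> R) (s C a : R) : S @ ufil --> s ->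
  (fun n => F n s) @ ufil --> a ->
  (forall n, `|F n (S n) - F n s| <= C * `|S n - s|) ->
  (fun n => F n (S n)) @ ufil --> a.
Proof.
move=> Ss Fa le; apply: (ucvg_near Fa _ le).
rewrite -[X in _ --> X](mulr0 C); apply: cvgM; first exact: cvg_cst.
by rewrite -[X in _ --> X](normr0 R) -(subrr s); apply: cvg_norm; apply: cvgB => //; exact: cvg_cst.
Qed.

(** Derivatives pass to ultralimits when the derivatives are equi-Lipschitz, because
the quadratic Taylor bound does. *)
Lemma deriv_ulim (U V : nat -> R -> R) (U0 V0 : R -> R) (C : R) :
  (forall n, deriv (U n) (V n)) -> 0 <= C ->
  (forall n s s', `|V n s - V n s'| <= C * `|s - s'|) ->
  (forall s, (fun n => U n s) @ ufil --> U0 s) ->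
  (forall s, (fun n => V n s) @ ufil --> V0 s) -> deriv U0 V0.
Proof.
move=> dU C0 lip cU cV s; apply: (@is_derive_quad _ _ _ _ C) => h.
have c : (fun n => `|U n (s + h) - U n s - h * V n s|) @ ufil -->
    `|U0 (s + h) - U0 s - h * V0 s|.
  apply: cvg_norm; apply: cvgB; first by apply: cvgB.
  by apply: cvgM => //; exact: cvg_cst.
apply: (cvgr_to_le c); apply: filterE => n.
by apply: (deriv_taylor C0 (dU n)) => y _; exact: lip.
Qed.

(** Convergent integers are eventually constant. *)
Lemma int_ulim (z : nat -> int) (r : R) : (fun n => (z n)%:~R) @ ufil --> r ->
  exists2 A, ufil A & forall n, A n -> r = (z n)%:~R.
Proof.
move=> zr; have /cvgrPdist_lt/(_ 2^-1) := zr; rewrite invr_gt0 ltr0n => /(_ isT) H.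
exists [set n | `|r - (z n)%:~R| < 2^-1] => // n /= hn.
have E : \forall k \near ufil, (z k)%:~R = (z n)%:~R :> R.
  apply: filterS H => k hk; congr (_%:~R).
  have : `|(z k)%:~R - (z n)%:~R| < 1 :> R.
    have := ler_distD r ((z k)%:~R) ((z n)%:~R); rewrite (distrC _ r); lra.
  rewrite -intrN -intrD -intr_norm -[X in _ < X]/(1%:~R) ltr_int; lia.
have c : (fun n => (z n)%:~R) @ ufil --> ((z n)%:~R : R).
  move=> B nB; apply: filterS E => k /= ->; exact: nbhs_singleton nB.
exact: (cvg_unique _ zr c).
Qed.

Definition close_to (F f : R -> R) (e : R) :=
  (forall x, `|F x - f x| <= e) /\ (forall x, `|derive1 F x - derive1 f x| <= e).

Lemma newton_orbit_translate (f g x1 p1 x2 p2 t : R -> R) (z1 z2 : int) (c : R) :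
  periodic f 1 -> periodic g 1 -> newton_orbit f g x1 p1 x2 p2 t ->
  newton_orbit f g (fun s => x1 s + z1%:~R) p1 (fun s => x2 s + z2%:~R) p2 (fun s => t s + c).
Proof.
move=> pf pg [n1 n2 en dt]; split; try exact: newton_translate.
  by move=> s; rewrite !periodicz.
apply: (deriv_ext (derivD dt (derivC c))) => // s.
by rewrite addr0 !periodicz.
Qed.

(** Ultralimits of closed orbits for converging potentials: the periods are bounded by
the lengths, and bounded below since a short closed orbit would have small velocity
along its whole course, against the energy relation. *)
Lemma closed_orbit_compact (F G : nat -> R -> R) (f g : R -> R) (K a : R)
    (z1 z2 : nat -> int) (ls e : nat -> R) (l : R) :
  e @ ufil --> (0:R) -> (forall n, e n <= 1) ->
  (forall n, C2per (F n) K) -> (forall n, C2per (G n) K) ->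
  C2per f K -> C2per g K -> 0 < a ->
  (forall n x y, a <= 1 + F n x + G n y) ->
  (forall n, close_to (F n) f (e n)) ->
  (forall n, close_to (G n) g (e n)) ->
  (forall n, `|ls n - l| <= e n) -> 0 < l ->
  (forall n, closed_orbit (F n) (G n) (z1 n) (z2 n) (ls n)) ->
  exists n, closed_orbit f g (z1 n) (z2 n) l.
Proof.
move=> e0 e1 cF cG cf cg a0 lo clF clG lls l0 orb.
have K0 := C2K cf.
pose P := 2 + 2 * K.
have P0 : 0 <= P by rewrite /P; lra.
have orb' n : exists S x1 p1 x2 p2 t, [/\ 0 < S, newton_orbit (F n) (G n) x1 p1 x2 p2 t,
    x1 S = x1 0 + (z1 n)%:~R /\ p1 S = p1 0, x2 S = x2 0 + (z2 n)%:~R /\ p2 S = p2 0 &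
    [/\ ls n = t S, t 0 = 0, `|x1 0| <= 1 & `|x2 0| <= 1]].
  have [S [x1 [p1 [x2 [p2 [t [S0 no [X1 P1] [X2 P2] E]]]]]]] := orb n.
  exists S, (fun s => x1 s + (- Num.floor (x1 0))%:~R), p1,
    (fun s => x2 s + (- Num.floor (x2 0))%:~R), p2, (fun s => t s + - t 0); split=> //.
  - exact: newton_orbit_translate (C2per0 (cF n)) (C2per0 (cG n)) no.
  - by rewrite X1 P1; split=> //; ring.
  - by rewrite X2 P2; split=> //; ring.
  - split=> //; first by rewrite subrr.
      rewrite intrN; have := floor_itv (x1 0); rewrite intrD => /andP[h1 h2].
      by rewrite ler_norml; apply/andP; split; lra.
    rewrite intrN; have := floor_itv (x2 0); rewrite intrD => /andP[h1 h2].
    by rewrite ler_norml; apply/andP; split; lra.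
have /choice[S {}orb'] := orb'; have /choice[x1 {}orb'] := orb'.
have /choice[p1 {}orb'] := orb'; have /choice[x2 {}orb'] := orb'.
have /choice[p2 {}orb'] := orb'; have /choice[t {}orb'] := orb'.
have no n : newton_orbit (F n) (G n) (x1 n) (p1 n) (x2 n) (p2 n) (t n) by have [] := orb' n.
have rhi n s : 1 + F n (x1 n s) + G n (x2 n s) <= 1 + 2 * K.
  have := C2b0 (cF n) (x1 n s); have := C2b0 (cG n) (x2 n s).
  by rewrite !ler_norml => /andP[? ?] /andP[? ?]; lra.
have en n s : p1 n s ^+ 2 + p2 n s ^+ 2 = 1 + F n (x1 n s) + G n (x2 n s).
  by have [] := no n.
have sqP (p : R) : p ^+ 2 <= 1 + 2 * K -> `|p| <= P.
  move=> h; rewrite -(@ler_pXn2r _ 2%N)// ?nnegrE// real_normK ?num_real//.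
  by apply: (le_trans h); rewrite /P; nra.
have p1P n s : `|p1 n s| <= P.
  by apply: sqP; have := en n s; have := rhi n s; have := sqr_ge0 (p2 n s); lra.
have p2P n s : `|p2 n s| <= P.
  by apply: sqP; have := en n s; have := rhi n s; have := sqr_ge0 (p1 n s); lra.
have x1L n s s' : `|x1 n s - x1 n s'| <= P * `|s - s'|.
  by have [[d _] _ _ _] := no n; exact: (deriv_lipT _ _ d).
have x2L n s s' : `|x2 n s - x2 n s'| <= P * `|s - s'|.
  by have [_ [d _] _ _] := no n; exact: (deriv_lipT _ _ d).
have half (u : R) : `|u| <= K -> `|u / 2| <= K.
  by move=> h; rewrite normrM (ger0_norm (_ : 0 <= 2^-1))//; have := normr_ge0 u; lra.
have p1L n s s' : `|p1 n s - p1 n s'| <= K * `|s - s'|.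
  have [[_ d] _ _ _] := no n; apply: (deriv_lipT _ _ d) => y; apply: half; exact: C2b1 (cF n) _.
have p2L n s s' : `|p2 n s - p2 n s'| <= K * `|s - s'|.
  have [_ [_ d] _ _] := no n; apply: (deriv_lipT _ _ d) => y; apply: half; exact: C2b1 (cG n) _.
have tL n s s' : `|t n s - t n s'| <= (1 + 2 * K) * `|s - s'|.
  have [_ _ _ d] := no n; apply: (deriv_lipT _ _ d) => y; rewrite ger0_norm//.
  by have := lo n (x1 n y) (x2 n y); lra.
have bnd (h : nat -> R -> R) C : (forall n s s', `|h n s - h n s'| <= C * `|s - s'|) ->
   (forall n, `|h n 0| <= 1) -> forall s n, `|h n s| <= 1 + C * `|s|.
  move=> L h0 s n; have := L n s 0; rewrite subr0; have := h0 n.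
  have := ler_normD (h n s - h n 0) (h n 0); rewrite subrK; lra.
have S_lo n : a * S n <= ls n.
  have [S0 [_ _ _ d] _ _ [-> t0 _ _]] := orb' n.
  have dl : deriv (fun s : R => a * s) (fun=> a).
    by apply: (deriv_ext (derivZ a derivX)) => // s; rewrite mulr1.
  have := deriv_le (ltW S0) dl d (fun s _ => lo n _ _); rewrite t0 mulr0; lra.
have S0 n : 0 < S n by have [] := orb' n.
have lsb n : ls n <= l + 1.
  by have := lls n; have := e1 n; rewrite ler_norml; lra.
have SB n : `|S n| <= (l + 1) / a.
  by rewrite (gtr0_norm (S0 n)) ler_pdivlMr// mulrC; have := S_lo n; have := lsb n; lra.
have cS := ulim_cvg SB; set s0 := ulim S in cS.
have x10 n : `|x1 n 0| <= 1 by have [_ _ _ _ []] := orb' n.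
have x20 n : `|x2 n 0| <= 1 by have [_ _ _ _ []] := orb' n.
have t0 n : `|t n 0| <= 1 by have [_ _ _ _ [_ ->]] := orb' n; rewrite normr0.
have cx1 s := ulim_cvg (bnd x1 P x1L x10 s).
have cx2 s := ulim_cvg (bnd x2 P x2L x20 s).
have cp1 s := ulim_cvg (fun n => p1P n s).
have cp2 s := ulim_cvg (fun n => p2P n s).
have ct s := ulim_cvg (bnd t (1 + 2 * K) tL t0 s).
have shift1 (h : nat -> R -> R) (h0 h0' : R -> R) s : (forall x, forall y, `|h0 x - h0 y| <= K * `|x - y|) ->
    (forall n x, `|h n x - h0 x| <= e n) ->
    forall (x : nat -> R -> R) (X : R), (fun n => x n s) @ ufil --> X ->
    (fun n => h n (x n s)) @ ufil --> h0 X.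
  move=> L cl x X cX.
  apply: (@ucvg_near _ (fun=> h0 X) (fun n => e n + K * `|x n s - X|)).
  - exact: cvg_cst.
  - rewrite -[X in _ --> X](addr0 0); apply: cvgD; first exact: e0.
    rewrite -[X in _ --> X](mulr0 K); apply: cvgM; first exact: cvg_cst.
    rewrite -[X in _ --> X](normr0 R) -(subrr X); apply: cvg_norm.
    by apply: cvgB => //; exact: cvg_cst.
  - move=> n; have := ler_distD (h0 (x n s)) (h n (x n s)) (h0 X).
    have := cl n (x n s); have := L (x n s) X; lra.
pose X1 s := ulim (x1 ^~ s); pose X2 s := ulim (x2 ^~ s).
pose Q1 s := ulim (p1 ^~ s); pose Q2 s := ulim (p2 ^~ s).
pose T s := ulim (t ^~ s).
have cF1 s : (fun n => derive1 (F n) (x1 n s) / 2) @ ufil --> derive1 f (X1 s) / 2.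
  apply: cvgM; last exact: cvg_cst.
  apply: (shift1 (fun n => derive1 (F n)) (derive1 f) (derive1 f) s _ _ x1 _ (cx1 s)).
    by move=> x y; exact: lip_derive1.
  by move=> n x; have [] := clF n.
have cG1 s : (fun n => derive1 (G n) (x2 n s) / 2) @ ufil --> derive1 g (X2 s) / 2.
  apply: cvgM; last exact: cvg_cst.
  apply: (shift1 (fun n => derive1 (G n)) (derive1 g) (derive1 g) s _ _ x2 _ (cx2 s)).
    by move=> x y; exact: lip_derive1.
  by move=> n x; have [] := clG n.
have crho s : (fun n => 1 + F n (x1 n s) + G n (x2 n s)) @ ufil --> 1 + f (X1 s) + g (X2 s).
  apply: cvgD; first apply: cvgD; first exact: cvg_cst.
    apply: (shift1 F f f s _ _ x1 _ (cx1 s)); first by move=> x y; exact: lip_C2.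
    by move=> n x; have [] := clF n.
  apply: (shift1 G g g s _ _ x2 _ (cx2 s)); first by move=> x y; exact: lip_C2.
  by move=> n x; have [] := clG n.
have lip2 (h : nat -> R -> R) (x : nat -> R -> R) : (forall n, C2per (h n) K) ->
    (forall n s s', `|x n s - x n s'| <= P * `|s - s'|) ->
    forall n s s', `|derive1 (h n) (x n s) / 2 - derive1 (h n) (x n s') / 2| <= K * P * `|s - s'|.
  move=> ch xL n s s'; rewrite -mulrBl normrM (ger0_norm (_ : 0 <= 2^-1))//.
  have := lip_derive1 (x n s) (x n s') (ch n); have := ler_wpM2l K0 (xL n s s').
  have := normr_ge0 (derive1 (h n) (x n s) - derive1 (h n) (x n s')); lra.
have dX1 : deriv X1 Q1.
  by apply: (@deriv_ulim x1 p1 X1 Q1 K) => // n; have [[]] := no n.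
have dX2 : deriv X2 Q2.
  by apply: (@deriv_ulim x2 p2 X2 Q2 K) => // n; have [_ []] := no n.
have dQ1 : deriv Q1 (fun s => derive1 f (X1 s) / 2).
  apply: (@deriv_ulim p1 (fun n s => derive1 (F n) (x1 n s) / 2) Q1 _ (K * P)) => //.
  - by move=> n; have [[]] := no n.
  - exact: mulr_ge0.
  - exact: lip2.
have dQ2 : deriv Q2 (fun s => derive1 g (X2 s) / 2).
  apply: (@deriv_ulim p2 (fun n s => derive1 (G n) (x2 n s) / 2) Q2 _ (K * P)) => //.
  - by move=> n; have [_ []] := no n.
  - exact: mulr_ge0.
  - exact: lip2.
have dT : deriv T (fun s => 1 + f (X1 s) + g (X2 s)).
  apply: (@deriv_ulim t (fun n s => 1 + F n (x1 n s) + G n (x2 n s)) T _ (K * P + K * P)) => //.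
  - by move=> n; have [] := no n.
  - by rewrite addr_ge0// mulr_ge0.
  - move=> n s s'.
    have h1 := le_trans (lip_C2 (x1 n s) (x1 n s') (cF n)) (ler_wpM2l K0 (x1L n s s')).
    have h2 := le_trans (lip_C2 (x2 n s) (x2 n s') (cG n)) (ler_wpM2l K0 (x2L n s s')).
    rewrite (_ : 1 + F n (x1 n s) + G n (x2 n s) - (1 + F n (x1 n s') + G n (x2 n s')) =
      F n (x1 n s) - F n (x1 n s') + (G n (x2 n s) - G n (x2 n s'))); last by ring.
    apply: (le_trans (ler_normD _ _)); rewrite mulrDl -mulrA; exact: lerD.
have en0 s : Q1 s ^+ 2 + Q2 s ^+ 2 = 1 + f (X1 s) + g (X2 s).
  have c : (fun n => p1 n s * p1 n s + p2 n s * p2 n s) @ ufil --> Q1 s * Q1 s + Q2 s * Q2 s.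
    by apply: cvgD; apply: cvgM; (exact: cp1 || exact: cp2).
  by rewrite !expr2; apply: (ucvg_eq c (crho s)) => n; rewrite -en !expr2.
have x1S := ulim_lip cS (cx1 s0) (fun n => x1L n (S n) s0).
have x2S := ulim_lip cS (cx2 s0) (fun n => x2L n (S n) s0).
have p1S := ulim_lip cS (cp1 s0) (fun n => p1L n (S n) s0).
have p2S := ulim_lip cS (cp2 s0) (fun n => p2L n (S n) s0).
have tS := ulim_lip cS (ct s0) (fun n => tL n (S n) s0).
have z1c : (fun n => (z1 n)%:~R) @ ufil --> X1 s0 - X1 0.
  have -> : (fun n => (z1 n)%:~R : R) = (fun n => x1 n (S n) - x1 n 0).
    by apply/funext => n; have [_ _ [-> _] _ _] := orb' n; ring.
  exact: cvgB x1S (cx1 0).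
have z2c : (fun n => (z2 n)%:~R) @ ufil --> X2 s0 - X2 0.
  have -> : (fun n => (z2 n)%:~R : R) = (fun n => x2 n (S n) - x2 n 0).
    by apply/funext => n; have [_ _ _ [-> _] _] := orb' n; ring.
  exact: cvgB x2S (cx2 0).
have [A1 uA1 A1P] := int_ulim z1c; have [A2 uA2 A2P] := int_ulim z2c.
have [n [nA1 nA2]] : exists n, A1 n /\ A2 n.
  by have [n] := @filter_ex _ ufil _ _ (filterI uA1 uA2); exists n.
have s00 : 0 < s0.
  have c1 : (fun n => (1 + 2 * K) * S n) @ ufil --> (1 + 2 * K) * s0.
    by apply: cvgM => //; exact: cvg_cst.
  have c2 : ls @ ufil --> l.
    by apply: (ucvg_near (cvg_cst l) e0).
  have : l <= (1 + 2 * K) * s0.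
    apply: (ler_cvg_to c2 c1); apply: filterE => m.
    have [Sm [_ _ _ d] _ _ [-> tm _ _]] := orb' m.
    have dl : deriv (fun s : R => (1 + 2 * K) * s) (fun=> 1 + 2 * K).
      by apply: (deriv_ext (derivZ (1 + 2 * K) derivX)) => // s; rewrite mulr1.
    by have := deriv_le (ltW Sm) d dl (fun s _ => rhi m s); rewrite tm mulr0; lra.
  move=> h; have : 0 < (1 + 2 * K) * s0 by lra.
  by rewrite pmulr_rgt0//; lra.
exists n, s0, X1, Q1, X2, Q2, T; split=> //.
- split; first by rewrite -(A1P n nA1); ring.
  by apply: (ucvg_eq p1S (cp1 0)) => m; have [_ _ [_ ->] _ _] := orb' m.
- split; first by rewrite -(A2P n nA2); ring.
  by apply: (ucvg_eq p2S (cp2 0)) => m; have [_ _ _ [_ ->] _] := orb' m.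
- have c2 : ls @ ufil --> l by apply: (ucvg_near (cvg_cst l) e0).
  have -> : T 0 = 0.
    by apply: (ucvg_eq (ct 0) (cvg_cst 0)) => m; have [_ _ _ _ []] := orb' m.
  by rewrite subr0; apply: (ucvg_eq c2 tS) => m; have [_ _ _ _ []] := orb' m.
Qed.

End Compactness.

(** * Lengths of oscillating geodesics *)

Section Sard.
Context {R : realType}.
Implicit Types (f g x p q : R -> R).

(* A closed orbit oscillating in the second variable, with its time origins
   normalised separately in the two decoupled variables. *)
Definition osc_orbit f g (k : nat) (y l : R) : Prop :=
  exists S x1 p1 x2 p2 q, [/\ 0 < S, newton f x1 p1 /\ newton g x2 p2,
   [/\ x1 0 = 0, x1 S = k%:R & p1 S = p1 0],
   [/\ x2 0 = y, x2 S = y, p2 0 = 0 & p2 S = 0] &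
   [/\ 0 < p1 0, p1 0 ^+ 2 = f 0 + (1 + g y),
       deriv q (fun s => p1 s ^+ 2 + p2 s ^+ 2) & l = q S - q 0]].

(** A coordinate that returns has a turning point. *)
Lemma rolle_newton x p (S : R) : 0 < S -> deriv x p -> x S = x 0 -> exists s, p s = 0.
Proof.
move=> S0 dx xS.
have [||c _ d] := @Rolle R x 0 S S0 _ _ (esym xS).
- by move=> y _; have [] := dx y.
- by apply: continuous_subspaceT; exact: deriv_cont dx.
exists c; have [_ <-] := d; by have [_ <-] := dx c.
Qed.

(** The integral of a periodic function over a period does not depend on its origin. *)
Lemma period_shift (q w : R -> R) (S s : R) : deriv q w -> (forall s, w (s + S) = w s) ->
  q (s + S) - q s = q S - q 0.
Proof.
move=> dq wP.
have da : deriv (fun s : R => s + S) (fun=> 1).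
  by apply: (deriv_ext (derivD derivX (derivC S))) => // u; rewrite addr0.
have dd : deriv (fun s => q (s + S) - q s) (fun=> 0).
  by apply: (deriv_ext (derivB (deriv_comp dq da) dq)) => // u; rewrite wP mulr1 subrr.
by have := deriv_const dd s 0; rewrite add0r.
Qed.

Lemma sqr_cont p : continuous p -> continuous (fun s => p s ^+ 2).
Proof.
by move=> cp s; exact: (@continuous_comp _ _ _ p (@GRing.exp R ^~ 2%N) s (cp s) (@exprn_continuous R 2 (p s))).
Qed.

(** The first coordinate must move, and one chooses the origin of time at a turning
point of the second one; the length is unchanged as an integral over a period. *)
Lemma osc_orbit_normal f g K1 K2 (z1 : int) (l : R) : C2per f K1 -> C2per g K2 ->
  (forall u v : R, 0 < 1 + f u + g v) ->
  closed_orbit f g z1 0 l -> exists (k : nat) (y : R), (0 <= y <= 1) /\ osc_orbit f g k y l.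
Proof.
move=> cf cg pos [S [x1 [p1 [x2 [p2 [t [S0 [n1 n2 en dt] [X1 P1] [X2 P2] ->]]]]]]].
have [b pb] : exists s, p2 s = 0.
  by apply: (rolle_newton S0 n2.1); rewrite X2 addr0.
have z0 : z1 != 0.
  apply/eqP => z0; have [c pc] : exists s, p1 s = 0.
    by apply: (rolle_newton S0 n1.1); rewrite X1 z0 addr0.
  have e1 := newton_energy (C2d1 cf) n1 c; have e2 := newton_energy (C2d1 cg) n2 b.
  have := en 0; rewrite pc in e1; rewrite pb in e2; have := pos (x1 c) (x2 b).
  by rewrite expr0n /= in e1 e2; lra.
(* reversing time in the first variable, one may assume that z1 is positive *)
have [x1' [p1' [z [[n1' z'0] [[X1' P1'] [E1 q1]]]]]] : exists x1' p1' (z : int),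
   (newton f x1' p1' /\ 0 < z) /\ ((x1' S = x1' 0 + z%:~R /\ p1' S = p1' 0) /\
   (p1' 0 ^+ 2 - f (x1' 0) = p1 0 ^+ 2 - f (x1 0) /\
    exists q, deriv q (fun s => p1' s ^+ 2) /\ exists q', deriv q' (fun s => p1 s ^+ 2) /\ q S - q 0 = q' S - q' 0)).
  have [q dq] := primitive (sqr_cont (deriv_cont n1.2)).
  have [zp|zn|zz] := ltgtP 0 z1; last by rewrite -zz eqxx in z0.
    by exists x1, p1, z1; do 2!split=> //; split=> //; exists q; split=> //; exists q.
  exists (fun s => x1 (- s + S)), (fun s => - p1 (- s + S)), (- z1); split.
    by split; [exact: newton_rev (newton_shift S n1)|rewrite oppr_gt0].
  rewrite oppr0 add0r addNr; split; first by rewrite X1 P1 intrN addrK.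
  split; first by rewrite sqrrN; exact: newton_energy (C2d1 cf) n1 S.
  exists (fun s => - q (- s + S)); split.
    have da : deriv (fun s : R => - s + S) (fun=> -1).
      by apply: (deriv_ext (derivD (derivN derivX) (derivC S))) => // s; rewrite addr0.
    apply: (deriv_ext (derivN (deriv_comp dq da))) => // s.
    by rewrite mulrN1 opprK sqrrN.
  by exists q; split=> //; rewrite oppr0 add0r addNr; ring.
have [q [dq [q' [dq' qq']]]] := q1.
have [q2 dq2] := primitive (sqr_cont (deriv_cont n2.2)).
have zn0 : z != 0 by rewrite gt_eqF.
have [a [j aj]] := cross_point 0 (deriv_cont n1'.1) zn0 X1'.
have x1P := newton_periodic cf n1' X1' P1'.
have x2P := newton_periodic cg n2 X2 P2.
have [al [f0 pE _ _]] := winding_orbit cf n1' S0 zn0 X1' P1'.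
have pn0 s : p1' s != 0 by rewrite -sqrf_eq0 pE gt_eqF.
have [c pc] : exists c, 0 < p1' c.
  apply: contrapT => /forallNP H.
  have : - x1' 0 <= - x1' S.
    by apply: (deriv_incr (ltW S0) (derivN n1'.1)) => s _; have /negP := H s; rewrite -leNgt; lra.
  rewrite X1'; have : (0:R) < z%:~R by rewrite ltr0z.
  lra.
have pa : 0 < p1' a.
  rewrite ltNge; apply/negP => pa; have cp := continuous_subspaceT (deriv_cont n1'.2).
  have [ac|/ltW ca] := leP a c.
    have [|s _ ps] := @IVT R p1' a c 0 ac (cp _); last by have := pn0 s; rewrite ps eqxx.
    by rewrite ge_min le_max pa (ltW pc) orbT.
  have [|s _ ps] := @IVT R p1' c a 0 ca (cp _); last by have := pn0 s; rewrite ps eqxx.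
  by rewrite ge_min le_max pa (ltW pc) orbT.
set m := Num.floor (x2 b).
exists (absz z), (x2 b - m%:~R); split.
  by have := floor_itv (x2 b); rewrite intrD -/m => /andP[h1 h2]; apply/andP; split; lra.
have zE : z%:~R = (absz z)%:R :> R by rewrite natr_absz ger0_norm// ltW.
exists S, (fun s => x1' (s + a) + (- j)%:~R), (fun s => p1' (s + a)),
  (fun s => x2 (s + b) + (- m)%:~R), (fun s => p2 (s + b)),
  (fun s => q (s + a) + q2 (s + b)).
have da d : deriv (fun s : R => s + d) (fun=> 1).
  by apply: (deriv_ext (derivD derivX (derivC d))) => // u; rewrite addr0.
rewrite !add0r ![S + _]addrC; have [-> ->] := x1P a; have [-> ->] := x2P b.
split=> //.
- by split; [exact: newton_translate (C2per0 cf) (newton_shift a n1')|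
    exact: newton_translate (C2per0 cg) (newton_shift b n2)].
- by rewrite aj add0r intrN subrr; split=> //; rewrite -zE; ring.
- by rewrite intrN pb; split=> //; ring.
split=> //.
- rewrite -intrN (periodicz _ _ (C2per0 cg)).
  have e1 := newton_energy (C2d1 cf) n1' a; have e2 := newton_energy (C2d1 cg) n2 b.
  have e0 := en 0; rewrite pb expr0n /= in e2.
  rewrite -(periodicz j 0 (C2per0 cf)) -aj.
  by move: e1; rewrite E1; lra.
- apply: (deriv_ext (derivD (deriv_comp dq (da a)) (deriv_comp dq2 (da b)))) => // s.
  by rewrite !mulr1.
- have h1 : q (a + S) - q a = q S - q 0.
    by apply: (@period_shift q _ S a dq) => s; have [_ ->] := x1P s.
  have h2 : q2 (b + S) - q2 b = q2 S - q2 0.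
    by apply: (@period_shift q2 _ S b dq2) => s; have [_ ->] := x2P s.
  have dd : deriv (fun s => t s - (q' s + q2 s)) (fun=> 0).
    by apply: (deriv_ext (derivB dt (derivD dq' dq2))) => // s; rewrite en subrr.
  have := deriv_const dd S 0; lra.
Qed.

(** Lengths of oscillating orbits are critical values of the length: its first
variation in the turning point [y] vanishes, whence a quadratic difference. *)
Lemma osc_orbit_quad f g (K a L : R) : C2per f K -> C2per g K -> 0 < a ->
  (forall u v : R, a <= 1 + f u + g v) ->
  exists2 C, 0 < C & forall k y y' l l', l <= L -> l' <= L ->
    osc_orbit f g k y l -> osc_orbit f g k y' l' -> `|l' - l| <= C * (y' - y) ^+ 2.
Proof.
move=> cf cg a0 lo.
have K0 := C2K cf.
pose r := Num.sqrt a; have r0 : 0 < r by rewrite sqrtr_gt0.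
have rE : r ^+ 2 = a by rewrite sqr_sqrtr// ltW.
pose B := `|L| / a; have B0 : 0 <= B by rewrite divr_ge0// ltW.
pose P := 2 + 2 * K; have P0 : 0 <= P by rewrite /P; lra.
pose E := ((K / r) ^+ 2 + 1) * expR ((K + 2) * B).
have E0 : 0 <= E by rewrite mulr_ge0 ?expR_ge0// addr_ge0// sqr_ge0.
pose C := (1 + K) * E * B + 3 * K * P * (E / a) + P * (E / a + (K / r) ^+ 2).
have KP0 : 0 <= K * P by rewrite mulr_ge0.
have Ea0 : 0 <= E / a by rewrite divr_ge0// ltW.
have C0 : 0 <= C.
  rewrite /C addr_ge0 ?addr_ge0//.
  - by rewrite mulr_ge0// mulr_ge0// addr_ge0.
  - by rewrite -mulrA -mulrA mulr_ge0// mulrA mulr_ge0.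
  - by rewrite mulr_ge0// addr_ge0// sqr_ge0.
exists (C + 1); first lra.
move=> k y y' l l' lL lL'.
move=> [S [x1 [p1 [x2 [p2 [q [S0 [n1 n2] [X10 X1S P1S] [X20 X2S P20 P2S] [p10 pE dq lE]]]]]]]].
move=> [S' [y1 [q1 [y2 [q2 [q' [S'0 [m1 m2] [Y10 Y1S Q1S] [Y20 Y2S Q20 Q2S] [q10 qE dq' lE']]]]]]]].
have en s : p1 s ^+ 2 + p2 s ^+ 2 = 1 + f (x1 s) + g (x2 s).
  have e1 := newton_energy (C2d1 cf) n1 s; have e2 := newton_energy (C2d1 cg) n2 s.
  by move: e1 e2; rewrite X10 X20 P20 pE expr0n /=; lra.
have en' s : q1 s ^+ 2 + q2 s ^+ 2 = 1 + f (y1 s) + g (y2 s).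
  have e1 := newton_energy (C2d1 cf) m1 s; have e2 := newton_energy (C2d1 cg) m2 s.
  by move: e1 e2; rewrite Y10 Y20 Q20 qE expr0n /=; lra.
have dl : deriv (fun s : R => a * s) (fun=> a).
  by apply: (deriv_ext (derivZ a derivX)) => // s; rewrite mulr1.
have SB : S <= B.
  rewrite ler_pdivlMr// mulrC.
  have := deriv_le (ltW S0) dl dq; rewrite -lE mulr0 subr0 => H.
  have aSl : a * S <= l by apply: H => s _; rewrite en lo.
  by have := ler_norm L; lra.
set D2 := (y' - y) ^+ 2.
have D20 : 0 <= D2 by exact: sqr_ge0.
have f0' u : 0 < f u + (1 + g y') by have := lo u y'; lra.
have q1s s : q1 s = spd f (1 + g y') (y1 s).
  by apply: (newton_pos cf f0' m1 q10); rewrite Y10.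
have rq1 s : r <= q1 s by rewrite q1s; apply: ler_wsqrtr; have := lo (y1 s) y'; lra.
have rp1 : r <= p1 0.
  by rewrite -(@ler_pXn2r _ 2%N) ?nnegrE ?(ltW r0) ?(ltW p10)// rE pE; have := lo 0 y; lra.
have dp : (q1 0 - p1 0) ^+ 2 <= (K / r) ^+ 2 * D2.
  have gl : `|g y' - g y| <= K * `|y' - y| by exact: lip_C2.
  have E1 : (q1 0 - p1 0) * (q1 0 + p1 0) = g y' - g y.
    by have -> : g y' - g y = q1 0 ^+ 2 - p1 0 ^+ 2 by [rewrite pE qE; ring]; ring.
  have h : `|q1 0 - p1 0| * r <= K * `|y' - y|.
    apply: le_trans gl; rewrite -E1 normrM ler_wpM2l//.
    by rewrite ger0_norm; have := rq1 0; lra.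
  rewrite -(real_normK (num_real (q1 0 - p1 0))) /D2 -(real_normK (num_real (y' - y))).
  have Kr0 : 0 <= K / r by rewrite divr_ge0// ltW.
  have Ky0 : 0 <= K / r * `|y' - y| by rewrite mulr_ge0.
  by rewrite -exprMn ler_pXn2r ?nnegrE// mulrAC ler_pdivlMr.
have ex s : s <= S -> expR ((K + 2) * s) <= expR ((K + 2) * B).
  by move=> sS; rewrite ler_expR ler_wpM2l//; lra.
have w1 s : 0 <= s <= S -> (y1 s - x1 s) ^+ 2 + (q1 s - p1 s) ^+ 2 <= E * D2.
  move=> /andP[s0 sS]; have := newton_close cf s0 m1 n1.
  rewrite Y10 X10 subrr expr0n /= add0r => /le_trans; apply.
  apply: (@le_trans _ _ ((K / r) ^+ 2 * D2 * expR ((K + 2) * B))).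
    by apply: ler_pM; [exact: sqr_ge0|exact: expR_ge0|exact: dp|exact: ex].
  by rewrite mulrAC /E ler_wpM2r// ler_wpM2r ?expR_ge0//; lra.
have w2 s : 0 <= s <= S -> (y2 s - x2 s) ^+ 2 + (q2 s - p2 s) ^+ 2 <= E * D2.
  move=> /andP[s0 sS]; have := newton_close cg s0 m2 n2.
  rewrite Y20 X20 Q20 P20 subrr expr0n /= addr0 -/D2 => /le_trans; apply.
  apply: (@le_trans _ _ (D2 * expR ((K + 2) * B))).
    by rewrite ler_wpM2l//; exact: ex.
  by rewrite mulrC ler_wpM2r// /E ler_peMl ?expR_ge0// lerDr sqr_ge0.
pose H s := 2 * (q' s - q s) - 2 * (p1 s * (y1 s - x1 s) + p2 s * (y2 s - x2 s)).
have dH := derivB (derivZ 2 (derivB dq' dq))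
  (derivZ 2 (derivD (derivM n1.2 (derivB m1.1 n1.1)) (derivM n2.2 (derivB m2.1 n2.1)))).
have tay h u v : C2per h K -> `|h v - h u - (v - u) * derive1 h u| <= K * (v - u) ^+ 2.
  move=> ch; have := @deriv_taylor R h (derive1 h) K u (v - u) K0 (C2d1 ch) (fun w _ => lip_derive1 w u ch).
  by rewrite (addrC u) subrK.
have HS : `|H S - H 0| <= 2 * (1 + K) * E * D2 * `|S - 0|.
  apply: (deriv_lip dH) => s; rewrite (min_idPl (ltW S0)) (max_idPr (ltW S0)) => sS.
  have t1 := tay f (x1 s) (y1 s) cf; have t2 := tay g (x2 s) (y2 s) cg.
  have h1 := w1 s sS; have h2 := w2 s sS.
  have e1 := en s; have e2 := en' s.
  set X := (X in `|X| <= _).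
  have -> : X = (q1 s - p1 s) ^+ 2 + (q2 s - p2 s) ^+ 2 +
     (f (y1 s) - f (x1 s) - (y1 s - x1 s) * derive1 f (x1 s)) +
     (g (y2 s) - g (x2 s) - (y2 s - x2 s) * derive1 g (x2 s)).
    rewrite /X.
    have -> : f (y1 s) = q1 s ^+ 2 + q2 s ^+ 2 - 1 - g (y2 s) by lra.
    have -> : f (x1 s) = p1 s ^+ 2 + p2 s ^+ 2 - 1 - g (x2 s) by lra.
    by field.
  have a1 := sqr_ge0 (q1 s - p1 s); have a2 := sqr_ge0 (q2 s - p2 s).
  have b1 := sqr_ge0 (y1 s - x1 s); have b2 := sqr_ge0 (y2 s - x2 s).
  have k1 : K * (y1 s - x1 s) ^+ 2 <= K * (E * D2) by rewrite ler_wpM2l//; lra.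
  have k2 : K * (y2 s - x2 s) ^+ 2 <= K * (E * D2) by rewrite ler_wpM2l//; lra.
  have -> : 2 * (1 + K) * E * D2 = E * D2 + E * D2 + K * (E * D2) + K * (E * D2) by ring.
  apply: (le_trans (ler_normD _ _)); apply: lerD; last by lra.
  apply: (le_trans (ler_normD _ _)); apply: lerD; last by lra.
  by rewrite ger0_norm; lra.
have T2 : (S - S') ^+ 2 <= E / a * D2.
  have h : (r * (S - S')) ^+ 2 <= (y1 S - x1 S) ^+ 2.
    have dr : deriv (fun s : R => r * s) (fun=> r).
      by apply: (deriv_ext (derivZ r derivX)) => // s; rewrite mulr1.
    rewrite X1S -Y1S.
    have [SS|/ltW SS] := leP S S'.
      have := deriv_le SS dr m1.1 (fun s _ => rq1 s) => hh.
      have -> : (r * (S - S')) ^+ 2 = (r * (S' - S)) ^+ 2 by ring.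
      have -> : (y1 S - y1 S') ^+ 2 = (y1 S' - y1 S) ^+ 2 by ring.
      have r1 : 0 <= r * (S' - S) by rewrite mulr_ge0 ?subr_ge0// ltW.
      rewrite ler_pXn2r ?nnegrE//; lra.
    have := deriv_le SS dr m1.1 (fun s _ => rq1 s) => hh.
    have r1 : 0 <= r * (S - S') by rewrite mulr_ge0 ?subr_ge0// ltW.
    rewrite ler_pXn2r ?nnegrE//; lra.
  rewrite mulrAC ler_pdivlMr// -rE mulrC -exprMn; apply: (le_trans h).
  have := w1 S; rewrite lexx (ltW S0) => /(_ isT); have := sqr_ge0 (q1 S - p1 S); lra.
have sqP (p : R) : p ^+ 2 <= 1 + 2 * K -> `|p| <= P.
  move=> h; rewrite -(@ler_pXn2r _ 2%N)// ?nnegrE// real_normK ?num_real//.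
  by apply: (le_trans h); rewrite /P; nra.
have rhi u v : 1 + f u + g v <= 1 + 2 * K.
  have := C2b0 cf u; have := C2b0 cg v.
  by rewrite !ler_norml => /andP[? ?] /andP[? ?]; lra.
have q1P s : `|q1 s| <= P by apply: sqP; have := en' s; have := rhi (y1 s) (y2 s); have := sqr_ge0 (q2 s); lra.
have q2P s : `|q2 s| <= P by apply: sqP; have := en' s; have := rhi (y1 s) (y2 s); have := sqr_ge0 (q1 s); lra.
have p1P : `|p1 0| <= P by apply: sqP; have := en 0; have := rhi (x1 0) (x2 0); have := sqr_ge0 (p2 0); lra.
have e1 : `|y1 S - k%:R - (S - S') * q1 0| <= K * (S - S') ^+ 2.
  have := @deriv_taylor R y1 q1 K S' (S - S') K0 m1.1.
  rewrite (addrC S') subrK Y1S Q1S; apply => s _.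
  rewrite -Q1S; apply: (deriv_lipT _ _ m1.2) => u.
  rewrite normrM (ger0_norm (_ : 0 <= 2^-1))//; have := C2b1 cf (y1 u).
  have := normr_ge0 (derive1 f (y1 u)); lra.
have e2 : `|q' S - q' S' - (S - S') * q1 0 ^+ 2| <= 2 * (K * P) * (S - S') ^+ 2.
  have := @deriv_taylor R q' _ (2 * (K * P)) S' (S - S') _ dq'.
  rewrite (addrC S') subrK Q1S Q2S expr0n /= addr0; apply; first by rewrite mulr_ge0.
  move=> s _.
  have -> : q1 s ^+ 2 + q2 s ^+ 2 - q1 0 ^+ 2 = (f (y1 s) - f (y1 S')) + (g (y2 s) - g (y2 S')).
    by rewrite en'; have := en' S'; rewrite Q1S Q2S expr0n /= addr0; lra.
  have h1 := le_trans (lip_C2 (y1 s) (y1 S') cf) (ler_wpM2l K0 (deriv_lipT S' s m1.1 q1P)).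
  have h2 := le_trans (lip_C2 (y2 s) (y2 S') cg) (ler_wpM2l K0 (deriv_lipT S' s m2.1 q2P)).
  apply: (le_trans (ler_normD _ _)).
  have -> : 2 * (K * P) * `|s - S'| = K * (P * `|s - S'|) + K * (P * `|s - S'|) by ring.
  exact: lerD.
have -> : l' - l = (H S - H 0) / 2 + (p1 0 * (y1 S - k%:R - (S - S') * q1 0)
   - (q' S - q' S' - (S - S') * q1 0 ^+ 2) + (S - S') * (q1 0 * (p1 0 - q1 0))).
  rewrite lE lE' /H P1S P2S P20 X1S Y10 X10; by field.
apply: (@le_trans _ _ (C * D2)); last by rewrite ler_wpM2r//; lra.
have KK : 0 <= K * P by [].
have b1 : `|(H S - H 0) / 2| <= (1 + K) * E * B * D2.
  rewrite normrM (ger0_norm (_ : 0 <= 2^-1))// ler_pdivrMr//; apply: (le_trans HS).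
  rewrite subr0 (gtr0_norm S0).
  have -> : (1 + K) * E * B * D2 * 2 = 2 * (1 + K) * E * D2 * B by ring.
  by rewrite ler_wpM2l// mulr_ge0// mulr_ge0// mulr_ge0// addr_ge0.
have b2 : `|p1 0 * (y1 S - k%:R - (S - S') * q1 0)| <= K * P * (E / a * D2).
  have -> : K * P * (E / a * D2) = P * (K * (E / a * D2)) by ring.
  rewrite normrM; apply: ler_pM => //.
  by apply: (le_trans e1); rewrite ler_wpM2l.
have b3 : `|q' S - q' S' - (S - S') * q1 0 ^+ 2| <= 2 * (K * P) * (E / a * D2).
  by apply: (le_trans e2); rewrite ler_wpM2l// mulr_ge0.
have b4 : `|(S - S') * (q1 0 * (p1 0 - q1 0))| <= P * ((E / a + (K / r) ^+ 2) * D2).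
  rewrite mulrCA normrM; apply: ler_pM; [by []|by []|exact: q1P|].
  rewrite normrM mulrDl.
  have -> : `|p1 0 - q1 0| = `|q1 0 - p1 0| by rewrite distrC.
  have := T2; have := dp.
  rewrite -(real_normK (num_real (S - S'))) -(real_normK (num_real (q1 0 - p1 0))).
  set U := `|S - S'|; set V := `|q1 0 - p1 0| => hU hV.
  have : 0 <= (U - V) ^+ 2 by exact: sqr_ge0.
  have := sqr_ge0 U; have := sqr_ge0 V; nra.
have -> : C * D2 = (1 + K) * E * B * D2 + ((K * P * (E / a * D2) + 2 * (K * P) * (E / a * D2))
   + P * ((E / a + (K / r) ^+ 2) * D2)) by rewrite /C; ring.
have sum4 (u1 u2 u3 u4 v1 v2 v3 v4 : R) : `|u1| <= v1 -> `|u2| <= v2 -> `|u3| <= v3 ->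
    `|u4| <= v4 -> `|u1 + (u2 - u3 + u4)| <= v1 + ((v2 + v3) + v4).
  by rewrite !ler_norml => /andP[? ?] /andP[? ?] /andP[? ?] /andP[? ?]; apply/andP; split; lra.
exact: sum4 b1 b2 b3 b4.
Qed.

End Sard.

(** * Gaps in the oscillating spectrum *)

Section Gaps.
Context {R : realType}.
Implicit Types (f g : R -> R).

(** The velocity in the winding variable is bounded, so bounded length bounds the
winding number. *)
Lemma osc_orbit_winding f g (K a L : R) k y l : C2per f K -> C2per g K -> 0 < a ->
  (forall u v : R, a <= 1 + f u + g v) -> l <= L ->
  osc_orbit f g k y l -> k%:R <= (2 + 2 * K) * (`|L| / a).
Proof.
move=> cf cg a0 lo lL.
move=> [S [x1 [p1 [x2 [p2 [q [S0 [n1 n2] [X10 X1S P1S] [X20 X2S P20 P2S] [p10 pE dq lE]]]]]]]].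
have K0 := C2K cf.
have en s : p1 s ^+ 2 + p2 s ^+ 2 = 1 + f (x1 s) + g (x2 s).
  have e1 := newton_energy (C2d1 cf) n1 s; have e2 := newton_energy (C2d1 cg) n2 s.
  by move: e1 e2; rewrite X10 X20 P20 pE expr0n /=; lra.
have dl : deriv (fun s : R => a * s) (fun=> a).
  by apply: (deriv_ext (derivZ a derivX)) => // s; rewrite mulr1.
have SB : S <= `|L| / a.
  rewrite ler_pdivlMr// mulrC.
  have := deriv_le (ltW S0) dl dq; rewrite -lE mulr0 subr0 => H.
  have aSl : a * S <= l by apply: H => s _; rewrite en lo.
  by have := ler_norm L; lra.
have p1P s : `|p1 s| <= 2 + 2 * K.
  have /andP[? ?] : - K <= f (x1 s) <= K by rewrite -ler_norml; exact: C2b0 cf _.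
  have /andP[? ?] : - K <= g (x2 s) <= K by rewrite -ler_norml; exact: C2b0 cg _.
  have h : p1 s ^+ 2 <= 1 + 2 * K by have := en s; have := sqr_ge0 (p2 s); lra.
  have PP : 0 <= 2 + 2 * K by lra.
  rewrite -(@ler_pXn2r _ 2%N) ?nnegrE//.
  by rewrite real_normK ?num_real//; nra.
have := deriv_lipT 0 S n1.1 p1P; rewrite X10 X1S !subr0 normr_nat (gtr0_norm S0) => h.
by apply: (le_trans h); rewrite ler_wpM2l//; lra.
Qed.

(** A map with [|l - l'| <= C (y - y')^2] on a set of reals has a null image: cut the
unit interval into N pieces and cover the image by intervals of total size C / N. *)
Lemma osc_gap f g (K a u v : R) : C2per f K -> C2per g K -> 0 < a ->
  (forall s t : R, a <= 1 + f s + g t) -> u < v ->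
  exists l, u <= l <= v /\ forall z1, ~ closed_orbit f g z1 0 l.
Proof.
move=> cf cg a0 lo uv; apply: contrapT => /forallNP H.
have pos (s t : R) : 0 < 1 + f s + g t by exact: lt_le_trans (lo s t).
have H' l : u <= l <= v -> exists ky : nat * R, (0 <= ky.2 <= 1) /\ osc_orbit f g ky.1 ky.2 l.
  move=> luv; have /not_andP[//|/existsNP[z1 /contrapT co]] := H l.
  have [k [y [yI o]]] := osc_orbit_normal cf cg pos co.
  by exists (k, y).
have [C C0 quad] := osc_orbit_quad v cf cg a0 lo.
pose kb := (2 + 2 * K) * (`|v| / a).
pose M := Num.bound kb.
have kM k y l : l <= v -> osc_orbit f g k y l -> (k < M.+1)%N.
  move=> lv o; have := osc_orbit_winding cf cg a0 lo lv o; rewrite -/kb => h.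
  have kb0 : 0 <= kb by apply: le_trans h.
  have := archi_boundP kb0; rewrite -/M => h'.
  by rewrite ltnS -(ler_nat R) ltW// (le_lt_trans h).
pose D := 2 * C * M.+1%:R / (v - u).
have D0 : 0 <= D by rewrite divr_ge0 ?subr_ge0 ?(ltW uv)// mulr_ge0// mulr_ge0// ltW.
pose N := (Num.bound D).+1.
have ND : D < N%:R by rewrite (lt_trans (archi_boundP D0))// ltr_nat.
have N0 : 0 < N%:R :> R by rewrite ltr0n.
pose Q := (M.+1 * N.+1)%N.
have Q0 : 0 < Q%:R :> R by rewrite ltr0n.
pose t (i : 'I_Q.+1) := u + (v - u) * (i%:R / Q%:R).
have tI i : u <= t i <= v.
  have i1 : i%:R / Q%:R <= 1 :> R by rewrite ler_pdivrMr// mul1r ler_nat -ltnS.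
  have i0 : 0 <= i%:R / Q%:R :> R by rewrite divr_ge0.
  rewrite /t; apply/andP; split.
    by rewrite lerDl mulr_ge0// subr_ge0 ltW.
  have : (v - u) * (i%:R / Q%:R) <= (v - u) * 1 by rewrite ler_wpM2l// subr_ge0 ltW.
  lra.
have /choice[ky kyP] : forall i, exists ky : nat * R, (0 <= ky.2 <= 1) /\ osc_orbit f g ky.1 ky.2 (t i).
  by move=> i; apply: H'.
pose j i := Num.truncn ((ky i).2 * N%:R).
have jP i : (j i)%:R <= (ky i).2 * N%:R < (j i).+1%:R.
  have [/andP[y0 y1] _] := kyP i; apply: truncn_itv; by rewrite mulr_ge0.
have jN i : (j i < N.+1)%N.
  have /andP[j1 _] := jP i; have [/andP[y0 y1] _] := kyP i.
  by rewrite ltnS -(ler_nat R) (le_trans j1)// ler_piMl.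
have kN i : ((ky i).1 < M.+1)%N.
  by have [_ o] := kyP i; have /andP[_ tv] := tI i; exact: kM tv o.
pose box i : 'I_M.+1 * 'I_N.+1 := (Ordinal (kN i), Ordinal (jN i)).
have : injective box.
  move=> i i' [kk jj]; apply: contrapT => /eqP ii'.
  have [_ o] := kyP i; have [_ o'] := kyP i'; rewrite -kk in o'.
  have /andP[_ tv] := tI i; have /andP[_ tv'] := tI i'.
  have le := quad _ _ _ _ _ tv tv' o o'.
  have jj1 := jP i; have jj2 := jP i'; rewrite -jj in jj2.
  have yy : ((ky i').2 - (ky i).2) ^+ 2 <= N%:R ^- 2.
    rewrite -(real_normK (num_real ((ky i').2 - _))) -exprVn.
    rewrite ler_pXn2r ?nnegrE ?invr_ge0//.
    rewrite -div1r ler_pdivlMr// -{1}(gtr0_norm N0) -normrM mulrBl ler_norml.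
    move: jj1 jj2; rewrite -natr1 => /andP[? ?] /andP[? ?]; lra.
  have tt : (v - u) / Q%:R <= `|t i' - t i|.
    have -> : t i' - t i = (v - u) / Q%:R * (i'%:R - i%:R) by rewrite /t; field; rewrite gt_eqF.
    have vq : 0 < (v - u) / Q%:R by rewrite divr_gt0// subr_gt0.
    rewrite normrM (gtr0_norm vq) ler_pMr//.
    have [h|h|h] := ltngtP i i'; last by case/negP: ii'; apply/eqP/val_inj.
      rewrite ger0_norm ?subr_ge0 ?ler_nat ?(ltnW h)//.
      by rewrite -natrB ?(ltnW h)// ler1n subn_gt0.
    rewrite ler0_norm ?subr_le0 ?ler_nat ?(ltnW h)// opprB.
    by rewrite -natrB ?(ltnW h)// ler1n subn_gt0.
  have : (v - u) / Q%:R <= C * N%:R ^- 2.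
    by apply: (le_trans tt); apply: (le_trans le); rewrite ler_wpM2l// ltW.
  rewrite ler_pdivrMr// mulrAC ler_pdivlMr ?exprn_gt0// /Q natrM.
  have N1 : 1 <= N%:R :> R by rewrite ler1n.
  have NN : N.+1%:R <= 2 * N%:R :> R by rewrite -natr1; lra.
  have := ND; rewrite ltr_pdivrMr ?subr_gt0//.
  move: NN N0 C0 uv; set n := N%:R; set m := M.+1%:R; set n1 := N.+1%:R => NN n0 C0 uv h1 h2.
  have m0 : 0 < m by rewrite ltr0n.
  have h3 : C * (m * n1) <= C * m * (2 * n) by rewrite mulrA ler_wpM2l// mulr_ge0// ltW.
  have h4 : 0 < n * (n * (v - u) - 2 * C * m) by rewrite mulr_gt0// subr_gt0.
  have h5 := le_trans h2 h3; rewrite expr2 in h5.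
  have E : n * (n * (v - u) - 2 * C * m) = (v - u) * (n * n) - C * m * (2 * n) by ring.
  rewrite E in h4; lra.
move=> /leq_card; rewrite card_prod !card_ord -/Q; by rewrite ltnn.
Qed.

End Gaps.

(** * Smooth bumps on the circle *)

Section Bump.
Context {R : realType}.
Implicit Types (f g h : R -> R).

(** A class of functions closed under differentiation consists of smooth functions. *)
Lemma smooth_class (E : (R -> R) -> Prop) :
  (forall h, E h -> exists2 h', E h' & deriv h h') ->
  forall h, E h -> forall (k : nat) (t : R), derivable (derive1n k h) t 1.
Proof.
move=> ED h Eh k; have Ek : E (derive1n k h).
  elim: k => [//|k /ED[h' Eh' dh]]; rewrite derive1nS.
  suff -> : derive1 (derive1n k h) = h' by [].
  by apply/funext => t; rewrite derive1E; apply: derive_val; exact: dh.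
by move=> t; have [h' _ /(_ t)[]] := ED _ Ek.
Qed.

(** The functions [x^-n exp (-1/x)], extended by zero; they are closed under
differentiation up to linear combinations. *)
Definition flat (n : nat) (x : R) : R :=
  if x <= 0 then 0 else x^-1 ^+ n * expR (- x^-1).

Lemma flat_le n (x : R) : `|flat n x| <= (n.+2)`!%:R * x ^+ 2.
Proof.
rewrite /flat; case: (leP x 0) => x0.
  by rewrite normr0 mulr_ge0// sqr_ge0.
have i0 : 0 < x^-1 by rewrite invr_gt0.
rewrite ger0_norm ?mulr_ge0 ?expR_ge0 ?exprn_ge0 ?(ltW i0)//.
rewrite expRN ler_pdivrMr ?expR_gt0//.
have fp : 0 < (n.+2)`!%:R :> R by rewrite ltr0n fact_gt0.
have := expR_ge1Dxn n.+1 (ltW i0).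
set e := expR _ => h.
have : (x^-1 ^+ n.+2 / (n.+2)`!%:R) * ((n.+2)`!%:R * x ^+ 2) <= e * ((n.+2)`!%:R * x ^+ 2).
  by rewrite ler_wpM2r ?mulr_ge0 ?sqr_ge0//; lra.
rewrite [e * _]mulrC; apply: le_trans.
rewrite !exprS le_eqVlt; apply/orP; left; apply/eqP; field.
by rewrite !gt_eqF.
Qed.

Lemma flat_deriv n : deriv (flat n) (fun x => flat n.+2 x - n%:R * flat n.+1 x).
Proof.
move=> x; have [x0|x0|->] := ltgtP x 0.
- rewrite /flat (ltW x0) mulr0 subr0.
  apply: near_eq_is_derive (is_derive_cst (0:R) x 1).
  by near=> y; rewrite ifT// ltW//; near: y; exact: lt_nbhsl.
- have i0 : x != 0 by rewrite gt_eqF.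
  have h0 : is_derive x (1:R) (fun y : R => y^-1) (- x ^- 2 * 1).
    exact: (@is_deriveV R id x 1 1 i0 (is_derive_id x 1)).
  have h1 := @is_derive_compR R expR (fun y => - y^-1) x _ _ (is_derive_expR _) (is_deriveN h0).
  have hX : is_derive (x^-1) (1:R) (fun z : R => z ^+ n) (n%:R * x^-1 ^+ n.-1).
    apply: DeriveDef; first exact: exprn_derivable.
    by rewrite -derive1E exp_derive1.
  have h2 : is_derive x (1:R) (fun y : R => y^-1 ^+ n) (n%:R * x^-1 ^+ n.-1 * (- x ^- 2 * 1)).
    exact: (@is_derive_compR R (fun z => z ^+ n) (fun y => y^-1) x _ _ hX h0).
  have h3 := is_deriveM h2 h1.
  apply: (@near_eq_is_derive _ _ _ (fun y : R => y^-1 ^+ n * expR (- y^-1))).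
    near=> y; rewrite /flat ifF//; apply/negbTE; rewrite -ltNge; near: y; exact: lt_nbhsr.
  apply: is_derive_eq h3 _; rewrite /flat leNgt x0 /= /GRing.scale /=.
  case: n {hX h2} => [|n]; first by rewrite !expr0 !mul0r !mulr0; field.
  by rewrite /= !exprS; field.
- rewrite /flat lexx mulr0 subr0; apply: (@is_derive_quad _ _ _ _ (n.+2)`!%:R) => y.
  by have := flat_le n y; rewrite add0r mulr0 !subr0 /flat lexx subr0.
Unshelve. all: by end_near. Qed.

Lemma flat_ge0 n x : 0 <= flat n x.
Proof.
rewrite /flat; case: (leP x 0) => // x0.
by rewrite mulr_ge0 ?expR_ge0// exprn_ge0// invr_ge0 ltW.
Qed.

Lemma flat_gt0 n x : 0 < x -> 0 < flat n x.
Proof.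
by move=> x0; rewrite /flat leNgt x0 /= mulr_gt0 ?expR_gt0// exprn_gt0// invr_gt0.
Qed.

(** The algebra generated by the trigonometric functions and by flat functions of the
cosine: closed under differentiation, hence smooth, and periodic by construction. *)
Inductive trigflat (c kap : R) : (R -> R) -> Prop :=
| tf_cst k : trigflat c kap (fun=> k)
| tf_cos : trigflat c kap (fun x => cos (2 * pi * (x - c)))
| tf_sin : trigflat c kap (fun x => sin (2 * pi * (x - c)))
| tf_flat n : trigflat c kap (fun x => flat n (cos (2 * pi * (x - c)) - kap))
| tf_add f g : trigflat c kap f -> trigflat c kap g -> trigflat c kap (fun x => f x + g x)
| tf_mul f g : trigflat c kap f -> trigflat c kap g -> trigflat c kap (fun x => f x * g x).

Lemma deriv_cos2pi (c : R) : deriv (fun x : R => cos (2 * pi * (x - c)))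
  (fun x : R => (- (2 * pi)) * sin (2 * pi * (x - c))).
Proof.
have d0 : deriv (fun x : R => 2 * pi * (x - c)) (fun=> 2 * pi).
  by apply: (deriv_ext (derivZ (2 * pi) (derivB derivX (derivC c)))) => // x; rewrite subr0 mulr1.
have dc : deriv (@cos R) (fun x => - sin x) by move=> x; exact: is_derive_cos.
by apply: (deriv_ext (deriv_comp dc d0)) => // x; ring.
Qed.

Lemma deriv_sin2pi (c : R) : deriv (fun x : R => sin (2 * pi * (x - c)))
  (fun x : R => (2 * pi) * cos (2 * pi * (x - c))).
Proof.
have d0 : deriv (fun x : R => 2 * pi * (x - c)) (fun=> 2 * pi).
  by apply: (deriv_ext (derivZ (2 * pi) (derivB derivX (derivC c)))) => // x; rewrite subr0 mulr1.
have ds : deriv (@sin R) cos by move=> x; exact: is_derive_sin.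
by apply: (deriv_ext (deriv_comp ds d0)) => // x; ring.
Qed.

Lemma trigflat_deriv c kap h : trigflat c kap h ->
  exists2 h', trigflat c kap h' & deriv h h'.
Proof.
elim=> {h}.
- by move=> k; exists (fun=> 0); [exact: tf_cst|exact: derivC].
- exists (fun x => (- (2 * pi)) * sin (2 * pi * (x - c))); last exact: deriv_cos2pi.
  by apply: tf_mul; [exact: tf_cst|exact: tf_sin].
- exists (fun x => (2 * pi) * cos (2 * pi * (x - c))); last exact: deriv_sin2pi.
  by apply: tf_mul; [exact: tf_cst|exact: tf_cos].
- move=> n.
  exists (fun x => (flat n.+2 (cos (2 * pi * (x - c)) - kap) + - n%:R * flat n.+1 (cos (2 * pi * (x - c)) - kap))
     * ((- (2 * pi)) * sin (2 * pi * (x - c)))).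
    apply: tf_mul; last by apply: tf_mul; [exact: tf_cst|exact: tf_sin].
    by apply: tf_add; [exact: tf_flat|apply: tf_mul; [exact: tf_cst|exact: tf_flat]].
  apply: (deriv_ext (deriv_comp (flat_deriv n) (derivB (deriv_cos2pi c) (derivC kap)))) => // x.
  by rewrite subr0 mulNr.
- move=> f g _ [f' tf' df] _ [g' tg' dg]; exists (fun x => f' x + g' x); first exact: tf_add.
  exact: derivD.
- move=> f g tf [f' tf' df] tg [g' tg' dg]; exists (fun x => f' x * g x + f x * g' x); last exact: derivM.
  by apply: tf_add; apply: tf_mul.
Qed.

Lemma trigflat_periodic c kap h : trigflat c kap h -> periodic h 1.
Proof.
have P x : 2 * pi * (x + 1 - c) = 2 * pi * (x - c) + pi *+ 2 :> R by rewrite mulr2n; ring.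
elim=> {h} //.
- by move=> x; rewrite P cosD2pi.
- by move=> x; rewrite P sinD2pi.
- by move=> n x; rewrite P cosD2pi.
- by move=> f g _ pf _ pg x; rewrite pf pg.
- by move=> f g _ pf _ pg x; rewrite pf pg.
Qed.

Lemma trigflat_circle c kap h : trigflat c kap h -> circle_smooth h.
Proof.
move=> th; split; last exact: trigflat_periodic th.
exact: (smooth_class (@trigflat_deriv c kap)).
Qed.

(** The cosine is decreasing on the half period, so its superlevel sets are
neighbourhoods of the integers. *)
Lemma cos_near (c eta : R) : 0 < eta < 2^-1 -> cos (2 * pi * eta) < 1 /\
  forall x : R, cos (2 * pi * eta) < cos (2 * pi * (x - c)) -> exists m : int, `|x - c - m%:~R| < eta.
Proof.
move=> /andP[e0 e1].
pose kap : R := cos (2 * pi * eta).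
have p0 : 0 <= pi :> R by exact: pi_ge0.
have rng (w : R) : 0 <= w -> w <= 2^-1 -> 2 * pi * w \in `[0, pi].
  move=> w0 w1; rewrite in_itv /= !mulr_ge0//=.
  have : pi * (2 * w) <= pi * 1 :> R by rewrite ler_wpM2l//; lra.
  by rewrite mulr1; lra.
split.
  have zI : (0:R) \in `[0, pi] by rewrite in_itv /= lexx.
  have eI : 2 * pi * eta \in `[0, pi] by exact: rng (ltW e0) (ltW e1).
  rewrite -[X in _ < X]cos0 (ltr_cos zI eI).
  by rewrite mulr_gt0// mulr_gt0// pi_gt0.
move=> x hk.
pose m := Num.floor (x - c + 2^-1).
have /andP[m1 m2] : m%:~R <= x - c + 2^-1 < m%:~R + 1.
  by have := floor_itv (x - c + 2^-1); rewrite intrD.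
exists m; rewrite ltNge; apply/negP => le.
set u := x - c - m%:~R in le.
have cE : cos (2 * pi * (x - c)) = cos (2 * pi * `|u|).
  have -> : 2 * pi * `|u| = `|2 * pi * u|.
    by rewrite normrM (ger0_norm (_ : 0 <= 2 * pi))// mulr_ge0 ?pi_ge0.
  rewrite cos_norm.
  have per : periodic (fun y : R => cos (2 * pi * y)) 1.
    by move=> y; rewrite mulrDr mulr1 -mulrA [2 * pi]mulrC mulr_natr cosD2pi mulrA.
  by rewrite -(periodicz m u per) /u subrK.
move: hk; rewrite cE; apply/negP; rewrite -leNgt.
have u2 : `|u| <= 2^-1 by rewrite ler_norml /u; apply/andP; split; lra.
rewrite leNgt ltr_cos ?rng ?(ltW e0) ?(ltW e1)// -leNgt.
by rewrite ler_wpM2l// mulr_ge0.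
Qed.

(** Compose a flat function with the cosine minus its value at distance [eta]. *)
Lemma bump_exists (c eta : R) : 0 < eta < 2^-1 ->
  exists h : circle_cinfty R, [/\ forall x, 0 <= h x, 0 < h c &
    forall x, 0 < h x -> exists m : int, `|x - c - m%:~R| < eta].
Proof.
move=> eI; have [cos_lt near] := cos_near c eI.
have th := @trigflat_circle c (cos (2 * pi * eta)) _ (tf_flat c (cos (2 * pi * eta)) 0).
exists (CircleCinfty th) => /=; split.
- by move=> x; exact: flat_ge0.
- by apply: flat_gt0; rewrite subrr mulr0 cos0 subr_gt0.
- move=> x hx; apply: near.
  by rewrite ltNge; apply/negP => h; move: hx; rewrite /flat subr_le0 h ltxx.
Qed.

End Bump.

(** * The topology of Liouville pairs *)

Section Topology.
Context {R : realType}.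
Implicit Types (f g h : circle_cinfty R).

Lemma circle_deriv f k : deriv (derive1n k f) (derive1n k.+1 f).
Proof.
case: f => f [/= df pf] x /=.
by apply: DeriveDef; [exact: df|rewrite -[LHS]derive1E -derive1nS].
Qed.

Lemma circle_periodic f k : periodic (derive1n k f) 1.
Proof.
elim: k => [|k IH]; first by case: f => f [].
by rewrite derive1nS; exact: derive1_periodic.
Qed.

Lemma derive1_eq (F G : R -> R) : deriv F G -> derive1 F = G.
Proof. by move=> d; apply/funext => x; rewrite derive1E; apply: derive_val; exact: d. Qed.

Lemma derive1n_addZ f h (s : R) k :
  derive1n k (fun x => f x + s * h x) = (fun x => derive1n k f x + s * derive1n k h x).
Proof.
elim: k => [//|k IH]; rewrite !derive1nS IH; apply: derive1_eq.
by rewrite -!derive1nS; exact: derivD (circle_deriv f k) (derivZ s (circle_deriv h k)).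
Qed.

Lemma circle_add_smooth f h (s : R) : circle_smooth (fun x => f x + s * h x).
Proof.
split=> [k t|x].
  rewrite derive1n_addZ.
  by have [] := derivD (circle_deriv f k) (derivZ s (circle_deriv h k)) t.
by have := circle_periodic f 0 x; have := circle_periodic h 0 x => /= -> ->.
Qed.

Definition circle_add f h s := CircleCinfty (circle_add_smooth f h s).

Lemma cvg_initial (S : choiceType) (T : topologicalType) (p : S -> T)
    (F : set_system S) (FF : Filter F) (s : S) :
  p @ F --> p s -> F --> (s : initial_topology p).
Proof.
move=> h A; rewrite nbhsE => -[B [[C oC <-] Cs] BA].
by apply: filterS BA _; apply: h; exact: open_nbhs_nbhs.
Qed.

(** Convergence in the initial topology is uniform convergence of every derivative. *)
Lemma cvg_circle (T : Type) (F : set_system T) (FF : Filter F) (u : T -> circle_cinfty R) f :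
  (forall k (e : R), 0 < e ->
     F [set t | forall x, `|derive1n k (u t) x - derive1n k f x| < e]) ->
  u @ F --> f.
Proof.
move=> H; apply: (@cvg_initial _ _ (@jets R)).
apply/cvg_sup => k; apply: (@cvg_initial _ _ (fun g : forall i : nat, {uniform R -> R} => g k)).
move=> A /uniform_nbhs[E [+ EA]]; rewrite -entourage_ballE => -[e /= e0 eE].
suff sub : [set t | forall x, `|derive1n k (u t) x - derive1n k f x| < e] `<=`
    [set t | A (jets (u t) k)] by exact: filterS sub (H k e e0).
move=> t /= te; apply: EA => y _; apply: eE => /=.
by rewrite /ball /= distrC; exact: te.
Qed.

Lemma nbhs_circle f k (e : R) : 0 < e ->
  nbhs f [set g | forall x, `|derive1n k g x - derive1n k f x| < e].
Proof.
move=> e0; have cj : continuous (@jets R : circle_cinfty R -> _) by exact: initial_continuous.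
have cp := @proj_continuous nat (fun=> {uniform R -> R}) k (jets f).
have N : nbhs (jets f k : {uniform R -> R}) [set h | forall y, `|h y - jets f k y| < e].
  apply/uniform_nbhs; exists [set xy | ball xy.1 e xy.2]; split.
    by rewrite -entourage_ballE; exists e.
  by move=> h /= H y; have := H y I; rewrite /ball /= distrC.
exact: (cj f _ (cp _ N)).
Qed.

Lemma pair_add_gt0 (f : liouville_pair R) h1 h2 (s t : R) :
  (forall x, 0 <= h1 x) -> (forall x, 0 <= h2 x) ->
  forall x y, 0 < 1 + circle_add (liouville1 f) h1 (Num.max 0 s) x
                   + circle_add (liouville2 f) h2 (Num.max 0 t) y.
Proof.
move=> p1 p2 x y /=; have := liouville_gt0 f x y.
have : 0 <= Num.max 0 s * h1 x by rewrite mulr_ge0// le_max lexx.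
have : 0 <= Num.max 0 t * h2 y by rewrite mulr_ge0// le_max lexx.
lra.
Qed.

(** The two parameters are truncated below at 0, so that positivity of the conformal
factor is preserved without any condition on them. *)
Definition pair_add (f : liouville_pair R) h1 h2 (p1 : forall x, 0 <= h1 x)
    (p2 : forall x, 0 <= h2 x) (s t : R) : liouville_pair R :=
  LiouvillePair (pair_add_gt0 f s t p1 p2).

(** The affine perturbation is continuous for all derivatives at once. *)
Lemma open_perturb (O : set (liouville_pair R)) (f : liouville_pair R) h1 h2
    (p1 : forall x, 0 <= h1 x) (p2 : forall x, 0 <= h2 x) :
  open O -> O f -> exists2 d, 0 < d & forall s t, 0 <= s < d -> 0 <= t < d ->
    O (pair_add f p1 p2 s t).
Proof.
move=> oO Of.
have bk h k : exists2 C, 0 <= C & forall x, `|derive1n k h x| <= C.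
  exact: periodic_bounded (deriv_cont (circle_deriv h k)) (circle_periodic h k).
have key g h : (fun s : R => circle_add g h (Num.max 0 s)) @ (0:R)^'+ --> g.
  apply: cvg_circle => k e e0; have [C C0 Cb] := bk h k.
  near=> s => x; rewrite /= derive1n_addZ addrAC subrr add0r normrM.
  have s0 : 0 < s by near: s; exact: nbhs_right_gt.
  rewrite max_r ?ltW// (ger0_norm (ltW s0)).
  have : s < e / (C + 1).
    by near: s; apply: nbhs_right_lt; rewrite divr_gt0//; lra.
  rewrite ltr_pdivlMr; last lra.
  have := ler_wpM2l (ltW s0) (Cb x); lra.
have [C oC CO] : exists2 C, open C & liouville_val @^-1` C = O by case: oO => C oC CO; exists C.
have nC : nbhs (liouville1 f, liouville2 f) C.
  by apply: open_nbhs_nbhs; split=> //; rewrite -CO in Of.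
have [[A B] /= [nA nB] AB] := nC.
have [e1 /= e10 He1] : (0:R)^'+ [set s | A (circle_add (liouville1 f) h1 (Num.max 0 s))] by exact: key nA.
have [e2 /= e20 He2] : (0:R)^'+ [set s | B (circle_add (liouville2 f) h2 (Num.max 0 s))] by exact: key nB.
have circle_add0 g h : circle_add g h (Num.max 0 0) = g.
  case: g => g gs; rewrite /circle_add maxxx.
  have E : (fun x => CircleCinfty gs x + 0 * h x) = g by apply/funext => x; rewrite mul0r addr0.
  by move: (circle_add_smooth _ _ _); rewrite E => gs'; congr CircleCinfty; exact: Prop_irrelevance.
have A0 : A (circle_add (liouville1 f) h1 (Num.max 0 0)).
  by rewrite circle_add0; exact: nbhs_singleton nA.
have B0 : B (circle_add (liouville2 f) h2 (Num.max 0 0)).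
  by rewrite circle_add0; exact: nbhs_singleton nB.
exists (Num.min e1 e2); first by rewrite lt_min e10.
move=> s t /andP[s0 s1] /andP[t0 t1]; rewrite -CO /=; apply: AB; split=> /=.
  move: s0; rewrite le_eqVlt => /predU1P[<-|s0]; first exact: A0.
  apply: He1 => //=; rewrite /ball /= sub0r normrN gtr0_norm//.
  by rewrite (lt_le_trans s1)// ge_min lexx.
move: t0; rewrite le_eqVlt => /predU1P[<-|t0]; first exact: B0.
apply: He2 => //=; rewrite /ball /= sub0r normrN gtr0_norm//.
by rewrite (lt_le_trans t1)// ge_min lexx orbT.
Unshelve. all: by end_near. Qed.

End Topology.

(** * Openness *)

Section Perturbation.
Context {R : realType}.
Implicit Types (f g h : circle_cinfty R).

(** Closeness up to second order, enough to control all orbits. *)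
Definition near2 f g (e : R) :=
  forall k, (k <= 2)%N -> forall x, `|derive1n k f x - derive1n k g x| < e.

Lemma C2per_le (F : R -> R) K K' : K <= K' -> C2per F K -> C2per F K'.
Proof.
move=> le [d1 d2 p0 K0 b0 b1 b2]; split=> //; first exact: le_trans le.
- by move=> y; exact: le_trans le.
- by move=> y; exact: le_trans le.
- by move=> y; exact: le_trans le.
Qed.

Lemma C2per_near f g K e : near2 f g e -> C2per g K -> C2per f (K + e).
Proof.
move=> n [d1 d2 p0 K0 b0 b1 b2].
have e0 : 0 < e by apply: le_lt_trans (n 0%N isT 0).
have B k x : (k <= 2)%N -> `|derive1n k g x| <= K -> `|derive1n k f x| <= K + e.
  move=> /n /(_ x) h1 h2; have := ler_normD (derive1n k f x - derive1n k g x) (derive1n k g x).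
  by rewrite subrK; lra.
split.
- exact: circle_deriv f 0.
- exact: circle_deriv f 1.
- exact: circle_periodic f 0.
- lra.
- by move=> y; exact: B 0%N y isT (b0 y).
- by move=> y; exact: B 1%N y isT (b1 y).
- by move=> y; exact: B 2%N y isT (b2 y).
Qed.

Lemma near2_close f g e : near2 f g e -> close_to f g e.
Proof. by move=> n; split=> x; apply: ltW; [exact: n 0%N isT x|exact: n 1%N isT x]. Qed.

Lemma near2_le f g e e' : e <= e' -> near2 f g e -> near2 f g e'.
Proof. by move=> le n k k2 x; exact: lt_le_trans (n k k2 x) le. Qed.

Lemma near2_lower (f f' : liouville_pair R) (a e : R) :
  (forall x y, a <= 1 + liouville1 f x + liouville2 f y) ->
  near2 (liouville1 f') (liouville1 f) e -> near2 (liouville2 f') (liouville2 f) e ->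
  forall x y, a - 2 * e <= 1 + liouville1 f' x + liouville2 f' y.
Proof.
move=> lo n1 n2 x y; have := lo x y.
have := n1 0%N isT x; have := n2 0%N isT y; rewrite /= => h1 h2.
have /andP[? ?] : - e < liouville1 f' x - liouville1 f x < e by rewrite -ltr_norml.
have /andP[? ?] : - e < liouville2 f' y - liouville2 f y < e by rewrite -ltr_norml.
lra.
Qed.

(** Upper semicontinuity of the set of lengths: otherwise the ultralimit of closed
orbits for potentials converging to [f] would be one of length [l]. *)
Lemma closed_orbit_semicont (f : liouville_pair R) (P : int -> int -> Prop) (l : R) : 0 < l ->
  ~ (exists z1 z2, P z1 z2 /\ closed_orbit (liouville1 f) (liouville2 f) z1 z2 l) ->
  exists2 d, 0 < d & forall (f' : liouville_pair R) l',
    near2 (liouville1 f') (liouville1 f) d -> near2 (liouville2 f') (liouville2 f) d ->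
    `|l' - l| < d ->
    ~ (exists z1 z2, P z1 z2 /\ closed_orbit (liouville1 f') (liouville2 f') z1 z2 l').
Proof.
move=> l0 no; apply: contrapT => H.
have [K1 cK1] := circle_C2per (liouville1 f).
have [K2 cK2] := circle_C2per (liouville2 f).
have [a a0 lo] := liouville_lower f.
have K10 := C2K cK1; have K20 := C2K cK2.
pose m := Num.min 1 (a / 4); have m0 : 0 < m by rewrite lt_min ltr01 divr_gt0.
have m1 : m <= 1 by rewrite ge_min lexx.
have ma : m <= a / 4 by rewrite ge_min lexx orbT.
pose e n := m * n.+1%:R^-1.
have ep n : 0 < e n by rewrite mulr_gt0// invr_gt0.
have em n : e n <= m by rewrite ler_piMr ?(ltW m0)// invf_le1 ?ler1n// ltr0n.
have /choice[f' f'P] : forall n, exists fl : liouville_pair R * R * (int * int),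
   [/\ near2 (liouville1 fl.1.1) (liouville1 f) (e n), near2 (liouville2 fl.1.1) (liouville2 f) (e n),
    `|fl.1.2 - l| < e n & P fl.2.1 fl.2.2 /\
    closed_orbit (liouville1 fl.1.1) (liouville2 fl.1.1) fl.2.1 fl.2.2 fl.1.2].
  move=> n; apply: contrapT => /forallNP Hn; apply: H; exists (e n) => // f' l' n1 n2 ll [z1 [z2 [Pz co]]].
  by apply: (Hn (f', l', (z1, z2))).
have [|||||||||||||n co] := @closed_orbit_compact R (fun n => liouville1 (f' n).1.1) (fun n => liouville2 (f' n).1.1)
  (liouville1 f) (liouville2 f) (K1 + K2 + 1) (a / 2) (fun n => (f' n).2.1) (fun n => (f' n).2.2)
  (fun n => (f' n).1.2) e l.
- rewrite -(mulr0 m); apply: cvgM; [exact: cvg_cst|exact: ucvg_harmonic].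
- by move=> n; apply: le_trans (em n) m1.
- move=> n; have [n1 _ _ _] := f'P n.
  by apply: C2per_le (C2per_near n1 cK1); have := em n; lra.
- move=> n; have [_ n2 _ _] := f'P n.
  by apply: C2per_le (C2per_near n2 cK2); have := em n; lra.
- by apply: C2per_le cK1; lra.
- by apply: C2per_le cK2; lra.
- lra.
- move=> n x y; have [n1 n2 _ _] := f'P n.
  by have := near2_lower lo n1 n2 x y; have := em n; lra.
- by move=> n; have [n1 _ _ _] := f'P n; exact: near2_close.
- by move=> n; have [_ n2 _ _] := f'P n; exact: near2_close.
- by move=> n; have [_ _ h _] := f'P n; exact: ltW.
- exact: l0.
- by move=> n; have [_ _ _ [_ co]] := f'P n; exact: co.
by apply: no; exists (f' n).2.1, (f' n).2.2; split=> //; have [_ _ _ []] := f'P n.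
Qed.

(** The first-order comparison in both directions gives continuity. *)
Lemma rot_semicont (f : liouville_pair R) m n l (e : R) : 0 < e ->
  rot_length m n (liouville1 f) (liouville2 f) l ->
  exists2 d, 0 < d & forall (f' : liouville_pair R) l',
    near2 (liouville1 f') (liouville1 f) d -> near2 (liouville2 f') (liouville2 f) d ->
    rot_length m n (liouville1 f') (liouville2 f') l' -> `|l' - l| < e.
Proof.
move=> e0 [al [be D]].
have [K1 cK1] := circle_C2per (liouville1 f).
have [K2 cK2] := circle_C2per (liouville2 f).
have [a a0 lo] := liouville_lower f.
pose S := m%:R * tau (liouville1 f) al.
have S0 : 0 <= S.
  by have [_ f0 _ _ _] := D; rewrite mulr_ge0// ltW// (tau_gt0 cK1 f0).
have l0 : 0 <= l.
  have [_ f0 g0 _ ->] := D.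
  by rewrite addr_ge0// mulr_ge0// ltW// ?(act_gt0 cK1 f0) ?(act_gt0 cK2 g0).
pose B := (l + e) / (a / 2).
have B0 : 0 <= B by rewrite divr_ge0//; lra.
pose d := Num.min (a / 4) (e / (S + B + 1)).
have SB : 0 < S + B + 1 by lra.
have d0 : 0 < d by rewrite lt_min !divr_gt0.
have da : d <= a / 4 by rewrite ge_min lexx.
have dS : d * (S + B + 1) <= e by rewrite -ler_pdivlMr// ge_min lexx orbT.
exists d => // f' l' n1 n2 [al' [be' D']].
have c1 := C2per_near n1 cK1; have c2 := C2per_near n2 cK2.
have dist (u v w : R) : `|u - v| < w -> u - v <= w /\ v - u <= w.
  by rewrite ltr_norml => /andP[? ?]; lra.
have h1 : l' <= l + S * d.
  apply: (rot_le cK1 cK2 c1 c2 D D') => x.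
    by have [] := dist _ _ _ (n1 0%N isT x).
  by have [] := dist _ _ _ (n2 0%N isT x).
have lo' := near2_lower lo n1 n2.
have lo2 x y : a / 2 <= 1 + liouville1 f' x + liouville2 f' y by have := lo' x y; lra.
pose S' := m%:R * tau (liouville1 f') al'.
have h2 : l <= l' + S' * d.
  apply: (rot_le c1 c2 cK1 cK2 D' D) => x.
    by have [] := dist _ _ _ (n1 0%N isT x).
  by have [] := dist _ _ _ (n2 0%N isT x).
have t1 := rot_time c1 c2 D' lo2; rewrite -/S' in t1.
have Sd : S * d <= e - d * (B + 1) by lra.
have dB : 0 < d * (B + 1) by rewrite mulr_gt0//; lra.
have S'B : S' <= B by rewrite /B ler_pdivlMr ?divr_gt0// mulrC; lra.
have S'd : S' * d <= B * d by rewrite ler_wpM2r// ltW.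
have Sd0 : 0 <= S * d by rewrite mulr_ge0// ltW.
by rewrite ltr_norml; apply/andP; split; lra.
Qed.

Lemma nbhs_near2 (f : liouville_pair R) (d : R) : 0 < d ->
  nbhs f [set f' | near2 (liouville1 f') (liouville1 f) d /\
                   near2 (liouville2 f') (liouville2 f) d].
Proof.
move=> d0.
have N (g : circle_cinfty R) : nbhs g [set g' | near2 g' g d].
  have FF : Filter (nbhs g) := nbhs_filter g.
  have H := @filterI _ _ FF _ _ (nbhs_circle g 0 d0)
    (@filterI _ _ FF _ _ (nbhs_circle g 1 d0) (nbhs_circle g 2 d0)).
  by apply: (@filterS _ _ FF _ _ _ H) => g' [h0 [h1 h2]]; case=> [|[|[|//]]] _.
have cv : continuous (@liouville_val R : liouville_pair R -> _) by exact: initial_continuous.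
suff : nbhs (liouville_val f) [set p | near2 p.1 (liouville1 f) d /\ near2 p.2 (liouville2 f) d].
  by move/(cv f).
exists ([set g' | near2 g' (liouville1 f) d], [set g' | near2 g' (liouville2 f) d]).
  by split; exact: N.
by move=> [p q] [].
Qed.

(** The torus persists with a nearby length, which still avoids the oscillating
spectrum by semicontinuity. *)
Lemma open_noncoincident : open (noncoincident_pairs R).
Proof.
rewrite openE => f /noncoincidentP[m [n [l [m0 n0 rl os]]]].
have [K1 cK1] := circle_C2per (liouville1 f).
have [K2 cK2] := circle_C2per (liouville2 f).
have l0 : 0 < l.
  have [al [be [_ f0 g0 _ ->]]] := rl.
  by rewrite addr_gt0// mulr_gt0 ?ltr0n// ?(act_gt0 cK1 f0) ?(act_gt0 cK2 g0).
have [d1 d10 H1] := @closed_orbit_semicont f (fun z1 z2 => z1 * z2 = 0) l l0 os.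
have [d2 d20 H2] := rot_semicont d10 rl.
have d0 : 0 < Num.min d1 d2 by rewrite lt_min d10.
have FF : Filter (nbhs f) := nbhs_filter f.
apply: (@filterS _ _ FF _ _ _ (nbhs_near2 f d0)) => f' [n1 n2].
have [K1' cK1'] := circle_C2per (liouville1 f').
have [K2' cK2'] := circle_C2per (liouville2 f').
have [l' rl'] := rot_exists m0 n0 cK1' cK2' (liouville_gt0 f').
apply/noncoincidentP; exists m, n, l'; split=> //.
have m1 : Num.min d1 d2 <= d1 by rewrite ge_min lexx.
have m2 : Num.min d1 d2 <= d2 by rewrite ge_min lexx orbT.
apply: (H1 f' l' (near2_le m1 n1) (near2_le m1 n2)).
exact: (H2 f' l' (near2_le m2 n1) (near2_le m2 n2) rl').
Qed.

End Perturbation.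

(** * Perturbations invisible to oscillating orbits *)

Section Confinement.
Context {R : realType}.
Implicit Types (f g h : circle_cinfty R).

Lemma deriv_lt0 (F w : R -> R) (a b : R) : deriv F w -> continuous w -> a < b ->
  (forall x, a <= x <= b -> 0 <= w x) -> 0 < w a -> F a < F b.
Proof.
move=> dF cw ab w0 wa.
have [e e0 He] : exists2 e : R, 0 < e & forall x, a <= x <= a + e -> 0 < w x.
  have /cvgrPdist_lt /(_ _ wa) := cw a.
  rewrite -filter_from_ballE /= => -[e /= e0 He].
  exists (e / 2); first by rewrite divr_gt0.
  move=> x xe; have /He : ball a e x.
    by rewrite /ball /= distrC ger0_norm; lra.
  by move=> /=; have := ler_norm (w a - w x); lra.
pose d := Num.min e (b - a).
have d0 : 0 < d by rewrite lt_min e0 subr_gt0.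
have de : d <= e /\ d <= b - a by rewrite /d !ge_min !lexx orbT.
apply: (@lt_le_trans _ _ (F (a + d))).
  apply: (deriv_sincr _ dF) => [|x xd]; first lra.
  by apply: He; lra.
by apply: (deriv_incr _ dF) => [|x xd]; [lra|apply: w0; lra].
Qed.

Lemma deriv_sign (F F' : R -> R) (y : R) : deriv F F' -> F y = 0 -> 0 < F' y ->
  exists2 r, 0 < r & forall x, `|x - y| <= r -> x != y -> 0 < F x * (x - y).
Proof.
move=> dF Fy D0; set D := F' y in D0.
have [dd dE] := dF y.
have c : (fun h : R => h^-1 *: ((F \o shift y) (h *: (1:R)) - F y)) @ 0^' --> D.
  by rewrite /D -dE; exact: dd.
have /cvgrPdist_lt /(_ _ D0) /nbhs_ballP[e /= e0 He] := c.
have e2 : 0 < e / 2 by rewrite divr_gt0.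
exists (e / 2) => // x xe xy.
have xyn : x - y != 0 by rewrite subr_eq0.
have bl : ball (0:R) e (x - y).
  by rewrite /ball /= sub0r normrN (le_lt_trans xe)// ltr_pdivrMr// mulr2n mulrDr mulr1 ltrDl.
have := He _ bl xyn.
rewrite /= [(x - y) *: (1:R)]mulr1 subrK Fy subr0 => H.
have pos : 0 < (x - y)^-1 * F x.
  have := le_lt_trans (ler_norm _) H; rewrite ltrBlDr -ltrBlDl subrr; exact.
have : 0 < (x - y)^-1 * F x * (x - y) ^+ 2.
  by rewrite mulr_gt0// exprn_even_gt0.
suff -> : (x - y)^-1 * F x * (x - y) ^+ 2 = F x * (x - y) by [].
by field.
Qed.

Lemma int_norm_lt1 (m : int) : `|m%:~R| < 1 :> R -> m = 0.
Proof. rewrite -intr_norm -[X in _ < X]/(1%:~R) ltr_int; lia. Qed.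

(** An orbit oscillating in the potential [g + s h] for a time at most [B] cannot visit
the support of [h] placed next to the nondegenerate minimum [y] of [g]: near [y] the
force pushes towards increasing distance from [y], so such an orbit would have to
leave slowly, while the turning point needed to come back lies further than [B]
allows. *)
Lemma confine g (y r K B : R) : C2per g K -> 0 < r -> r < 2^-1 ->
  (forall x, g y <= g x) ->
  (forall x, `|x - y| <= r -> x != y -> 0 < derive1 g x * (x - y)) ->
  exists2 d, 0 < d <= r & forall (c e : R) h, y < c - e -> c + e < y + d -> 0 < e ->
    (forall x, 0 <= h x) ->
    (forall x, 0 < h x -> exists m : int, `|x - c - m%:~R| < e) ->
    exists2 s0, 0 < s0 & forall s, 0 <= s <= s0 ->
    forall (x p : R -> R) S, newton (circle_add g h s) x p -> 0 < S -> S <= B ->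
    x S = x 0 -> p S = p 0 -> forall t, h (x t) = 0.
Proof.
move=> cg r0 r2 ymin gy.
have K0 := C2K cg.
pose M := (K + 3) * expR ((K + 3) * B).
have M0 : 0 <= M by rewrite mulr_ge0 ?expR_ge0//; lra.
have M1 : 0 < M + 1 by lra.
pose d := r / (M + 1).
have d0 : 0 < d by rewrite divr_gt0.
have dr : d <= r by rewrite ler_pdivrMr// ler_peMr ?(ltW r0)//; lra.
have Md : M * d ^+ 2 < r ^+ 2.
  rewrite /d expr_div_n mulrA ltr_pdivrMr ?exprn_gt0// mulrC.
  rewrite ltr_pM2l ?exprn_gt0//; nra.
exists d; first by rewrite d0.
move=> c e h yc cd e0 h0 hsupp.
have [Kh ch] := circle_C2per h.
have Kh0 := C2K ch.
have ce : c - e <= c + e by lra.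
have [x0 + x0m] := @EVT_min R (derive1 g) (c - e) (c + e) ce (continuous_subspaceT (deriv_cont (C2d2 cg))).
rewrite in_itv /= => x0I.
have c00 : 0 < derive1 g x0.
  have := gy x0; rewrite ler_norml => H.
  have : 0 < derive1 g x0 * (x0 - y) by apply: H; [lra|rewrite gt_eqF//; lra].
  by rewrite pmulr_lgt0//; lra.
pose s0 := Num.min (Kh + 1)^-1 (derive1 g x0 / (2 * (Kh + 1))).
have Kh1 : 0 < Kh + 1 by lra.
have s00 : 0 < s0 by rewrite lt_min invr_gt0 Kh1 divr_gt0// mulr_gt0.
exists s0 => // s /andP[sp ss0] x p S n S0 SB xS pS t.
have sK : s * (Kh + 1) <= 1.
  by rewrite -ler_pdivlMr// div1r (le_trans ss0)// ge_min lexx.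
have sc : s * (2 * (Kh + 1)) <= derive1 g x0.
  by rewrite -ler_pdivlMr ?mulr_gt0// (le_trans ss0)// ge_min lexx orbT.
pose G := circle_add g h s.
have GE u : G u = g u + s * h u by [].
have dGE u : derive1 G u = derive1 g u + s * derive1 h u.
  by have := derive1n_addZ g h s 1; rewrite !derive1n1 => ->.
have cG : C2per G (K + 1).
  have sb (u : R) : `|u| <= Kh -> `|s * u| <= 1.
    move=> uK; rewrite normrM (ger0_norm sp).
    by have := ler_wpM2l sp uK; lra.
  have B1 (u v : R) : `|u| <= K -> `|v| <= Kh -> `|u + s * v| <= K + 1 :> R.
    by move=> uK vK; have := ler_normD u (s * v); have := sb v vK; lra.
  split.
  - exact: circle_deriv G 0.
  - exact: circle_deriv G 1.
  - exact: circle_periodic G 0.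
  - lra.
  - by move=> u; rewrite GE; apply: B1; [exact: C2b0 cg u|exact: C2b0 ch u].
  - by move=> u; rewrite dGE; apply: B1; [exact: C2b1 cg u|exact: C2b1 ch u].
  - move=> u; have := derive1n_addZ g h s 2; rewrite !derive1nS !derive1n0 => ->.
    by apply: B1; [exact: C2b2 cg u|exact: C2b2 ch u].
(* the only part of the support of h near y is the one around c *)
have supp u : `|u - y| <= r -> 0 < h u -> `|u - c| < e.
  move=> uy /hsupp[m um]; suff m0 : m = 0 by rewrite m0 subr0 in um.
  have : `|m%:~R| < 1 :> R.
    move: um uy; rewrite ltr_norml ler_norml => /andP[? ?] /andP[? ?].
    rewrite ltr_norml; apply/andP; split; lra.
  exact: int_norm_lt1.
have hy : h y = 0.
  apply/eqP; rewrite eq_le h0 andbT leNgt; apply/negP => hy.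
  have := supp y; rewrite subrr normr0 (ltW r0) => /(_ isT hy).
  rewrite ltr_norml; lra.
have Gsign u : `|u - y| <= r -> u != y -> 0 < derive1 G u * (u - y).
  move=> uy uny; have [hu|hu] := leP (h u) 0.
    have hu0 : h u = 0 by apply/eqP; rewrite eq_le hu h0.
    have dh : derive1 h u = 0.
      by apply: (derive1_min0 (C2d1 ch)) => v; rewrite hu0.
    by rewrite dGE dh mulr0 addr0; exact: gy.
  have := supp u uy hu; rewrite ltr_norml => uc.
  have cu : derive1 g x0 <= derive1 g u by apply: x0m; rewrite in_itv /=; lra.
  have /andP[b1 b2] : - Kh <= derive1 h u <= Kh by rewrite -ler_norml; exact: C2b1 ch u.
  have sb := ler_wpM2l sp b1.
  by rewrite dGE mulr_gt0//; lra.
have Gmin u : G y <= G u.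
  rewrite !GE hy mulr0 addr0 (le_trans (ymin u))// lerDl mulr_ge0//.
have dGy : derive1 G y = 0 by apply: (derive1_min0 (C2d1 cG)).
apply/eqP; rewrite eq_le h0 andbT leNgt; apply/negP => ht.
have [m um] := hsupp _ ht.
have xS0 : x S = x 0 + 0%:~R by rewrite addr0.
pose X u := x (u + t) + (- m)%:~R; pose P u := p (u + t).
have nX : newton G X P by exact: newton_translate (C2per0 cG) (newton_shift t n).
have XS : X S = X 0.
  have [E _] := newton_periodic cG n xS0 pS t.
  by rewrite /X add0r addrC [S + t]addrC E addr0 addrC.
have PS : P S = P 0.
  have [_ E] := newton_periodic cG n xS0 pS t.
  by rewrite /P add0r [S + t]addrC E.
have X0E : X 0 = x t - m%:~R by rewrite /X add0r intrN.
have X0c : `|X 0 - c| < e by rewrite X0E (_ : x t - m%:~R - c = x t - c - m%:~R) //; ring.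
rewrite ltr_norml in X0c.
have [t1 Pt1] := rolle_newton S0 nX.1 XS.
have en := newton_energy (C2d1 cG) nX t1; have z2 : (0:R) ^+ 2 = 0 by rewrite expr0n.
rewrite Pt1 z2 in en.
have K10 : 0 <= K + 1 by lra.
have tay : G (X 0) - G y <= (K + 1) * (X 0 - y) ^+ 2.
  have := @deriv_taylor R G (derive1 G) (K + 1) y (X 0 - y) K10 (C2d1 cG) (fun w _ => lip_derive1 w y cG).
  by rewrite (addrC y) subrK dGy mulr0 subr0 => /(le_trans (ler_norm _)).
have P0 : P 0 ^+ 2 <= (K + 1) * (X 0 - y) ^+ 2 by have := Gmin (X t1); lra.
have Xd : (X 0 - y) ^+ 2 <= d ^+ 2.
  by rewrite ler_pXn2r ?nnegrE//; lra.
have near u : 0 <= u <= S -> `|X u - y| <= r.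
  move=> /andP[u0 uS].
  have := newton_close cG u0 nX (newton_const dGy); rewrite subr0 => le.
  have ex : expR ((K + 1 + 2) * u) <= expR ((K + 3) * B).
    by rewrite ler_expR (_ : K + 1 + 2 = K + 3); [rewrite ler_wpM2l//; lra|ring].
  have D0 : 0 <= (X 0 - y) ^+ 2 + (P 0 - 0) ^+ 2 by rewrite addr_ge0 ?sqr_ge0.
  have h1 := ler_wpM2l D0 ex.
  have h2 : ((X 0 - y) ^+ 2 + (P 0 - 0) ^+ 2) * expR ((K + 3) * B) <=
      (K + 3) * d ^+ 2 * expR ((K + 3) * B).
    rewrite ler_wpM2r ?expR_ge0// subr0.
    have := ler_wpM2l K10 Xd; have := sqr_ge0 d; lra.
  have h3 : (K + 3) * d ^+ 2 * expR ((K + 3) * B) = M * d ^+ 2 by rewrite /M; ring.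
  rewrite -(@ler_pXn2r _ 2%N) ?nnegrE ?(ltW r0)// real_normK ?num_real//.
  have := sqr_ge0 (P u); lra.
pose F u := (X u - y) * P u.
have dF : deriv F (fun u => P u * P u + (X u - y) * (derive1 G (X u) / 2)).
  by apply: (deriv_ext (derivM (derivB nX.1 (derivC y)) nX.2)) => // u; rewrite subr0.
suff : F 0 < F S by rewrite /F XS PS ltxx.
have cX := deriv_cont nX.1; have cP := deriv_cont nX.2.
apply: (deriv_lt0 dF) => //.
- apply: contD; first exact: contM.
  apply: contM; first by move=> u; apply: cvgB; [exact: cX|exact: cvg_cst].
  move=> u; apply: cvgM; last exact: cvg_cst.
  by apply: (@continuous_comp _ _ _ X (derive1 G)); [exact: cX|exact: deriv_cont (C2d2 cG) _].
- move=> u /near Xu; have sq := sqr_ge0 (P u); rewrite expr2 in sq.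
  have -> : (X u - y) * (derive1 G (X u) / 2) = derive1 G (X u) * (X u - y) / 2 by ring.
  have [->|ne] := eqVneq (X u) y; first by rewrite subrr mulr0 mul0r addr0.
  by have := Gsign _ Xu ne; lra.
- have X0n : X 0 != y by rewrite gt_eqF//; lra.
  have H : 0 < derive1 G (X 0) * (X 0 - y).
    by apply: Gsign => //; rewrite ler_norml; apply/andP; split; lra.
  have -> : (X 0 - y) * (derive1 G (X 0) / 2) = derive1 G (X 0) * (X 0 - y) / 2 by ring.
  have := sqr_ge0 (P 0); rewrite expr2; lra.
Qed.

(** The two variables play the same role. *)
Lemma closed_orbit_swap (F G : R -> R) z1 z2 l : closed_orbit F G z1 z2 l ->
  closed_orbit G F z2 z1 l.
Proof.
move=> [S [x1 [p1 [x2 [p2 [t [S0 [n1 n2 en dt] X1 X2 E]]]]]]].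
exists S, x2, p2, x1, p1, t; split=> //; split=> //.
  by move=> s; rewrite addrC en; ring.
by apply: (deriv_ext dt) => // s; ring.
Qed.

(** Place the bump between the minimum and the edge of the region of confinement. *)
Lemma step_bump g K : C2per g K -> forall (B : R), 
  (exists y, (forall x, g y <= g x) /\ 0 < derive1 (derive1 g) y) ->
  exists h, [/\ forall x, 0 <= h x, exists x0, 0 < h x0 &
    exists2 s0, 0 < s0 & forall s, 0 <= s <= s0 ->
    forall (x p : R -> R) S, newton (circle_add g h s) x p -> 0 < S -> S <= B ->
    x S = x 0 -> p S = p 0 -> forall t, h (x t) = 0].
Proof.
move=> cg B [y [ymin y2]].
set D := derive1 (derive1 g) y in y2.
have gy0 := derive1_min0 (C2d1 cg) ymin.
have [r1 r10 gr] := deriv_sign (C2d2 cg) gy0 y2.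
pose r := Num.min r1 4^-1.
have r0 : 0 < r by rewrite lt_min r10 invr_gt0 ltr0n.
have rr1 : r <= r1 by rewrite ge_min lexx.
have r4 : r <= 4^-1 by rewrite ge_min lexx orbT.
have r2 : r < 2^-1 by lra.
have gr' x : `|x - y| <= r -> x != y -> 0 < derive1 g x * (x - y).
  by move=> xr; apply: gr; exact: le_trans rr1.
have [d /andP[d0 dr] conf] := @confine g y r K B cg r0 r2 ymin gr'.
have dI : 0 < d / 4 < 2^-1 by apply/andP; split; lra.
have [h [h0 hc hs]] := bump_exists (y + d / 2) dI.
exists h; split=> //; first by exists (y + d / 2).
by apply: (conf (y + d / 2) (d / 4)) => //; lra.
Qed.

End Confinement.

(** * Density *)

Section Dense.
Context {R : realType}.
Implicit Types (f g h : circle_cinfty R).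

(** The potential [h] is invisible to all closed orbits of bounded period. *)
Definition avoids g h (s0 B : R) := forall s, 0 <= s <= s0 ->
  forall (x p : R -> R) S, newton (circle_add g h s) x p -> 0 < S -> S <= B ->
    x S = x 0 -> p S = p 0 -> forall t, h (x t) = 0.

(** An orbit which does not see [h] is an orbit of the unperturbed metric. *)
Lemma avoid_closed_orbit f g h (s0 B a s l : R) z1 : avoids g h s0 B -> 0 <= s <= s0 ->
  (forall x, 0 <= h x) -> 0 < a -> (forall u v : R, a <= 1 + f u + g v) ->
  l <= a * B ->
  closed_orbit f (circle_add g h s) z1 0 l -> closed_orbit f g z1 0 l.
Proof.
move=> av ss h0 a0 lo lB [S [x1 [p1 [x2 [p2 [t [S0 [n1 n2 en dt] X1 [X2 P2] lE]]]]]]].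
have sp : 0 <= s by case/andP: ss.
have dl : deriv (fun s : R => a * s) (fun=> a).
  by apply: (deriv_ext (derivZ a derivX)) => // u; rewrite mulr1.
have SB : S <= B.
  rewrite -(ler_pM2l a0); apply: le_trans lB; rewrite lE.
  have := deriv_le (ltW S0) dl dt; rewrite mulr0 subr0; apply=> u _ /=.
  by have := lo (x1 u) (x2 u); have := mulr_ge0 sp (h0 (x2 u)); lra.
rewrite addr0 in X2.
have hx := av s ss x2 p2 S n2 S0 SB X2 P2.
have [Kh ch] := circle_C2per h.
have dh u : derive1 h (x2 u) = 0.
  by apply: (derive1_min0 (C2d1 ch)) => v; rewrite hx.
exists S, x1, p1, x2, p2, t; split=> //; last by rewrite addr0.
split=> //.
- split; first exact: n2.1.
  apply: (deriv_ext n2.2) => // u; congr (_ / 2).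
  by have := derive1n_addZ g h s 1; rewrite !derive1n1 => ->; rewrite dh mulr0 addr0.
- by move=> u; rewrite en /= hx mulr0 addr0.
- by apply: (deriv_ext dt) => // u /=; rewrite hx mulr0 addr0.
Qed.

(** Adding [s h] moves the rotation length continuously and strictly, whereas the
oscillating lengths in one direction do not move; so the rotation length can be
pushed into a gap of the latter. *)
Lemma step f g h Kf Kg (a B l0 s0 s1 : R) : C2per f Kf -> C2per g Kg -> 0 < a ->
  (forall u v : R, a <= 1 + f u + g v) -> rot_length 1 1 f g l0 -> l0 + 1 <= a * B ->
  (forall x, 0 <= h x) -> (exists x0, 0 < h x0) -> 0 < s0 -> avoids g h s0 B -> 0 < s1 ->
  exists s l, [/\ 0 <= s <= s1, rot_length 1 1 f (circle_add g h s) l, l <= l0 + 1 &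
    forall z1, ~ closed_orbit f (circle_add g h s) z1 0 l].
Proof.
move=> cf cg a0 lo rl lB h0 [x0 hx0] s00 av s10.
pose sb := Num.min s0 s1.
have sb0 : 0 < sb by rewrite lt_min s00.
have sbs0 : sb <= s0 by rewrite ge_min lexx.
have sbs1 : sb <= s1 by rewrite ge_min lexx orbT.
have lo' s u v : 0 <= s -> a <= 1 + f u + circle_add g h s v.
  by move=> sp; have := lo u v; have := mulr_ge0 sp (h0 v); rewrite /=; lra.
have /choice[lf lfP] : forall s, exists l, 0 <= s -> rot_length 1 1 f (circle_add g h s) l.
  move=> s; have [sp|sn] := leP 0 s; last by exists 0 => sp; lra.
  have [Ks cs] := circle_C2per (circle_add g h s).
  have [l lP] := rot_exists (ltn0Sn 0) (ltn0Sn 0) cf cs (fun u v => lt_le_trans a0 (lo' s u v sp)).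
  by exists l.
have lf0 : lf 0 = l0.
  have := lfP 0 (lexx 0).
  have -> : (circle_add g h 0 : R -> R) = g by apply/funext => x; rewrite /= mul0r addr0.
  by move=> rl'; exact: rot_unique cf cg rl' rl.
have lflt s s' : 0 <= s -> s < s' -> lf s < lf s'.
  move=> sp ss; have s'p : 0 <= s' by exact: le_trans sp (ltW ss).
  have [Ks cs] := circle_C2per (circle_add g h s).
  have [Ks' cs'] := circle_C2per (circle_add g h s').
  apply: (@rot_length_lt _ 1 1 f (circle_add g h s) (circle_add g h s') _ _ _ _ _ x0 _ cf cs cs' (lfP s sp) (lfP s' s'p)) => //.
    by move=> x /=; rewrite lerD2l; apply: ler_wpM2r; [exact: h0|exact: ltW].
  by rewrite /= ltrD2l ltr_pM2r.
have [Kh ch] := circle_C2per h.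
have Kh0 := C2K ch.
have lip1 s s' : 0 <= s <= sb -> 0 <= s' <= sb -> lf s' <= lf s + lf sb / a * Kh * `|s - s'|.
  move=> /andP[sp ssb] /andP[s'p s'sb].
  have [Ks cs] := circle_C2per (circle_add g h s).
  have [Ks' cs'] := circle_C2per (circle_add g h s').
  have [al [be D]] := lfP s sp; have [al' [be' D']] := lfP s' s'p.
  have t1 := rot_time cf cs D (fun u v => lo' s u v sp).
  have lsb : lf s <= lf sb by move: ssb; rewrite le_eqVlt => /predU1P[->//|/(lflt _ _ sp)/ltW].
  have d0 : 0 <= Kh * `|s - s'| by rewrite mulr_ge0.
  have := rot_le cf cs cf cs' D D' (d := Kh * `|s - s'|).
  have h1 : forall x, f x - f x <= Kh * `|s - s'| by move=> x; rewrite subrr.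
  have h2 : forall x, circle_add g h s' x - circle_add g h s x <= Kh * `|s - s'|.
    move=> x /=; apply: (le_trans (ler_norm _)).
    rewrite (_ : _ - _ = (s' - s) * h x); last by ring.
    by rewrite normrM distrC mulrC; apply: ler_wpM2r; [exact: normr_ge0|exact: C2b0 ch x].
  move=> /(_ h1 h2) /le_trans; apply; rewrite lerD2l -(mulrA _ Kh); apply: ler_wpM2r => //.
  by rewrite ler_pdivlMr// mulrC (le_trans t1).
pose v := Num.min (lf sb) (l0 + 1).
have l0v : l0 < v by rewrite lt_min -{1}lf0 lflt//= ltrDl.
have cf' : C2per f (Kf + Kg) by apply: C2per_le cf; rewrite lerDl (C2K cg).
have cg' : C2per g (Kf + Kg) by apply: C2per_le cg; rewrite lerDr (C2K cf).
have [l [/andP[l1 l2] nol]] := osc_gap cf' cg' a0 lo l0v.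
have lsb : l <= lf sb by rewrite (le_trans l2)// ge_min lexx.
have ll0 : l <= l0 + 1 by rewrite (le_trans l2)// ge_min lexx orbT.
have [||s ssb E] := @lip_ivt R (fun s => l - lf s) 0 sb (lf sb / a * Kh) (ltW sb0).
- move=> s s' sI s'I.
  have h1 := lip1 s s' sI s'I; have h2 := lip1 s' s s'I sI; rewrite distrC in h2.
  move: h1 h2; rewrite ler_norml; set Z := _ * `|_|; move: Z => Z h1 h2.
  by apply/andP; split; lra.
- by rewrite lf0 subr_le0 subr_ge0 lsb.
have /andP[sp ss] := ssb.
have lE : lf s = l by move/eqP: E; rewrite subr_eq0 => /eqP.
exists s, l; split=> //.
- by rewrite sp (le_trans ss).
- by rewrite -lE; exact: lfP.
- move=> z1 co; apply: (nol z1).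
  apply: (avoid_closed_orbit av _ h0 a0 lo _ co); last by apply: le_trans lB.
  by rewrite sp (le_trans ss).
Qed.

Lemma second_derive_min g (K y : R) : C2per g K -> (forall x, g y <= g x) ->
  0 <= derive1 (derive1 g) y.
Proof.
move=> cg ym; rewrite leNgt; apply/negP => D0.
have gy0 := derive1_min0 (C2d1 cg) ym.
have dN := derivN (C2d2 cg).
have [||r r0 neg] := deriv_sign (y := y) dN; first by rewrite gy0 oppr0.
  by rewrite oppr_gt0.
have yr : y < y + r by rewrite ltrDl.
have neg' x : y < x <= y + r -> derive1 g x < 0.
  move=> /andP[x1 x2].
  have xy : x != y by rewrite gt_eqF.
  have xr : `|x - y| <= r by rewrite ger0_norm ?subr_ge0 ?(ltW x1)// lerBlDl.
  by have := neg x xr xy; rewrite mulNr oppr_gt0 pmulr_llt0// subr_gt0.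
have yh : y + r / 2 < y + r by rewrite ltrD2l ltr_pdivrMr// mulr2n mulrDr mulr1 ltrDl.
have yh0 : y < y + r / 2 by rewrite ltrDl divr_gt0.
have lt1 : - g (y + r / 2) < - g (y + r).
  apply: (deriv_sincr yh (derivN (C2d1 cg))) => x /andP[x1 x2].
  by rewrite oppr_gt0; apply: neg'; rewrite x2 (lt_le_trans yh0).
have le1 : - g y <= - g (y + r / 2).
  apply: (deriv_incr (ltW yh0) (derivN (C2d1 cg))) => x /andP[x1 x2].
  have [->|xy] := eqVneq x y; first by rewrite gy0 oppr0.
  rewrite oppr_ge0 ltW//; apply: neg'; rewrite lt_neqAle eq_sym xy x1 /=.
  exact: le_trans x2 (ltW yh).
by have := ym (y + r); lra.
Qed.

(** Add a small multiple of [1 - cos] at the minimum. *)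
Lemma nondeg_min_add g K : C2per g K ->
  exists h, (forall x, 0 <= h x) /\ exists y, forall s, 0 < s ->
    (forall x, circle_add g h s y <= circle_add g h s x) /\
    0 < derive1 (derive1 (circle_add g h s)) y.
Proof.
move=> cg.
have [y ym] := periodic_min (deriv_cont (C2d1 cg)) (C2per0 cg).
have th := trigflat_circle (tf_add (tf_cst y 0 1) (tf_mul (tf_cst y 0 (-1)) (tf_cos y 0))).
pose h := CircleCinfty th.
have hE x : h x = 1 - cos (2 * pi * (x - y)) by rewrite /= mulN1r.
exists h; split; first by move=> x; rewrite hE subr_ge0 cos_le1.
exists y => s s0.
have hy : h y = 0 by rewrite hE subrr mulr0 cos0 subrr.
have h0 x : 0 <= h x by rewrite hE subr_ge0 cos_le1.
have Gm x : circle_add g h s y <= circle_add g h s x.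
  change (g y + s * h y <= g x + s * h x).
  by rewrite hy mulr0 addr0 (le_trans (ym x))// lerDl mulr_ge0// ltW.
split=> //.
have := derive1n_addZ g h s 2; rewrite !derive1nS !derive1n0 => ->.
have d1 : derive1 h = (fun x => (2 * pi) * sin (2 * pi * (x - y))).
  apply: derive1_eq.
  apply: (deriv_ext (derivD (derivC 1) (derivZ (-1) (deriv_cos2pi y)))) => // x.
  by rewrite add0r; ring.
have d2 : derive1 (derive1 h) y = (2 * pi) ^+ 2.
  rewrite d1 (derive1_eq (derivZ (2 * pi) (deriv_sin2pi y))) subrr mulr0 cos0; ring.
have d20 : 0 < s * (2 * pi) ^+ 2 by rewrite mulr_gt0// exprn_gt0// mulr_gt0// pi_gt0.
by rewrite d2 ltr_wpDl// (second_derive_min cg).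
Qed.

(** Make both minima nondegenerate, then push the rotation length into a gap of the
oscillating spectrum of each direction in turn; the second push is so small that the
first avoidance survives by semicontinuity. *)
Lemma dense_noncoincident : dense (noncoincident_pairs R).
Proof.
move=> O [f0 Of0] oO.
have [k1 ck1] := circle_C2per (liouville1 f0).
have [k2 ck2] := circle_C2per (liouville2 f0).
have [u1 [u10 [y1 uy1]]] := nondeg_min_add ck1.
have [u2 [u20 [y2 uy2]]] := nondeg_min_add ck2.
have [d0 d00 Od0] := open_perturb u10 u20 oO Of0.
pose f := pair_add f0 u10 u20 (d0 / 2) (d0 / 2).
have half (w : R) : 0 < w -> 0 < w / 2 /\ w / 2 < w.
  by move=> w0; split; [rewrite divr_gt0|rewrite ltr_pdivrMr// mulr2n mulrDr mulr1 ltrDl].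
have [d0h d0h'] := half _ d00.
have Of : O f by apply: Od0; rewrite (ltW d0h).
have mx : 0 < Num.max 0 (d0 / 2) by rewrite lt_max d0h orbT.
have m1 := uy1 _ mx; have m2 := uy2 _ mx.
have [K1 cK1] := circle_C2per (liouville1 f).
have [K2 cK2] := circle_C2per (liouville2 f).
have [a a0 lo] := liouville_lower f.
have [l0 rl0] := rot_exists (ltn0Sn 0) (ltn0Sn 0) cK1 cK2 (liouville_gt0 f).
pose B := (l0 + 2) / a.
have aB : a * B = l0 + 2 by rewrite /B mulrC divfK// gt_eqF.
have E1 : liouville1 f = circle_add (liouville1 f0) u1 (Num.max 0 (d0 / 2)) by [].
have [|h1 [h10 h1p [s1 s10 av1]]] := step_bump cK1 B.
  by exists y1; rewrite E1; exact: m1.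
have E2 : liouville2 f = circle_add (liouville2 f0) u2 (Num.max 0 (d0 / 2)) by [].
have [|h2 [h20 h2p [s2 s20 av2]]] := step_bump cK2 B.
  by exists y2; rewrite E2; exact: m2.
have [d d_gt0 Od] := open_perturb h10 h20 oO Of.
have [d2 d2'] := half _ d_gt0.
have lB0 : l0 + 1 <= a * B by rewrite aB lerD2l ler1n.
have [t [l [/andP[t0 td] rl ll nol]]] :=
  step cK1 cK2 a0 lo rl0 lB0 h20 h2p s20 av2 d2.
pose fb := pair_add f h10 h20 0 t.
have fb1 : (liouville1 fb : R -> R) = liouville1 f.
  by apply/funext => x; rewrite /= maxxx mul0r addr0.
have fb2 : liouville2 fb = circle_add (liouville2 f) h2 t by rewrite -[in RHS](max_r t0).
have [Kb cKb] := circle_C2per (liouville2 fb).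
have rlb : rot_length 1 1 (liouville1 fb) (liouville2 fb) l by rewrite fb1 fb2.
have l_gt0 : 0 < l.
  have [al [be [_ p1 p2 _ ->]]] := rlb; rewrite fb1 in p1 *.
  by rewrite addr_gt0// mul1r ?(act_gt0 cK1 p1) ?(act_gt0 cKb p2).
have no1 : ~ (exists z1 z2 : int, z2 = 0 /\ closed_orbit (liouville1 fb) (liouville2 fb) z1 z2 l).
  by move=> [z1 [z2 [->]]]; rewrite fb1 fb2; exact: nol.
have [e1 e10 H1] := @closed_orbit_semicont R fb (fun _ z2 => z2 = 0) l l_gt0 no1.
have [e2 e20 H2] := rot_semicont e10 rlb.
pose e := Num.min e1 e2.
have e_gt0 : 0 < e by rewrite lt_min e10.
have [Kh ch] := circle_C2per h1.
have Kh0 := C2K ch.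
have Kh2 : 0 < 2 * (Kh + 1) by rewrite mulr_gt0// ltr_wpDl.
(* small enough for the avoidance obtained for fb to persist *)
pose s' := Num.min (d / 2) (e / (2 * (Kh + 1))).
have s'0 : 0 < s' by rewrite lt_min d2 divr_gt0.
have s'd : s' <= d / 2 by rewrite ge_min lexx.
have s'e : s' * (2 * (Kh + 1)) <= e by rewrite -ler_pdivlMr// ge_min lexx orbT.
have lo21 u v : a <= 1 + liouville2 fb u + liouville1 f v.
  rewrite fb2; have -> : 1 + circle_add (liouville2 f) h2 t u + liouville1 f v =
    1 + liouville1 f v + liouville2 f u + t * h2 u by rewrite /=; ring.
  by rewrite (le_trans (lo v u))// lerDl mulr_ge0.
have rl21 : rot_length 1 1 (liouville2 fb) (liouville1 f) l.
  by rewrite fb2; exact: rot_length_swap.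
have lB1 : l + 1 <= a * B by rewrite aB; lra.
have [s [l' [/andP[s_ge0 ss'] rl' ll' nol']]] :=
  step cKb cK1 a0 lo21 rl21 lB1 h10 h1p s10 av1 s'0.
pose fs := pair_add f h10 h20 s t.
have fs1 : liouville1 fs = circle_add (liouville1 f) h1 s by rewrite -[in RHS](max_r s_ge0).
have fs2 : liouville2 fs = liouville2 fb by [].
have rls : rot_length 1 1 (liouville1 fs) (liouville2 fs) l'.
  by rewrite fs1 fs2; exact: rot_length_swap.
exists fs; split.
  by apply: Od; rewrite ?s_ge0 ?t0 /=; [exact: le_lt_trans (le_trans ss' s'd) d2'|exact: le_lt_trans td d2'].
have n2 e' : 0 < e' -> near2 (liouville2 fs) (liouville2 fb) e'.
  by move=> e'0 k _ x; rewrite fs2 subrr normr0.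
have n1 : near2 (liouville1 fs) (liouville1 fb) e.
  move=> k k2' x; rewrite fb1 fs1 derive1n_addZ addrAC subrr add0r normrM (ger0_norm s_ge0).
  have hb : `|derive1n k h1 x| <= Kh.
    by move: k k2' => [|[|[|//]]] _; [exact: C2b0 ch x|exact: C2b1 ch x|exact: C2b2 ch x].
  apply: (le_lt_trans (ler_pM s_ge0 (normr_ge0 _) ss' hb)).
  apply: (lt_le_trans _ s'e); rewrite ltr_pM2l//; lra.
have ee1 : e <= e1 by rewrite ge_min lexx.
have ee2 : e <= e2 by rewrite ge_min lexx orbT.
have A := H1 fs l' (near2_le ee1 n1) (n2 _ e10)
  (H2 fs l' (near2_le ee2 n1) (n2 _ e20) rls).
apply/noncoincidentP; exists 1%N, 1%N, l'; split=> // -[z1 [z2 [zz co]]].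
have /orP[/eqP z10|/eqP z20] : (z1 == 0) || (z2 == 0) by rewrite -mulf_eq0 zz.
  apply: (nol' z2); rewrite -fs1; apply: closed_orbit_swap.
  by rewrite -z10 -fs2.
by apply: A; exists z1, z2.
Qed.

End Dense.

(** * Square-summable sequences and matrices *)

Section SquareSummable.
Context {R : realType}.
Implicit Types (a b c F G : nat -> R) (K : nat -> nat -> R).

(** Absolute summability, as boundedness of the partial sums. *)
Definition smb F := exists C, forall N, \sum_(i < N) `|F i| <= C.
(** The sum of a series; a junk value when it does not converge. *)
Definition tot F : R := limn (fun N => \sum_(i < N) F i).

Lemma tot_cvg F : smb F -> (fun N => \sum_(i < N) F i) @ \oo --> tot F.
Proof.
move=> [C hC].
have : cvgn (series F).
  apply: normed_cvg; apply: nondecreasing_is_cvgn.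
    by apply: (@nondecreasing_series _ _ xpredT 0%N) => n _ _; exact: normr_ge0.
  by exists C => _ [n _ <-]; apply: le_trans (hC n); rewrite -(big_mkord xpredT (fun i => `|F i|)).
by rewrite seriesEord.
Qed.

Lemma totE F l : (fun N => \sum_(i < N) F i) @ \oo --> l -> tot F = l.
Proof. exact: cvg_lim. Qed.

Lemma totD F G : smb F -> smb G -> tot (fun i => F i + G i) = tot F + tot G.
Proof.
move=> sF sG; apply: totE; under eq_fun do rewrite big_split.
by apply: cvgD; exact: tot_cvg.
Qed.

Lemma totZ t F : smb F -> tot (fun i => t * F i) = t * tot F.
Proof.
move=> sF; apply: totE; under eq_fun do rewrite -mulr_sumr.
by apply: cvgMr; exact: tot_cvg.
Qed.

Lemma smb_le F G : (forall i, `|F i| <= G i) -> smb G -> smb F.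
Proof.
move=> le [C hC]; exists C => N; apply: le_trans (hC N); apply: ler_sum => i _.
exact: le_trans (le i) (ler_norm _).
Qed.

Lemma smbD F G : smb F -> smb G -> smb (fun i => F i + G i).
Proof.
move=> [C hC] [D hD]; exists (C + D) => N; apply: le_trans (lerD (hC N) (hD N)).
by rewrite -big_split; apply: ler_sum => i _; exact: ler_normD.
Qed.

Lemma smbZ t F : smb F -> smb (fun i => t * F i).
Proof.
move=> [C hC]; exists (`|t| * C) => N; under eq_bigr do rewrite normrM.
by rewrite -mulr_sumr ler_wpM2l.
Qed.

Lemma tot_le_ub F C : smb F -> (forall N, \sum_(i < N) F i <= C) -> tot F <= C.
Proof. by move=> /tot_cvg h hC; apply: (cvgr_to_le h); apply: filterE. Qed.

Lemma psum_le_tot F N : smb F -> (forall i, 0 <= F i) -> \sum_(i < N) F i <= tot F.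
Proof.
move=> /tot_cvg h F0; apply: (cvgr_to_ge h).
near=> M; have NM : (N <= M)%N by near: M; exact: nbhs_infty_ge.
rewrite -(subnKC NM) big_split_ord/= lerDl; apply: sumr_ge0 => i _; exact: F0.
Unshelve. all: by end_near. Qed.

Lemma tot_ge0 F : smb F -> (forall i, 0 <= F i) -> 0 <= tot F.
Proof. by move=> s F0; have := psum_le_tot 0 s F0; rewrite big_ord0. Qed.

Definition l2 a := smb (fun i => a i * a i).
Definition ip a b := tot (fun i => a i * b i).
(** The only linear operation needed on sequences. *)
Definition axpy a t b := fun i : nat => a i + t * b i.

Lemma ip_smb a b : l2 a -> l2 b -> smb (fun i => a i * b i).
Proof.
move=> la lb; apply: (smb_le _ (smbD la lb)) => i.
by have := sqr_ge0 (a i - b i); have := sqr_ge0 (a i + b i); rewrite ler_norml; nra.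
Qed.

Lemma ip_cvg a b : l2 a -> l2 b -> (fun N => \sum_(i < N) a i * b i) @ \oo --> ip a b.
Proof. by move=> la lb; apply: tot_cvg; exact: ip_smb. Qed.

Lemma ipC a b : ip a b = ip b a.
Proof. by rewrite /ip; congr tot; apply/funext => i; rewrite mulrC. Qed.

Lemma l2_axpy a t b : l2 a -> l2 b -> l2 (axpy a t b).
Proof.
move=> la lb; apply: (smb_le _ (smbD (smbZ 2 la) (smbZ (2 * t ^+ 2) lb))) => i.
rewrite ger0_norm; last by rewrite -expr2 sqr_ge0.
by rewrite /axpy; have := sqr_ge0 (a i - t * b i); nra.
Qed.

Lemma l20 : l2 (fun=> 0).
Proof. by exists 0 => N; rewrite big1// => i _; rewrite mulr0 normr0. Qed.

Lemma ip0 a : ip (fun=> 0) a = 0.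
Proof.
by apply: totE; under eq_fun do (rewrite big1; last by move=> i _; rewrite mul0r); exact: cvg_cst.
Qed.

Lemma ip_axpy a t b c : l2 a -> l2 b -> l2 c -> ip (axpy a t b) c = ip a c + t * ip b c.
Proof.
move=> la lb lc; rewrite /ip -totZ; last exact: ip_smb.
rewrite -totD; [|exact: ip_smb|by apply: smbZ; exact: ip_smb].
by congr tot; apply/funext => i; rewrite /axpy mulrDl mulrA.
Qed.

Lemma ip_axpyr a t b c : l2 a -> l2 b -> l2 c -> ip c (axpy a t b) = ip c a + t * ip c b.
Proof. by move=> la lb lc; rewrite ipC ip_axpy// (ipC a) (ipC b). Qed.

Lemma ip_axpy2 a t b : l2 a -> l2 b ->
  ip (axpy a t b) (axpy a t b) = ip a a + 2 * t * ip a b + t ^+ 2 * ip b b.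
Proof.
move=> la lb; have lab := l2_axpy t la lb.
by rewrite ip_axpy// !ip_axpyr// (ipC b a); ring.
Qed.

Lemma ip_ge0 a : l2 a -> 0 <= ip a a.
Proof. by move=> la; apply: tot_ge0 => // i; rewrite -expr2 sqr_ge0. Qed.

Lemma psum_le_ip a N : l2 a -> \sum_(i < N) a i * a i <= ip a a.
Proof. by move=> la; apply: psum_le_tot => // i; rewrite -expr2 sqr_ge0. Qed.

Lemma entry_le_ip a i : l2 a -> a i ^+ 2 <= ip a a.
Proof.
move=> la; apply: le_trans (psum_le_ip i.+1 la).
by rewrite big_ord_recr/= expr2 lerDr sumr_ge0// => j _; rewrite -expr2 sqr_ge0.
Qed.

Lemma ip_eq0 a : l2 a -> ip a a = 0 -> a = (fun=> 0).
Proof.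
move=> la a0; apply/funext => i; have := entry_le_ip i la.
by rewrite a0 => h; apply/eqP; rewrite -sqrf_eq0; apply/eqP/le_anti; rewrite h sqr_ge0.
Qed.

Lemma CS a b : l2 a -> l2 b -> ip a b ^+ 2 <= ip a a * ip b b.
Proof.
move=> la lb; have := ip_ge0 lb; rewrite le_eqVlt => /predU1P[b0|b0].
  have -> : b = fun=> 0 by apply: ip_eq0.
  by rewrite ipC !ip0 expr0n mulr0.
have := ip_ge0 (l2_axpy (- (ip a b / ip b b)) la lb); rewrite ip_axpy2//.
set x := ip a b; set y := ip b b in b0 *; set z := ip a a.
have -> : z + 2 * - (x / y) * x + (- (x / y)) ^+ 2 * y = (z * y - x ^+ 2) / y.
  by field; rewrite gt_eqF.
by rewrite pmulr_lge0 ?invr_gt0// subr_ge0.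
Qed.

Definition base (j : nat) : nat -> R := fun i => (i == j)%:R.

Lemma base_cvg a j : (fun N => \sum_(i < N) a i * base j i) @ \oo --> a j.
Proof.
apply: cvg_near_cst; near=> N.
have jN : (j < N)%N by near: N; exact: nbhs_infty_gt.
rewrite (bigD1 (Ordinal jN))//= /base eqxx mulr1 big1 ?addr0// => i ij.
by rewrite (_ : (i == j :> nat) = false) ?mulr0//; apply/negbTE.
Unshelve. all: by end_near. Qed.

Lemma l2_base j : l2 (base j).
Proof.
exists 1 => N; have [jN|jN] := ltnP j N.
  rewrite (bigD1 (Ordinal jN))//= /base eqxx mulr1 normr1 big1 ?addr0// => i ij.
  by rewrite (_ : (i == j :> nat) = false) ?mulr0 ?normr0//; apply/negbTE.
rewrite big1// => i _; rewrite /base (_ : (i == j :> nat) = false) ?mulr0 ?normr0//.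
by apply/negbTE; rewrite neq_ltn (leq_trans (ltn_ord i) jN).
Qed.

Lemma ip_base a j : ip a (base j) = a j.
Proof. by apply: totE; exact: base_cvg. Qed.

Definition tail (N : nat) a := fun i => if (i < N)%N then 0 else a i.

Lemma l2_tail N a : l2 a -> l2 (tail N a).
Proof.
move=> la; apply: (smb_le _ la) => i; rewrite /tail; case: ifP => _.
  by rewrite mulr0 normr0 -expr2 sqr_ge0.
by rewrite -expr2 ger0_norm// sqr_ge0.
Qed.

Lemma ip_tail N a b : l2 a -> l2 b -> ip (tail N a) b = ip a b - \sum_(i < N) a i * b i.
Proof.
move=> la lb; apply: totE.
have h : (fun M => \sum_(i < M) a i * b i - \sum_(i < N) a i * b i) @ \oo -->
    ip a b - \sum_(i < N) a i * b i.
  by apply: cvgB; [exact: ip_cvg|exact: cvg_cst].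
apply: (cvg_trans _ h); apply: near_eq_cvg; near=> M.
have NM : (N <= M)%N by near: M; exact: nbhs_infty_ge.
rewrite -(subnKC NM) !big_split_ord/= addrAC subrr add0r [in RHS]big1 ?add0r; last first.
  by move=> i _; rewrite /tail ltn_ord mul0r.
by apply: eq_bigr => i _; rewrite /tail ltnNge leq_addr.
Unshelve. all: by end_near. Qed.

Lemma ip_tail2 N a : l2 a -> ip (tail N a) (tail N a) = ip a a - \sum_(i < N) a i * a i.
Proof.
move=> la; rewrite ip_tail//; last exact: l2_tail.
rewrite ipC ip_tail// [X in _ - _ - X]big1 ?subr0// => i _.
by rewrite /tail ltn_ord mulr0.
Qed.

(** Cauchy-Schwarz for tails controls the error of truncating a scalar product; this
is what turns weak limits into limits. *)
Lemma tail_CS N a b : l2 a -> l2 b ->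
  (ip a b - \sum_(i < N) a i * b i) ^+ 2 <= (ip a a - \sum_(i < N) a i * a i) * ip b b.
Proof. by move=> la lb; rewrite -ip_tail// -ip_tail2//; apply: CS => //; exact: l2_tail. Qed.

Lemma cvg_le_cst (u : nat -> R) (l C : R) : u @ \oo --> l -> (forall n, u n <= C) -> l <= C.
Proof. by move=> h hC; apply: (cvgr_to_le h); apply: filterE. Qed.

Lemma tail_cvg0 a C : l2 a ->
  (fun N => (ip a a - \sum_(i < N) a i * a i) * C) @ \oo --> (0 : R).
Proof.
move=> la; have : (fun N => (ip a a - \sum_(i < N) a i * a i) * C) @ \oo --> (ip a a - ip a a) * C.
  by apply: cvgMl; apply: cvgB; [exact: cvg_cst|exact: ip_cvg].
by rewrite subrr mul0r.
Qed.

(** Hilbert-Schmidt matrices act through scalar products with their rows. *)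
Definition hs K := (forall i, l2 (K i)) /\ smb (fun i => ip (K i) (K i)).
Definition hsn K := tot (fun i => ip (K i) (K i)).
Definition op K a := fun i => ip (K i) a.
Definition sym K := forall i j, K i j = K j i.

Lemma op_entry K a i : hs K -> l2 a -> op K a i * op K a i <= ip (K i) (K i) * ip a a.
Proof. by move=> [lK _] la; rewrite -expr2; exact: CS. Qed.

Lemma op_l2 K a : hs K -> l2 a -> l2 (op K a).
Proof.
move=> hK la; apply: (@smb_le _ (fun i => ip a a * ip (K i) (K i))); last exact: smbZ hK.2.
by move=> i; rewrite ger0_norm; [rewrite [leRHS]mulrC op_entry|rewrite -expr2 sqr_ge0].
Qed.

Lemma op_bound K a : hs K -> l2 a -> ip (op K a) (op K a) <= hsn K * ip a a.
Proof.
move=> hK la; have h : smb (fun i => ip a a * ip (K i) (K i)) by exact: smbZ hK.2.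
apply: tot_le_ub; first exact: op_l2.
move=> N; apply: (@le_trans _ _ (\sum_(i < N) ip (K i) (K i) * ip a a)).
  by apply: ler_sum => i _; exact: op_entry.
rewrite -mulr_suml ler_wpM2r ?ip_ge0// psum_le_tot//; first exact: hK.2.
by move=> i; apply: ip_ge0; exact: hK.1.
Qed.

Lemma op_axpy K a t b : hs K -> l2 a -> l2 b -> op K (axpy a t b) = axpy (op K a) t (op K b).
Proof. by move=> [lK _] la lb; apply/funext => i; rewrite /op ip_axpyr. Qed.

Lemma op_base K j : hs K -> sym K -> op K (base j) = K j.
Proof. by move=> hK sK; apply/funext => i; rewrite /op ip_base sK. Qed.

(** Symmetry is clear against finitely supported vectors, and the truncation error
tends to zero. *)
Lemma op_sym K a b : hs K -> sym K -> l2 a -> l2 b -> ip (op K a) b = ip a (op K b).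
Proof.
move=> hK sK la lb; have la' := op_l2 hK la; have lb' := op_l2 hK lb.
have key N : (ip a (op K b) - \sum_(j < N) op K a j * b j) ^+ 2 <=
    (ip b b - \sum_(i < N) b i * b i) * (hsn K * ip a a).
  have lt := l2_tail N lb.
  have split_b : op K b = axpy (op K (tail N b)) 1 (fun i => \sum_(j < N) K i j * b j).
    by apply/funext => i; rewrite /axpy mul1r /op ipC (ipC _ (tail N b)) ip_tail//;
      [under [in RHS]eq_bigr do rewrite mulrC; rewrite subrK|exact: hK.1].
  have fin M : l2 (fun i => \sum_(j < M) K i j * b j) /\
      ip a (fun i => \sum_(j < M) K i j * b j) = \sum_(j < M) op K a j * b j.
    elim: M => [|M [l e]].
      have -> : (fun i => \sum_(j < 0) K i j * b j) = fun=> 0.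
        by apply/funext => i; rewrite big_ord0.
      by split; [exact: l20|rewrite ipC ip0 big_ord0].
    have -> : (fun i => \sum_(j < M.+1) K i j * b j) =
        axpy (fun i => \sum_(j < M) K i j * b j) (b M) (K M).
      by apply/funext => i; rewrite big_ord_recr /axpy/= sK mulrC.
    split; first by apply: l2_axpy => //; exact: hK.1.
    rewrite ip_axpyr//; last exact: hK.1.
    by rewrite e big_ord_recr /= mulrC /op (ipC a).
  have [lf ef] := fin N.
  rewrite split_b ip_axpyr//; last exact: op_l2.
  rewrite mul1r ef addrK.
  apply: (le_trans (CS la (op_l2 hK lt))).
  rewrite -ip_tail2// mulrC mulrCA mulrA ler_wpM2r ?ip_ge0//.
  exact: op_bound.
have c1 : (fun N => (ip a (op K b) - \sum_(j < N) op K a j * b j) ^+ 2 -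
    (ip b b - \sum_(i < N) b i * b i) * (hsn K * ip a a)) @ \oo -->
    (ip a (op K b) - ip (op K a) b) ^+ 2 - 0.
  apply: cvgB; last exact: tail_cvg0.
  rewrite expr2; under eq_fun do rewrite expr2.
  by apply: cvgM; apply: cvgB; [exact: cvg_cst|exact: ip_cvg|exact: cvg_cst|exact: ip_cvg].
have h0 : (ip a (op K b) - ip (op K a) b) ^+ 2 <= 0.
  by rewrite -[leLHS]subr0; apply: (cvg_le_cst c1) => N; rewrite subr_le0.
apply/eqP; rewrite eq_sym -subr_eq0 -sqrf_eq0; apply/eqP/le_anti.
by rewrite h0 sqr_ge0.
Qed.

End SquareSummable.

(** * Eigenvectors of symmetric Hilbert-Schmidt matrices *)

Section CompactSymmetric.
Context {R : realType}.
Local Notation vec := (nat -> R).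
Implicit Types (a b c v w : vec) (K : nat -> nat -> R) (s : seq (R * vec)).

Lemma ucvg_sum (F : nat -> nat -> R) (w : nat -> R) N :
  (forall i, (fun n => F n i) @ ufil --> w i) ->
  (fun n => \sum_(i < N) F n i) @ ufil --> \sum_(i < N) w i.
Proof.
move=> h; elim: N => [|N IH].
  by rewrite big_ord0; under eq_fun do rewrite big_ord0; exact: cvg_cst.
by rewrite big_ord_recr; under eq_fun do rewrite big_ord_recr; exact: cvgD.
Qed.

Lemma ucvg_le (u : nat -> R) (l C : R) : u @ ufil --> l -> (forall n, u n <= C) -> l <= C.
Proof. by move=> h hC; apply: (cvgr_to_le h); apply: filterE. Qed.

(** Entrywise ultralimit; scalar products with a fixed vector converge because tails
are uniformly small. *)
Lemma weak_limit (A : nat -> vec) (C : R) : (forall n, l2 (A n) /\ ip (A n) (A n) <= C) ->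
  exists w, [/\ l2 w, ip w w <= C & forall c, l2 c -> (fun n => ip c (A n)) @ ufil --> ip c w].
Proof.
move=> hA; have C0 : 0 <= C by have [l h] := hA 0%N; apply: le_trans h; exact: ip_ge0.
have en n i : `|A n i| <= Num.sqrt C.
  have [l h] := hA n; rewrite -sqrtr_sqr; apply: ler_wsqrtr.
  exact: le_trans (entry_le_ip i l) h.
pose w i := ulim (fun n => A n i).
have cw i : (fun n => A n i) @ ufil --> w i by apply: (@ulim_cvg _ _ (Num.sqrt C)) => n.
have hw N : \sum_(i < N) w i * w i <= C.
  have h : (fun n => \sum_(i < N) A n i * A n i) @ ufil --> \sum_(i < N) w i * w i.
    by apply: (ucvg_sum (F := fun n i => A n i * A n i) (w := fun i => w i * w i)) => i; exact: cvgM.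
  by apply: (ucvg_le h) => n; have [l hn] := hA n; apply: le_trans hn; exact: psum_le_ip.
have lw : l2 w.
  by exists C => N; under eq_bigr do rewrite ger0_norm -?expr2 ?sqr_ge0// expr2.
have wC : ip w w <= C by exact: tot_le_ub.
exists w; split=> // c lc.
have bd n : `|ip c (A n)| <= Num.sqrt (ip c c * C).
  have [l h] := hA n; rewrite -sqrtr_sqr; apply: ler_wsqrtr.
  by apply: (le_trans (CS lc l)); rewrite ler_wpM2l// ip_ge0.
have cL := ulim_cvg bd.
suff <- : ulim (fun n => ip c (A n)) = ip c w by [].
set L := ulim _ in cL *.
have key N : (L - \sum_(i < N) c i * w i) ^+ 2 <= (ip c c - \sum_(i < N) c i * c i) * C.
  have h : (fun n => (ip c (A n) - \sum_(i < N) c i * A n i) ^+ 2) @ ufil -->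
      (L - \sum_(i < N) c i * w i) ^+ 2.
    have h1 : (fun n => ip c (A n) - \sum_(i < N) c i * A n i) @ ufil -->
      L - \sum_(i < N) c i * w i.
      apply: cvgB => //; apply: (ucvg_sum (F := fun n i => c i * A n i) (w := fun i => c i * w i)) => i.
      by apply: cvgM => //; exact: cvg_cst.
    by rewrite expr2; under eq_fun do rewrite expr2; exact: cvgM.
  apply: (ucvg_le h) => n; have [l hn] := hA n.
  apply: (le_trans (tail_CS N lc l)); rewrite ler_wpM2l// subr_ge0; exact: psum_le_ip.
have c1 : (fun N => (L - \sum_(i < N) c i * w i) ^+ 2 -
    (ip c c - \sum_(i < N) c i * c i) * C) @ \oo --> (L - ip c w) ^+ 2 - 0.
  apply: cvgB; last exact: tail_cvg0.
  rewrite expr2; under eq_fun do rewrite expr2.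
  by apply: cvgM; apply: cvgB; [exact: cvg_cst|exact: ip_cvg|exact: cvg_cst|exact: ip_cvg].
have h0 : (L - ip c w) ^+ 2 <= 0.
  by rewrite -[leLHS]subr0; apply: (cvg_le_cst c1) => N; rewrite subr_le0.
by apply/eqP; rewrite -subr_eq0 -sqrf_eq0; apply/eqP/le_anti; rewrite h0 sqr_ge0.
Qed.

(** Rows of a Hilbert-Schmidt matrix have summable square norms, so weak limits
become strong after applying it. *)
Lemma op_weak K (A : nat -> vec) (C q : R) w : hs K ->
  (forall n, l2 (A n) /\ ip (A n) (A n) <= C) -> l2 w ->
  (forall c, l2 c -> (fun n => ip c (A n)) @ ufil --> ip c w) ->
  (forall e, 0 < e -> ufil [set n | q - e <= ip (op K (A n)) (op K (A n))]) ->
  q <= ip (op K w) (op K w).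
Proof.
move=> hK hA lw cw hq.
have C0 : 0 <= C by have [l h] := hA 0%N; apply: le_trans h; exact: ip_ge0.
have r0 i : 0 <= ip (K i) (K i) by apply: ip_ge0; exact: hK.1.
have key N : q <= \sum_(i < N) op K w i * op K w i +
    C * (hsn K - \sum_(i < N) ip (K i) (K i)).
  have h : (fun n => \sum_(i < N) op K (A n) i * op K (A n) i) @ ufil -->
      \sum_(i < N) op K w i * op K w i.
    apply: (ucvg_sum (F := fun n i => op K (A n) i * op K (A n) i)
      (w := fun i => op K w i * op K w i)) => i.
    by apply: cvgM; apply: cw; exact: hK.1.
  apply/ler_addgt0Pr => e e0.
  rewrite -lerBlDr -lerBlDr; apply: (cvgr_to_ge h).
  apply: filterS (hq e e0) => n /= hn.
  have [ln hnC] := hA n; have lo := op_l2 hK ln.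
  suff : ip (op K (A n)) (op K (A n)) <= \sum_(i < N) op K (A n) i * op K (A n) i +
    C * (hsn K - \sum_(i < N) ip (K i) (K i)) by move: hn; lra.
  apply: tot_le_ub => // M; have [MN|NM] := leqP M N.
    apply: (@le_trans _ _ (\sum_(i < N) op K (A n) i * op K (A n) i)).
      rewrite -(subnKC MN) big_split_ord/= lerDl sumr_ge0// => i _.
      by rewrite -expr2 sqr_ge0.
    rewrite lerDl mulr_ge0// subr_ge0; apply: psum_le_tot => //; exact: hK.2.
  rewrite -(subnKC (ltnW NM)) big_split_ord/= lerD2l.
  apply: (@le_trans _ _ (\sum_(i < M - N) C * ip (K (N + i)%N) (K (N + i)%N))).
    apply: ler_sum => i _; apply: (le_trans (op_entry _ hK ln)).
    by rewrite mulrC ler_wpM2r.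
  rewrite -mulr_sumr ler_wpM2l// lerBrDl.
  by have := psum_le_tot (N + (M - N)) hK.2 r0; rewrite big_split_ord.
have c1 : (fun N => \sum_(i < N) op K w i * op K w i +
    C * (hsn K - \sum_(i < N) ip (K i) (K i))) @ \oo --> ip (op K w) (op K w) + C * (hsn K - hsn K).
  apply: cvgD; first by apply: ip_cvg; exact: op_l2.
  by apply: cvgMr; apply: cvgB; [exact: cvg_cst|exact: tot_cvg hK.2].
rewrite subrr mulr0 addr0 in c1.
by apply: (cvgr_to_ge c1); apply: filterE.
Qed.

Definition orth s a := forall x, x \in s -> ip x.2 a = 0.

(** Orthonormal systems of eigenvectors, listed with their eigenvalues so that
multiplicities are counted by the list. *)
Fixpoint onsys K s : Prop :=
  if s is x :: s' then
    [/\ l2 x.2, ip x.2 x.2 = 1, op K x.2 = (fun i => x.1 * x.2 i), orth s' x.2 & onsys K s']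
  else True.

Lemma onsys_mem K s : onsys K s -> forall x, x \in s ->
  [/\ l2 x.2, ip x.2 x.2 = 1 & op K x.2 = (fun i => x.1 * x.2 i)].
Proof.
elim: s => //= y s IH [l n e _ os] x; rewrite inE => /orP[/eqP->//|].
exact: IH.
Qed.

Lemma ipZ t a b : l2 a -> l2 b -> ip (fun i => t * a i) b = t * ip a b.
Proof.
move=> la lb; rewrite /ip -totZ; last exact: ip_smb.
by congr tot; apply/funext => i; rewrite mulrA.
Qed.

Lemma l2Z t a : l2 a -> l2 (fun i => t * a i).
Proof.
move=> la; apply: (smb_le _ (smbZ (t ^+ 2) la)) => i.
by rewrite ger0_norm; [rewrite mulrACA expr2|rewrite -expr2 sqr_ge0].
Qed.

Lemma orth_op K s a : hs K -> sym K -> onsys K s -> l2 a -> orth s a -> orth s (op K a).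
Proof.
move=> hK sK os la oa x xs; have [lx _ ex] := onsys_mem os xs.
by rewrite -op_sym// ex ipZ// oa// mulr0.
Qed.

Lemma orth_axpy K s a t b : onsys K s -> l2 a -> l2 b -> orth s a -> orth s b -> orth s (axpy a t b).
Proof.
move=> os la lb oa ob x xs; have [lx _ _] := onsys_mem os xs.
by rewrite ip_axpyr// oa// ob// mulr0 addr0.
Qed.

Definition energy K a := ip (op K a) (op K a).

Lemma hsn_ge0 K : hs K -> 0 <= hsn K.
Proof. by move=> [lK sK]; apply: tot_ge0 => // i; exact: ip_ge0. Qed.

Lemma energyZ K t a : hs K -> l2 a -> energy K (fun i => t * a i) = t ^+ 2 * energy K a.
Proof.
move=> hK la; have lo := op_l2 hK la; rewrite /energy.
have -> : op K (fun i => t * a i) = fun i => t * op K a i.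
  by apply/funext => i; rewrite /op ipC ipZ//; [rewrite ipC|exact: hK.1].
by rewrite ipZ// ?(ipC (op K a)) ?ipZ//; [ring|exact: l2Z].
Qed.

(** Maximising sequences have weak limits, and the energy is weakly continuous. *)
Lemma energy_attained K s : hs K -> onsys K s ->
  exists w q, [/\ l2 w, orth s w, ip w w <= 1, q <= energy K w &
    forall a, l2 a -> orth s a -> energy K a <= q * ip a a].
Proof.
move=> hK os.
pose E := [set r | exists a, [/\ l2 a, orth s a, ip a a <= 1 & r = energy K a]].
have l2_0 : l2 (fun=> 0 : R) := l20.
have E0 : E (energy K (fun=> 0)).
  by exists (fun=> 0); split=> //; [move=> x xs; rewrite ipC ip0|rewrite ip0].
have hE : has_sup E.
  split; first by exists (energy K (fun=> 0)).
  exists (hsn K) => _ [a [la oa a1 ->]]; apply: (le_trans (op_bound hK la)).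
  by apply: ler_piMr => //; exact: hsn_ge0.
pose q := sup E.
have qub r : E r -> r <= q by move=> Er; apply: sup_ubound => //; exact: hE.2.
have /choice[A hA] : forall n : nat, exists a, [/\ l2 a, orth s a, ip a a <= 1 &
    q - n.+1%:R^-1 <= energy K a].
  move=> n; have e0 : 0 < n.+1%:R^-1 :> R by rewrite invr_gt0.
  have [_ [a [la oa a1 ->]] h] := sup_adherent e0 hE.
  by exists a; split=> //; exact: ltW.
have hA1 n : l2 (A n) /\ ip (A n) (A n) <= 1 by have [] := hA n.
have [w [lw w1 cw]] := weak_limit hA1.
exists w, q; split=> //.
- move=> x xs; have [lx _ _] := onsys_mem os xs.
  apply: (ucvg_eq (cw _ lx) (cvg_cst 0)) => n.
  by have [_ o _ _] := hA n; exact: o.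
- apply: (op_weak hK hA1 lw cw) => e e0.
  have := @ucvg_harmonic R => /cvgrPdist_lt /(_ e e0); apply: filterS => n /=.
  rewrite sub0r normrN ger0_norm ?invr_ge0// => ne.
  by have [_ _ _ h] := hA n; apply: le_trans h; rewrite lerD2l lerN2 ltW.
- move=> a la oa; have := ip_ge0 la; rewrite le_eqVlt => /predU1P[a0|a0].
    have -> : a = fun=> 0 by apply: ip_eq0.
    rewrite ip0 mulr0 /energy.
    have -> : op K (fun=> 0) = fun=> 0 by apply/funext => i; rewrite /op ipC ip0.
    by rewrite ip0.
  pose t := (Num.sqrt (ip a a))^-1.
  have t2 : t ^+ 2 = (ip a a)^-1 by rewrite exprVn sqr_sqrtr// ltW.
  have lt := l2Z t la.
  have : energy K (fun i => t * a i) <= q.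
    apply: qub; exists (fun i => t * a i); split=> //.
      by move=> x xs; have [lx _ _] := onsys_mem os xs; rewrite ipC ipZ// ipC oa// mulr0.
    by rewrite ipZ// ipC ipZ// mulrA -expr2 t2 mulVf// gt_eqF.
  by rewrite energyZ// t2 mulrC ler_pdivrMr.
Qed.

(** First variation at the maximiser: a nonnegative quadratic form vanishing at
[w] has vanishing differential there. *)
Lemma eig_exists K s q w : hs K -> sym K -> onsys K s -> l2 w -> orth s w ->
  ip w w <= 1 -> q <= energy K w ->
  (forall a, l2 a -> orth s a -> energy K a <= q * ip a a) -> 0 < q ->
  exists x, onsys K (x :: s) /\ x.1 ^+ 2 = q.
Proof.
move=> hK sK os lw ow w1 qw qa q0.
have lKw := op_l2 hK lw; have lKKw := op_l2 hK lKw.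
have oKw := orth_op hK sK os lw ow; have oKKw := orth_op hK sK os lKw oKw.
have var v : l2 v -> orth s v -> ip (op K w) (op K v) = q * ip w v.
  move=> lv ov; have lKv := op_l2 hK lv.
  have quad t : 0 <= 2 * t * (q * ip w v - ip (op K w) (op K v)) +
      t ^+ 2 * (q * ip v v - energy K v).
    have := qa _ (l2_axpy t lw lv) (orth_axpy t os lw lv ow ov).
    rewrite /energy op_axpy// !ip_axpy2// -/(energy K w) -/(energy K v).
    have : q * ip w w <= q by rewrite ger_pMr.
    by nra.
  set b := q * ip w v - _ in quad; set d := q * ip v v - _ in quad.
  suff : b = 0 by rewrite /b => /eqP; rewrite subr_eq0 => /eqP.
  have d0 : 0 <= d by rewrite subr_ge0; exact: qa.
  (* the shift by 1 keeps the denominator positive when d vanishes *)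
  have := quad (- b / (d + 1)).
  have d1 : 0 < d + 1 by lra.
  have -> : 2 * (- b / (d + 1)) * b + (- b / (d + 1)) ^+ 2 * d =
     - (b ^+ 2) * ((d + 2) / (d + 1) ^+ 2) by field; rewrite gt_eqF.
  rewrite mulNr oppr_ge0 pmulr_lle0; last by rewrite divr_gt0 ?exprn_gt0//; lra.
  by move=> h; apply/eqP; rewrite -sqrf_eq0; apply/eqP/le_anti; rewrite h sqr_ge0.
have zE : op K (op K w) = fun i => q * w i.
  have lz := l2_axpy (- q) lKKw lw.
  have : axpy (op K (op K w)) (- q) w = fun=> 0.
    apply: ip_eq0 => //; set z := axpy _ _ _ in lz *.
    have oz : orth s z by exact: orth_axpy os _ _ _ _.
    rewrite {1}/z ip_axpy// op_sym// var//; ring.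
  move=> h; apply/funext => i; have := congr1 (fun f => f i) h; rewrite /axpy => {}h.
  by apply/eqP; rewrite -subr_eq0; apply/eqP; move: h; lra.
pose r := Num.sqrt q.
have r2 : r ^+ 2 = q by rewrite sqr_sqrtr// ltW.
have r0 : 0 < r by rewrite sqrtr_gt0.
have norm m y : l2 y -> orth s y -> op K y = (fun i => m * y i) -> m ^+ 2 = q -> y <> (fun=> 0) ->
    exists x, onsys K (x :: s) /\ x.1 ^+ 2 = q.
  move=> ly oy ey m2 y0.
  have yp : 0 < ip y y.
    by rewrite lt_neqAle ip_ge0// andbT eq_sym; apply/eqP => /(ip_eq0 ly).
  pose t := (Num.sqrt (ip y y))^-1.
  have t2 : t ^+ 2 = (ip y y)^-1 by rewrite exprVn sqr_sqrtr// ltW.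
  have lt := l2Z t ly.
  exists (m, fun i => t * y i); split=> //; split=> //=.
  - by rewrite ipZ// ipC ipZ// mulrA -expr2 t2 mulVf// gt_eqF.
  - apply/funext => i; have h : ip (K i) y = m * y i := congr1 (fun f => f i) ey.
    by rewrite /op ipC ipZ//; [rewrite (ipC y) h; ring|exact: hK.1].
  - by move=> x xs; have [lx _ _] := onsys_mem os xs; rewrite ipC ipZ// ipC oy// mulr0.
(* (K - r)(K + r) w = 0: either (K + r) w is an eigenvector for r, or w is one for - r *)
pose y := axpy (op K w) r w.
have ly : l2 y by exact: l2_axpy.
have oy : orth s y by exact: orth_axpy os _ _ _ _.
have ey : op K y = fun i => r * y i.
  by rewrite op_axpy// zE; apply/funext => i; rewrite /axpy mulrDr mulrA -expr2 r2 addrC.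
have [y0|y0] := pselect (y = fun=> 0); last exact: (norm r y).
apply: (norm (- r) w) => //; last 2 first.
- by rewrite sqrrN.
- move=> w0; move: qw; rewrite leNgt => /negP; apply.
  rewrite /energy w0; have -> : op K (fun=> 0) = fun=> 0.
    by apply/funext => i; rewrite /op ipC ip0.
  by rewrite ip0.
apply/funext => i; have := congr1 (fun f => f i) y0; rewrite /y /axpy => h.
by rewrite mulNr; lra.
Qed.

End CompactSymmetric.

(** * The trace formula *)

Section TraceFormula.
Context {R : realType}.
Local Notation vec := (nat -> R).
Implicit Types (a b c v w : vec) (K : nat -> nat -> R) (s : seq (R * vec)).

(** Component of a vector orthogonal to an orthonormal system. *)
Definition rest s a : vec := foldr (fun x r => axpy r (- ip x.2 a) x.2) a s.

Lemma restP K s a : onsys K s -> l2 a ->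
  [/\ l2 (rest s a), orth s (rest s a),
    ip (rest s a) (rest s a) = ip a a - \sum_(x <- s) ip x.2 a ^+ 2 &
    forall y, l2 y -> orth s y -> ip y (rest s a) = ip y a].
Proof.
move=> + la; elim: s => [_|x s IH /= [lx nx ex ox os]].
  by split=> //; rewrite big_nil subr0.
have [lr or nr ir] := IH os.
have xr : ip x.2 (rest s a) = ip x.2 a by exact: ir.
split; first exact: l2_axpy.
- move=> y; rewrite inE => /predU1P[->|ys].
  + by rewrite ip_axpyr// xr nx mulr1 subrr.
  + by have [ly _ _] := onsys_mem os ys; rewrite ip_axpyr// or// ox// mulr0 addr0.
- by rewrite ip_axpy2// nr big_cons nx (ipC _ x.2) xr; ring.
- move=> y ly oy; rewrite ip_axpyr// ir//.
    by rewrite (ipC y x.2) oy ?mem_head// mulr0 addr0.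
  by move=> z zs; apply: oy; rewrite inE zs orbT.
Qed.

Lemma op_rest K s a : hs K -> sym K -> onsys K s -> l2 a ->
  op K (rest s a) = rest s (op K a).
Proof.
move=> hK sK + la; elim: s => [//|x s IH /= [lx nx ex ox os]].
have [lr _ _ _] := restP os la.
rewrite op_axpy// (IH os) -op_sym// ex ipZ//.
by apply/funext => i; rewrite /axpy; ring.
Qed.

Lemma bessel K s a : onsys K s -> l2 a -> \sum_(x <- s) ip x.2 a ^+ 2 <= ip a a.
Proof.
by move=> os la; have [lr _ nr _] := restP os la; rewrite -subr_ge0 -nr ip_ge0.
Qed.

(** Bessel's inequality for each row, summed over the rows. *)
Lemma trace_le K s : hs K -> onsys K s -> \sum_(x <- s) x.1 ^+ 2 <= hsn K.
Proof.
move=> hK os.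
have c : (fun N => \sum_(x <- s) \sum_(i < N) ip x.2 (K i) ^+ 2) @ \oo --> \sum_(x <- s) x.1 ^+ 2.
  elim: s os => [_|x s IH /= [lx nx ex ox os]].
    by under eq_fun do rewrite big_nil; rewrite big_nil; exact: cvg_cst.
  under eq_fun do rewrite big_cons; rewrite big_cons; apply: cvgD; last exact: IH.
  have -> : x.1 ^+ 2 = ip (op K x.2) (op K x.2).
    by rewrite ex ipZ//; [rewrite ipC ipZ// nx; ring|exact: l2Z].
  have -> : (fun N => \sum_(i < N) ip x.2 (K i) ^+ 2) =
      (fun N => \sum_(i < N) op K x.2 i * op K x.2 i).
    by apply/funext => N; apply: eq_bigr => i _; rewrite expr2 /op (ipC (K i)).
  by apply: ip_cvg; exact: op_l2.
apply: (cvg_le_cst c) => N; rewrite exchange_big/=.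
apply: (@le_trans _ _ (\sum_(i < N) ip (K i) (K i))).
  by apply: ler_sum => i _; apply: bessel os _; exact: hK.1.
by apply: psum_le_tot hK.2 _ => i; apply: ip_ge0; exact: hK.1.
Qed.

(** Bessel bounds the number of eigenvalues above a threshold, so the system cannot be
extended for ever. *)
Lemma maximal_system K (tau : R) : hs K -> 0 < tau ->
  exists s, [/\ onsys K s, forall x, x \in s -> tau <= x.1 ^+ 2 &
    forall x, onsys K (x :: s) -> x.1 ^+ 2 < tau].
Proof.
move=> hK t0; apply: contrapT => H.
have ex n : exists s, [/\ onsys K s, forall x, x \in s -> tau <= x.1 ^+ 2 & size s = n].
  elim: n => [|n [s [os ls sn]]]; first by exists [::].
  apply: contrapT => H'; apply: H; exists s; split=> // x ox.
  rewrite ltNge; apply/negP => xt; apply: H'; exists (x :: s); split=> //=; last by rewrite sn.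
  by move=> y; rewrite inE => /predU1P[->|]; [|exact: ls].
have [s [os ls sn]] := ex (Num.bound (hsn K / tau)).
have := trace_le hK os; rewrite leNgt => /negP; apply.
have : \sum_(x <- s) tau <= \sum_(x <- s) x.1 ^+ 2.
  by rewrite big_seq [leRHS]big_seq; apply: ler_sum.
apply: lt_le_trans; rewrite big_const_seq count_predT sn iter_addr addr0 -mulr_natl.
rewrite -ltr_pdivrMr//; apply: archi_boundP.
by rewrite divr_ge0 ?(ltW t0)// hsn_ge0.
Qed.

(** On the orthogonal complement of a maximal system the matrix has norm at most the
threshold, so the rows of any finite block are exhausted by the system up to a small
error. *)
Lemma trace_ge K (e : R) : hs K -> sym K -> 0 < e ->
  exists s, [/\ onsys K s, forall x, x \in s -> x.1 != 0 & hsn K - e <= \sum_(x <- s) x.1 ^+ 2].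
Proof.
move=> hK sK e0; have e2 : 0 < e / 2 by rewrite divr_gt0.
have r0 i : 0 <= ip (K i) (K i) by apply: ip_ge0; exact: hK.1.
have [N hN] : exists N, hsn K - e / 2 <= \sum_(i < N) ip (K i) (K i).
  have /cvgrPdist_lt/(_ _ e2) [N _ /(_ N (leqnn N)) /= h] := tot_cvg hK.2.
  by exists N; have := ler_norm (tot (fun i => ip (K i) (K i)) - \sum_(i < N) ip (K i) (K i)); rewrite /hsn; lra.
(* N rows lose at most tau each *)
pose tau := e / 2 / N.+1%:R.
have t0 : 0 < tau by rewrite divr_gt0.
have [s [os ls mx]] := maximal_system hK t0.
exists s; split=> //.
  by move=> x xs; have := ls x xs; apply: contraTneq => ->; rewrite expr0n -ltNge.
have small a : l2 a -> orth s a -> energy K a <= tau * ip a a.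
  have [w [q [lw ow w1 qw qa]]] := energy_attained hK os.
  move=> la oa; apply: le_trans (qa a la oa) _; apply: ler_wpM2r; first exact: ip_ge0.
  have [//|tq] := leP q tau.
  have [x [ox xq]] := eig_exists hK sK os lw ow w1 qw qa (lt_trans t0 tq).
  by have := mx x ox; rewrite xq ltNge (ltW tq).
have row i : ip (K i) (K i) <= \sum_(x <- s) x.1 ^+ 2 * x.2 i ^+ 2 + tau.
  have lb := @l2_base R i; have lKi := hK.1 i.
  have [lr or nr _] := restP os lb.
  have [_ _ nk _] := restP os lKi.
  have E : energy K (rest s (base i)) = ip (K i) (K i) - \sum_(x <- s) x.1 ^+ 2 * x.2 i ^+ 2.
    rewrite /energy op_rest// op_base// nk; congr (_ - _).
    rewrite big_seq [RHS]big_seq; apply: eq_bigr => x xs.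
    have [lx _ ex] := onsys_mem os xs.
    by rewrite -(op_base i hK sK) -op_sym// ex ipZ// ip_base exprMn.
  have := small _ lr or; rewrite E lerBlDl => /le_trans; apply; rewrite lerD2l.
  rewrite ger_pMr// nr ip_base /base eqxx lerBlDr lerDl sumr_ge0// => x _; exact: sqr_ge0.
have := ler_sum (index_enum 'I_N) (fun (i : 'I_N) (_ : true) => row i).
rewrite big_split/= exchange_big/= sumr_const card_ord => h.
have h1 : \sum_(x <- s) \sum_(i < N) x.1 ^+ 2 * x.2 i ^+ 2 <= \sum_(x <- s) x.1 ^+ 2.
  rewrite big_seq [leRHS]big_seq; apply: ler_sum => x xs.
  have [lx nx _] := onsys_mem os xs.
  rewrite -mulr_sumr ger_pMr; last by apply: lt_le_trans t0 (ls x xs).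
  by rewrite -nx; under eq_bigr do rewrite expr2; exact: psum_le_ip.
have h2 : tau *+ N <= e / 2.
  have -> : tau *+ N = (e / 2) * (N%:R / N.+1%:R) by rewrite -mulr_natl /tau; ring.
  by apply: ler_piMr; rewrite ?(ltW e2)// ler_pdivrMr// mul1r ler_nat.
lra.
Qed.

Lemma onsys_filter K s (p : pred (R * vec)) : onsys K s -> onsys K (seq.filter p s).
Proof.
elim: s => //= x s IH [lx nx ex ox os]; case: ifP => _; last exact: IH.
split=> //; last exact: IH.
by move=> y; rewrite mem_filter => /andP[_ ys]; exact: ox.
Qed.

Lemma l2_comb (I : Type) (r : seq I) (P : pred I) (f : I -> R) (u : I -> vec) b :
  (forall i, l2 (u i)) -> l2 b ->
  l2 (fun n => \sum_(i <- r | P i) f i * u i n) /\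
  ip b (fun n => \sum_(i <- r | P i) f i * u i n) = \sum_(i <- r | P i) f i * ip b (u i).
Proof.
move=> lu lb; elim: r => [|i r [IHl IHe]].
  have -> : (fun n => \sum_(i <- [::] | P i) f i * u i n) = fun=> 0.
    by apply/funext => n; rewrite big_nil.
  by split; [exact: l20|rewrite ipC ip0 big_nil].
rewrite big_cons; case: (boolP (P i)) => Pi; last first.
  by under eq_fun do rewrite big_cons (negbTE Pi).
have -> : (fun n => \sum_(j <- i :: r | P j) f j * u j n) =
    axpy (fun n => \sum_(j <- r | P j) f j * u j n) (f i) (u i).
  by apply/funext => n; rewrite big_cons Pi /axpy addrC.
split; first exact: l2_axpy.
by rewrite ip_axpyr// IHe addrC.
Qed.

Definition independent d (u : 'I_d -> vec) :=
  forall c : 'I_d -> R, (forall n, \sum_i c i * u i n = 0) -> forall i, c i = 0.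

(** A space of dimension greater than the number of constraints contains a
unit vector satisfying them. *)
Lemma unit_orth d (u : 'I_d.+1 -> vec) (s : seq (R * vec)) : (forall i, l2 (u i)) ->
  independent u -> (size s <= d)%N -> (forall x, x \in s -> l2 x.2) ->
  exists c : 'I_d.+1 -> R, ip (fun n => \sum_i c i * u i n) (fun n => \sum_i c i * u i n) = 1 /\
    orth s (fun n => \sum_i c i * u i n).
Proof.
move=> lu iu sd ls.
pose M : 'M[R]_(d.+1, size s) := \matrix_(i, j) ip (nth (0, fun=> 0) s j).2 (u i).
have : kermx M != 0.
  rewrite -mxrank_eq0 mxrank_ker subn_eq0 -ltnNge ltnS.
  exact: leq_trans (rank_leq_col M) sd.
case/rowV0Pn => c cM c0; move/sub_kermxP: cM => cM.
pose v n := \sum_i c ord0 i * u i n.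
have [lv _] := @l2_comb _ (index_enum 'I_d.+1) xpredT (fun i => c ord0 i) u (fun=> 0) lu l20.
have ov : orth s v.
  move=> x xs; have [_ ->] := @l2_comb _ (index_enum 'I_d.+1) xpredT (fun i => c ord0 i) u _ lu (ls x xs).
  have js : (index x s < size s)%N by rewrite index_mem.
  have := congr1 (fun A : 'rV_(size s) => A ord0 (Ordinal js)) cM.
  rewrite !mxE => h; rewrite -[RHS]h; apply: eq_bigr => i _.
  by rewrite !mxE /= nth_index.
have v0 : 0 < ip v v.
  rewrite lt_neqAle ip_ge0// andbT eq_sym; apply/eqP => /(ip_eq0 lv) ve.
  move/negP: c0; apply; apply/eqP/rowP => i; rewrite mxE.
  by apply: (iu (fun i => c ord0 i)) => n; exact: (congr1 (fun f => f n) ve).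
pose t := (Num.sqrt (ip v v))^-1.
have t2 : t ^+ 2 = (ip v v)^-1 by rewrite exprVn sqr_sqrtr// ltW.
have vE : (fun n => \sum_i (t * c ord0 i) * u i n) = fun n => t * v n.
  by apply/funext => n; rewrite mulr_sumr; apply: eq_bigr => i _; rewrite mulrA.
exists (fun i => t * c ord0 i); rewrite vE; have lt := l2Z t lv; split.
  by rewrite ipZ// ipC ipZ// mulrA -expr2 t2 mulVf// gt_eqF.
by move=> x xs; rewrite ipC ipZ//; [rewrite ipC ov// mulr0|exact: ls].
Qed.

(** The Hilbert-Schmidt norm is determined by the multiplicities of the nonzero
eigenvalues. *)
Lemma hsn_le K K' : hs K -> sym K -> hs K' -> sym K' ->
  (forall (m : R) s, m != 0 -> onsys K s -> (forall x, x \in s -> x.1 = m) ->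
    exists u : 'I_(size s) -> vec, [/\ forall i, l2 (u i),
      forall i, op K' (u i) = (fun n => m * u i n) & independent u]) ->
  hsn K <= hsn K'.
Proof.
move=> hK sK hK' sK' H.
have tr s : onsys K s -> (forall x, x \in s -> x.1 != 0) ->
    exists s', onsys K' s' /\ map fst s' = map fst s.
  elim: s => [_ _|x s IH oxs nz]; first by exists [::].
  have [_ _ _ _ os] := oxs.
  have [|s' [os' ms']] := IH os; first by move=> y ys; apply: nz; rewrite inE ys orbT.
  pose p := fun y : R * vec => y.1 == x.1.
  have x0 : x.1 != 0 by apply: nz; exact: mem_head.
  have [|u [lu eu iu]] := H x.1 (seq.filter p (x :: s)) x0 (onsys_filter p oxs).
    by move=> y; rewrite mem_filter => /andP[/eqP].
  have sz : size (seq.filter p s') = size (seq.filter p s).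
    have cE (r : seq (R * vec)) : size (seq.filter p r) = count (pred1 x.1) (map fst r).
      by rewrite size_filter count_map.
    by rewrite !cE ms'.
  have pE : size (seq.filter p (x :: s)) = (size (seq.filter p s)).+1 by rewrite /= /p eqxx.
  move: u lu eu iu; rewrite pE => u lu eu iu.
  have [||c [nc oc]] := unit_orth (s := seq.filter p s') lu iu; first by rewrite sz.
    by move=> y ys; have [] := onsys_mem (onsys_filter p os') ys.
  pose v n := \sum_i c i * u i n.
  have [lv _] := @l2_comb _ (index_enum 'I_(size (seq.filter p s)).+1) xpredT c u (fun=> 0) lu l20.
  have ev : op K' v = fun n => x.1 * v n.
    apply/funext => n.
    have [_] := @l2_comb _ (index_enum 'I_(size (seq.filter p s)).+1) xpredT c u _ lu (hK'.1 n).
    rewrite /op -/v => ->; rewrite /v mulr_sumr; apply: eq_bigr => i _.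
    have h : ip (K' n) (u i) = x.1 * u i n := congr1 (fun f => f n) (eu i).
    by rewrite h mulrCA.
  exists ((x.1, v) :: s'); split; last by rewrite /= ms'.
  split=> //= y ys; have [yx|yx] := eqVneq y.1 x.1.
    by apply: oc; rewrite mem_filter ys andbT /p yx.
  have [ly _ ey] := onsys_mem os' ys.
  have : y.1 * ip y.2 v = x.1 * ip y.2 v.
    have h1 : ip (op K' y.2) v = y.1 * ip y.2 v by rewrite ey ipZ.
    have h2 : ip y.2 (op K' v) = x.1 * ip y.2 v by rewrite ev ipC ipZ// ipC.
    by rewrite -h1 -h2 op_sym.
  by move/eqP; rewrite -subr_eq0 -mulrBl mulf_eq0 subr_eq0 (negbTE yx) => /eqP.
rewrite -(lerD2r 0) addr0; apply/ler_addgt0Pr => e e0.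
have [s [os nz h]] := trace_ge hK sK e0.
have [s' [os' ms]] := tr s os nz.
have := trace_le hK' os'.
have -> : \sum_(x <- s') x.1 ^+ 2 = \sum_(x <- s) x.1 ^+ 2.
  by rewrite -(big_map fst xpredT (fun r => r ^+ 2)) ms big_map.
lra.
Qed.

End TraceFormula.

(** * The mean of a function on the torus *)

Section Mean.
Context {R : realType}.
Local Notation plane := 'rV[R]_2.
Implicit Types (f g : plane -> R) (x : plane).

Definition bnd f := exists C, forall x, `|f x| <= C.

(** Averages over the grids of mesh [1/n!]: these grids are eventually invariant
under every rational translation. *)
Definition avg n f : R := (n`!%:R^-1) ^+ 2 *
  \sum_(i < n`!) \sum_(j < n`!) f (row2 (i%:R / n`!%:R) (j%:R / n`!%:R)).
Definition mean f : R := ulim (fun n => avg n f).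

Lemma factN0 n : 0 < n`!%:R :> R.
Proof. by rewrite ltr0n fact_gt0. Qed.

Lemma avg_le n f g : (forall x, f x <= g x) -> avg n f <= avg n g.
Proof.
move=> le; rewrite ler_wpM2l ?sqr_ge0//; apply: ler_sum => i _; apply: ler_sum => j _; exact: le.
Qed.

Lemma avg_cst n (C : R) : avg n (fun=> C) = C.
Proof.
rewrite /avg !sumr_const !card_ord -[C *+ _ *+ _]mulr_natl -[C *+ _]mulr_natl; field.
by have := factN0 n; rewrite lt0r => /andP[].
Qed.

Lemma avgD n f g : avg n (fun x => f x + g x) = avg n f + avg n g.
Proof.
rewrite /avg -mulrDr -big_split/=; congr (_ * _); apply: eq_bigr => i _.
by rewrite -big_split.
Qed.

Lemma avgZ n (t : R) f : avg n (fun x => t * f x) = t * avg n f.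
Proof.
rewrite /avg mulrCA; congr (_ * _); rewrite mulr_sumr; apply: eq_bigr => i _.
by rewrite mulr_sumr.
Qed.

Lemma avg_norm n f (C : R) : (forall x, `|f x| <= C) -> `|avg n f| <= C.
Proof.
move=> h; rewrite ler_norml -[X in X <= _ <= _](avg_cst n) -[X in _ && (_ <= X)](avg_cst n).
by apply/andP; split; apply: avg_le => x; have := h x; rewrite ler_norml => /andP[].
Qed.

Lemma mean_cvg f : bnd f -> (fun n => avg n f) @ ufil --> mean f.
Proof. by move=> [C h]; apply: (@ulim_cvg _ _ C) => n; exact: avg_norm. Qed.

Lemma meanE f (l : R) : (fun n => avg n f) @ ufil --> l -> mean f = l.
Proof. exact: ulim_unique. Qed.

Lemma meanD f g : bnd f -> bnd g -> mean (fun x => f x + g x) = mean f + mean g.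
Proof.
move=> bf bg; apply: meanE; under eq_fun do rewrite avgD.
by apply: cvgD; exact: mean_cvg.
Qed.

Lemma meanZ (t : R) f : bnd f -> mean (fun x => t * f x) = t * mean f.
Proof.
move=> bf; apply: meanE; under eq_fun do rewrite avgZ.
by apply: cvgMr; exact: mean_cvg.
Qed.

Lemma mean_cst (C : R) : mean (fun=> C) = C.
Proof. by apply: meanE; under eq_fun do rewrite avg_cst; exact: cvg_cst. Qed.

Lemma mean_norm f (C : R) : (forall x, `|f x| <= C) -> `|mean f| <= C.
Proof.
move=> h; have bf : bnd f by exists C.
by apply: (ucvg_le (cvg_norm (mean_cvg bf))) => n; exact: avg_norm.
Qed.

Lemma bndD f g : bnd f -> bnd g -> bnd (fun x => f x + g x).
Proof. by move=> [C hC] [D hD]; exists (C + D) => x; apply: le_trans (ler_normD _ _) _; exact: lerD. Qed.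

Lemma bndM f g : bnd f -> bnd g -> bnd (fun x => f x * g x).
Proof. by move=> [C hC] [D hD]; exists (C * D) => x; rewrite normrM ler_pM. Qed.

Lemma bndC (C : R) : bnd (fun=> C).
Proof. by exists `|C|. Qed.

Lemma bndZ (t : R) f : bnd f -> bnd (fun x => t * f x).
Proof. by move=> bf; exact: bndM (bndC t) bf. Qed.

Lemma mean_ge0 f : bnd f -> (forall x, 0 <= f x) -> 0 <= mean f.
Proof.
move=> bf f0; apply: (cvgr_to_ge (mean_cvg bf)); apply: filterE => n.
by rewrite -(avg_cst n 0) avg_le.
Qed.

Lemma shift_sum (G : nat -> R) N p : (forall i, G (i + N)%N = G i) ->
  \sum_(i < N) G (i + p)%N = \sum_(i < N) G i.
Proof.
move=> per; elim: p => [|p IH]; first by apply: eq_bigr => i _; rewrite addn0.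
case: N per IH => [|N] per IH; first by rewrite !big_ord0.
rewrite -IH big_ord_recr [RHS]big_ord_recl/= addrC; congr (_ + _).
  by rewrite -(per (0 + p)%N) add0n addnC addSnnS addnC.
by apply: eq_bigr => i _; rewrite /bump /= add1n addSnnS.
Qed.

Lemma row2D (a b c d : R) : row2 a b + row2 c d = row2 (a + c) (b + d).
Proof. by apply/rowP => k; rewrite !mxE; case: ifP. Qed.

Lemma lattice_row2 (p q : int) : lattice (row2 p q) = row2 p%:~R q%:~R :> plane.
Proof. by apply/rowP => k; rewrite !mxE; case: ifP. Qed.

(** Reindexing a periodic sum. *)
Lemma avg_shift n f (p q : nat) : biperiodic f ->
  avg n (fun x => f (x + row2 (p%:R / n`!%:R) (q%:R / n`!%:R))) = avg n f.
Proof.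
move=> pf; have n0 := factN0 n; rewrite /avg; congr (_ * _).
set N := n`! in n0 *.
pose F (i j : nat) := f (row2 (i%:R / N%:R) (j%:R / N%:R)).
have FS i j : f (row2 (i%:R / N%:R) (j%:R / N%:R) + row2 (p%:R / N%:R) (q%:R / N%:R)) = F (i + p)%N (j + q)%N.
  by rewrite row2D -!mulrDl -!natrD.
have P1 i j : F (i + N)%N j = F i j.
  rewrite /F -(pf (row2 (i%:R / N%:R) (j%:R / N%:R)) (row2 1 0)) lattice_row2 row2D mulr1z mulr0z addr0.
  by rewrite natrD mulrDl divff ?lt0r_neq0.
have P2 i j : F i (j + N)%N = F i j.
  rewrite /F -(pf (row2 (i%:R / N%:R) (j%:R / N%:R)) (row2 0 1)) lattice_row2 row2D mulr1z mulr0z addr0.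
  by rewrite natrD mulrDl divff ?lt0r_neq0.
under eq_bigr do under eq_bigr do rewrite FS.
under eq_bigr => i _ do rewrite (shift_sum (G := fun j => F (i + p)%N j) q (P2 _)).
by rewrite (shift_sum (G := fun i => \sum_(j < N) F i j) p)// => i; apply: eq_bigr.
Qed.

(** A telescoping sum over the grid. *)
Lemma mean_deriv (i : 'I_2) f g (C : R) : bnd f -> biperiodic f -> bnd g -> 0 <= C ->
  (forall x t, `|t| <= 1 -> `|f (x + t *: delta_mx ord0 i) - f x - t * g x| <= C * t ^+ 2) ->
  mean g = 0.
Proof.
move=> bf pf bg C0 h; apply: meanE.
suff key n : `|avg n g| <= C * n`!%:R^-1.
  apply: (ucvg_near (cvg_cst 0) (e := fun n => C * n`!%:R^-1)) => //.
    have -> : 0 = C * 0 :> R by rewrite mulr0.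
    apply: cvgM; first exact: cvg_cst.
    apply: ucvg_oo; apply/cvgrPdist_lt => e e0.
    have := @cvg_harmonic R => /cvgrPdist_lt /(_ e e0) [N _ HN].
    exists N.+1 => // -[|n] /= Nn; first by rewrite ltn0 in Nn.
    have := HN n Nn; rewrite /= !sub0r !normrN => /(le_lt_trans _); apply.
    rewrite !ger0_norm ?invr_ge0// lef_pV2 ?posrE ?factN0// ler_nat.
    by rewrite factS leq_pmulr// fact_gt0.
  by move=> n; rewrite subr0.
have n0 := factN0 n; set d := (n`!%:R : R)^-1.
have d0 : 0 < d by rewrite invr_gt0.
(* one grid step: the translated average equals the average *)
have d1 : `|d| <= 1.
  by rewrite ger0_norm ?(ltW d0)// invf_le1// ler1n fact_gt0.
have : `|avg n (fun x => f (x + d *: delta_mx ord0 i) + (-1) * f x + (- d) * g x)| <= C * d ^+ 2.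
  by apply: avg_norm => x; have := h x d d1; rewrite mulN1r mulNr.
rewrite !avgD !avgZ.
have -> : avg n (fun x => f (x + d *: delta_mx ord0 i)) = avg n f.
  have -> : d *: delta_mx ord0 i =
      row2 ((i == 0)%:R / n`!%:R) ((i == 1)%:R / n`!%:R) :> plane.
    by apply/rowP => k; rewrite !mxE; case: (ord2P k) => ->; case: (ord2P i) => -> /=;
      rewrite ?mulr1 ?mulr0 ?mul1r ?mul0r.
  exact: avg_shift.
rewrite mulN1r subrr add0r normrM normrN (ger0_norm (ltW d0)) expr2 mulrCA.
by rewrite ler_pM2l.
Qed.

(** Translate by the integer part of the difference, reduced modulo [M]. *)
Lemma frac_near (x a : R) (M : nat) : (0 < M)%N -> exists (p : nat) (z : int),
  `|x + p%:R / M%:R - a - z%:~R| <= M%:R^-1.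
Proof.
move=> M0; have Mp : 0 < M%:R :> R by rewrite ltr0n.
pose m := Num.floor ((a - x) * M%:R).
exists `|(m %% M%:Z)%Z|%N, (- (m %/ M%:Z)%Z)%R.
have pE : `|(m %% M%:Z)%Z|%N%:R = m%:~R - (m %/ M%:Z)%Z%:~R * M%:R :> R.
  have -> : `|(m %% M%:Z)%Z|%N%:R = (m %% M%:Z)%Z%:~R :> R.
    by rewrite -[in RHS](@gez0_abs (m %% M%:Z)%Z) ?modz_ge0// eqz_nat -lt0n.
  have h : m%:~R = (m %/ M%:Z)%Z%:~R * M%:R + (m %% M%:Z)%Z%:~R :> R.
    by rewrite -[X in _ * X]/(M%:Z%:~R) -intrM -intrD -divz_eq.
  by rewrite h [RHS]addrC addKr.
have /andP[h1 h2] : m%:~R <= (a - x) * M%:R < m%:~R + 1.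
  by rewrite -intrD1 floor_le_tmp lt_succ_floor.
have -> : x + `|(m %% M%:Z)%Z|%N%:R / M%:R - a - (- (m %/ M%:Z)%Z)%:~R =
    (m%:~R - (a - x) * M%:R) / M%:R.
  by rewrite pE rmorphN/=; field; rewrite gt_eqF.
rewrite normrM [`|M%:R^-1|]ger0_norm ?invr_ge0// ler_piMl ?invr_ge0//.
by rewrite ler0_norm; lra.
Qed.

(** A translate of the small square by a rational grid covers the torus, and the mean
is invariant under such translations. *)
Lemma mean_pos x0 (d : R) : 0 < d -> exists2 k, 0 < k &
  forall f c, bnd f -> biperiodic f -> (forall x, 0 <= f x) ->
    (forall x, (forall i, `|x ord0 i - x0 ord0 i| <= d) -> c <= f x) -> k * c <= mean f.
Proof.
move=> d0; pose M := (Num.bound d^-1).+1.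
have Mp : 0 < M%:R :> R by rewrite ltr0n.
have Md : M%:R^-1 <= d.
  rewrite -[leRHS]invrK lef_pV2 ?posrE ?invr_gt0//.
  apply: (le_trans (ltW (archi_boundP _))); first by rewrite invr_ge0 ltW.
  by rewrite ler_nat.
exists (M%:R^-1 ^+ 2); first by rewrite exprn_gt0// invr_gt0.
move=> f c bf pf f0 fc.
apply: (cvgr_to_ge (mean_cvg bf)); apply: oo_ufil; exists M => // n /= Mn.
have [m mE] : exists m, n`! = (m * M)%N by exists (n`! %/ M)%N; rewrite divnK// dvdn_fact.
have sh p q : avg n (fun x => f (x + row2 (p%:R / M%:R) (q%:R / M%:R))) = avg n f.
  rewrite -[RHS](avg_shift n (p * m) (q * m) pf); congr avg; apply/funext => x.
  have m0 : m%:R != 0 :> R.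
    by rewrite pnatr_eq0; apply: contra_eq_neq mE => ->; rewrite mul0n -lt0n fact_gt0.
  have E (k : nat) : k%:R / M%:R = (k * m)%:R / n`!%:R :> R.
    by rewrite mE !natrM; field; rewrite m0 gt_eqF.
  by rewrite (E p) (E q).
have : avg n (fun=> c) <= avg n (fun x => \sum_(p < M) \sum_(q < M) f (x + row2 (p%:R / M%:R) (q%:R / M%:R))).
  apply: avg_le => x.
  have cov i : exists (p : 'I_M) (z : int), `|x ord0 i + p%:R / M%:R - x0 ord0 i - z%:~R| <= d.
    have [p [z h]] := frac_near (x ord0 i) (x0 ord0 i) (ltn0Sn _ : (0 < M)%N).
    have pM : (p %% M < M)%N by rewrite ltn_mod.
    exists (Ordinal pM), (z - (p %/ M)%N%:Z); apply: le_trans Md; apply: le_trans h.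
    rewrite le_eqVlt; apply/orP; left; apply/eqP; congr `|_|.
    have hp : p%:R = (p %/ M)%:R * M%:R + (p %% M)%:R :> R by rewrite -natrM -natrD -divn_eq.
    have hz : (z - (p %/ M)%N%:Z)%:~R = z%:~R - (p %/ M)%:R :> R by rewrite intrB.
    by rewrite hp hz /=; field; rewrite (gt_eqF Mp).
  have [p [z hp]] := cov 0; have [q [w hq]] := cov 1.
  have fx : c <= f (x + row2 (p%:R / M%:R) (q%:R / M%:R)).
    rewrite -(pf _ (row2 (- z) (- w))); apply: fc => i.
    have eqn (u v : R) : u = v -> `|u| <= `|v| by move=> ->.
    rewrite lattice_row2 !mxE; case: (ord2P i) => -> /=.
      by apply: le_trans hp; apply: eqn; rewrite intrN; ring.
    by apply: le_trans hq; apply: eqn; rewrite intrN; ring.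
  apply: (le_trans fx); rewrite (bigD1 p)//= (bigD1 q)//= -addrA lerDl.
  by rewrite addr_ge0// sumr_ge0// => *; rewrite ?sumr_ge0.
rewrite avg_cst; have -> : avg n (fun x => \sum_(p < M) \sum_(q < M)
    f (x + row2 (p%:R / M%:R) (q%:R / M%:R))) = M%:R ^+ 2 * avg n f.
  have av (I : Type) (r : seq I) (F : I -> plane -> R) :
      avg n (fun x => \sum_(i <- r) F i x) = \sum_(i <- r) avg n (F i).
    elim: r => [|i r IH].
      by under eq_fun do rewrite big_nil; rewrite big_nil avg_cst.
    by under eq_fun do rewrite big_cons; rewrite avgD IH big_cons.
  rewrite av; under eq_bigr do rewrite av; under eq_bigr do under eq_bigr do rewrite sh.
  by rewrite !sumr_const !card_ord -[_ *+ M *+ M]mulr_natl -[avg n f *+ M]mulr_natl; ring.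
by rewrite exprVn ler_pdivrMl// exprn_gt0.
Qed.

End Mean.

(** * The Hartley basis *)

Section Hartley.
Context {R : realType}.
Local Notation plane := 'rV[R]_2.
Local Notation idx := (int * int)%type.
Implicit Types (f g w : plane -> R) (x : plane) (k l : idx).

(** Hartley's kernel: a real orthonormal basis in one formula, with one integer index
per basis function. *)
Definition cas (t : R) : R := cos (2 * pi * t) + sin (2 * pi * t).

Lemma casN t : cas (- t) = cos (2 * pi * t) - sin (2 * pi * t).
Proof. by rewrite /cas mulrN cosN sinN. Qed.

Lemma cas_norm t : `|cas t| <= 2.
Proof.
apply: (le_trans (ler_normD _ _)); rewrite -[leRHS](_ : 1 + 1 = 2)//.
by apply: lerD; rewrite ler_norml ?cos_geN1 ?cos_le1 ?sin_geN1 ?sin_le1.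
Qed.

Lemma cas_periodic (z : int) t : cas (t + z%:~R) = cas t.
Proof.
have pc : periodic (fun y : R => cos (2 * pi * y)) 1.
  by move=> y; rewrite mulrDr mulr1 -mulrA [2 * pi]mulrC mulr_natr cosD2pi mulrA.
have ps : periodic (fun y : R => sin (2 * pi * y)) 1.
  by move=> y; rewrite mulrDr mulr1 -mulrA [2 * pi]mulrC mulr_natr sinD2pi mulrA.
by rewrite /cas (periodicz z t pc) (periodicz z t ps).
Qed.

(** Product-to-sum formula; both the orthonormality and the convolution structure of
multiplication operators come from it. *)
Lemma casM a b : cas a * cas b = 2^-1 * (cas (a - b) + cas (b - a) + cas (a + b) - cas (- (a + b))).
Proof.
rewrite -(opprB a b) !casN /cas (mulrBr (2 * pi)) (mulrDr (2 * pi)) cosB sinB cosD sinD.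
by field.
Qed.

Lemma cas_deriv : deriv cas (fun t => 2 * pi * cas (- t)).
Proof.
apply: (deriv_ext (derivD (deriv_cos2pi 0) (deriv_sin2pi 0))) => t; rewrite ?casN /= subr0 //.
by ring.
Qed.

(** The derivative is again Hartley's kernel at the opposite argument. *)
Lemma cas_taylor t h : `|cas (t + h) - cas t - h * (2 * pi * cas (- t))| <=
  2 * (2 * pi) ^+ 2 * h ^+ 2.
Proof.
have p0 : 0 <= 2 * pi :> R by rewrite mulr_ge0// pi_ge0.
apply: deriv_taylor cas_deriv _; first by rewrite mulr_ge0// sqr_ge0.
move=> y _; rewrite -mulrBr normrM (ger0_norm p0).
have -> : `|y - t| = `|- y - - t| by rewrite -[LHS]normrN; congr `|_|; ring.
have -> : 2 * (2 * pi) ^+ 2 * `|- y - - t| = 2 * pi * (2 * pi * 2 * `|- y - - t|) by ring.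
rewrite ler_wpM2l//; apply: (deriv_lipT _ _ cas_deriv) => u.
by rewrite normrM (ger0_norm p0) ler_wpM2l// cas_norm.
Qed.

Definition dot k x : R := k.1%:~R * x ord0 0 + k.2%:~R * x ord0 1.
Definition phi k x : R := cas (dot k x).
Definition comp k (i : 'I_2) : int := if i == 0 then k.1 else k.2.

Lemma dotD k x y : dot k (x + y) = dot k x + dot k y.
Proof. by rewrite /dot !mxE; ring. Qed.

Lemma dotDl k l x : dot (k + l) x = dot k x + dot l x.
Proof. by rewrite /dot /= !intrD; ring. Qed.

Lemma dotNl k x : dot (- k) x = - dot k x.
Proof. by rewrite /dot /= !intrN; ring. Qed.

Lemma dot_delta k i (t : R) : dot k (t *: delta_mx ord0 i) = t * (comp k i)%:~R.
Proof. by rewrite /dot /comp !mxE; case: (ord2P i) => -> /=; ring. Qed.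

Lemma phi_norm k x : `|phi k x| <= 2.
Proof. exact: cas_norm. Qed.

Lemma bnd_phi k : bnd (phi k).
Proof. by exists 2 => x; exact: phi_norm. Qed.

Lemma phi_periodic k : biperiodic (phi k).
Proof.
move=> x z; rewrite /phi dotD.
have -> : dot k (lattice z) = (k.1 * z ord0 0 + k.2 * z ord0 1)%:~R.
  by rewrite /dot !mxE intrD !intrM.
exact: cas_periodic.
Qed.

Lemma phi0 x : phi 0 x = 1.
Proof. by rewrite /phi /dot /= !mul0r addr0 /cas mulr0 cos0 sin0 addr0. Qed.

Lemma phiM k l x : phi k x * phi l x =
  2^-1 * (phi (k - l) x + phi (l - k) x + phi (k + l) x - phi (- (k + l)) x).
Proof. by rewrite /phi casM !dotNl !dotDl !dotNl. Qed.

Lemma phi_taylor k x h : `|phi k (x + h) - phi k x - 2 * pi * dot k h * phi (- k) x| <=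
  2 * (2 * pi) ^+ 2 * dot k h ^+ 2.
Proof.
rewrite /phi dotD dotNl; apply: le_trans (cas_taylor (dot k x) (dot k h)).
by rewrite mulrA (mulrC (dot k h)).
Qed.

Lemma mean_phi k : mean (phi k) = (k == 0)%:R.
Proof.
case: eqVneq => [->|k0].
  by rewrite -[RHS](mean_cst 1); congr mean; apply/funext => x; exact: phi0.
have [i ki] : exists i, comp k i != 0.
  apply: contrapT => H; move/negP: k0; apply; apply/eqP.
  rewrite (surjective_pairing k); congr pair; apply/eqP; rewrite -[_ == _]negbK.
    by apply/negP => h; apply: H; exists 0.
  by apply/negP => h; apply: H; exists 1.
have p0 : pi != 0 :> R by rewrite gt_eqF// pi_gt0.
pose a : R := 2 * pi * (comp (- k) i)%:~R.
have a0 : a != 0.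
  rewrite /a; have -> : comp (- k) i = - comp k i by rewrite /comp; case: ifP.
  by rewrite !mulf_neq0// intr_eq0 oppr_eq0.
have E : mean (fun x => a * phi k x) = 0.
  apply: (@mean_deriv _ i (phi (- k)) _ (2 * a ^+ 2)).
  - exact: bnd_phi.
  - exact: phi_periodic.
  - by apply: bndZ; exact: bnd_phi.
  - by rewrite mulr_ge0// sqr_ge0.
  - move=> x t _; have := phi_taylor (- k) x (t *: delta_mx ord0 i).
    rewrite opprK dot_delta => h.
    have -> : t * (a * phi k x) = 2 * pi * (t * (comp (- k) i)%:~R) * phi k x by rewrite /a; ring.
    by apply: (le_trans h); rewrite le_eqVlt; apply/orP; left; apply/eqP; rewrite /a; ring.
move: E; rewrite meanZ; last exact: bnd_phi.
by move/eqP; rewrite mulf_eq0 (negbTE a0) => /eqP.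
Qed.

Lemma mean_phiM_expand w k l : bnd w -> mean (fun x => w x * (phi k x * phi l x)) =
  2^-1 * (mean (fun x => w x * phi (k - l) x) + mean (fun x => w x * phi (l - k) x) +
   mean (fun x => w x * phi (k + l) x) - mean (fun x => w x * phi (- (k + l)) x)).
Proof.
move=> bw; have b m : bnd (fun x => w x * phi m x) by apply: bndM => //; exact: bnd_phi.
have -> : (fun x => w x * (phi k x * phi l x)) = fun x => 2^-1 * (w x * phi (k - l) x +
    w x * phi (l - k) x + w x * phi (k + l) x + (- 1) * (w x * phi (- (k + l)) x)).
  by apply/funext => x; rewrite phiM; ring.
have bs := bndD (bndD (b (k - l)) (b (l - k))) (b (k + l)).
rewrite meanZ; last by apply: bndD => //; exact: bndZ.
rewrite meanD//; last exact: bndZ.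
rewrite meanD//; last exact: bndD.
by rewrite meanD// meanZ// mulN1r.
Qed.

Lemma phi_orthonormal k l : mean (fun x => phi k x * phi l x) = (k == l)%:R.
Proof.
have e m : mean (fun x => 1 * phi m x) = (m == 0)%:R.
  by rewrite -mean_phi; congr mean; apply/funext => x; rewrite mul1r.
have -> : (fun x => phi k x * phi l x) = fun x => 1 * (phi k x * phi l x).
  by apply/funext => x; rewrite mul1r.
by rewrite (mean_phiM_expand k l (bndC 1)) !e !subr_eq0 oppr_eq0 (eq_sym l); field.
Qed.

Definition coef w k := mean (fun x => w x * phi k x).

(** The orthogonal complement of the basis, stable under multiplication by basis
functions. *)
Definition annihilates w := bnd w /\ forall k, coef w k = 0.

Lemma annihilates_phi w k : annihilates w -> annihilates (fun x => w x * phi k x).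
Proof.
move=> [bw zw]; split; first by apply: bndM => //; exact: bnd_phi.
move=> l; rewrite /coef; under eq_fun do rewrite -mulrA.
by rewrite mean_phiM_expand// -!/(coef w _) !zw; ring.
Qed.

Lemma annihilates_lin (a b : R) f g : annihilates f -> annihilates g ->
  annihilates (fun x => a * f x + b * g x).
Proof.
move=> [bf zf] [bg zg]; split; first by apply: bndD; exact: bndZ.
move=> l; rewrite /coef.
have bp h : bnd h -> bnd (fun x => h x * phi l x) by move=> bh; apply: bndM => //; exact: bnd_phi.
have -> : (fun x => (a * f x + b * g x) * phi l x) =
  fun x => a * (f x * phi l x) + b * (g x * phi l x) by apply/funext => x; ring.
rewrite meanD ?meanZ; try exact: bp; try by apply: bndZ; exact: bp.
by rewrite -!/(coef _ _) zf zg !mulr0 addr0.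
Qed.

(** [cos (2 pi (x_i - a))] is a combination of two basis functions. *)
Lemma annihilates_peak w (i : 'I_2) (a : R) : annihilates w ->
  annihilates (fun x => w x * ((1 + cos (2 * pi * (x ord0 i - a))) / 2)).
Proof.
move=> zw; pose e : idx := if i == 0 then (1, 0) else (0, 1).
pose A := (cos (2 * pi * a) + sin (2 * pi * a)) / 2.
pose B := (cos (2 * pi * a) - sin (2 * pi * a)) / 2.
have de x : dot e x = x ord0 i.
  by rewrite /dot /e; case: (ord2P i) => -> /=; rewrite ?mul1r ?mul0r ?addr0 ?add0r.
have h1 := annihilates_lin A B (annihilates_phi e zw) (annihilates_phi (- e) zw).
have h2 := annihilates_lin 2^-1 2^-1 zw h1.
rewrite (_ : (fun x => _) = (fun x => 2^-1 * w x + 2^-1 *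
   (A * (w x * phi e x) + B * (w x * phi (- e) x))))//.
apply/funext => x; rewrite /phi dotNl casN de /cas mulrBr cosB /A /B; by field.
Qed.

Lemma plane_nbhs w x0 (e : R) : {for x0, continuous w} -> 0 < e ->
  exists2 d, 0 < d & forall x, (forall i, `|x ord0 i - x0 ord0 i| <= d) -> `|w x - w x0| < e.
Proof.
move=> /cvgrPdist_lt/(_ e) cw e0; have := cw e0 => /nbhs_ballP[d /= d0 H].
exists (d / 2); first by rewrite divr_gt0.
move=> x hx; rewrite distrC; apply: H; split=> // i j.
rewrite (ord1 i) /ball /= distrC; apply: le_lt_trans (hx j) _.
by rewrite ltr_pdivrMr// mulr2n mulrDr mulr1 ltrDl.
Qed.

(** If [w] is positive at a point, multiply it by high powers of a trigonometric
polynomial peaked there: the positive part near the peak dominates, while all these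
products have mean zero. *)
Lemma complete_le0 w : continuous w -> biperiodic w -> annihilates w -> forall x, w x <= 0.
Proof.
move=> cw pw zw x0; rewrite leNgt; apply/negP => w0.
have [bw _] := zw; have [B hB] := bw.
have B0 : 0 <= B by apply: le_trans (hB x0).
pose c := w x0 / 2; have c0 : 0 < c by rewrite divr_gt0.
have [d1 d10 hd1] := plane_nbhs (cw x0) c0.
pose d := Num.min d1 (1 / 4).
have d0 : 0 < d by rewrite lt_min d10 divr_gt0.
have dd1 : d <= d1 by rewrite ge_min lexx.
have d2 : d < 2^-1.
  by apply: (@le_lt_trans _ _ (1 / 4)); [rewrite ge_min lexx orbT|lra].
have dI : 0 < d < 2^-1 by rewrite d0.
pose C (i : 'I_2) x := (1 + cos (2 * pi * (x ord0 i - x0 ord0 i))) / 2.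
have C0 i x : 0 <= C i x.
  by rewrite /C; have := cos_geN1 (2 * pi * (x ord0 i - x0 ord0 i)); lra.
have C1 i x : C i x <= 1.
  by rewrite /C; have := cos_le1 (2 * pi * (x ord0 i - x0 ord0 i)); lra.
pose P x := C 0 x * C 1 x.
have P0 x : 0 <= P x by rewrite mulr_ge0.
have P1 x : P x <= 1 by rewrite /P -[leRHS]mulr1 ler_pM.
pose r := (1 + cos (2 * pi * d)) / 2.
have r0 : 0 <= r by rewrite /r; have := cos_geN1 (2 * pi * d); lra.
have r1 : r < 1 by rewrite /r; have [h _] := cos_near 0 dI; lra.
have near x : r < P x -> c <= w x.
  move=> rP.
  have rC i : r < C i x.
    apply: (lt_le_trans rP); case: (ord2P i) => ->; rewrite /P.
      by rewrite -[leRHS]mulr1 ler_wpM2l.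
    by rewrite -[leRHS]mul1r ler_wpM2r.
  have cc i : exists m : int, `|x ord0 i - x0 ord0 i - m%:~R| < d.
    have [_ h] := cos_near (x0 ord0 i) dI; apply: h.
    by have := rC i; rewrite /r /C; lra.
  have [m1 h1] := cc 0; have [m2 h2] := cc 1.
  rewrite -(pw x (row2 (- m1) (- m2))).
  suff : `|w (x + lattice (row2 (- m1) (- m2))) - w x0| < c.
    by rewrite ltr_norml /c => /andP[+ _]; lra.
  apply: hd1 => i; apply: le_trans dd1; apply/ltW.
  have eqn (u v : R) : u = v -> `|v| < d -> `|u| < d by move=> ->.
  rewrite lattice_row2 !mxE; case: (ord2P i) => -> /=.
    by apply: (eqn _ _ _ h1); rewrite intrN; ring.
  by apply: (eqn _ _ _ h2); rewrite intrN; ring.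
(* far from the peak P is at most r, and close to it at least r' > r *)
pose r' := (1 + r) / 2.
have r'0 : 0 < r' by rewrite /r'; lra.
have rr' : r < r' by rewrite /r'; lra.
have [d' d'0 hd'] : exists2 d', 0 < d' & forall x, (forall i, `|x ord0 i - x0 ord0 i| <= d') -> r' <= P x.
  have pi2 : 0 < 2 * pi :> R by rewrite mulr_gt0// pi_gt0.
  pose eta := (1 - r') / (2 * (2 * pi) ).
  have eta0 : 0 < eta by rewrite divr_gt0 ?mulr_gt0// ?pi_gt0// /r'; lra.
  exists eta => // x hx.
  have hC i : 1 - (1 - r') / 2 <= C i x.
    have l1 := deriv_lipT (x ord0 i) (x0 ord0 i) (deriv_cos2pi (x0 ord0 i)) (C := 2 * pi).
    have /l1 : forall y : R, `|- (2 * pi) * sin (2 * pi * (y - x0 ord0 i))| <= 2 * pi.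
      move=> y; rewrite normrM normrN (ger0_norm (ltW pi2)) ger_pMr//.
      by rewrite ler_norml sin_geN1 sin_le1.
    rewrite subrr mulr0 cos0 => h.
    have : 2 * pi * `|x0 ord0 i - x ord0 i| <= (1 - r') / 2.
      apply: (le_trans (_ : _ <= 2 * pi * eta)); first by rewrite distrC ler_wpM2l// ltW.
      by rewrite /eta; move: pi2; set pp := 2 * pi; move=> pp0; rewrite le_eqVlt; apply/orP; left;
        apply/eqP; field; rewrite gt_eqF.
    move/(le_trans h); rewrite ler_norml => /andP[_ h1]; rewrite /C.
    have : 0 <= 1 - r' by rewrite /r'; lra.
    by lra.
  have h0 := hC 0; have h1 := hC 1.
  have s0 : 0 <= 1 - (1 - r') / 2 by rewrite /r'; lra.
  apply: (le_trans _ (ler_pM s0 s0 h0 h1)).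
  by have := sqr_ge0 (1 - r'); nra.
pose d3 := Num.min d d'.
have zn n : annihilates (fun x => w x * P x ^+ n).
  elim: n => [|n IH]; first by under eq_fun do rewrite expr0 mulr1.
  have := annihilates_peak 1 (x0 ord0 1) (annihilates_peak 0 (x0 ord0 0) IH).
  rewrite (_ : (fun x => _ * _ * _) = (fun x => w x * P x ^+ n.+1))//.
  by apply/funext => x; rewrite exprS /P /C; ring.
have d30 : 0 < d3 by rewrite lt_min d0.
have [k3 k30 hk3] := mean_pos x0 d30.
have main n : k3 * (c * r' ^+ n) <= B * r ^+ n.
  have bwP : bnd (fun x => w x * P x ^+ n) := (zn n).1.
  have pos x : 0 <= w x * P x ^+ n + B * r ^+ n.
    have [rP|Pr] := ltP r (P x).
      by rewrite addr_ge0// mulr_ge0 ?exprn_ge0// (le_trans (ltW c0))// near.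
    rewrite -lerBlDr sub0r; apply: le_trans (_ : - (`|w x| * P x ^+ n) <= _).
      by rewrite lerN2 ler_pM ?exprn_ge0// lerXn2r// nnegrE.
    by rewrite -mulNr ler_wpM2r ?exprn_ge0// lerNl -normrN ler_norm.
  have := hk3 (fun x => w x * P x ^+ n + B * r ^+ n) (c * r' ^+ n) _ _ pos.
  rewrite meanD//; last exact: bndC.
  have -> : mean (fun x => w x * P x ^+ n) = 0.
    by have := (zn n).2 0; rewrite /coef; under eq_fun do rewrite phi0 mulr1.
  rewrite mean_cst add0r; apply.
  - by apply: bndD => //; exact: bndC.
  - move=> x z; rewrite pw; congr (_ * _ ^+ _ + _).
    have Cz i : C i (x + lattice z) = C i x.
      have per : periodic (fun y : R => cos (2 * pi * y)) 1.
        by move=> y; rewrite mulrDr mulr1 -mulrA [2 * pi]mulrC mulr_natr cosD2pi mulrA.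
      by rewrite /C !mxE addrAC (periodicz (z ord0 i) _ per).
    by rewrite /P !Cz.
  - move=> x hx.
    have P' : r' <= P x.
      by apply: hd' => i; apply: le_trans (hx i) _; rewrite ge_min lexx orbT.
    apply: (@le_trans _ _ (w x * P x ^+ n)); last by rewrite lerDl mulr_ge0// exprn_ge0.
    apply: ler_pM; rewrite ?(ltW c0) ?exprn_ge0 ?(ltW r'0)//.
      by apply: near; exact: lt_le_trans P'.
    by rewrite lerXn2r// nnegrE ?(ltW r'0).
have q1 : `|r / r'| < 1.
  have q0 : 0 <= r / r' by rewrite divr_ge0// ltW.
  by rewrite (ger0_norm q0) ltr_pdivrMr// mul1r.
have cv : (fun n => B * (r / r') ^+ n) @ \oo --> B * 0.
  by apply: cvgMr; exact: cvg_expr.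
rewrite mulr0 in cv.
have : k3 * c <= 0.
  apply: (cvgr_to_ge cv); apply: filterE => n.
  have -> : B * (r / r') ^+ n = B * r ^+ n / r' ^+ n by rewrite expr_div_n mulrA.
  by rewrite ler_pdivlMr ?exprn_gt0// -mulrA; exact: main.
by rewrite leNgt mulr_gt0.
Qed.

Lemma complete w : continuous w -> biperiodic w -> bnd w -> (forall k, coef w k = 0) ->
  forall x, w x = 0.
Proof.
move=> cw pw bw zw x; apply/le_anti; rewrite (complete_le0 cw pw (conj bw zw))/=.
have zN : annihilates (fun x => - w x).
  have := annihilates_lin (-1) 0 (conj bw zw) (conj bw zw).
  by under eq_fun do rewrite mul0r addr0 mulN1r.
have := complete_le0 _ _ zN x; rewrite oppr_le0; apply.
  by move=> y; apply: continuousN; exact: cw.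
by move=> y z; rewrite pw.
Qed.

End Hartley.

(** * Smooth functions on the torus *)

Section TorusSmooth.
Context {R : realType}.
Local Notation plane := 'rV[R]_2.
Local Notation idx := (int * int)%type.
Implicit Types (f g w : plane -> R) (x : plane) (k l : idx).

(** The candidate differential, packaged as a linear form. *)
Definition lform (l : 'I_2 -> R) (h : plane) : R^o := \sum_i h ord0 i * l i.

Fact lform_linear (l : 'I_2 -> R) : linear (lform l).
Proof.
move=> a u v; rewrite /lform scaler_sumr -big_split; apply: eq_bigr => i _.
by rewrite !mxE mulrDl /= /GRing.scale /= mulrA.
Qed.

HB.instance Definition _ (l : 'I_2 -> R) := GRing.isLinear.Build R plane R^o _ (lform l) (lform_linear l).

Lemma lform_continuous (l : 'I_2 -> R) : continuous (lform l).
Proof.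
have -> : lform l = (fun h : plane => h ord0 0 * l 0 + h ord0 1 * l 1) :> (plane -> R).
  by apply/funext => h; rewrite /lform sum2.
by apply: contD; apply: contM; first [exact: cst_continuous|move=> y; exact: coord_continuous].
Qed.

Lemma entry_le_norm x i : `|x ord0 i| <= `|x|.
Proof. by rewrite [leRHS]/Num.Def.normr/= mx_normrE; apply/bigmax_geP; right => /=; exists (ord0, i). Qed.

Lemma differentiable_quad f x (l : 'I_2 -> R) (C : R) :
  (forall h, `|f (x + h) - f x - lform l h| <= C * (h ord0 0 ^+ 2 + h ord0 1 ^+ 2)) ->
  differentiable f x /\ forall i, partial i f x = l i.
Proof.
move=> H.
have C0 : 0 <= C.
  have := H (row2 1 0); rewrite row2_0 row2_1 expr1n expr0n addr0 mulr1.
  exact: le_trans.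
have o : (f : plane -> R^o) \o shift x = cst (f x) + lform l +o_ (0 : plane) id.
  apply/eqaddoP => _/posnumP[e]; near=> h.
  have -> : ((f : plane -> R^o) \o shift x - (cst (f x) + lform l)) h = f (x + h) - f x - lform l h.
    by rewrite !fctE /= [h + x]addrC opprD addrA.
  apply: (le_trans (H h)).
  have hn : h ord0 0 ^+ 2 + h ord0 1 ^+ 2 <= 2 * `|h| * `|h|.
    have b i : h ord0 i ^+ 2 <= `|h| * `|h|.
      by rewrite -(real_normK (num_real (h ord0 i))) expr2 ler_pM// entry_le_norm.
    by have := b 0; have := b 1; rewrite -mulrA; lra.
  apply: (le_trans (ler_wpM2l C0 hn)); rewrite mulrA; apply: ler_wpM2r => //.
  have : `|h| <= e%:num / (2 * C + 1).
    by near: h; apply: (@nbhs0_le _ plane); rewrite divr_gt0//; lra.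
  rewrite ler_pdivlMr; last by lra.
  by apply: le_trans; have := normr_ge0 h; nra.
have dE := diff_unique (@lform_continuous l) o.
have df : differentiable (f : plane -> R^o) x.
  apply/diff_locallyP; rewrite dE; split=> //; exact: lform_continuous.
split=> // i; rewrite /partial (deriveE _ df) dE; change (lform l (delta_mx ord0 i) = l i).
rewrite /lform (bigD1 i)//= big1 ?addr0.
  by rewrite mxE !eqxx mul1r.
by move=> j ji; rewrite mxE (negbTE ji) andbF mul0r.
Unshelve. all: by end_near. Qed.

Lemma smooth_diff w x : torus_smooth w -> differentiable w x.
Proof. by move=> [h _]; exact: (h [::]). Qed.

Lemma smooth_continuous w : torus_smooth w -> continuous w.
Proof. by move=> sw x; apply: differentiable_continuous; exact: smooth_diff. Qed.

Lemma smooth_partial w i : torus_smooth w -> torus_smooth (partial i w).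
Proof.
move=> [d p]; split.
  by move=> s x; have := d (rcons s i) x; rewrite foldr_rcons.
move=> x z; rewrite /partial /derive.
have -> // : (fun h : R => h^-1 *: ((w \o shift (x + lattice z)) (h *: delta_mx ord0 i) - w (x + lattice z))) =
  (fun h => h^-1 *: ((w \o shift x) (h *: delta_mx ord0 i) - w x)).
by apply/funext => h /=; rewrite addrA !p.
Qed.

Lemma smooth_line w i x t : torus_smooth w ->
  is_derive t (1:R) (fun s : R => w (x + s *: delta_mx ord0 i)) (partial i w (x + t *: delta_mx ord0 i)).
Proof.
move=> sw; have dw := smooth_diff (x + t *: delta_mx ord0 i) sw.
have dv := @diff_derivable _ _ _ w _ (delta_mx ord0 i) dw.
have H : (fun h : R => h^-1 *: (((fun s : R => w (x + s *: delta_mx ord0 i)) \o shift t) (h *: (1:R)) -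
    w (x + t *: delta_mx ord0 i))) =
    (fun h => h^-1 *: ((w \o shift (x + t *: delta_mx ord0 i)) (h *: delta_mx ord0 i) - w (x + t *: delta_mx ord0 i))).
  apply/funext => h /=; congr (_ *: (w _ - _)).
  by rewrite [h *: 1]mulr1 scalerDl addrCA.
split; first by rewrite /derivable H; exact: dv.
by rewrite /partial /derive H.
Qed.

(** Every point is equivalent to one of the compact unit square. *)
Lemma smooth_bnd w : torus_smooth w -> bnd w.
Proof.
move=> sw; have [_ pw] := sw.
pose A := fun _ : 'I_2 => [set` `[0 : R, 1]].
have cpt : compact [set v : plane | forall i, A i (v ord0 i)].
  by apply: rV_compact => i; exact: segment_compact.
have cn : {within [set v : plane | forall i, A i (v ord0 i)], continuous (fun x => `|w x|)}.
  apply: continuous_subspaceT => x; apply: continuous_comp; first exact: smooth_continuous.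
  exact: norm_continuous.
have ne : [set v : plane | forall i, A i (v ord0 i)] !=set0.
  by exists 0 => i; rewrite /A /= in_itv /= mxE lexx ler01.
have [x0 _ mx] := compact_EVT_max ne cpt cn.
exists `|w x0| => x; pose z : 'rV[int]_2 := \row_i (- Num.floor (x ord0 i)).
rewrite -(pw x z); apply: mx; rewrite inE => i; rewrite /A /= in_itv /= !mxE intrN.
by have /andP[h1 h2] := floor_itv (x ord0 i); rewrite intrD in h2; apply/andP; split; lra.
Qed.
End TorusSmooth.

(** * Decay of Fourier coefficients *)

Section Decay.
Context {R : realType}.
Local Notation plane := 'rV[R]_2.
Local Notation idx := (int * int)%type.
Implicit Types (f g w : plane -> R) (x : plane) (k l : idx).

(** Taylor's formula along a coordinate line, uniform by boundedness of the second
derivative. *)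
Lemma smooth_taylor w i : torus_smooth w -> exists2 C, 0 <= C &
  forall x t, `|w (x + t *: delta_mx ord0 i) - w x - t * partial i w x| <= C * t ^+ 2.
Proof.
move=> sw; have s1 := smooth_partial i sw; have s2 := smooth_partial i s1.
have [C hC] := smooth_bnd s2; have C0 : 0 <= C by apply: le_trans (hC 0).
exists C => // x t.
have d1 : deriv (fun s : R => w (x + s *: delta_mx ord0 i)) (fun s => partial i w (x + s *: delta_mx ord0 i)).
  by move=> s; exact: smooth_line.
have d2 : deriv (fun s : R => partial i w (x + s *: delta_mx ord0 i))
    (fun s => partial i (partial i w) (x + s *: delta_mx ord0 i)).
  by move=> s; exact: smooth_line.
have := @deriv_taylor _ _ _ C 0 t C0 d1.
rewrite add0r scale0r addr0; apply => y _.
by have := deriv_lipT 0 y d2 (fun u => hC _); rewrite scale0r addr0.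
Qed.

Lemma phi_line k x i (t : R) :
  `|phi k (x + t *: delta_mx ord0 i) - phi k x - t * (2 * pi * (comp k i)%:~R * phi (- k) x)| <=
  2 * (2 * pi) ^+ 2 * (comp k i)%:~R ^+ 2 * t ^+ 2.
Proof.
have := phi_taylor k x (t *: delta_mx ord0 i); rewrite dot_delta => h.
have -> : t * (2 * pi * (comp k i)%:~R * phi (- k) x) = 2 * pi * (t * (comp k i)%:~R) * phi (- k) x by ring.
by apply: (le_trans h); rewrite le_eqVlt; apply/orP; left; apply/eqP; ring.
Qed.

(** Integration by parts against a basis function. *)
Lemma coef_partial w i k : torus_smooth w ->
  coef (partial i w) k = - (2 * pi * (comp k i)%:~R * coef w (- k)).
Proof.
move=> sw; have [C1 C10 t1] := smooth_taylor i sw.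
have bw := smooth_bnd sw; have bp := smooth_bnd (smooth_partial i sw).
have [B hB] := bw; have [B' hB'] := bp.
have B0 : 0 <= B by apply: le_trans (hB 0).
have B'0 : 0 <= B' by apply: le_trans (hB' 0).
pose a : R := 2 * pi * (comp k i)%:~R.
pose C2 : R := 2 * (2 * pi) ^+ 2 * (comp k i)%:~R ^+ 2.
have C20 : 0 <= C2 by rewrite mulr_ge0 ?sqr_ge0// mulr_ge0 ?sqr_ge0.
have bphi l : bnd (phi l : plane -> R) := bnd_phi l.
have : mean (fun x => partial i w x * phi k x + a * (w x * phi (- k) x)) = 0.
  apply: (@mean_deriv _ i (fun x => w x * phi k x) _ (B' * `|a| * 2 + C1 * 2 + (B + B') * C2)).
  - exact: bndM.
  - by move=> x z; rewrite sw.2 phi_periodic.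
  - by apply: bndD; [exact: bndM|apply: bndZ; exact: bndM].
  - exact: (addr_ge0 (addr_ge0 (mulr_ge0 (mulr_ge0 B'0 (normr_ge0 a)) (ler0n _ 2))
      (mulr_ge0 C10 (ler0n _ 2))) (mulr_ge0 (addr_ge0 B0 B'0) C20)).
  - move=> x t t1'; set y := x + _.
    have r1 := t1 x t; have r2 := phi_line k x i t; rewrite -/y -/a -/C2 in r1 r2.
    rewrite (_ : _ - _ - _ = (w y - w x - t * partial i w x) * phi k y +
      (w x + t * partial i w x) * (phi k y - phi k x - t * (a * phi (- k) x)) +
      t ^+ 2 * (partial i w x * (a * phi (- k) x))); last by ring.
    have p2 l (z : plane) : `|phi l z| <= 2 := phi_norm l z.
    have t2 : 0 <= t ^+ 2 := sqr_ge0 t.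
    have hX : `|(w y - w x - t * partial i w x) * phi k y| <= C1 * t ^+ 2 * 2.
      by rewrite normrM; apply: ler_pM.
    have hY : `|(w x + t * partial i w x) * (phi k y - phi k x - t * (a * phi (- k) x))| <=
        (B + B') * (C2 * t ^+ 2).
      rewrite normrM; apply: ler_pM => //.
      apply: (le_trans (ler_normD _ _)); apply: lerD => //.
      by rewrite normrM -[leRHS]mul1r ler_pM.
    have hZ : `|t ^+ 2 * (partial i w x * (a * phi (- k) x))| <= t ^+ 2 * (B' * (`|a| * 2)).
      by rewrite normrM (ger0_norm t2) ler_wpM2l// !normrM ler_pM// ler_wpM2l.
    apply: (le_trans (ler_normD _ _)); apply: (le_trans (lerD (le_trans (ler_normD _ _) (lerD hX hY)) hZ)).
    by rewrite le_eqVlt; apply/orP; left; apply/eqP; ring.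
rewrite meanD; [|exact: bndM|by apply: bndZ; exact: bndM].
rewrite meanZ; last exact: bndM.
by move/eqP; rewrite addr_eq0 => /eqP h; exact: h.
Qed.

Lemma coef_partial2 w i k : torus_smooth w ->
  coef (partial i (partial i w)) k = - (2 * pi * (comp k i)%:~R) ^+ 2 * coef w k.
Proof.
move=> sw; rewrite coef_partial; last exact: smooth_partial.
rewrite coef_partial// opprK.
have -> : comp (- k) i = - comp k i by rewrite /comp; case: ifP.
by rewrite intrN; ring.
Qed.

(** The symbol of 1 minus the Laplacian, up to normalisation. *)
Definition wt k : R := 1 + k.1%:~R ^+ 2 + k.2%:~R ^+ 2.

Lemma wt_ge1 k : 1 <= wt k.
Proof. by rewrite /wt -addrA lerDl addr_ge0 ?sqr_ge0. Qed.

Lemma wt_gt0 k : 0 < wt k.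
Proof. exact: lt_le_trans ltr01 (wt_ge1 k). Qed.

Lemma wtN k : wt (- k) = wt k.
Proof. by rewrite /wt /= !intrN !sqrrN. Qed.

(** Peetre's inequality, which makes decay compatible with convolution. *)
Lemma wt_peetre k l : wt (k + l) <= 2 * wt k * wt l.
Proof.
rewrite /wt /= !intrD; set a := k.1%:~R; set b := k.2%:~R; set c := l.1%:~R; set d := l.2%:~R.
have := sqr_ge0 (a - c); have := sqr_ge0 (b - d).
have := sqr_ge0 (a * c); have := sqr_ge0 (a * d); have := sqr_ge0 (b * c); have := sqr_ge0 (b * d).
by have := sqr_ge0 a; have := sqr_ge0 b; have := sqr_ge0 c; have := sqr_ge0 d; nra.
Qed.

Lemma coef_norm w k (C : R) : (forall x, `|w x| <= C) -> `|coef w k| <= C * 2.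
Proof. by move=> h; apply: mean_norm => x; rewrite normrM ler_pM// phi_norm. Qed.

(** Each factor [wt k] is paid for by two derivatives. *)
Lemma coef_decay s w : torus_smooth w -> exists2 C, 0 <= C & forall k, `|coef w k| * wt k ^+ s <= C.
Proof.
elim: s w => [|s IH] w sw.
  have [C hC] := smooth_bnd sw; have C0 : 0 <= C by apply: le_trans (hC 0).
  by exists (C * 2); rewrite ?mulr_ge0// => k; rewrite expr0 mulr1; exact: coef_norm.
have [C C0 hC] := IH w sw.
have [D D0 hD] := IH _ (smooth_partial 0 (smooth_partial 0 sw)).
have [E E0 hE] := IH _ (smooth_partial 1 (smooth_partial 1 sw)).
exists (C + D + E); first by rewrite !addr_ge0.
move=> k; have e i : `|coef (partial i (partial i w)) k| = (2 * pi) ^+ 2 * (comp k i)%:~R ^+ 2 * `|coef w k|.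
  by rewrite (coef_partial2 i k sw) normrM normrN (ger0_norm (sqr_ge0 _)) exprMn.
have P0 : 0 <= `|coef w k| * wt k ^+ s by rewrite mulr_ge0// exprn_ge0// ltW// wt_gt0.
have p1 : 1 <= (2 * pi) ^+ 2 :> R.
  by rewrite exprn_ege1//; have := pi_ge2 R; lra.
have big i (Q : R) : `|coef (partial i (partial i w)) k| * wt k ^+ s <= Q ->
    (comp k i)%:~R ^+ 2 * (`|coef w k| * wt k ^+ s) <= Q.
  rewrite e; apply: le_trans; move: P0 (sqr_ge0 (comp k i)%:~R : 0 <= _ :> R).
  set c := (comp k i)%:~R ^+ 2; set u := `|coef w k|; set v := wt k ^+ s => P0 c0.
  have -> : (2 * pi) ^+ 2 * c * u * v = (2 * pi) ^+ 2 * (c * (u * v)) by ring.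
  by apply: ler_peMl => //; exact: mulr_ge0.
have h2 := big 0 _ (hD k); have h3 := big 1 _ (hE k); have h1 := hC k.
have -> : `|coef w k| * wt k ^+ s.+1 = `|coef w k| * wt k ^+ s +
    (comp k 0)%:~R ^+ 2 * (`|coef w k| * wt k ^+ s) +
    (comp k 1)%:~R ^+ 2 * (`|coef w k| * wt k ^+ s).
  by rewrite exprS {1}/wt /comp /=; ring.
by apply: lerD => //; apply: lerD.
Qed.

Lemma ler_sum_uniq (I : eqType) (r r' : seq I) (F : I -> R) : (forall i, 0 <= F i) ->
  uniq r -> {subset r <= r'} -> \sum_(i <- r) F i <= \sum_(i <- r') F i.
Proof.
move=> F0; elim: r r' => [|i r IH] r' /=.
  by move=> _ _; rewrite big_nil sumr_ge0.
move=> /andP[ir ur] sub; have ir' : i \in r' by apply: sub; exact: mem_head.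
have pr := perm_to_rem ir'; rewrite (perm_big _ pr) !big_cons lerD2l; apply: IH => // j jr.
have : j \in i :: rem i r' by rewrite -(perm_mem pr) sub// inE jr orbT.
by rewrite inE => /predU1P[ji|//]; rewrite -ji jr in ir.
Qed.

(** Compare with the telescoping series of [3 / ((n + 1)(n + 2))]. *)
Lemma sum_nat_sqr (r : seq nat) : uniq r -> \sum_(n <- r) (1 + n%:R ^+ 2)^-1 <= 3 :> R.
Proof.
move=> ur; pose N := (\max_(n <- r) n).+1.
have tele M : \sum_(n < M) (1 + n%:R ^+ 2)^-1 <= 3 - 3 * M.+1%:R^-1 :> R.
  elim: M => [|M IH]; first by rewrite big_ord0 invr1 mulr1 subrr.
  rewrite big_ord_recr/=; apply: (le_trans (lerD IH (lexx _))).
  have M0 : 0 <= M%:R :> R := ler0n _ _.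
  rewrite -[M.+2%:R]natr1 -[M.+1%:R]natr1; move: M0; set y := M%:R => y0.
  rewrite -subr_ge0.
  have -> : 3 - 3 * (y + 1 + 1)^-1 - (3 - 3 * (y + 1)^-1 + (1 + y ^+ 2)^-1) =
    (2 * y ^+ 2 - 3 * y + 1) / ((y + 1) * (y + 1 + 1) * (1 + y ^+ 2)).
    by field; rewrite !gt_eqF//; nra.
  apply: divr_ge0; last by rewrite !mulr_ge0//; nra.
  rewrite /y; case: M {IH y y0} => [|M]; first by rewrite expr0n !mulr0; lra.
  have : 1 <= M.+1%:R :> R by rewrite ler1n.
  by nra.
have sub : {subset r <= index_iota 0 N}.
  by move=> n nr; rewrite mem_index_iota /= ltnS (leq_bigmax_seq _ nr).
apply: (le_trans (ler_sum_uniq (F := fun n => (1 + n%:R ^+ 2)^-1) _ ur sub)).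
  by move=> n; rewrite invr_ge0 addr_ge0// sqr_ge0.
rewrite big_mkord; apply: (le_trans (tele N)).
by rewrite lerBlDr lerDl mulr_ge0// invr_ge0.
Qed.

Lemma sum_int_sqr (r : seq int) : uniq r -> \sum_(j <- r) (1 + j%:~R ^+ 2)^-1 <= 6 :> R.
Proof.
move=> ur; rewrite (bigID (fun j : int => 0 <= j)) /=.
have half (p : pred int) : {in p &, injective absz} ->
    \sum_(j <- r | p j) (1 + j%:~R ^+ 2)^-1 <= 3 :> R.
  move=> inj; rewrite -big_filter.
  rewrite (eq_bigr (fun j => (1 + (`|j|%N)%:R ^+ 2)^-1)); last first.
    move=> j _; congr (_ + _)^-1.
    by rewrite -[LHS](real_normK (num_real _)) -intr_norm -abszE.
  rewrite -(big_map absz xpredT (fun n : nat => (1 + n%:R ^+ 2)^-1)); apply: sum_nat_sqr.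
  rewrite map_inj_in_uniq ?filter_uniq// => i j.
  by rewrite !mem_filter => /andP[pi' _] /andP[pj _]; exact: inj.
rewrite -[6](_ : 3 + 3 = 6); last by ring.
apply: lerD; apply: half => i j; rewrite !unfold_in /= => hi hj h.
  by move: hi hj h; clear; case: i => i; case: j => j //= _ _ ->.
by move: hi hj h; clear; case: i => i; case: j => j //= _ _ [->].
Qed.

(** The square of the weight dominates a product of one-dimensional weights. *)
Lemma sum_wt (r : seq idx) : uniq r -> \sum_(k <- r) (wt k ^+ 2)^-1 <= 36.
Proof.
move=> ur; pose f (j : int) : R := (1 + j%:~R ^+ 2)^-1.
have f0 j : 0 <= f j by rewrite invr_ge0 addr_ge0// sqr_ge0.
apply: (@le_trans _ _ (\sum_(k <- r) f k.1 * f k.2)).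
  apply: ler_sum => k _; rewrite /f -invfM lef_pV2 ?posrE ?exprn_gt0 ?wt_gt0//.
    rewrite /wt; set a := k.1%:~R; set b := k.2%:~R.
    have := sqr_ge0 a; have := sqr_ge0 b; have := sqr_ge0 (a * b); have := sqr_ge0 (a ^+ 2); have := sqr_ge0 (b ^+ 2); nra.
  by rewrite mulr_gt0// ltr_pwDl// sqr_ge0.
pose r1 := undup (map fst r); pose r2 := undup (map snd r).
apply: (le_trans (ler_sum_uniq (r' := [seq (i, j) | i <- r1, j <- r2])
    (F := fun k : idx => f k.1 * f k.2) _ ur _)).
- by move=> k; rewrite mulr_ge0.
- move=> [i j] kr; apply: allpairs_f; rewrite mem_undup.
    by apply/mapP; exists (i, j).
  by apply/mapP; exists (i, j).
rewrite big_allpairs/=; under eq_bigr do rewrite -mulr_sumr.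
rewrite -mulr_suml -[36](_ : 6 * 6 = 36); last by ring.
by apply: ler_pM; rewrite ?sumr_ge0// sum_int_sqr// undup_uniq.
Qed.

Lemma idx_enum : exists b : nat -> idx, bijective b.
Proof.
have inf : ~ finite_set [set: idx].
  move=> fin; apply: infinite_nat.
  apply: (sub_finite_set _ (finite_image (fun k : idx => `|k.1|%N) fin)) => n _.
  by exists (n%:Z, 0).
have /card_set_bijP[f] := eq_card_nat (countableP [set: idx]) inf.
rewrite setTT_bijective => -[g fg gf]; exists g; exact: Bijective gf fg.
Qed.

(** An enumeration of the frequencies, so that sums over them are series. *)
Definition freq : nat -> idx := sval (cid idx_enum).

Lemma freq_bij : bijective freq.
Proof. by rewrite /freq; case: cid. Qed.

Lemma freq_inj : injective freq.
Proof. exact: bij_inj freq_bij. Qed.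

Lemma freq_onto k : exists n, freq n = k.
Proof. by have [g _ gf] := freq_bij; exists (g k). Qed.

Lemma smb_wt (h : idx -> idx) : injective h -> smb (fun n => (wt (h (freq n)) ^+ 2)^-1).
Proof.
move=> ih; exists 36 => N.
apply: le_trans (_ : \sum_(k <- map (h \o freq) (index_iota 0 N)) (wt k ^+ 2)^-1 <= _).
  rewrite big_map big_mkord; apply: ler_sum => i _.
  by rewrite ger0_norm// invr_ge0 sqr_ge0.
apply: sum_wt; rewrite map_inj_uniq ?iota_uniq//.
exact: inj_comp ih freq_inj.
Qed.

End Decay.

(** * Fourier series *)

Section FourierSeries.
Context {R : realType}.
Local Notation plane := 'rV[R]_2.
Local Notation idx := (int * int)%type.
Implicit Types (f g w v : plane -> R) (x : plane) (k l : idx) (a c F G : nat -> R).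

(** Tails are compared termwise before passing to the limit. *)
Lemma tot_tail F G N : (forall n, `|F n| <= G n) -> smb G ->
  `|tot F - \sum_(n < N) F n| <= tot G - \sum_(n < N) G n.
Proof.
move=> le sG; have sF := smb_le le sG.
have G0 n : 0 <= G n by apply: le_trans (le n).
have c1 : (fun M => `|\sum_(n < M) F n - \sum_(n < N) F n|) @ \oo --> `|tot F - \sum_(n < N) F n|.
  by apply: cvg_norm; apply: cvgB; [exact: tot_cvg|exact: cvg_cst].
apply: (cvgr_to_le c1); near=> M.
have NM : (N <= M)%N by near: M; exact: nbhs_infty_ge.
rewrite -(subnKC NM) big_split_ord/= addrAC subrr add0r.
have := psum_le_tot (N + (M - N)) sG G0; rewrite big_split_ord/= => h.
apply: le_trans (_ : \sum_(i < M - N) G (N + i)%N <= _); last by rewrite lerBrDl.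
by apply: (le_trans (ler_norm_sum _ _ _)); apply: ler_sum => i _.
Unshelve. all: by end_near. Qed.

Lemma tot_norm F G : (forall n, `|F n| <= G n) -> smb G -> `|tot F| <= tot G.
Proof. by move=> le sG; have := tot_tail 0 le sG; rewrite !big_ord0 !subr0. Qed.

(** Coefficients decreasing faster than any power of the weight. *)
Definition rapid a := forall s, exists2 C, 0 <= C & forall n, `|a n| * wt (freq n) ^+ s <= C :> R.

Definition hat w n := coef w (freq n).

Lemma rapid_hat w : torus_smooth w -> rapid (hat w).
Proof. by move=> sw s; have [C C0 h] := coef_decay s sw; exists C => // n; exact: h. Qed.

Lemma rapid0 : rapid (fun=> 0).
Proof. by move=> s; exists 0 => // n; rewrite normr0 mul0r. Qed.

Lemma rapid_smb a h (C : R) s : rapid a -> (forall n, `|h n| <= C * wt (freq n) ^+ s) ->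
  smb (fun n => a n * h n).
Proof.
move=> ra hh; have [D D0 hD] := ra (s + 2)%N.
have C0 : 0 <= C.
  have := le_trans (normr_ge0 _) (hh 0%N); rewrite pmulr_lge0//.
  by rewrite exprn_gt0// wt_gt0.
apply: (@smb_le _ _ (fun n => (C * D) * (wt (freq n) ^+ 2)^-1)); last first.
  by apply: smbZ; exact: (@smb_wt R id).
move=> n; rewrite normrM; have w0 := wt_gt0 (freq n) : 0 < _ :> R.
apply: (le_trans (ler_wpM2l (normr_ge0 _) (hh n))).
rewrite ler_pdivlMr ?exprn_gt0//.
have -> : `|a n| * (C * wt (freq n) ^+ s) * wt (freq n) ^+ 2 = C * (`|a n| * wt (freq n) ^+ (s + 2)).
  by rewrite exprD; ring.
exact: ler_wpM2l.
Qed.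

Lemma rapid_smb1 a : rapid a -> smb (fun n => 2 * `|a n|).
Proof.
move=> ra; have := @rapid_smb a (fun=> 1) 1 0 ra; rewrite /= => h.
apply: smbZ; apply: (@smb_le _ _ (fun n => `|a n * 1|)); first by move=> n; rewrite normr_id mulr1.
have [|B hB] := h; first by move=> n; rewrite normr1 mul1r expr0.
by exists B => N; under eq_bigr do rewrite normr_id.
Qed.

Lemma comp_wt k i : `|(comp k i)%:~R| <= wt k :> R.
Proof.
rewrite /wt; set u := k.1%:~R; set v := k.2%:~R.
have key (y : R) : `|y| <= 1 + y ^+ 2.
  by rewrite -(real_normK (num_real y)); have := sqr_ge0 (`|y| - 2^-1); nra.
rewrite /comp; case: ifP => _; first by rewrite (le_trans (key _))// lerDl sqr_ge0.
by apply: (le_trans (key _)); rewrite addrAC lerDl sqr_ge0.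
Qed.

Lemma rapidM a i (q : R) : rapid a -> rapid (fun n => q * (comp (freq n) i)%:~R * a n).
Proof.
move=> ra s; have [D D0 hD] := ra s.+1; exists (`|q| * D); first by rewrite mulr_ge0.
move=> n; have := hD n; have := comp_wt (freq n) i.
have w0 : 0 <= wt (freq n) ^+ s :> R by rewrite exprn_ge0// ltW// wt_gt0.
rewrite !normrM -!mulrA exprS => h1 h2; apply: ler_wpM2l => //.
apply: le_trans h2; rewrite mulrCA; apply: ler_wpM2l => //.
exact: ler_wpM2r.
Qed.

(** Two coefficients per index, for a frequency and its opposite: differentiation then
exchanges them and no series has to be rearranged. *)
Definition ser a c x := tot (fun n => a n * phi (freq n) x + c n * phi (- freq n) x).

Lemma ser_smb a c x : rapid a -> rapid c ->
  smb (fun n => a n * phi (freq n) x + c n * phi (- freq n) x).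
Proof.
move=> ra rc; apply: smbD; apply: (@rapid_smb _ _ 2 0) => // n;
  by rewrite expr0 mulr1 phi_norm.
Qed.

Definition dser1 i c n : R := - (2 * pi) * (comp (freq n) i)%:~R * c n.
Definition dser2 i a n : R := 2 * pi * (comp (freq n) i)%:~R * a n.

Lemma dot_wt k (h : plane) : dot k h ^+ 2 <= wt k * (h ord0 0 ^+ 2 + h ord0 1 ^+ 2).
Proof.
rewrite /dot /wt; set u := k.1%:~R; set v := k.2%:~R; set y := h ord0 0; set z := h ord0 1.
have := sqr_ge0 (u * z - v * y); have := sqr_ge0 y; have := sqr_ge0 z; nra.
Qed.

Lemma tot_lin4 (p q r : R) F1 F2 F3 F4 : smb F1 -> smb F2 -> smb F3 -> smb F4 ->
  tot (fun n => (F1 n + p * F2 n) + (q * F3 n + r * F4 n)) =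
  tot F1 + p * tot F2 + (q * tot F3 + r * tot F4).
Proof.
move=> h1 h2 h3 h4; rewrite -(totZ p h2) -(totZ q h3) -(totZ r h4).
have z2 := smbZ p h2; have z3 := smbZ q h3; have z4 := smbZ r h4.
by rewrite -(totD h1 z2) -(totD z3 z4) -(totD (smbD h1 z2) (smbD z3 z4)).
Qed.

(** Termwise second-order Taylor expansion, with summable remainders. *)
Lemma ser_quad a c : rapid a -> rapid c -> exists C, forall x h,
  `|ser a c (x + h) - ser a c x - lform (fun i => ser (dser1 i c) (dser2 i a) x) h| <=
  C * (h ord0 0 ^+ 2 + h ord0 1 ^+ 2).
Proof.
move=> ra rc; pose q : R := 2 * (2 * pi) ^+ 2.
have q0 : 0 <= q by rewrite mulr_ge0// sqr_ge0.
pose G n := q * ((`|a n| + `|c n|) * wt (freq n)).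
have sG : smb G.
  apply: smbZ; have rn b : rapid b -> smb (fun n => `|b n| * wt (freq n)).
    move=> rb; apply: (@rapid_smb (fun n => `|b n|) _ 1 1).
      by move=> s; have [D D0 hD] := rb s; exists D => // n; rewrite normr_id.
    by move=> n; rewrite expr1 mul1r ger0_norm// ltW// wt_gt0.
  have -> : (fun n => (`|a n| + `|c n|) * wt (freq n)) =
    fun n => `|a n| * wt (freq n) + `|c n| * wt (freq n) by apply/funext => n; rewrite mulrDl.
  by apply: smbD; exact: rn.
exists (tot G) => x h; set H := _ + _ ^+ 2.
have H0 : 0 <= H by rewrite addr_ge0// sqr_ge0.
have r1 i : rapid (dser1 i c) by exact: rapidM.
have r2 i : rapid (dser2 i a) by exact: rapidM.
have s1 := ser_smb (x + h) ra rc; have s2 := ser_smb x ra rc.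
have s3 i := ser_smb x (r1 i) (r2 i).
pose T b d y n : R := b n * phi (freq n) y + d n * phi (- freq n) y.
have -> : ser a c (x + h) - ser a c x - lform (fun i => ser (dser1 i c) (dser2 i a) x) h =
    tot (fun n => (T a c (x + h) n + (-1) * T a c x n) + ((- h ord0 0) * T (dser1 0 c) (dser2 0 a) x n +
      (- h ord0 1) * T (dser1 1 c) (dser2 1 a) x n)).
  rewrite (tot_lin4 (-1) (- h ord0 0) (- h ord0 1) s1 s2 (s3 0) (s3 1)).
  by rewrite /lform sum2 /ser; ring.
have -> : tot G * H = tot (fun n => H * G n) by rewrite totZ// mulrC.
apply: tot_norm; last exact: smbZ.
move=> n; set k := freq n.
have e1 := phi_taylor k x h; have e2 := phi_taylor (- k) x h.
rewrite opprK dotNl sqrrN in e2.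
have -> : T a c (x + h) n + -1 * T a c x n + (- h ord0 0 * T (dser1 0 c) (dser2 0 a) x n +
      - h ord0 1 * T (dser1 1 c) (dser2 1 a) x n) =
   a n * (phi k (x + h) - phi k x - 2 * pi * dot k h * phi (- k) x) +
   c n * (phi (- k) (x + h) - phi (- k) x - 2 * pi * - dot k h * phi k x).
  by rewrite /T /dser1 /dser2 -/k /dot /comp /=; ring.
apply: (le_trans (ler_normD _ _)); rewrite !normrM.
apply: (le_trans (lerD (ler_wpM2l (normr_ge0 _) e1) (ler_wpM2l (normr_ge0 _) e2))).
rewrite -mulrDl -/q /G -/k.
have -> : H * (q * ((`|a n| + `|c n|) * wt k)) = (`|a n| + `|c n|) * (q * (wt k * H)) by ring.
by apply: ler_wpM2l; [exact: addr_ge0|apply: ler_wpM2l => //; exact: dot_wt].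
Qed.

Lemma partial_ser a c i : rapid a -> rapid c -> partial i (ser a c) = ser (dser1 i c) (dser2 i a).
Proof.
move=> ra rc; have [C h] := ser_quad ra rc; apply/funext => x.
by have [_ ->] := differentiable_quad (h x).
Qed.

(** The class of such series is closed under partial derivatives. *)
Lemma ser_smooth a c : rapid a -> rapid c -> torus_smooth (ser a c).
Proof.
move=> ra rc; split; last first.
  by move=> x z; congr tot; apply/funext => n; rewrite !phi_periodic.
move=> s x; suff [a' [c' [ra' rc' ->]]] : exists a' c', [/\ rapid a', rapid c' &
    foldr partial (ser a c) s = ser a' c'].
  by have [C h] := ser_quad ra' rc'; have [] := differentiable_quad (h x).
elim: s => [|i s [a' [c' [ra' rc' E]]]]; first by exists a, c.
exists (dser1 i c'), (dser2 i a'); split; [exact: rapidM|exact: rapidM|].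
by rewrite /= E partial_ser.
Qed.

Lemma mean_sum N (F : nat -> plane -> R) : (forall n, bnd (F n)) ->
  bnd (fun x => \sum_(n < N) F n x) /\
  mean (fun x => \sum_(n < N) F n x) = \sum_(n < N) mean (F n).
Proof.
move=> bF; elim: N => [|N [bS eS]].
  have -> : (fun x => \sum_(n < 0) F n x) = fun=> 0 by apply/funext => x; rewrite big_ord0.
  by split; [exact: bndC|rewrite mean_cst big_ord0].
have -> : (fun x => \sum_(n < N.+1) F n x) = fun x => \sum_(n < N) F n x + F N x.
  by apply/funext => x; rewrite big_ord_recr.
by split; [exact: bndD|rewrite meanD// eS big_ord_recr].
Qed.

Local Notation ser1 a := (ser a (fun=> 0)).

(** Uniform convergence lets the mean act term by term. *)
Lemma mean_ser a v : rapid a -> bnd v -> mean (fun x => ser1 a x * v x) = tot (fun n => a n * hat v n).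
Proof.
move=> ra bv; have [B hB] := bv; have B0 : 0 <= B by apply: le_trans (hB 0).
have bs := smooth_bnd (ser_smooth ra rapid0).
have sG := rapid_smb1 ra.
have le n x : `|a n * phi (freq n) x + 0 * phi (- freq n) x| <= 2 * `|a n|.
  by rewrite mul0r addr0 normrM mulrC ler_wpM2r// phi_norm.
symmetry; apply: totE; apply/cvgrPdist_le => e e0.
have cz : (fun N => (tot (fun n => 2 * `|a n|) - \sum_(n < N) 2 * `|a n|) * B) @ \oo -->
    (tot (fun n => 2 * `|a n|) - tot (fun n => 2 * `|a n|)) * B.
  by apply: cvgMl; apply: cvgB; [exact: cvg_cst|exact: tot_cvg].
rewrite subrr mul0r in cz; have /cvgrPdist_le/(_ e e0) := cz.
apply: filterS => N; rewrite sub0r normrN => hN.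
apply: le_trans (le_trans (ler_norm _) hN).
have bt n : bnd (fun x => a n * phi (freq n) x * v x) by apply: bndM => //; apply: bndZ; exact: bnd_phi.
have [bS eS] := mean_sum N bt.
have -> : \sum_(n < N) a n * hat v n = \sum_(n < N) mean (fun x => a n * phi (freq n) x * v x).
  apply: eq_bigr => n _; rewrite /hat /coef -meanZ; last by apply: bndM => //; exact: bnd_phi.
  by congr mean; apply/funext => x; ring.
rewrite -eS -[X in _ - X]mul1r -mulNr -meanZ// -meanD; [|exact: bndM|exact: bndZ].
apply: mean_norm => x.
have -> : ser1 a x * v x + -1 * \sum_(n < N) a n * phi (freq n) x * v x =
    (ser1 a x - \sum_(n < N) (a n * phi (freq n) x + 0 * phi (- freq n) x)) * v x.
  rewrite mulrBl mulN1r mulr_suml; congr (_ - _); apply: eq_bigr => n _.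
  by rewrite mul0r addr0.
rewrite normrM; apply: ler_pM => //.
exact: (tot_tail N (fun n => le n x) sG).
Qed.

Lemma hat_ser a j : rapid a -> hat (ser1 a) j = a j.
Proof.
move=> ra; rewrite /hat /coef mean_ser; [|exact: ra|exact: bnd_phi].
rewrite -[RHS](ip_base a j); congr tot; apply/funext => n; congr (_ * _).
rewrite /hat /coef phi_orthonormal /base eq_sym.
by rewrite (inj_eq freq_inj).
Qed.

(** Completeness applied to the difference. *)
Lemma hat_eq w v : continuous w -> biperiodic w -> bnd w -> torus_smooth v ->
  hat w =1 hat v -> w = v.
Proof.
move=> cw pw bw sv e; apply/funext => x; apply/eqP; rewrite -subr_eq0; apply/eqP.
have bv := smooth_bnd sv.
apply: (@complete _ (fun x => w x - v x)).
- have c2 : continuous (fun x => - v x) by move=> y; apply: continuousN; exact: smooth_continuous.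
  exact: contD cw c2.
- by move=> y z; rewrite pw sv.2.
- have := bndD bw (bndZ (-1) bv).
  by rewrite (_ : (fun x => w x + -1 * v x) = fun x => w x - v x)//; apply/funext => y; rewrite mulN1r.
- move=> k; have [n <-] := freq_onto k.
  rewrite /coef (_ : (fun x => _) = fun x => w x * phi (freq n) x + (-1) * (v x * phi (freq n) x)).
    rewrite meanD; [|apply: bndM => //; exact: bnd_phi|apply: bndZ; apply: bndM => //; exact: bnd_phi].
    rewrite meanZ; last by apply: bndM => //; exact: bnd_phi.
    by have := e n; rewrite /hat /coef => ->; ring.
  by apply/funext => y; ring.
Qed.

Lemma expansion w : torus_smooth w -> ser1 (hat w) = w.
Proof.
move=> sw; have rw := rapid_hat sw; have ss := ser_smooth rw rapid0.
apply: hat_eq => //; [exact: smooth_continuous|exact: ss.2|exact: smooth_bnd|].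
by move=> n; exact: hat_ser.
Qed.

Lemma parseval w v : torus_smooth w -> bnd v -> mean (fun x => w x * v x) = tot (fun n => hat w n * hat v n).
Proof.
by move=> sw bv; rewrite -mean_ser//; [rewrite expansion|exact: rapid_hat].
Qed.

(** The mean of the squared distance to a partial sum is nonnegative. *)
Lemma bessel_hat v (B : R) : 0 <= B -> (forall x, `|v x| <= B) ->
  l2 (hat v) /\ ip (hat v) (hat v) <= B ^+ 2.
Proof.
move=> B0 hB; have bv : bnd v by exists B.
have key N : \sum_(n < N) hat v n * hat v n <= B ^+ 2.
  pose S x := \sum_(n < N) hat v n * phi (freq n) x.
  have bn n : bnd (fun x => hat v n * phi (freq n) x) by apply: bndZ; exact: bnd_phi.
  have [bS _] := mean_sum N bn; rewrite -/S in bS.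
  have SM g : bnd g -> mean (fun x => S x * g x) = \sum_(n < N) hat v n * coef g (freq n).
    move=> bg; have bng n : bnd (fun x => hat v n * (g x * phi (freq n) x)).
      by apply: bndZ; apply: bndM => //; exact: bnd_phi.
    have [_ eS] := mean_sum N bng.
    transitivity (\sum_(n < N) mean (fun x => hat v n * (g x * phi (freq n) x))).
      rewrite -eS; congr mean; apply/funext => x; rewrite /S mulr_suml.
      by apply: eq_bigr => n _; ring.
    by apply: eq_bigr => n _; rewrite meanZ//; apply: bndM => //; exact: bnd_phi.
  have SS : mean (fun x => S x * S x) = \sum_(n < N) hat v n * hat v n.
    rewrite SM//; apply: eq_bigr => m _; congr (_ * _).
    rewrite /coef SM; last exact: bnd_phi.
    rewrite (bigD1 m)//= /coef phi_orthonormal eqxx mulr1 big1 ?addr0// => n nm.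
    rewrite phi_orthonormal (inj_eq freq_inj) (_ : (m == n :> nat) = false) ?mulr0//.
    by apply/negbTE; rewrite eq_sym.
  have : 0 <= mean (fun x => (v x * v x + (-2) * (S x * v x)) + S x * S x).
    apply: mean_ge0; last by move=> x; have := sqr_ge0 (v x - S x); nra.
    by apply: bndD; [apply: bndD; [exact: bndM|apply: bndZ; exact: bndM]|exact: bndM].
  rewrite meanD; [|by apply: bndD; [exact: bndM|apply: bndZ; exact: bndM]|exact: bndM].
  rewrite meanD; [|exact: bndM|by apply: bndZ; exact: bndM].
  rewrite meanZ; last exact: bndM.
  rewrite SM// SS -/(hat v) => h.
  have : `|mean (fun x => v x * v x)| <= B ^+ 2.
    by apply: mean_norm => x; rewrite normrM expr2 ler_pM.
  rewrite ler_norml => /andP[_]; apply: le_trans.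
  by move: h; rewrite /hat; lra.
have lv : l2 (hat v).
  by exists (B ^+ 2) => N; under eq_bigr do rewrite ger0_norm -?expr2 ?sqr_ge0// expr2.
by split=> //; exact: tot_le_ub.
Qed.

End FourierSeries.

(** * The Laplacian as a Hilbert-Schmidt matrix *)

Section Kernel.
Context {R : realType}.
Local Notation plane := 'rV[R]_2.
Local Notation idx := (int * int)%type.
Implicit Types (rho u v : plane -> R) (x : plane) (k l : idx) (a c w : nat -> R) (m n : nat).

Lemma cvg_psum (F : nat -> nat -> R) w N : (forall i, (fun M => F M i) @ \oo --> w i) ->
  (fun M => \sum_(i < N) F M i) @ \oo --> \sum_(i < N) w i.
Proof.
move=> h; elim: N => [|N IH].
  by rewrite big_ord0; under eq_fun do rewrite big_ord0; exact: cvg_cst.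
by rewrite big_ord_recr; under eq_fun do rewrite big_ord_recr; exact: cvgD.
Qed.

Lemma l2I a (C : R) : (forall N, \sum_(i < N) a i * a i <= C) -> l2 a /\ ip a a <= C.
Proof.
move=> h; have la : l2 a.
  by exists C => N; under eq_bigr do rewrite ger0_norm -?expr2 ?sqr_ge0// expr2.
by split=> //; exact: tot_le_ub.
Qed.

Lemma hsI (K : nat -> nat -> R) (C : R) :
  (forall N M, \sum_(i < N) \sum_(j < M) K i j * K i j <= C) -> hs K.
Proof.
move=> h; have lK i : l2 (K i).
  suff h' M : \sum_(j < M) K i j * K i j <= C by exact: (l2I h').1.
  apply: le_trans (h i.+1 M).
  rewrite big_ord_recr/= lerDr; apply: sumr_ge0 => m _; apply: sumr_ge0 => j _.
  by rewrite -expr2 sqr_ge0.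
split=> //; exists C => N; under eq_bigr do rewrite ger0_norm ?ip_ge0//.
have c : (fun M => \sum_(i < N) \sum_(j < M) K i j * K i j) @ \oo --> \sum_(i < N) ip (K i) (K i).
  by apply: (cvg_psum (F := fun M i => \sum_(j < M) K i j * K i j) (w := fun i => ip (K i) (K i))) => i; exact: ip_cvg.
by apply: (cvg_le_cst c) => M.
Qed.

(** Square root of the n-th eigenvalue of the flat Laplacian. *)
Definition bet n : R := 2 * pi * Num.sqrt ((freq n).1%:~R ^+ 2 + (freq n).2%:~R ^+ 2).
Definition kap n : R := (bet n)^-1.
Definition zero_idx : nat := sval (cid (freq_onto (0 : idx))).

Lemma freq0 : freq zero_idx = 0.
Proof. by rewrite /zero_idx; case: cid. Qed.

Lemma bet_sqr n : bet n ^+ 2 = (2 * pi * (comp (freq n) 0)%:~R) ^+ 2 + (2 * pi * (comp (freq n) 1)%:~R) ^+ 2.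
Proof.
rewrite /bet exprMn sqr_sqrtr ?addr_ge0 ?sqr_ge0//.
by rewrite /comp /=; ring.
Qed.

Lemma bet_ge0 n : 0 <= bet n.
Proof. by rewrite mulr_ge0 ?sqrtr_ge0// mulr_ge0// pi_ge0. Qed.

Lemma bet0 : bet zero_idx = 0.
Proof. by rewrite /bet freq0 /= mulr0z expr0n addr0 sqrtr0 mulr0. Qed.

Lemma wt_le_bet n : n != zero_idx -> wt (freq n) <= bet n ^+ 2.
Proof.
move=> nz; have fz : freq n != 0 by rewrite -freq0 (inj_eq freq_inj).
rewrite /bet exprMn sqr_sqrtr ?addr_ge0 ?sqr_ge0// /wt -addrA.
set s := (X in 1 + X); have s1 : 1 <= s.
  have h (j : int) : j != 0 -> 1 <= j%:~R ^+ 2 :> R.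
    by move=> j0; rewrite -(real_normK (num_real _)) exprn_ege1// norm_intr_ge1 ?intr_int// intr_eq0.
  have [z1|z1] := eqVneq (freq n).1 0; last first.
    by apply: (le_trans (h _ z1)); rewrite lerDl sqr_ge0.
  have z2 : (freq n).2 != 0.
    by apply: contra_neq fz => z2; rewrite (surjective_pairing (freq n)) z1 z2.
  by apply: (le_trans (h _ z2)); rewrite lerDr sqr_ge0.
have p : 2 <= (2 * pi) ^+ 2 :> R.
  by have := pi_ge2 R => p2; rewrite expr2; nra.
have : 2 * s <= (2 * pi) ^+ 2 * s by rewrite ler_wpM2r//; lra.
move=> h; apply: (le_trans _ h); lra.
Qed.

Lemma bet_neq0 n : n != zero_idx -> bet n != 0.
Proof.
move=> /wt_le_bet h; apply/negP => /eqP b0; move: h; rewrite b0 expr0n /= leNgt => /negP; apply.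
exact: wt_gt0.
Qed.

Lemma kap_bet n : n != zero_idx -> kap n * bet n = 1.
Proof. by move=> /bet_neq0 h; rewrite mulVf. Qed.

Lemma kap0 : kap zero_idx = 0.
Proof. by rewrite /kap bet0 invr0. Qed.

Lemma kap_ge0 n : 0 <= kap n.
Proof. by rewrite invr_ge0 bet_ge0. Qed.

Lemma kap_sqr n : kap n ^+ 2 <= (wt (freq n))^-1.
Proof.
have w0 := wt_gt0 (freq n) : 0 < _ :> R.
have [->|nz] := eqVneq n zero_idx; first by rewrite kap0 expr0n invr_ge0 ltW// wt_gt0.
have b0 := lt_le_trans w0 (wt_le_bet nz).
by rewrite /kap exprVn lef_pV2 ?posrE// wt_le_bet.
Qed.

Lemma kap_le1 n : kap n <= 1.
Proof.
have h : kap n ^+ 2 <= 1 by apply: (le_trans (kap_sqr n)); rewrite invf_le1 ?wt_gt0// wt_ge1.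
by rewrite leNgt; apply/negP => k1; have := kap_ge0 n; nra.
Qed.

(** Matrix of multiplication by [rho]. *)
Definition Mx rho m := hat (fun x => rho x * phi (freq m) x).
(** The form [rho u v] with the constants projected out: the equation for [u] at
frequency zero determines its mean, and substituting it gives this rank-one
correction. *)
Definition Ex rho m := axpy (Mx rho m) (- (hat rho m / mean rho)) (hat rho).
(** With [w = bet u^] the equation [- lap u = lam rho u] reads [w = lam K w]. *)
Definition Kx rho m n := kap m * (kap n * Ex rho m n).

Lemma Mx_sym rho m n : Mx rho m n = Mx rho n m.
Proof. by rewrite /Mx /hat /coef; congr mean; apply/funext => x; ring. Qed.

Lemma hat_zero u : hat u zero_idx = mean u.
Proof. by rewrite /hat /coef freq0; congr mean; apply/funext => x; rewrite phi0 mulr1. Qed.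

Lemma Mx_zero rho m : Mx rho m zero_idx = hat rho m.
Proof. by rewrite Mx_sym /Mx /hat /coef freq0; congr mean; apply/funext => x; rewrite phi0 mulr1. Qed.

Lemma Ex_sym rho m n : Ex rho m n = Ex rho n m.
Proof. by rewrite /Ex /axpy Mx_sym; ring. Qed.

Lemma Kx_sym rho : sym (Kx rho).
Proof. by move=> m n; rewrite /Kx Ex_sym; ring. Qed.

Section Density.
Variable rho : plane -> R.
Hypotheses (sr : torus_smooth rho) (r0 : forall x, 0 < rho x).

Lemma mean_rho_gt0 : 0 < mean rho.
Proof.
have c0 : 0 < rho 0 / 2 by rewrite divr_gt0.
have [d d0 hd] := plane_nbhs (smooth_continuous sr (x := 0)) c0.
have [k k0 hk] := mean_pos 0 d0.
apply: (@lt_le_trans _ _ (k * (rho 0 / 2))); first exact: mulr_gt0.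
apply: hk; [exact: smooth_bnd|exact: sr.2|by move=> x; exact: ltW|].
by move=> x /hd; rewrite ltr_norml => /andP[+ _]; lra.
Qed.

(** The rank-one correction was made for this row to vanish. *)
Lemma Ex_zero m : Ex rho m zero_idx = 0.
Proof.
rewrite /Ex /axpy Mx_zero hat_zero mulNr divfK ?subrr//.
by rewrite (gt_eqF mean_rho_gt0).
Qed.

(** Rows of a multiplication operator are bounded by Bessel's inequality. *)
Lemma rho_rows : exists C, forall m, l2 (Mx rho m) /\ (forall N, \sum_(n < N) Ex rho m n * Ex rho m n <= C).
Proof.
have [B hB] := smooth_bnd sr; have B0 : 0 <= B by apply: le_trans (hB 0).
have [lh hh] := bessel_hat B0 hB.
exists (2 * (B * 2) ^+ 2 + 2 * (B * 2 / mean rho) ^+ 2 * B ^+ 2) => m.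
have B2 : 0 <= B * 2 by rewrite mulr_ge0.
have bM x : `|rho x * phi (freq m) x| <= B * 2 by rewrite normrM ler_pM// phi_norm.
have [lM hM] := bessel_hat B2 bM.
split=> // N; set t := - (hat rho m / mean rho).
have t2 : t ^+ 2 <= (B * 2 / mean rho) ^+ 2.
  have V0 := mean_rho_gt0.
  rewrite /t sqrrN -(real_normK (num_real _)) lerXn2r ?nnegrE// ?divr_ge0 ?(ltW V0)//.
  by rewrite normrM normfV (ger0_norm (ltW V0)) ler_wpM2r ?invr_ge0 ?(ltW V0)// coef_norm.
apply: (@le_trans _ _ (\sum_(n < N) (2 * (Mx rho m n * Mx rho m n) + 2 * t ^+ 2 * (hat rho n * hat rho n)))).
  apply: ler_sum => n _; rewrite /Ex /axpy -/t.
  by have := sqr_ge0 (Mx rho m n - t * hat rho n); nra.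
rewrite big_split/= -!mulr_sumr; apply: lerD.
  by rewrite ler_wpM2l//; apply: le_trans hM; exact: psum_le_ip.
apply: ler_pM.
- by rewrite mulr_ge0// sqr_ge0.
- by apply: sumr_ge0 => n _; rewrite -expr2 sqr_ge0.
- exact: ler_wpM2l.
- by apply: le_trans hh; exact: psum_le_ip.
Qed.

(** The product of [kap m ^ 2] and [kap n ^ 2] is at most the mean of their squares,
which are summable, and rows are bounded. *)
Lemma Kx_hs : hs (Kx rho).
Proof.
have [C hC] := rho_rows.
have C0 : 0 <= C by have [_ /(_ 0%N)] := hC 0%N; rewrite big_ord0.
pose p n : R := (wt (freq n) ^+ 2)^-1.
have p0 n : 0 <= p n by rewrite invr_ge0 sqr_ge0.
have P N : \sum_(n < N) p n <= 36.
  rewrite -(big_mkord xpredT p) -(big_map freq xpredT (fun k => (wt k ^+ 2)^-1)).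
  by apply: sum_wt; rewrite map_inj_uniq ?iota_uniq//; exact: freq_inj.
apply: (@hsI _ (36 * C + 36 * C)) => N M.
apply: (@le_trans _ _ (\sum_(m < N) \sum_(n < M) (p m * (Ex rho m n * Ex rho m n) +
    p n * (Ex rho n m * Ex rho n m)))).
  apply: ler_sum => m _; apply: ler_sum => n _; rewrite (Ex_sym _ n m) -mulrDl.
  have -> : Kx rho m n * Kx rho m n = kap m ^+ 2 * kap n ^+ 2 * (Ex rho m n * Ex rho m n).
    by rewrite /Kx; ring.
  apply: ler_wpM2r; first by rewrite -expr2 sqr_ge0.
  apply: (le_trans (ler_pM (sqr_ge0 _) (sqr_ge0 _) (kap_sqr m) (kap_sqr n))).
  rewrite /p -!exprVn; have := sqr_ge0 ((wt (freq m))^-1 - (wt (freq n))^-1 : R).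
  have := sqr_ge0 ((wt (freq m))^-1 : R); have := sqr_ge0 ((wt (freq n))^-1 : R); nra.
under eq_bigr do rewrite big_split/=.
rewrite big_split/=; apply: lerD.
  apply: (@le_trans _ _ (\sum_(m < N) p m * C)).
    by apply: ler_sum => m _; rewrite -mulr_sumr ler_wpM2l//; exact: (hC m).2.
  by rewrite -mulr_suml ler_wpM2r.
rewrite exchange_big/=; apply: (@le_trans _ _ (\sum_(n < M) p n * C)).
  by apply: ler_sum => n _; rewrite -mulr_sumr ler_wpM2l//; exact: (hC n).2.
by rewrite -mulr_suml ler_wpM2r.
Qed.

Definition lap u x := partial 0 (partial 0 u) x + partial 1 (partial 1 u) x.

Lemma hat_lap u n : torus_smooth u -> hat (lap u) n = - (bet n ^+ 2) * hat u n.
Proof.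
move=> su; have s2 i := smooth_bnd (smooth_partial i (smooth_partial i su)).
have E : hat (lap u) n = coef (partial 0 (partial 0 u)) (freq n) + coef (partial 1 (partial 1 u)) (freq n).
  rewrite /hat /coef -meanD; try by apply: bndM => //; exact: bnd_phi.
  by congr mean; apply/funext => x; rewrite /lap mulrDl.
apply: (etrans E).
apply: (etrans (congr2 (fun a b : R => a + b) (coef_partial2 0 (freq n) su) (coef_partial2 1 (freq n) su))).
by rewrite bet_sqr /hat -mulrDl opprD.
Qed.

(** Passing to [bet n * u_n] symmetrises the weak form of the eigenvalue
equation. *)
Lemma eig_to_l2 u (lam : R) : torus_smooth u -> (forall x, - lap u x = lam * (rho x * u x)) ->
  lam != 0 -> l2 (fun n => bet n * hat u n) /\
  op (Kx rho) (fun n => bet n * hat u n) = (fun n => lam^-1 * (bet n * hat u n)).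
Proof.
move=> su eu l0; have br := smooth_bnd sr; have bu := smooth_bnd su.
have ru := rapid_hat su.
have bru : bnd (fun x => rho x * u x) by exact: bndM.
have bw n : `|bet n| <= 2 * pi * wt (freq n) ^+ 1.
  rewrite (ger0_norm (bet_ge0 n)) /bet expr1 ler_wpM2l ?mulr_ge0 ?pi_ge0//.
  rewrite /wt -addrA; set s := (X in Num.sqrt X).
  have s0 : 0 <= s by rewrite addr_ge0// sqr_ge0.
  have := sqr_sqrtr s0; have := sqrtr_ge0 s; set z := Num.sqrt s => z0 zs.
  by rewrite -/s; have := sqr_ge0 (z - 2^-1); nra.
have hE n : hat (fun x => rho x * u x) n = lam^-1 * (bet n ^+ 2 * hat u n).
  have : hat (lap u) n = - lam * hat (fun x => rho x * u x) n.
    rewrite /hat /coef -meanZ; last by apply: bndM => //; exact: bnd_phi.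
    congr mean; apply/funext => x.
    have -> : lap u x = - (lam * (rho x * u x)) by rewrite -eu opprK.
    by rewrite !mulNr !mulrA.
  rewrite hat_lap// => h; apply: (mulfI l0); rewrite mulVKf//.
  by apply: oppr_inj; rewrite -mulNr -h mulNr.
split.
  have := rapid_smb (a := hat u) (h := fun n => bet n ^+ 2 * hat u n).
  have [C C0 hC] := ru 0%N.
  move=> /(_ ((2 * pi) ^+ 2 * C) 2%N ru) H.
  rewrite /l2 (_ : (fun i => _) = fun n => hat u n * (bet n ^+ 2 * hat u n)); last by apply/funext => n; ring.
  apply: H => n; have b2 : bet n ^+ 2 <= (2 * pi) ^+ 2 * wt (freq n) ^+ 2.
    have := bw n; rewrite expr1 (ger0_norm (bet_ge0 n)) => h.
    rewrite -[leRHS]exprMn; apply: lerXn2r => //; rewrite nnegrE ?bet_ge0//.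
    exact: le_trans (bet_ge0 n) h.
  rewrite normrM (ger0_norm (sqr_ge0 _)) -[leRHS]mulrA (mulrC C) mulrA.
  by apply: ler_pM => //; [exact: sqr_ge0|have := hC n; rewrite expr0 mulr1].
apply/funext => m; rewrite /op.
have bm : bnd (fun x => rho x * phi (freq m) x) by apply: bndM => //; exact: bnd_phi.
have lu : l2 (hat u).
  have [B hB] := bu; have B0 : 0 <= B by apply: le_trans (hB 0).
  by have [] := bessel_hat B0 hB.
have lr : l2 (hat rho).
  have [B hB] := br; have B0 : 0 <= B by apply: le_trans (hB 0).
  by have [] := bessel_hat B0 hB.
have [C hC] := rho_rows; have lM := (hC m).1.
have -> : ip (Kx rho m) (fun n => bet n * hat u n) = kap m * ip (Ex rho m) (hat u).
  rewrite /ip -totZ; last by apply: ip_smb => //; exact: l2_axpy.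
  congr tot; apply/funext => n; rewrite /Kx.
  have [->|nz] := eqVneq n zero_idx; first by rewrite Ex_zero; ring.
  have := kap_bet nz => kb.
  by rewrite (_ : _ * _ = kap m * (Ex rho m n * (kap n * bet n) * hat u n)); [rewrite kb mulr1|ring].
have -> : ip (Ex rho m) (hat u) = lam^-1 * (bet m ^+ 2 * hat u m).
  rewrite ip_axpy//.
  have -> : ip (Mx rho m) (hat u) = hat (fun x => rho x * u x) m.
    rewrite ipC; apply: (etrans (esym (parseval su bm))).
    by rewrite /hat /coef; congr mean; apply/funext => x; rewrite mulrCA mulrA.
  have -> : ip (hat rho) (hat u) = 0.
    rewrite ipC; apply: (etrans (esym (parseval su br))).
    have := hE zero_idx; rewrite bet0 expr0n mul0r mulr0 hat_zero => <-.
    by congr mean; apply/funext => x; rewrite mulrC.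
  by rewrite mulr0 addr0 hE.
have [->|mz] := eqVneq m zero_idx; first by rewrite kap0 bet0; ring.
have := kap_bet mz => kb.
have -> : kap m * (lam^-1 * (bet m ^+ 2 * hat u m)) = lam^-1 * (kap m * bet m * bet m * hat u m) by ring.
by rewrite kb mul1r.
Qed.

Lemma wt_sum4 k l j : (k = l + j \/ k = - l + j \/ k = l - j \/ k = - l - j) ->
  wt k <= 2 * wt l * wt j :> R.
Proof.
by case=> [->|[->|[->|->]]]; [have := @wt_peetre R l j|have := @wt_peetre R (- l) j|
  have := @wt_peetre R l (- j)|have := @wt_peetre R (- l) (- j)]; rewrite ?wtN.
Qed.
End Density.
End Kernel.

(** * Elliptic regularity *)

Section Regularity.
Context {R : realType}.
Local Notation plane := 'rV[R]_2.
Local Notation idx := (int * int)%type.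
Implicit Types (u v : plane -> R) (x : plane) (k l : idx) (a w : nat -> R) (m n : nat).

Variable rho : plane -> R.
Hypotheses (sr : torus_smooth rho) (r0 : forall x, 0 < rho x).
Local Notation ser1 a := (ser a (fun=> 0)).

(** Multiplication by a smooth function preserves polynomial decay: the coefficients
of [rho] absorb the difference of frequencies by Peetre's inequality. *)
Lemma conv_bound s : exists2 D, 0 <= D & forall a (C : R), 0 <= C ->
  (forall n, `|a n| * wt (freq n) ^+ s <= C) -> forall m,
  `|tot (fun n => Mx rho m n * a n)| * wt (freq m) ^+ s <= D * C.
Proof.
have [E E0 hE] := coef_decay (s + 2) sr.
exists (2 ^+ s * E * 72); first by rewrite !mulr_ge0// exprn_ge0.
move=> a C C0 hC m; set k := freq m.
have W0 l : 0 < wt l :> R := wt_gt0 l.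
have Ws0 l : 0 < wt l ^+ s :> R by rewrite exprn_gt0.
pose p l : R := (wt l ^+ 2)^-1.
have one l n : (k = l + freq n \/ k = - l + freq n \/ k = l - freq n \/ k = - l - freq n) ->
    `|coef rho l| * `|a n| * wt k ^+ s <= 2 ^+ s * E * C * p l.
  move=> /(@wt_sum4 R) h; rewrite /p ler_pdivlMr ?exprn_gt0//.
  have h' : wt k ^+ s <= (2 * wt l * wt (freq n)) ^+ s :> R.
    by apply: lerXn2r h; rewrite nnegrE ?mulr_ge0// ltW.
  have h1 := hE l; have h2 := hC n.
  apply: (@le_trans _ _ (2 ^+ s * (`|coef rho l| * wt l ^+ (s + 2)) * (`|a n| * wt (freq n) ^+ s))).
    have -> : 2 ^+ s * (`|coef rho l| * wt l ^+ (s + 2)) * (`|a n| * wt (freq n) ^+ s) =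
        `|coef rho l| * `|a n| * (2 * wt l * wt (freq n)) ^+ s * wt l ^+ 2.
      by rewrite !exprMn exprD; ring.
    apply: ler_wpM2r; first by rewrite sqr_ge0.
    by apply: ler_wpM2l h'; rewrite mulr_ge0.
  apply: ler_pM => //; rewrite ?mulr_ge0 ?exprn_ge0// ?(ltW (W0 _))//.
  by rewrite ler_wpM2l// exprn_ge0.
have bd n : `|Mx rho m n * a n| * wt k ^+ s <= (2^-1 * (2 ^+ s * E * C)) *
    (p (k - freq n) + p (freq n - k) + p (k + freq n) + p (- (k + freq n))).
  have -> : Mx rho m n = 2^-1 * (coef rho (k - freq n) + coef rho (freq n - k) + coef rho (k + freq n) -
      coef rho (- (k + freq n))).
    rewrite -(mean_phiM_expand k (freq n) (smooth_bnd sr)) /Mx /hat /coef.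
    by congr mean; apply/funext => x; rewrite mulrA.
  have o1 := one (k - freq n) n (or_introl (esym (subrK _ _))).
  have o2 : `|coef rho (freq n - k)| * `|a n| * wt k ^+ s <= 2 ^+ s * E * C * p (freq n - k).
    by apply: one; right; left; rewrite opprB subrK.
  have o3 : `|coef rho (k + freq n)| * `|a n| * wt k ^+ s <= 2 ^+ s * E * C * p (k + freq n).
    by apply: one; right; right; left; rewrite addrK.
  have o4 : `|coef rho (- (k + freq n))| * `|a n| * wt k ^+ s <= 2 ^+ s * E * C * p (- (k + freq n)).
    by apply: one; right; right; right; rewrite opprK addrK.
  move: o1 o2 o3 o4; set c1 := coef _ _; set c2 := coef _ _; set c3 := coef _ _; set c4 := coef _ _.
  set K := 2 ^+ s * E * C; set p1 := p _; set p2 := p _; set p3 := p _; set p4 := p _.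
  set A := `|a n|; set W := wt k ^+ s => o1 o2 o3 o4.
  have AW : 0 <= A * W := mulr_ge0 (normr_ge0 _) (ltW (Ws0 k)).
  have tri : `|c1 + c2 + c3 - c4| <= `|c1| + `|c2| + `|c3| + `|c4|.
    apply: (le_trans (ler_normB _ _)); rewrite lerD2r.
    by apply: (le_trans (ler_normD _ _)); rewrite lerD2r ler_normD.
  have n2 : `|2^-1 : R| = 2^-1 by rewrite ger0_norm// invr_ge0.
  rewrite !normrM n2 -/A -[leLHS]mulrA -[leLHS]mulrA -[leRHS]mulrA.
  apply: ler_wpM2l; first by rewrite invr_ge0.
  apply: (le_trans (ler_wpM2r AW tri)).
  have -> : (`|c1| + `|c2| + `|c3| + `|c4|) * (A * W) =
    `|c1| * A * W + `|c2| * A * W + `|c3| * A * W + `|c4| * A * W by ring.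
  have -> : K * (p1 + p2 + p3 + p4) = K * p1 + K * p2 + K * p3 + K * p4 by ring.
  by apply: lerD => //; apply: lerD => //; apply: lerD.
have sp (h : idx -> idx) : injective h -> smb (fun n => p (h (freq n))) /\ tot (fun n => p (h (freq n))) <= 36.
  move=> ih; have sh := @smb_wt R h ih; split=> //; apply: tot_le_ub => // N.
  rewrite -(big_mkord xpredT (fun n => p (h (freq n)))) -(big_map (h \o freq) xpredT p).
  by apply: sum_wt; rewrite map_inj_uniq ?iota_uniq//; apply: inj_comp ih freq_inj.
have i1 : injective (fun l : idx => k - l) by move=> l j /addrI /oppr_inj.
have i2 : injective (fun l : idx => l - k) by move=> l j /addIr.
have i3 : injective (fun l : idx => k + l) by move=> l j /addrI.
have i4 : injective (fun l : idx => - (k + l)) by move=> l j /oppr_inj /addrI.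
have [s1 t1] := sp _ i1; have [s2 t2] := sp _ i2; have [s3 t3] := sp _ i3; have [s4 t4] := sp _ i4.
have s12 := smbD s1 s2; have s123 := smbD s12 s3; have s1234 := smbD s123 s4.
pose Q := 2^-1 * (2 ^+ s * E * C) / wt k ^+ s.
have Q0 : 0 <= Q.
  by rewrite /Q divr_ge0 ?(ltW (Ws0 _))// !mulr_ge0// ?invr_ge0// exprn_ge0.
have := @tot_norm R (fun n => Mx rho m n * a n) _ _ (smbZ Q s1234).
rewrite (totZ Q s1234) (totD s123 s4) (totD s12 s3) (totD s1 s2) => tn.
have {}tn : `|tot (fun n => Mx rho m n * a n)| <= Q * 144.
  apply: (le_trans (tn _)); last by apply: ler_wpM2l => //; lra.
  move=> n; rewrite /Q mulrAC ler_pdivlMr ?Ws0//.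
have -> : 2 ^+ s * E * 72 * C = Q * 144 * wt k ^+ s.
  by rewrite /Q; field; rewrite gt_eqF// Ws0.
by rewrite ler_wpM2r// ltW// Ws0.
Qed.

(** Bootstrap: each use of the equation gains one power of the weight. *)
Lemma regular a (mu : R) : l2 a -> (forall m, tot (fun n => Mx rho m n * a n) = mu * (bet m ^+ 2 * a m)) ->
  mu != 0 -> rapid a.
Proof.
move=> la eqa m0; elim=> [|s [C C0 hC]].
  exists (Num.sqrt (ip a a)); first exact: sqrtr_ge0.
  move=> n; rewrite expr0 mulr1 -sqrtr_sqr; apply: ler_wsqrtr; exact: entry_le_ip.
have [D D0 hD] := conv_bound s.
exists (C * wt (freq zero_idx) + `|mu|^-1 * (D * C)).
  by rewrite addr_ge0 ?mulr_ge0 ?invr_ge0// ltW// wt_gt0.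
move=> m; have [->|mz] := eqVneq m zero_idx.
  rewrite exprSr mulrA; apply: ler_wpDr; first by rewrite mulr_ge0 ?mulr_ge0 ?invr_ge0.
  by apply: ler_wpM2r; [rewrite ltW// wt_gt0|exact: hC].
apply: ler_wpDl; first by rewrite mulr_ge0// ltW// wt_gt0.
have := hD a C C0 hC m; rewrite eqa (normrM mu) (normrM (bet m ^+ 2)) => h.
rewrite ler_pdivlMl ?normr_gt0//; apply: le_trans h.
rewrite (ger0_norm (sqr_ge0 _)) (exprS (wt (freq m))).
have := @wt_le_bet R m mz; have := exprn_ge0 s (ltW (@wt_gt0 R (freq m))).
move: (bet m ^+ 2) (wt (freq m)) (wt (freq m) ^+ s) (`|a m|) (normr_ge0 (a m)) => b y ys A A0 ys0 yb.
have -> : `|mu| * (b * A) * ys = `|mu| * (b * (A * ys)) by ring.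
have -> : A * (y * ys) = y * (A * ys) by ring.
by apply: ler_wpM2l; [exact: normr_ge0|apply: ler_wpM2r; [exact: (mulr_ge0 A0 ys0)|exact: yb]].
Qed.

Lemma lap_ser a x : rapid a -> lap (ser1 a) x = - tot (fun n => bet n ^+ 2 * a n * phi (freq n) x).
Proof.
move=> ra; have d1 i : rapid (dser1 i (fun=> 0) : nat -> R) by apply: rapidM; exact: rapid0.
have d2 i : rapid (dser2 i a) by exact: rapidM.
have e i : partial i (partial i (ser1 a)) = ser (dser1 i (dser2 i a)) (dser2 i (dser1 i (fun=> 0))).
  by rewrite (partial_ser i ra rapid0) (partial_ser i (d1 i) (d2 i)).
have dd1 i : rapid (dser1 i (dser2 i a)) by exact: rapidM.
have dd2 i : rapid (dser2 i (dser1 i (fun=> 0)) : nat -> R) by exact: rapidM.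
rewrite /lap !e /ser -totD; [|exact: ser_smb|exact: ser_smb].
rewrite -mulN1r -totZ.
  congr tot; apply/funext => n; rewrite bet_sqr /dser1 /dser2.
  set p0 := (comp _ 0)%:~R; set p1 := (comp _ 1)%:~R; ring.
have := @rapid_smb R a (fun n => bet n ^+ 2 * phi (freq n) x) ((2 * pi) ^+ 2 * 2) 1 ra.
move=> H; rewrite (_ : (fun n => _) = fun n => a n * (bet n ^+ 2 * phi (freq n) x)); last first.
  by apply/funext => n; ring.
apply: H => n; rewrite normrM mulrAC; apply: ler_pM => //; last exact: phi_norm.
rewrite (ger0_norm (sqr_ge0 _)) /bet exprMn sqr_sqrtr ?addr_ge0 ?sqr_ge0// ler_wpM2l ?sqr_ge0//.
by rewrite expr1 /wt -addrA lerDr.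
Qed.

(** Choose the mean of [u] so that the equation holds at frequency zero; regularity
makes the series smooth, and completeness turns the equality of coefficients into
the differential equation. *)
Lemma l2_to_eig w (mu : R) : l2 w -> op (Kx rho) w = (fun n => mu * w n) -> mu != 0 ->
  exists u, [/\ torus_smooth u, forall x, - lap u x = mu^-1 * (rho x * u x) &
    forall n, bet n * hat u n = w n].
Proof.
move=> lw ew m0; have V0 := mean_rho_gt0 sr r0.
have [CM hM] := rho_rows sr r0.
have w_zero : w zero_idx = 0.
  have : mu * w zero_idx = 0.
    have <- : op (Kx rho) w zero_idx = mu * w zero_idx by rewrite ew.
    rewrite /op -[RHS](ip0 w); congr ip; apply/funext => n; by rewrite /Kx kap0 mul0r.
  by move/eqP; rewrite mulf_eq0 (negbTE m0) => /eqP.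
pose kw n := kap n * w n.
have lkw : l2 kw.
  apply: (smb_le _ lw) => n; rewrite ger0_norm; last by rewrite -expr2 sqr_ge0.
  have -> : kw n * kw n = kap n ^+ 2 * (w n * w n) by rewrite /kw; ring.
  rewrite -[leRHS]mul1r; apply: ler_wpM2r; first by rewrite -expr2 sqr_ge0.
  by rewrite expr_le1// ?kap_ge0// kap_le1.
have lr : l2 (hat rho).
  have [B hB] := smooth_bnd sr; have B0 : 0 <= B by apply: le_trans (hB 0).
  by have [] := bessel_hat B0 hB.
(* the mean of u that solves the equation at frequency zero *)
pose q := - ((mean rho)^-1 * ip (hat rho) kw).
pose a := axpy kw q (base zero_idx).
have lb := @l2_base R zero_idx.
have la : l2 a by exact: l2_axpy.
have az m : m != zero_idx -> a m = kap m * w m.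
  by move=> mz; rewrite /a /axpy /base (negbTE mz) mulr0 addr0.
have eqa m : tot (fun n => Mx rho m n * a n) = mu * (bet m ^+ 2 * a m).
  have lM := (hM m).1.
  have -> : tot (fun n => Mx rho m n * a n) = ip (Ex rho m) kw.
    change (ip (Mx rho m) a = ip (Ex rho m) kw).
    rewrite /a (ip_axpyr q lkw lb lM) ip_base Mx_zero /Ex (ip_axpy _ lM lr lkw) /q.
    by move: (ip _ _) (ip _ _) => X Y; field; rewrite gt_eqF.
  have [->|mz] := eqVneq m zero_idx.
    have -> : Ex rho zero_idx = fun=> 0.
      by apply/funext => n; rewrite Ex_sym; exact: Ex_zero.
    by rewrite ip0 bet0 expr0n mul0r mulr0.
  rewrite (az m mz).
  have : op (Kx rho) w m = mu * w m by rewrite ew.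
  have -> : op (Kx rho) w m = kap m * ip (Ex rho m) kw.
    have lE : l2 (Ex rho m) by exact: l2_axpy.
    rewrite /op /ip -totZ; last exact: ip_smb.
    by congr tot; apply/funext => n; rewrite /Kx /kw; ring.
  move=> h; have b0 := @bet_neq0 R m mz; apply: (mulfI (_ : kap m != 0)).
    by rewrite /kap invr_neq0.
  by rewrite h /kap; field.
have ra := regular la eqa m0.
have bd2 : rapid (fun n => mu * (bet n ^+ 2 * a n)).
  move=> s; have [C C0 hC] := ra s.+1.
  exists (`|mu| * ((2 * pi) ^+ 2 * C)).
    exact: (mulr_ge0 (normr_ge0 mu) (mulr_ge0 (sqr_ge0 _) C0)).
  move=> n; rewrite (normrM mu) (normrM (bet n ^+ 2)) (ger0_norm (sqr_ge0 _)).
  have hb : bet n ^+ 2 <= (2 * pi) ^+ 2 * wt (freq n) :> R.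
    rewrite /bet exprMn sqr_sqrtr ?addr_ge0 ?sqr_ge0//.
    by apply: ler_wpM2l; [exact: sqr_ge0|rewrite /wt -addrA lerDr].
  have ws0 := exprn_ge0 s (ltW (@wt_gt0 R (freq n))).
  have := hC n; rewrite (exprS (wt (freq n))).
  move: hb ws0; set b := bet n ^+ 2; set y := wt (freq n); set ys := y ^+ s.
  set A := `|a n|; set P := (2 * pi) ^+ 2 => hb ws0 hA.
  have -> : `|mu| * (b * A) * ys = `|mu| * (b * (A * ys)) by ring.
  apply: ler_wpM2l; first exact: normr_ge0.
  apply: (le_trans (ler_wpM2r (mulr_ge0 (normr_ge0 _) ws0) hb)).
  have -> : P * y * (A * ys) = P * (A * (y * ys)) by ring.
  by apply: ler_wpM2l => //; exact: sqr_ge0.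
have su := ser_smooth ra rapid0.
exists (ser1 a); split=> //; last first.
  move=> n; rewrite hat_ser//; have [->|nz] := eqVneq n zero_idx; first by rewrite bet0 mul0r w_zero.
  by rewrite az// mulrA (mulrC (bet n)) kap_bet// mul1r.
have bu := smooth_bnd su; have br := smooth_bnd sr.
have E : (fun x => rho x * ser1 a x) = ser1 (fun n => mu * (bet n ^+ 2 * a n)).
  apply: hat_eq.
  - by apply: contM; exact: smooth_continuous.
  - by move=> x z; rewrite sr.2 su.2.
  - exact: bndM.
  - exact: ser_smooth bd2 rapid0.
  - move=> m; rewrite hat_ser// -eqa /hat /coef.
    have bm : bnd (fun x => rho x * phi (freq m) x) by apply: bndM => //; exact: bnd_phi.
    transitivity (mean (fun x => ser1 a x * (rho x * phi (freq m) x))).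
      by congr mean; apply/funext => x; rewrite mulrCA mulrA.
    rewrite mean_ser//; congr tot; apply/funext => n; by rewrite mulrC.
move=> x; have := congr1 (fun f => f x) E; rewrite /= => ->.
rewrite lap_ser// opprK /ser -totZ; last exact: ser_smb bd2 rapid0.
by congr tot; apply/funext => n; rewrite mul0r addr0 -!mulrA mulKf.
Qed.

End Regularity.

(** * Isospectral deformations *)

Section Isospectral.
Context {R : realType}.
Local Notation plane := 'rV[R]_2.
Local Notation idx := (int * int)%type.
Implicit Types (rho u v U f : plane -> R) (x : plane) (k : idx) (a w : nat -> R) (m n : nat).

(** In dimension two the conformal factor cancels inside the divergence. *)
Lemma laplace_conformal rho u x : (forall x, 0 < rho x) ->
  laplace_beltrami (conformal_metric rho) u x = (rho x)^-1 * lap u x.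
Proof.
move=> r0; have dE y : Num.sqrt (\det (conformal_metric rho y)) = rho y.
  by rewrite /conformal_metric det_scalar sqrtr_sqr ger0_norm// ltW.
have iE i : (fun y => \sum_j Num.sqrt (\det (conformal_metric rho y)) *
    invmx (conformal_metric rho y) i j * partial j u y) = partial i u.
  apply/funext => y; have ry : rho y != 0 by rewrite gt_eqF.
  rewrite (bigD1 i)//= big1 ?addr0; last first.
    move=> j ji; rewrite /conformal_metric invmx_scalar2// mxE eq_sym (negbTE ji).
    by rewrite mulr0n mulr0 mul0r.
  by rewrite dE /conformal_metric invmx_scalar2// mxE eqxx mulr1n divff// mul1r.
by rewrite /laplace_beltrami dE sum2 !iE.
Qed.

Lemma eigenP rho lam u : (forall x, 0 < rho x) ->
  eigenfunction (conformal_metric rho) lam u <->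
  torus_smooth u /\ forall x, - lap u x = lam * (rho x * u x).
Proof.
move=> r0; have ry x : rho x != 0 by rewrite gt_eqF.
split=> -[su eu]; split=> // x.
  have := eu x; rewrite laplace_conformal// => h.
  by rewrite mulrCA -h mulrN mulVKf.
by rewrite laplace_conformal// -mulrN eu mulrCA mulKf.
Qed.

(** A supremum of integers larger than [d] is reached beyond [d]; then drop the extra
functions. *)
Lemma spec_mult (g g' : plane -> 'M[R]_2) lam d (u : 'I_d -> plane -> R) :
  Spec g = Spec g' -> (forall i, eigenfunction g lam (u i)) -> lin_indep u ->
  exists u' : 'I_d -> plane -> R, (forall i, eigenfunction g' lam (u' i)) /\ lin_indep u'.
Proof.
case: d u => [|d] u eS eu iu.
  by exists (fun _ _ => 0); split=> [[]|c _ []].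
have : (d%:R%:E < Spec g' lam)%E.
  rewrite -eS; apply: (@lt_le_trans _ _ d.+1%:R%:E); first by rewrite lte_fin ltr_nat.
  by apply: ereal_sup_ubound; exists d.+1; [exists u; split|reflexivity].
move=> /ereal_sup_gt[_ [k [u' [eu' iu']] <-]]; rewrite lte_fin ltr_nat => dk.
have kE : k = (d.+1 + (k - d.+1))%N by rewrite subnKC.
move: u' eu' iu'; rewrite kE => u' eu' iu'.
exists (fun i => u' (lshift _ i)); split=> [i|c hc i]; first exact: eu'.
pose c' (j : 'I_(d.+1 + (k - d.+1))) := match fintype.split j with inl i => c i | inr _ => 0 end.
have cl j : c' (lshift (k - d.+1) j) = c j by rewrite /c' (unsplitK (inl j)).
have cr j : c' (rshift d.+1 j) = 0 by rewrite /c' (unsplitK (inr j)).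
rewrite -cl; apply: iu' => x; rewrite big_split_ord/= -[RHS](hc x).
rewrite [X in _ + X]big1 ?addr0; last by move=> j _; rewrite cr mul0r.
by apply: eq_bigr => j _; rewrite cl.
Qed.

Lemma hat_comb d (c : 'I_d -> R) (u : 'I_d -> plane -> R) v : (forall i, bnd (u i)) -> bnd v ->
  bnd (fun x => \sum_i c i * u i x) /\
  mean (fun x => (\sum_i c i * u i x) * v x) = \sum_i c i * mean (fun x => u i x * v x).
Proof.
move=> bu bv; elim: (index_enum _) => [|i r [IHb IHe]].
  have -> : (fun x => \sum_(i <- [::]) c i * u i x) = fun=> 0 by apply/funext => x; rewrite big_nil.
  split; first exact: bndC.
  by rewrite big_nil -[RHS](mean_cst 0); congr mean; apply/funext => x; rewrite big_nil mul0r.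
have bi := bndZ (c i) (bu i).
have E : (fun x => \sum_(j <- i :: r) c j * u j x) = fun x => c i * u i x + \sum_(j <- r) c j * u j x.
  by apply/funext => x; rewrite big_cons.
split; first by rewrite E; exact: bndD.
have -> : (fun x => (\sum_(j <- i :: r) c j * u j x) * v x) =
    fun x => c i * (u i x * v x) + (\sum_(j <- r) c j * u j x) * v x.
  by apply/funext => x; rewrite big_cons mulrDl mulrA.
by rewrite meanD ?meanZ ?IHe ?big_cons//; [exact: bndM|apply: bndZ; exact: bndM|exact: bndM].
Qed.

Lemma onsys_ip (K : nat -> nat -> R) (s : seq (R * (nat -> R))) (x0 : R * (nat -> R)) i j : onsys K s ->
  (i < size s)%N -> (j < size s)%N -> ip (nth x0 s i).2 (nth x0 s j).2 = (i == j)%:R.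
Proof.
elim: s i j => [//|y s IH] [|i] [|j] /= [ly ny ey oy os] hi hj //.

- by rewrite ipC oy// mem_nth.
- by rewrite oy// mem_nth.
- by rewrite IH.
Qed.

Lemma onsys_free (K : nat -> nat -> R) (s : seq (R * (nat -> R))) (x0 : R * (nat -> R))
    (c : 'I_(size s) -> R) : onsys K s ->
  (forall n, \sum_i c i * (nth x0 s i).2 n = 0) -> forall j, c j = 0.
Proof.
move=> os cw j; pose w (i : 'I_(size s)) := (nth x0 s i).2.
have lw i : l2 (w i) by have [] := onsys_mem os (mem_nth x0 (ltn_ord i)).
have [_] := @l2_comb R _ (index_enum 'I_(size s)) xpredT c w (w j) lw (lw j).
have -> : (fun n => \sum_i c i * w i n) = fun=> 0 by apply/funext => n; exact: cw.
rewrite ipC ip0 (bigD1 j)//= (onsys_ip x0 os (ltn_ord j) (ltn_ord j)) eqxx mulr1 big1 ?addr0//.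
move=> i ij; rewrite (onsys_ip x0 os (ltn_ord j) (ltn_ord i)) (_ : (j == i :> nat) = false) ?mulr0//.
by apply/negbTE; rewrite eq_sym.
Qed.

Lemma comb_continuous d (c : 'I_d -> R) (u : 'I_d -> plane -> R) :
  (forall i, continuous (u i)) -> continuous (fun x => \sum_i c i * u i x).
Proof.
move=> cu; elim: (index_enum _) => [|i r IH].
  have -> : (fun x => \sum_(i <- [::]) c i * u i x) = fun=> 0 by apply/funext => x; rewrite big_nil.
  exact: cst_continuous.
have -> : (fun x => \sum_(j <- i :: r) c j * u j x) = fun x => c i * u i x + \sum_(j <- r) c j * u j x.
  by apply/funext => x; rewrite big_cons.
by apply: contD IH; apply: contM (cu i); exact: cst_continuous.
Qed.

Lemma constant_of_coef f : continuous f -> biperiodic f -> bnd f ->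
  (forall k, k != 0 -> coef f k = 0) -> forall x, f x = mean f.
Proof.
move=> cf pf bf h x; apply/eqP; rewrite -subr_eq0; apply/eqP; move: x.
apply: (@complete _ (fun x => f x - mean f)).
- by apply: contD cf _; exact: cst_continuous.
- by move=> y z; rewrite pf.
- exact: bndD bf (bndC _).
- move=> k; rewrite /coef.
  have -> : (fun y => (f y - mean f) * phi k y) = fun y => f y * phi k y + (- mean f) * phi k y.
    by apply/funext => y; rewrite mulrDl.
  rewrite (meanD (bndM bf (bnd_phi k)) (bndZ _ (bnd_phi k))) (meanZ _ (bnd_phi k)).
  rewrite mean_phi; have [kz|kz] := eqVneq k 0.
    rewrite mulr1 kz; have -> : (fun y => f y * phi 0 y) = f.
      by apply/funext => y; rewrite phi0 mulr1.
    by rewrite subrr.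
  by rewrite mulr0 addr0; exact: h.
Qed.

(** The Laplacian has mean zero. *)
Lemma mean_rho_eig rho u lam : torus_smooth rho -> torus_smooth u ->
  (forall x, - lap u x = lam * (rho x * u x)) -> lam != 0 -> mean (fun x => u x * rho x) = 0.
Proof.
move=> sr su eu l0; have br := smooth_bnd sr; have bu := smooth_bnd su.
have : mean (lap u) = 0.
  by rewrite -hat_zero hat_lap// bet0 expr0n /= oppr0 mul0r.
have -> : lap u = fun x => - lam * (u x * rho x).
  by apply/funext => x; rewrite mulNr (mulrC (u x)) -eu opprK.
by rewrite meanZ; [move/eqP; rewrite mulf_eq0 oppr_eq0 (negbTE l0) => /eqP|exact: bndM].
Qed.

(** Eigenvectors of the matrix and eigenfunctions of the metric correspond to each
other, so equal multiplicities of the metrics give equal multiplicities of the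
matrices. *)
Lemma hsn_transfer rho rho' : torus_smooth rho -> (forall x, 0 < rho x) ->
  torus_smooth rho' -> (forall x, 0 < rho' x) ->
  Spec (conformal_metric rho) = Spec (conformal_metric rho') ->
  hsn (Kx rho) <= hsn (Kx rho').
Proof.
move=> sr r0 sr' r0' eS.
apply: hsn_le; [exact: Kx_hs|exact: Kx_sym|exact: Kx_hs|exact: Kx_sym|].
move=> mu s m0 os hs; pose x0 : R * (nat -> R) := (0, fun=> 0).
have mi0 : mu^-1 != 0 by rewrite invr_neq0.
pose w (i : 'I_(size s)) := (nth x0 s i).2.
have ws i : nth x0 s (i : 'I_(size s)) \in s by rewrite mem_nth.
have ew (i : 'I_(size s)) : exists u, [/\ torus_smooth u,
    forall x, - lap u x = mu^-1 * (rho x * u x) & forall n, bet n * hat u n = w i n].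
  have [lw _ e] := onsys_mem os (ws i).
  by apply: (l2_to_eig sr r0 lw _ m0); rewrite /w e (hs _ (ws i)).
have [u uP] := choice ew.
have lw i : l2 (w i) by have [] := onsys_mem os (ws i).
have bu i : bnd (u i) by apply: smooth_bnd; have [] := uP i.
have iu : lin_indep u.
  move=> c hc j.
  have cw n : \sum_i c i * w i n = 0.
    have [_ h] := hat_comb c bu (bnd_phi (freq n)).
    have : mean (fun x => (\sum_i c i * u i x) * phi (freq n) x) = 0.
      by rewrite -[RHS](mean_cst 0); congr mean; apply/funext => x; rewrite hc mul0r.
    rewrite h => h0.
    transitivity (bet n * \sum_i c i * mean (fun x => u i x * phi (freq n) x)).
      rewrite mulr_sumr; apply: eq_bigr => i _.
      by have [_ _ /(_ n) <-] := uP i; rewrite mulrCA.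
    by rewrite h0 mulr0.
  exact: (onsys_free os cw).
have eu i : eigenfunction (conformal_metric rho) mu^-1 (u i).
  by have [su e _] := uP i; exact: (proj2 (eigenP _ _ r0) (conj su e)).
have [u' [eu' iu']] := spec_mult eS eu iu.
have u'P i : torus_smooth (u' i) /\ forall x, - lap (u' i) x = mu^-1 * (rho' x * u' i x).
  exact: (proj1 (eigenP _ _ r0') (eu' i)).
have bu' i : bnd (u' i) by apply: smooth_bnd; have [] := u'P i.
exists (fun i n => bet n * hat (u' i) n); split.
- by move=> i; have [su e] := u'P i; have [] := eig_to_l2 sr' r0' su e mi0.
- by move=> i; have [su e] := u'P i; have [_] := eig_to_l2 sr' r0' su e mi0; rewrite invrK.
move=> c hc; apply: iu'; pose f x := \sum_i c i * u' i x; move: (hc).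
have bf : bnd f by have [] := hat_comb c bu' (bndC 1).
have cf k : coef f k = \sum_i c i * coef (u' i) k.
  by have [_] := hat_comb c bu' (bnd_phi k).
pose q := mean f.
have fq x : f x = q.
  apply: constant_of_coef; [|move=> y z|exact: bf|].
  2: by apply: eq_bigr => i _; have [[_ ->]] := u'P i.
  - by apply: comb_continuous => i; apply: smooth_continuous; have [] := u'P i.
  - move=> k kz; have [n nk] := freq_onto k.
    have nz : n != zero_idx by apply: contra_neq kz => nz; rewrite -nk nz freq0.
    apply: (mulfI (@bet_neq0 R n nz)); rewrite mulr0 cf mulr_sumr -[RHS](hc n) -nk.
    by apply: eq_bigr => i _; rewrite mulrCA.
have q0 : q = 0.
  have [_ h] := hat_comb c bu' (smooth_bnd sr').
  have : mean (fun x => f x * rho' x) = 0.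
    rewrite h; apply: big1 => i _; have [su e] := u'P i.
    by rewrite (mean_rho_eig sr' su e mi0) mulr0.
  have -> : (fun x => f x * rho' x) = fun x => q * rho' x.
    by apply/funext => x; rewrite fq.
  rewrite (meanZ _ (smooth_bnd sr')).
  by move/eqP; rewrite mulf_eq0 (gt_eqF (mean_rho_gt0 sr' r0')) orbF => /eqP.
by move=> _ x; have := fq x; rewrite q0.
Qed.

Lemma tot_lin5 (p1 p2 p3 p4 p5 : R) (F1 F2 F3 F4 F5 : nat -> R) :
  smb F1 -> smb F2 -> smb F3 -> smb F4 -> smb F5 ->
  smb (fun n => p1 * F1 n + p2 * F2 n + p3 * F3 n + p4 * F4 n + p5 * F5 n) /\
  tot (fun n => p1 * F1 n + p2 * F2 n + p3 * F3 n + p4 * F4 n + p5 * F5 n) =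
  p1 * tot F1 + p2 * tot F2 + p3 * tot F3 + p4 * tot F4 + p5 * tot F5.
Proof.
move=> h1 h2 h3 h4 h5.
have z1 := smbZ p1 h1; have z2 := smbZ p2 h2; have z3 := smbZ p3 h3; have z4 := smbZ p4 h4.
have z5 := smbZ p5 h5; have z12 := smbD z1 z2; have z13 := smbD z12 z3; have z14 := smbD z13 z4.
split; first exact: smbD.
by rewrite (totD z14 z5) (totD z13 z4) (totD z12 z3) (totD z1 z2) !totZ.
Qed.

Lemma entry_le_tot (F : nat -> R) n : smb F -> (forall i, 0 <= F i) -> F n <= tot F.
Proof.
move=> sF F0; apply: le_trans (psum_le_tot n.+1 sF F0).
by rewrite big_ord_recr/= lerDr sumr_ge0.
Qed.

(** The fourth difference in [e] annihilates the quadratic [c0 * V(e)^2] and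
keeps only the squared leading coefficient of a square of a quadratic. *)
Lemma quartic_rigid (K : R -> nat -> nat -> R) (V v h c0 : R) (A B C : nat -> nat -> R) : 0 < h ->
  (forall e, `|e| <= 2 * h -> [/\ hs (K e), hsn (K e) = c0 &
    forall m n, (V + e * v) * K e m n = A m n + e * B m n + e ^+ 2 * C m n]) ->
  forall m n, C m n = 0.
Proof.
move=> h0 H.
have ab (t : R) : -2 <= t <= 2 -> `|t * h| <= 2 * h.
  by move=> ht; rewrite normrM (ger0_norm (ltW h0)) ler_wpM2r ?(ltW h0)// ler_norml.
have [|s1 n1 k1] := H (-2 * h); first by apply: ab; lra.
have [|s2 n2 k2] := H (-1 * h); first by apply: ab; lra.
have [|s3 n3 k3] := H (0 * h); first by apply: ab; lra.
have [|s4 n4 k4] := H (1 * h); first by apply: ab; lra.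
have [|s5 n5 k5] := H (2 * h); first by apply: ab; lra.
(* the binomial weights 1, -4, 6, -4, 1 of the fourth difference, times the squared masses *)
pose p1 := 1 * (V + -2 * h * v) ^+ 2; pose p2 := - 4 * (V + -1 * h * v) ^+ 2.
pose p3 := 6 * (V + 0 * h * v) ^+ 2; pose p4 := - 4 * (V + 1 * h * v) ^+ 2.
pose p5 := 1 * (V + 2 * h * v) ^+ 2.
have row m : smb (fun n => 24 * h ^+ 4 * C m n ^+ 2) /\ tot (fun n => 24 * h ^+ 4 * C m n ^+ 2) =
    p1 * ip (K (-2 * h) m) (K (-2 * h) m) + p2 * ip (K (-1 * h) m) (K (-1 * h) m) +
    p3 * ip (K (0 * h) m) (K (0 * h) m) + p4 * ip (K (1 * h) m) (K (1 * h) m) +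
    p5 * ip (K (2 * h) m) (K (2 * h) m).
  have := tot_lin5 p1 p2 p3 p4 p5 (s1.1 m) (s2.1 m) (s3.1 m) (s4.1 m) (s5.1 m).
  set F := (fun n => _ + p5 * _); have -> // : F = fun n => 24 * h ^+ 4 * C m n ^+ 2.
  apply/funext => n; rewrite /F /p1 /p2 /p3 /p4 /p5.
  have sq (r e X : R) : r * e ^+ 2 * (X * X) = r * (e * X) ^+ 2 by ring.
  rewrite !sq k1 k2 k3 k4 k5; ring.
have row0 m n : 0 <= 24 * h ^+ 4 * C m n ^+ 2.
  by rewrite mulr_ge0 ?sqr_ge0// mulr_ge0// exprn_ge0// ltW.
have [sG tG] := tot_lin5 p1 p2 p3 p4 p5 s1.2 s2.2 s3.2 s4.2 s5.2.
have GE : (fun m => p1 * ip (K (-2 * h) m) (K (-2 * h) m) + p2 * ip (K (-1 * h) m) (K (-1 * h) m) +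
    p3 * ip (K (0 * h) m) (K (0 * h) m) + p4 * ip (K (1 * h) m) (K (1 * h) m) +
    p5 * ip (K (2 * h) m) (K (2 * h) m)) = fun m => tot (fun n => 24 * h ^+ 4 * C m n ^+ 2).
  by apply/funext => m; have [_ ->] := row m.
rewrite GE in sG tG.
have G0 m : 0 <= tot (fun n => 24 * h ^+ 4 * C m n ^+ 2) by apply: tot_ge0; [exact: (row m).1|exact: row0].
have tot0 : tot (fun m => tot (fun n => 24 * h ^+ 4 * C m n ^+ 2)) = 0.
  rewrite tG -/(hsn (K (-2 * h))) -/(hsn (K (-1 * h))) -/(hsn (K (0 * h))) -/(hsn (K (1 * h))) -/(hsn (K (2 * h))).
  by rewrite n1 n2 n3 n4 n5 /p1 /p2 /p3 /p4 /p5; ring.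
move=> m n; have h1 := entry_le_tot m sG G0; rewrite tot0 in h1.
have h2 := le_trans (entry_le_tot n (row m).1 (row0 m)) h1.
have hp : 0 < 24 * h ^+ 4 by rewrite mulr_gt0// exprn_gt0.
rewrite pmulr_rle0// in h2.
by apply/eqP; rewrite -sqrf_eq0; apply/eqP/le_anti; rewrite h2 sqr_ge0.
Qed.

(** Far out on the diagonal the matrix of multiplication by [U] tends to the
mean of [U], while the products of coefficients tend to zero. *)
Lemma rank_one_trivial U : torus_smooth U ->
  (forall m n, m != zero_idx -> n != zero_idx -> mean U * Mx U m n = hat U m * hat U n) ->
  forall x, U x = 0.
Proof.
move=> sU H; set v := mean U in H.
have [C C0 hC] := coef_decay 1 sU.
have cC k (j : nat) : (j%:R : R) <= wt k -> `|coef U k| * j%:R <= C.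
  by move=> jk; apply: le_trans (hC k); rewrite expr1 ler_wpM2l.
have diag (j : nat) : (0 < j)%N -> v ^+ 2 * j%:R <= C ^+ 2 + `|v| * C.
  (* on the frequency (j, 0) the weight is at least j *)
  move=> j0; have [m mE] := freq_onto (j%:Z, 0).
  have mz : m != zero_idx.
    by apply/negP => /eqP e; move: mE; rewrite e freq0 => -[] e'; move: j0; rewrite -e'.
  have j1 : 1 <= j%:R :> R by rewrite ler1n.
  have jj : (j%:R : R) <= j%:R ^+ 2 by rewrite expr2 ler_peMl// ler0n.
  have w1 : (j%:R : R) <= wt (freq m).
    by rewrite mE /wt /= expr0n addr0 (le_trans jj)// lerDr.
  have w2 : (j%:R : R) <= wt (freq m + freq m).
    rewrite mE /wt /= !intrD expr2; move: jj; rewrite !expr2 -[j%:~R]/(j%:R).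
    by have := sqr_ge0 (j%:R : R); rewrite expr2 mulr0z; nra.
  have := H m m mz mz.
  have -> : Mx U m m = 2^-1 * (v + v + coef U (freq m + freq m) - coef U (- (freq m + freq m))).
    have := mean_phiM_expand (freq m) (freq m) (smooth_bnd sU); rewrite subrr.
    have -> : mean (fun x => U x * phi 0 x) = v.
      by congr mean; apply/funext => x; rewrite phi0 mulr1.
    by move=> <-; rewrite /Mx /hat /coef; congr mean; apply/funext => x; rewrite mulrA.
  have b1 : `|hat U m| * j%:R <= C := cC _ _ w1.
  have b2 : `|coef U (freq m + freq m)| * j%:R <= C := cC _ _ w2.
  have b3 : `|coef U (- (freq m + freq m))| * j%:R <= C by apply: cC; rewrite wtN.
  move: b1 b2 b3; set a := hat U m; set b := coef U (freq m + freq m); set d := coef U (- _).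
  set J := j%:R in j1 * => b1 b2 b3 E.
  have v2 : v ^+ 2 = a ^+ 2 + v * (2^-1 * (d - b)).
    have -> : a ^+ 2 = v * (2^-1 * (v + v + b - d)) by rewrite E expr2.
    by field.
  have J0 : 0 <= J by apply: le_trans j1.
  have a2 : a ^+ 2 * J <= C ^+ 2.
    rewrite -(real_normK (num_real a)) expr2 -mulrA expr2; apply: ler_pM; rewrite ?mulr_ge0//.
    by apply: le_trans b1; rewrite ler_peMr.
  have vb : v * (2^-1 * (d - b)) * J <= `|v| * C.
    apply: (le_trans (ler_norm _)); rewrite !normrM -mulrA; apply: ler_wpM2l => //.
    rewrite (ger0_norm (_ : 0 <= 2^-1 :> R)) ?invr_ge0// (ger0_norm J0).
    have t := ler_wpM2r J0 (ler_normB d b); rewrite mulrDl in t.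
    by rewrite -mulrA; lra.
  by rewrite v2 mulrDl; exact: lerD.
have v0 : v = 0.
  apply/eqP; rewrite -sqrf_eq0; apply/eqP/le_anti; rewrite sqr_ge0 andbT.
  rewrite leNgt; apply/negP => vp.
  have Q0 : 0 <= (C ^+ 2 + `|v| * C) / v ^+ 2.
    by apply: divr_ge0; [rewrite addr_ge0 ?sqr_ge0// mulr_ge0|exact: ltW].
  have := archi_boundP Q0; set j := Num.bound _; rewrite ltr_pdivrMr// (mulrC j%:R) ltNge => /negP; apply.
  have [j0|j0] := posnP j; last exact: diag.
  by rewrite j0 mulr0 addr_ge0 ?sqr_ge0// mulr_ge0.
apply: complete; [exact: smooth_continuous|exact: sU.2|exact: smooth_bnd|].
move=> k; have [n <-] := freq_onto k; have [->|nz] := eqVneq n zero_idx.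
  by rewrite -/(hat U zero_idx) hat_zero.
have := H n n nz nz; rewrite v0 mul0r => /esym/eqP.
by rewrite mulf_eq0 orbb => /eqP.
Qed.

Lemma hat_line rho U (e : R) g : bnd rho -> bnd U -> bnd g ->
  mean (fun x => (rho x + e * U x) * g x) = mean (fun x => rho x * g x) + e * mean (fun x => U x * g x).
Proof.
move=> br bU bg; rewrite -meanZ; last exact: bndM.
rewrite -meanD; [|exact: bndM|by apply: bndZ; exact: bndM].
by congr mean; apply/funext => x; rewrite mulrDl mulrA.
Qed.

(** Multiplied by the total mass, the matrix is a quadratic polynomial in [e] whose
squared norm is a quadratic polynomial as well. So its leading coefficient, built
from [U] alone, vanishes. *)
Lemma isospectral_rigidity rho U (e0 : R) : torus_smooth U -> 0 < e0 ->
  (forall e, `|e| < e0 -> [/\ torus_smooth (fun x => rho x + e * U x),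
    forall x, 0 < rho x + e * U x &
    Spec (conformal_metric (fun x => rho x + e * U x)) = Spec (conformal_metric rho)]) ->
  forall x, U x = 0.
Proof.
move=> sU e0p H.
have rE : (fun x => rho x + 0 * U x) = rho by apply/funext => x; rewrite mul0r addr0.
have [|sr r0 _] := H 0; first by rewrite normr0.
rewrite rE in sr; have {}r0 x : 0 < rho x by have := r0 x; rewrite mul0r addr0.
have br := smooth_bnd sr; have bU := smooth_bnd sU.
pose h := e0 / 4; have h0 : 0 < h by rewrite divr_gt0.
have key := @quartic_rigid (fun e => Kx (fun x => rho x + e * U x)) (mean rho) (mean U) h
  (hsn (Kx rho))
  (fun m n => kap m * kap n * (mean rho * Mx rho m n - hat rho m * hat rho n))
  (fun m n => kap m * kap n * (mean rho * Mx U m n + mean U * Mx rho m n -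
      hat rho m * hat U n - hat U m * hat rho n))
  (fun m n => kap m * kap n * (mean U * Mx U m n - hat U m * hat U n)) h0.
apply: rank_one_trivial => // m n mz nz.
have /key/(_ m n) : forall e, `|e| <= 2 * h -> [/\ hs (Kx (fun x => rho x + e * U x)),
    hsn (Kx (fun x => rho x + e * U x)) = hsn (Kx rho) &
    forall m n, (mean rho + e * mean U) * Kx (fun x => rho x + e * U x) m n =
    kap m * kap n * (mean rho * Mx rho m n - hat rho m * hat rho n) +
    e * (kap m * kap n * (mean rho * Mx U m n + mean U * Mx rho m n -
      hat rho m * hat U n - hat U m * hat rho n)) +
    e ^+ 2 * (kap m * kap n * (mean U * Mx U m n - hat U m * hat U n))].
  move=> e eh; have ee : `|e| < e0 by apply: (le_lt_trans eh); rewrite /h; lra.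
  have [se re Se] := H e ee.
  split; first exact: (Kx_hs se re).
    by apply/le_anti/andP; split; [exact: (hsn_transfer se re sr r0 Se)|exact: (hsn_transfer sr r0 se re (esym Se))].
  move=> i j; have V0 := mean_rho_gt0 se re.
  have mE : mean (fun x => rho x + e * U x) = mean rho + e * mean U.
    by rewrite (meanD br (bndZ e bU)) (meanZ e bU).
  have hE l : hat (fun x => rho x + e * U x) l = hat rho l + e * hat U l.
    exact: (hat_line e br bU (bnd_phi (freq l))).
  have ME : Mx (fun x => rho x + e * U x) i j = Mx rho i j + e * Mx U i j.
    have := hat_line e br bU (bndM (bnd_phi (freq i)) (bnd_phi (freq j))).
    rewrite /Mx /hat /coef => hl; have asM (g : plane -> R) :
        mean (fun x => g x * phi (freq i) x * phi (freq j) x) =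
        mean (fun x => g x * (phi (freq i) x * phi (freq j) x)).
      by congr mean; apply/funext => x; rewrite mulrA.
    by rewrite !asM hl.
  rewrite /Kx /Ex /axpy mE !hE ME; rewrite mE in V0.
  move: V0; set W := mean rho + e * mean U => W0.
  have WE : W = mean rho + e * mean U by [].
  transitivity (kap i * kap j * (W * (Mx rho i j + e * Mx U i j) -
     (hat rho i + e * hat U i) * (hat rho j + e * hat U j))).
    by field; rewrite gt_eqF.
  by rewrite WE; ring.
have km (l : nat) : l != zero_idx -> kap l != 0 :> R.
  by move=> lz; rewrite /kap invr_neq0// bet_neq0.
by move/eqP; rewrite !mulf_eq0 (negbTE (km m mz)) (negbTE (km n nz)) /= subr_eq0 => /eqP.
Qed.

End Isospectral.

Theorem theorem1p1 (R : realType) :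
  [/\ open (noncoincident_pairs R),
      dense (noncoincident_pairs R)
    & forall (f : liouville_pair R) (U : 'rV[R]_2 -> R),
        noncoincident_pairs R f ->
        torus_smooth U ->
        (exists2 e0 : R, 0 < e0 & forall e : R, `|e| < e0 ->
           riemannian_metric (deformed_metric f U e) /\
           Spec (deformed_metric f U e) = Spec (liouville_metric f)) ->
        forall x : 'rV[R]_2, U x = 0].
Proof.
split; [exact: open_noncoincident|exact: dense_noncoincident|].
move=> f U _ sU [e0 e0p H]; apply: (@isospectral_rigidity _ (liouville_factor f) U e0 sU e0p).
move=> e ee; have [[sg _ pg] Se] := H e ee; split; last exact: Se.
  have := sg 0 0; congr torus_smooth; apply/funext => x.
  by rewrite /deformed_metric /conformal_metric mxE eqxx mulr1n.
move=> x; have v0 : row2 1 0 != 0 :> 'rV[R]_2.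
  by apply/eqP => /rowP/(_ 0); rewrite !mxE /= => /eqP; rewrite oner_eq0.
have := pg x _ v0; rewrite /deformed_metric metric_dotE row2_0 row2_1.
by rewrite expr1n expr0n addr0 mulr1.
Qed.
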